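(* Let $R_{5,5}$ be the rational elliptic surface obtained by blowing up $\mathbb{P}^2$ over $\mathbb{C}$ in the nine (possibly infinitely near) base points of the pencil of cubics $$\lambda x_1x_2(x_0-x_1)+\mu x_0(x_0-x_1-x_2)(x_0-x_2)=0 .$$ There are exactly three conic bundles on $R_{5,5}$ up to automorphisms of $R_{5,5}$, namely the conic bundles $B_1,B_2,B_3$ induced by the following pencils (with parameter $\tau$) of plane rational curves: $$B_1:\ x_1=\tau x_0,\qquad B_2:\ x_1x_2=\tau(x_0x_2-x_0^2),\qquad B_3:\ x_1x_2=(\tau+1)x_0x_2-\tau x_0^2 .$$
   Context: The surface $R_{5,5}$ is the elliptic modular surface of level 5; the pencil of cubics induces its elliptic fibration $R_{5,5}\to\mathbb{P}^1$. The base points of the pencil are $Q_1=(0:0:1)$ and the infinitely near point in the direction of the line $x_0=0$; $Q_2=(1:1:0)$ and the infinitely near point in the direction of $x_0-x_1-x_2=0$; $Q_3=(0:1:0)$ and the infinitely near point in the direction of $x_2=0$; $Q_4=(1:0:1)$ and the infinitely near point in the direction of $x_1=0$; and $Q_5=(1:1:1)$. A conic bundle on a surface $R$ is a base-point-free linear system of rational curves giving a morphism $R\to\mathbb{P}^1$ (a fibration in rational curves). A pencil of plane rational curves induces a conic bundle on $R_{5,5}$ by taking proper transforms of its members. Two conic bundles are identified up to automorphisms if an automorphism of $R_{5,5}$ takes one to the other. *)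

(* Defs.v *)
From HB Require Import structures.
From mathcomp Require Import all_boot all_order all_algebra.
From mathcomp Require Import fraction mpoly complex reals.

Set Implicit Arguments.
Unset Strict Implicit.
Unset Printing Implicit Defensive.

Import GRing.Theory.
Local Open Scope ring_scope.

(* Rational surfaces are treated as models in the sense of Zariski: a surface
   is the set of the local rings of its closed points, all of them subrings of
   the function field of P^2.  Rings are predicates on that field, and are
   compared extensionally. *)

(* k(x1/x0, x2/x0) *)
Definition ffield (k : fieldType) := {fraction {mpoly k[2]}}.

Definition subring_eq (k : fieldType) (A B : ffield k -> Prop) : Prop :=
  forall z, A z <-> B z.

Definition const (k : fieldType) (c : k) : ffield k := tofrac (c%:MP).

Definition dehom (k : fieldType) (A : {mpoly k[3]}) : ffield k :=
  tofrac (comp_mpoly [tuple 1; 'X_ord0; 'X_ord_max] A).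

Definition ratio (k : fieldType) (A B : {mpoly k[3]}) : ffield k :=
  dehom A / dehom B.

(* The maximal ideal of a local ring O: its non-invertible elements
   (recall that 0^-1 = 0). *)
Definition maxid (k : fieldType) (O : ffield k -> Prop) (z : ffield k) : Prop :=
  O z /\ (O z^-1 -> z = 0).

(* The local ring of P^2 at the point with homogeneous coordinates a. *)
Definition plane_local_ring (k : fieldType) (a : 'I_3 -> k)
    (z : ffield k) : Prop :=
  exists (d : nat) (A B : {mpoly k[3]}),
    [/\ A \is d.-homog, B \is d.-homog, B.@[a] != 0 & z = ratio A B].

(* O' is the local ring of a closed point of the exceptional curve of the
   blow-up of O.  If s, t generate the maximal ideal of O, the point infinitely
   near to O in the direction of the curve t = 0 has for local ring the
   localization of O[t/s] at the ideal (s, t/s).  An element Q(t/s) of O[t/s]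
   lies outside this ideal iff the constant coefficient of Q is a unit of O.
   All closed points of the exceptional curve are obtained when (s, t) ranges
   over the pairs of generators. *)
Definition quadratic_transform (k : fieldType) (O O' : ffield k -> Prop) : Prop :=
  exists s t : ffield k,
    (forall z, maxid O z <->
       exists a b, [/\ O a, O b & z = a * s + b * t]) /\
    (forall z, O' z <->
       exists P Q : {poly ffield k},
         [/\ forall i, O P`_i, forall i, O Q`_i, ~ maxid O Q`_0
           & z = P.[t / s] / Q.[t / s]]).

(* In the factorial ring O write T = a/b with a, b coprime: the proper
   transforms of the members of the pencil with parameter T have equations
   la * a + mu * b = 0, and they all pass through the point iff neither a nor b
   is a unit, i.e. iff neither T nor T^-1 is in O. *)
Definition base_point (k : fieldType) (T : ffield k) (O : ffield k -> Prop) : Prop :=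
  ~ O T /\ ~ O T^-1.

(* The points of P^2, and the infinitely near points obtained from them by
   successively blowing up base points of the pencil with parameter T. *)
Inductive near_point (k : fieldType) (T : ffield k) :
    (ffield k -> Prop) -> Prop :=
| PlanePoint (a : 'I_3 -> k) (O : ffield k -> Prop) :
    (exists i, a i != 0) -> subring_eq O (plane_local_ring a) ->
    near_point T O
| InfinitelyNearPoint (O O' : ffield k -> Prop) :
    near_point T O -> base_point T O -> quadratic_transform O O' ->
    near_point T O'.

(* The blow-up of P^2 at all the (possibly infinitely near) base points of the
   pencil with parameter T: the points that have been blown up are discarded. *)
Definition blowup_base_points (k : fieldType) (T : ffield k)
    (O : ffield k -> Prop) : Prop :=
  near_point T O /\ ~ base_point T O.

Definition x0 (k : fieldType) : {mpoly k[3]} := 'X_(inord 0).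
Definition x1 (k : fieldType) : {mpoly k[3]} := 'X_(inord 1).
Definition x2 (k : fieldType) : {mpoly k[3]} := 'X_(inord 2).
Arguments x0 {k}.
Arguments x1 {k}.
Arguments x2 {k}.

(* The two cubics span the pencil; lambda F + mu G = 0 is the curve
   F / G = - mu / lambda. *)
Definition R55 (k : fieldType) : (ffield k -> Prop) -> Prop :=
  blowup_base_points
    (ratio (x1 * x2 * (x0 - x1)) (x0 * (x0 - x1 - x2) * (x0 - x2))).

(* A curve on the surface X is given by its local ring: the localization, at a
   prime element, of the (factorial) local ring of a point of the curve. *)
Definition prime_elt (k : fieldType) (O : ffield k -> Prop) (p : ffield k) : Prop :=
  [/\ maxid O p, p != 0
    & forall a b, O a -> O b -> O (a * b / p) -> O (a / p) \/ O (b / p)].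

Definition curve_on (k : fieldType) (X : (ffield k -> Prop) -> Prop)
    (V : ffield k -> Prop) : Prop :=
  exists (O : ffield k -> Prop) (p : ffield k),
    [/\ X O, prime_elt O p
      & forall z, V z <->
          exists a b, [/\ O a, O b, ~ O (b / p) & z = a / b]].

(* The residue field of V, i.e. the function field of the curve, is
   k-isomorphic to k(t): rho is the residue map. *)
Definition rational_curve (k : fieldType) (V : ffield k -> Prop) : Prop :=
  exists rho : ffield k -> {fraction {poly k}},
    [/\ forall x y, V x -> V y ->
          rho (x + y) = rho x + rho y /\ rho (x * y) = rho x * rho y,
        forall c, rho (const c) = tofrac (c%:P),
        forall q, exists2 x, V x & rho x = q
      & forall x, V x -> (rho x = 0 <-> maxid V x)].

(* The divisor f = tau on X is a single rational curve, with multiplicity 1. *)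
Definition rational_fibre (k : fieldType) (X : (ffield k -> Prop) -> Prop)
    (f : ffield k) (tau : k) : Prop :=
  exists V : ffield k -> Prop,
    [/\ curve_on X V, rational_curve V,
        forall W, curve_on X W -> maxid W (f - const tau) -> subring_eq W V
      & forall z, maxid V z <-> exists2 w, V w & z = w * (f - const tau)].

(* A base-point-free pencil of rational curves, given by the corresponding
   morphism f : X -> P^1, a rational function such that f or f^-1 is regular at
   each point.  As usual finitely many members may degenerate.  The second
   condition rules out constant functions. *)
Definition conic_bundle (k : fieldType) (X : (ffield k -> Prop) -> Prop)
    (f : ffield k) : Prop :=
  (forall O, X O -> O f \/ O f^-1) /\
  (exists s : seq k, forall tau, tau \notin s -> rational_fibre X f tau).

(* f and g define the same linear system: they differ by an automorphism of
   P^1. *)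
Definition same_pencil (k : fieldType) (f g : ffield k) : Prop :=
  exists a b c d : k,
    a * d - b * c != 0 /\
    g * (const c * f + const d) = const a * f + const b.

(* The pull-back of functions by an automorphism of X: a k-automorphism of the
   function field permuting the local rings of X. *)
Definition is_automorphism (k : fieldType) (X : (ffield k -> Prop) -> Prop)
    (sigma : {rmorphism ffield k -> ffield k}) : Prop :=
  [/\ bijective sigma, forall c, sigma (const c) = const c
    & forall O : ffield k -> Prop, X (fun z => O (sigma z)) <-> X O].

Definition equiv_up_to_aut (k : fieldType) (X : (ffield k -> Prop) -> Prop)
    (f g : ffield k) : Prop :=
  exists sigma : {rmorphism ffield k -> ffield k},
    is_automorphism X sigma /\ same_pencil (sigma f) g.

(* The rational function tau on the plane whose level curves are the members of
   a pencil P tau = A - tau * B, with B = P 0 - P 1. *)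
Definition pencil_map (k : fieldType) (P : k -> {mpoly k[3]}) : ffield k :=
  ratio (P 0) (P 0 - P 1).

Definition B1 (k : fieldType) : ffield k :=
  pencil_map (fun tau => x1 - tau *: x0).
Definition B2 (k : fieldType) : ffield k :=
  pencil_map (fun tau => x1 * x2 - tau *: (x0 * x2 - x0 ^+ 2)).
Definition B3 (k : fieldType) : ffield k :=
  pencil_map (fun tau =>
    x1 * x2 - ((tau + 1) *: (x0 * x2) - tau *: x0 ^+ 2)).
Arguments B1 : clear implicits.
Arguments B2 : clear implicits.
Arguments B3 : clear implicits.
Arguments R55 : clear implicits.

(* Main.v *)
(* The negative curves of the surface are the ten components of the two fibres of
   type I5 and the five sections of the elliptic fibration.  Let C be a general
   member of a pencil f of rational curves without base points.  Its class is nef,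
   and is therefore determined by fifteen nonnegative intersection numbers; a
   finite search shows that a nef class contains, up to a fixed part, two distinct
   products of the six lines x0, x1, x2, x0 - x1, x0 - x2, x0 - x1 - x2, whose
   quotient is one of 21 monomials.  If C is the curve f = tau, a function with at
   most a simple pole along C is an affine function of 1 / (f - tau), hence f is
   one of the 21 monomials up to an automorphism of P^1.
   The translation of order 5 and an automorphism of order 4 act on these
   monomials; twenty of them fall in the orbits of B1, B2, B3, and the last one
   is the elliptic fibration.  Its smooth members are not rational: for a
   parametrization (A : B : C) of a smooth cubic F = 0, the cross product of
   (A, B, C) and (A', B', C') is proportional to the gradient of F, which has
   larger degree unless the cross product vanishes.
   The three bundles are distinguished by the largest multiplicity of a point on
   a member: 3, 2 and 4. *)

Require Import Defs.
From HB Require Import structures.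
From mathcomp Require Import all_boot all_order all_algebra.
From mathcomp Require Import fraction mpoly complex reals boolp.
From mathcomp Require Import ring zify.

Set Implicit Arguments.
Unset Strict Implicit.
Unset Printing Implicit Defensive.

Import Order.TTheory GRing.Theory Num.Theory.
Local Open Scope ring_scope.

(** The surface X is given only as a set of local rings: no projective embedding, intersection
    product or cohomology is at hand, so every geometric fact is restated for subrings of the
    function field. Each point is [loc u v], the localization of k[u, v] at the origin, for one of
    finitely many pairs (u, v) up to translation; each curve is a discrete valuation ring
    [Wc u v c]; properness is the existence of a centre on X for every valuation ring with residue
    field k. That a field automorphism permutes the points would need a case analysis over all
    charts. Instead, six functions, the orbit of x under the translation together with T, recover a
    point from any valuation ring dominating it. An automorphism that permutes these six functions
    up to homographies then permutes the points. Classes are not elements of a Picard group: a plane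
    curve gets ten integers, read off the orders of its equation along the line at infinity and the
    nine exceptional curves, and nefness comes from restricting the equation to lines. The finite
    search on nef classes is a branch and bound procedure, proved sound and then evaluated. *)

Lemma lift_ord2 : lift ord0 ord0 = ord_max :> 'I_2.
Proof. exact/val_inj. Qed.

(** * Substitution in polynomials of two variables *)

Section Eval.
Variables (k : fieldType) (S : comNzRingType) (h : {rmorphism k -> S}).

Definition mev (u v : S) (p : {mpoly k[2]}) : S :=
  mmap h (fun i : 'I_2 => if i == ord0 then u else v) p.

HB.instance Definition _ u v := GRing.RMorphism.copy (mev u v)
  (mmap h (fun i : 'I_2 => if i == ord0 then u else v)).

Variables u v : S.

Lemma mevC c : mev u v c%:MP = h c.
Proof. exact: mmapC. Qed.

Lemma mevX : mev u v 'X_ord0 = u.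
Proof. by rewrite /mev mmapX mmap1U. Qed.

Lemma mevY : mev u v 'X_ord_max = v.
Proof. by rewrite /mev mmapX mmap1U. Qed.

Lemma mevE p : mev u v p =
  \sum_(m <- msupp p) h p@_m * (u ^+ m ord0 * v ^+ m ord_max).
Proof.
rewrite /mev /mmap; apply: eq_bigr => m _; congr (_ * _).
by rewrite /mmap1 !big_ord_recl big_ord0 mulr1 lift_ord2.
Qed.

Lemma mevXm m : mev u v 'X_[m] = u ^+ m ord0 * v ^+ m ord_max.
Proof. by rewrite /mev mmapX /mmap1 !big_ord_recl big_ord0 mulr1 lift_ord2. Qed.
End Eval.

Lemma mpoly2_ext (k : fieldType) (S : comNzRingType) (f g : {rmorphism {mpoly k[2]} -> S}) :
  (forall c, f c%:MP = g c%:MP) -> f 'X_ord0 = g 'X_ord0 ->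
  f 'X_ord_max = g 'X_ord_max -> f =1 g.
Proof.
move=> hc hx hy p; rewrite [p]mpolyE !rmorph_sum; apply: eq_bigr => m _.
rewrite -mul_mpolyC !rmorphM hc; congr (_ * _).
by rewrite mpolyXE_id !big_ord_recl big_ord0 mulr1 lift_ord2 !rmorphM !rmorphXn /= hx hy.
Qed.

Lemma fracB (F : fieldType) (a b c d : F) : b != 0 -> d != 0 ->
  a / b - c / d = (a * d - c * b) / (b * d).
Proof. by move=> b0 d0; field; rewrite b0 d0. Qed.

(* The fields k(x, y) and k(t) through an abstract interface: with the concrete
   fraction fields, failing unifications unfold the whole quotient construction. *)
Record funfield (k : fieldType) := FunField {
  ff : fieldType;
  tf : {rmorphism {mpoly k[2]} -> ff};
  tf_inj : injective tf;
  ffP : forall z : ff, exists a b, b != 0 /\ z = tf a / tf b;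
  rf : fieldType;
  pf : {rmorphism {poly k} -> rf};
  pf_inj : injective pf;
  pfP : forall q : rf, exists a b, b != 0 /\ q = pf a / pf b }.

(** * The notions of the statement over an abstract function field *)

Section Notions.
Variables (k : fieldType) (M : funfield k).
Local Notation K := (ff M).

Definition cst : {rmorphism k -> K} := (tf M \o @mpolyC 2 k).

Definition dh (A : {mpoly k[3]}) : K :=
  tf M (comp_mpoly [tuple 1; 'X_ord0; 'X_ord_max] A).

Definition mx (O : K -> Prop) (z : K) : Prop := O z /\ (O z^-1 -> z = 0).

Definition planeloc (a : 'I_3 -> k) (z : K) : Prop :=
  exists (d : nat) (A B : {mpoly k[3]}),
    [/\ A \is d.-homog, B \is d.-homog, B.@[a] != 0 & z = dh A / dh B].

Definition qtrans (O O' : K -> Prop) : Prop :=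
  exists s t : K,
    (forall z, mx O z <-> exists a b, [/\ O a, O b & z = a * s + b * t]) /\
    (forall z, O' z <->
       exists P Q : {poly K}, [/\ forall i, O P`_i, forall i, O Q`_i, ~ mx O Q`_0
           & z = P.[t / s] / Q.[t / s]]).

Definition basept (T : K) (O : K -> Prop) : Prop := ~ O T /\ ~ O T^-1.

(** The inductive [near_point] in impredicative form: the intersection of all predicates closed
    under its two constructors. Extensional comparison of rings has become equality. *)
Definition nearp (T : K) (O : K -> Prop) : Prop :=
  forall P : (K -> Prop) -> Prop,
  (forall a, (exists i, a i != 0) -> P (planeloc a)) ->
  (forall O O', P O -> basept T O -> qtrans O O' -> P O') -> P O.

Definition TT : K :=
  dh (x1 * x2 * (x0 - x1)) / dh (x0 * (x0 - x1 - x2) * (x0 - x2)).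

Definition XX (O : K -> Prop) : Prop := nearp TT O /\ ~ basept TT O.

Definition prime_in (O : K -> Prop) (p : K) : Prop :=
  [/\ mx O p, p != 0
    & forall a b, O a -> O b -> O (a * b / p) -> O (a / p) \/ O (b / p)].

Definition curve (V : K -> Prop) : Prop :=
  exists (O : K -> Prop) (p : K),
    [/\ XX O, prime_in O p
      & forall z, V z <-> exists a b, [/\ O a, O b, ~ O (b / p) & z = a / b]].

Definition ratcurve (V : K -> Prop) : Prop :=
  exists rho : K -> rf M,
    [/\ forall x y, V x -> V y ->
          rho (x + y) = rho x + rho y /\ rho (x * y) = rho x * rho y,
        forall c, rho (cst c) = pf M c%:P,
        forall q, exists2 x, V x & rho x = q
      & forall x, V x -> (rho x = 0 <-> mx V x)].

Definition ratfib (f : K) (tau : k) : Prop :=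
  exists V : K -> Prop,
    [/\ curve V, ratcurve V,
        forall W, curve W -> mx W (f - cst tau) -> forall z, W z <-> V z
      & forall z, mx V z <-> exists2 w, V w & z = w * (f - cst tau)].

Definition cbundle (f : K) : Prop :=
  (forall O, XX O -> O f \/ O f^-1) /\
  (exists s : seq k, forall tau, tau \notin s -> ratfib f tau).

Definition samep (f g : K) : Prop :=
  exists a b c d : k,
    a * d - b * c != 0 /\ g * (cst c * f + cst d) = cst a * f + cst b.

Definition autX (sigma : {rmorphism K -> K}) : Prop :=
  [/\ bijective sigma, forall c, sigma (cst c) = cst c
    & forall O, XX (fun z => O (sigma z)) <-> XX O].

Definition eqaut (f g : K) : Prop :=
  exists sigma : {rmorphism K -> K}, autX sigma /\ samep (sigma f) g.

Lemma cstE c : cst c = tf M c%:MP. Proof. by []. Qed.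

Lemma mxE O z : mx O z <-> (O z /\ (O z^-1 -> z = 0)).
Proof. by []. Qed.

Lemma nearp_plane T a : (exists i, a i != 0) -> nearp T (planeloc a).
Proof. by move=> ha P h1 h2; apply: h1. Qed.

Lemma nearp_inf T O O' : nearp T O -> basept T O -> qtrans O O' -> nearp T O'.
Proof. by move=> h hb hq P h1 h2; apply: (h2 O) => //; apply: h. Qed.

Definition ev (u v : K) : {rmorphism {mpoly k[2]} -> K} := mev cst u v.

Lemma evE u v p : ev u v p = mev cst u v p. Proof. by []. Qed.
End Notions.
Opaque cst ev mev.

(** * Pairs of generators of the function field *)

Section FunctionField.
Variables (k : fieldType) (M : funfield k).
Local Notation K := (ff M).
Local Notation tf := (tf M).
Local Notation cst := (cst M).
Local Notation ev := (@ev k M).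

Lemma tf_eq0 p : (tf p == 0) = (p == 0).
Proof. by rewrite -(rmorph0 tf) (inj_eq (@tf_inj k M)). Qed.

(** The affine coordinates x1/x0 and x2/x0 of the plane, since [dehom] sets x0 = 1. *)
Definition fx : K := locked (tf 'X_ord0).
Definition fy : K := locked (tf 'X_ord_max).

Lemma fxE : fx = tf 'X_ord0. Proof. by rewrite /fx -lock. Qed.
Lemma fyE : fy = tf 'X_ord_max. Proof. by rewrite /fy -lock. Qed.
Opaque fx fy.

Lemma evC u v c : ev u v c%:MP = cst c. Proof. by rewrite evE mevC. Qed.
Lemma evX u v : ev u v 'X_ord0 = u. Proof. by rewrite evE mevX. Qed.
Lemma evY u v : ev u v 'X_ord_max = v. Proof. by rewrite evE mevY. Qed.

Lemma ev_xy p : ev fx fy p = tf p.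
Proof.
apply: mpoly2_ext => [c||]; first by rewrite evC cstE.
  by rewrite evX fxE.
by rewrite evY fyE.
Qed.

Lemma ev_inj_neq0 u v p : injective (ev u v) -> p != 0 -> ev u v p != 0.
Proof. by move=> inj; apply: contraNneq => e; apply/eqP/inj; rewrite rmorph0. Qed.

(** A numerator and a denominator are picked by choice for each element; injectivity makes the value
    independent of the pick ([phiE]). *)
Lemma lift_morph u v : injective (ev u v) ->
  exists phi : {rmorphism K -> K},
    [/\ forall c, phi (cst c) = cst c, phi fx = u, phi fy = v
      & forall a b, phi (tf a / tf b) = ev u v a / ev u v b].
Proof.
move=> inj.
have ex z : exists ab : {mpoly k[2]} * {mpoly k[2]},
    (ab.2 != 0) && (z == tf ab.1 / tf ab.2).
  by have [a [b [b0 ->]]] := ffP z; exists (a, b); rewrite b0 eqxx.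
pose nd z := xchoose (ex z).
pose phi z : K := ev u v (nd z).1 / ev u v (nd z).2.
have phiE a b : b != 0 -> phi (tf a / tf b) = ev u v a / ev u v b.
  move=> b0; move: (xchooseP (ex (tf a / tf b))); rewrite /phi /nd.
  case: (xchoose _) => c d /= /andP[d0 /eqP e].
  have : tf (a * d) = tf (c * b) :> K.
    rewrite !rmorphM /=; apply/eqP; rewrite -eqr_div ?tf_eq0 //; exact/eqP.
  move=> /(@tf_inj k M) /(congr1 (ev u v)); rewrite !rmorphM /= => e2.
  by apply/eqP; rewrite eqr_div ?ev_inj_neq0 // mulrC e2 mulrC.
have phi1 a : phi (tf a) = ev u v a.
  by rewrite -[tf a]divr1 -(rmorph1 tf) phiE ?oner_neq0 // rmorph1 divr1.
have zm : zmod_morphism phi.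
  move=> z w; have [a [b [b0 ->]]] := ffP z; have [c [d [d0 ->]]] := ffP w.
  have -> : tf a / tf b - tf c / tf d =
            tf (a * d - c * b) / tf (b * d) :> K.
    by rewrite rmorphB !rmorphM fracB ?tf_eq0.
  rewrite !phiE ?mulf_neq0 // rmorphB !rmorphM.
  by rewrite fracB ?ev_inj_neq0.
have mm : monoid_morphism phi.
  split=> [|z w]; first by rewrite -{1}(rmorph1 tf) phi1 (rmorph1 (ev u v)).
  have [a [b [b0 ->]]] := ffP z; have [c [d [d0 ->]]] := ffP w.
  by rewrite mulf_div -!rmorphM !phiE ?mulf_neq0 // !rmorphM mulf_div.
pose m1 := GRing.isZmodMorphism.Build K K phi zm.
pose m2 := GRing.isMonoidMorphism.Build K K phi mm.
pose F : {rmorphism K -> K} := HB.pack phi m1 m2.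
exists F; split=> /=.
- by move=> c; rewrite cstE phi1 evC.
- by rewrite fxE phi1 evX.
- by rewrite fyE phi1 evY.
move=> a b; have [->|b0] := eqVneq b 0; last exact: phiE.
by rewrite (rmorph0 tf) (rmorph0 (ev u v)) !invr0 !mulr0 -{1}(rmorph0 tf) phi1 (rmorph0 (ev u v)).
Qed.

(** Says that K = k(u, v), by asking for a k-automorphism that sends the coordinates to u and v. In
    this form changes of coordinates are compositions of automorphisms. *)
Definition birat (u v : K) := exists phi : {rmorphism K -> K},
  [/\ bijective phi, forall c, phi (cst c) = cst c, phi fx = u & phi fy = v].

Lemma morph_ev (phi : {rmorphism K -> K}) u v p :
  (forall c, phi (cst c) = cst c) -> phi (ev u v p) = ev (phi u) (phi v) p.
Proof.
move=> hc; pose f := [the {rmorphism _ -> _} of phi \o ev u v].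
apply: (@mpoly2_ext k K f (ev (phi u) (phi v))) => [c||] /=.
- by rewrite !evC hc.
- by rewrite !evX.
- by rewrite !evY.
Qed.

Lemma morph_tf (phi : {rmorphism K -> K}) p :
  (forall c, phi (cst c) = cst c) -> phi (tf p) = ev (phi fx) (phi fy) p.
Proof. by move=> hc; rewrite -ev_xy morph_ev. Qed.

Lemma birat_inj u v : birat u v -> injective (ev u v).
Proof.
move=> [phi [/bij_inj inj hc hx hy]] p q; rewrite -hx -hy -!morph_tf //.
by move/inj/(@tf_inj k M).
Qed.

Lemma morph_id_gen (phi : {rmorphism K -> K}) :
  (forall c, phi (cst c) = cst c) -> phi fx = fx -> phi fy = fy -> phi =1 id.
Proof.
move=> hc hx hy z; have [a [b [b0 ->]]] := ffP z.
by rewrite rmorphM fmorphV !morph_tf // hx hy !ev_xy.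
Qed.

Lemma birat_xy : birat fx fy.
Proof. by exists idfun; split=> //; exists idfun. Qed.

Lemma birat_inverse u v (phi psi : {rmorphism K -> K}) :
  (forall c, phi (cst c) = cst c) -> (forall c, psi (cst c) = cst c) ->
  phi fx = u -> phi fy = v -> psi u = fx -> psi v = fy -> phi (psi fx) = fx ->
  phi (psi fy) = fy -> birat u v.
Proof.
move=> hc hc' hx hy hx' hy' hx2 hy2; exists phi; split=> //; exists psi.
- by apply: (@morph_id_gen [the {rmorphism _ -> _} of psi \o phi]) => //=;
    rewrite ?hx ?hy // => c; rewrite hc hc'.
- by apply: (@morph_id_gen [the {rmorphism _ -> _} of phi \o psi]) => //= c;
    rewrite hc' hc.
Qed.

(** Two polynomial substitutions inverse to each other form an automorphism of k[x, y], which
    extends to fractions. It serves for swaps, scalings, translations and shears. *)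
Lemma birat_poly (P Q P' Q' : {mpoly k[2]}) :
  mev (@mpolyC 2 k) P Q P' = 'X_ord0 -> mev (@mpolyC 2 k) P Q Q' = 'X_ord_max ->
  mev (@mpolyC 2 k) P' Q' P = 'X_ord0 -> mev (@mpolyC 2 k) P' Q' Q = 'X_ord_max ->
  birat (tf P) (tf Q).
Proof.
have comp (A B : {mpoly k[2]}) p : ev (tf A) (tf B) p =
    tf (mev (@mpolyC 2 k) A B p).
  pose f := [the {rmorphism _ -> _} of tf \o mev (@mpolyC 2 k) A B].
  apply: (@mpoly2_ext k K (ev (tf A) (tf B)) f) => [c||] /=.
  - by rewrite evC mevC.
  - by rewrite evX mevX.
  - by rewrite evY mevY.
move=> h1 h2 h3 h4.
have id2 (A B A' B' : {mpoly k[2]}) : mev (@mpolyC 2 k) A' B' A = 'X_ord0 ->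
    mev (@mpolyC 2 k) A' B' B = 'X_ord_max ->
    cancel (mev (@mpolyC 2 k) A B) (mev (@mpolyC 2 k) A' B').
  move=> e1 e2 p.
  pose f := [the {rmorphism _ -> _} of mev (@mpolyC 2 k) A' B' \o mev (@mpolyC 2 k) A B].
  apply: (@mpoly2_ext k {mpoly k[2]} f idfun) => [c||] /=.
  - by rewrite !mevC.
  - by rewrite mevX.
  - by rewrite mevY.
have inj (A B A' B' : {mpoly k[2]}) : mev (@mpolyC 2 k) A' B' A = 'X_ord0 ->
    mev (@mpolyC 2 k) A' B' B = 'X_ord_max -> injective (ev (tf A) (tf B)).
  move=> e1 e2 p q; rewrite !comp => /(@tf_inj k M).
  exact: (can_inj (id2 _ _ _ _ e1 e2)).
have [phi [c1 x1 y1 _]] := lift_morph (inj _ _ _ _ h3 h4).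
have [psi [c2 x2 y2 _]] := lift_morph (inj _ _ _ _ h1 h2).
apply: (@birat_inverse _ _ phi psi) => //.
- by rewrite morph_tf // x2 y2 comp h3 fxE.
- by rewrite morph_tf // x2 y2 comp h4 fyE.
- by rewrite x2 morph_tf // x1 y1 comp h1 fxE.
- by rewrite y2 morph_tf // x1 y1 comp h2 fyE.
Qed.

Lemma birat_comp u v (phi : {rmorphism K -> K}) :
  bijective phi -> (forall c, phi (cst c) = cst c) ->
  birat u v -> birat (phi u) (phi v).
Proof.
move=> bij hc [psi [bij' hc' <- <-]].
exists [the {rmorphism _ -> _} of phi \o psi]; split=> //=; first exact: bij_comp.
by move=> c; rewrite hc' hc.
Qed.

Lemma birat_affine u v (P Q P' Q' : {mpoly k[2]}) :
  mev (@mpolyC 2 k) P Q P' = 'X_ord0 -> mev (@mpolyC 2 k) P Q Q' = 'X_ord_max ->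
  mev (@mpolyC 2 k) P' Q' P = 'X_ord0 -> mev (@mpolyC 2 k) P' Q' Q = 'X_ord_max ->
  birat u v -> birat (ev u v P) (ev u v Q).
Proof.
move=> h1 h2 h3 h4 [phi [bij hc <- <-]]; rewrite -!morph_tf //.
by apply: birat_comp => //; apply: birat_poly h1 h2 h3 h4.
Qed.

Lemma birat_swap u v : birat u v -> birat v u.
Proof.
move=> h; have := @birat_affine u v 'X_ord_max 'X_ord0 'X_ord_max 'X_ord0.
by rewrite evX evY; apply; rewrite ?mevX ?mevY.
Qed.

Lemma birat_scale u v c : c != 0 -> birat u v -> birat (cst c * u) v.
Proof.
move=> c0 h.
have e1 : ev u v (c%:MP * 'X_ord0) = cst c * u by rewrite rmorphM /= evC evX.
have e2 : ev u v 'X_ord_max = v by rewrite evY.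
suff: birat (ev u v (c%:MP * 'X_ord0)) (ev u v 'X_ord_max) by rewrite e1 e2.
apply: (@birat_affine u v _ _ (c^-1%:MP * 'X_ord0) 'X_ord_max) h.
- by rewrite rmorphM /= mevC mevX mulrA -mpolyCM mulVf ?mul1r.
- by rewrite mevY.
- by rewrite rmorphM /= mevC mevX mulrA -mpolyCM mulfV ?mul1r.
- by rewrite mevY.
Qed.

Lemma birat_addC u v c : birat u v -> birat (u + cst c) v.
Proof.
move=> h.
have e1 : ev u v ('X_ord0 + c%:MP) = u + cst c by rewrite rmorphD /= evC evX.
have e2 : ev u v 'X_ord_max = v by rewrite evY.
suff: birat (ev u v ('X_ord0 + c%:MP)) (ev u v 'X_ord_max) by rewrite e1 e2.
apply: (@birat_affine u v _ _ ('X_ord0 - c%:MP) 'X_ord_max) h.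
- by rewrite rmorphD rmorphN /= mevC mevX addrK.
- by rewrite mevY.
- by rewrite rmorphD /= mevC mevX subrK.
- by rewrite mevY.
Qed.

Lemma birat_shear u v c : birat u v -> birat (u + cst c * v) v.
Proof.
move=> h.
have e1 : ev u v ('X_ord0 + c%:MP * 'X_ord_max) = u + cst c * v by rewrite rmorphD rmorphM /= evC evX evY.
have e2 : ev u v 'X_ord_max = v by rewrite evY.
suff: birat (ev u v ('X_ord0 + c%:MP * 'X_ord_max)) (ev u v 'X_ord_max) by rewrite e1 e2.
apply: (@birat_affine u v _ _ ('X_ord0 - c%:MP * 'X_ord_max) 'X_ord_max) h.
- by rewrite rmorphD rmorphN rmorphM /= mevC mevX mevY addrK.
- by rewrite mevY.
- by rewrite rmorphD rmorphM /= mevC mevX mevY subrK.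
- by rewrite mevY.
Qed.

(** The monomial x^i y^j becomes x^(i+j) y^j, and this map [g] on exponents is injective, so no
    cancellation occurs. The substitution has no polynomial inverse, so [birat_poly] cannot give
    it. *)
Lemma ev_x_xy_inj : injective (ev fx (fx * fy)).
Proof.
apply/(@raddf_inj _ _ (ev fx (fx * fy))) => p e.
pose g (m : 'X_{1..2}) : 'X_{1..2} := [multinom [tuple (m ord0 + m ord_max)%N; m ord_max]].
have ginj : injective g.
  move=> m1 m2 /mnmP e2; have := e2 ord0; have := e2 ord_max.
  rewrite !multinomE /= !(tnth_nth 0%N) /= => e3 e4; apply/mnmP => i.
  have -> : i = ord0 \/ i = ord_max -> m1 i = m2 i by case=> ->; lia.
    by [].
  by case: i => [[|[|//]] hi]; [left|right]; apply/val_inj.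
apply/mpolyP => m; rewrite mcoeff0; apply/eqP/negPn/negP => hm.
have : ev fx (fx * fy) p = tf (\sum_(m <- msupp p) p@_m *: 'X_[g m]).
  rewrite evE mevE rmorph_sum; apply: eq_bigr => m' _ /=.
  rewrite -mul_mpolyC [RHS]rmorphM; congr (_ * _).
  rewrite -[RHS]/(tf 'X_[g m']) -ev_xy [RHS]evE [RHS]mevXm !multinomE /= !(tnth_nth 0%N) /= exprMn exprD.
  by rewrite mulrA.
rewrite e => /esym/eqP; rewrite tf_eq0 => /eqP /(congr1 (mcoeff (g m))).
rewrite raddf_sum mcoeff0 /= (bigD1_seq m) ?msupp_uniq ?mcoeff_msupp //=.
rewrite mcoeffZ mcoeffX eqxx mulr1 big1 ?addr0; first by move/eqP; rewrite (negPf hm).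
by move=> m' hm'; rewrite mcoeffZ mcoeffX (inj_eq ginj) (negPf hm') mulr0.
Qed.

Lemma X0_neq0 (R : idomainType) : 'X_ord0 != 0 :> {mpoly R[2]}.
Proof. by rewrite -msize_poly_eq0 msizeX mdeg1. Qed.

Lemma X1_neq0 (R : idomainType) : 'X_ord_max != 0 :> {mpoly R[2]}.
Proof. by rewrite -msize_poly_eq0 msizeX mdeg1. Qed.

Lemma fx_neq0 : fx != 0. Proof. by rewrite fxE tf_eq0 X0_neq0. Qed.
Lemma fy_neq0 : fy != 0. Proof. by rewrite fyE tf_eq0 X1_neq0. Qed.

Lemma birat_neq0 u v : birat u v -> u != 0 /\ v != 0.
Proof.
move=> [phi [_ _ <- <-]]; split; first by rewrite (fmorph_eq0 phi fx) fx_neq0.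
by rewrite (fmorph_eq0 phi fy) fy_neq0.
Qed.

(** Surjective because y = (x y) / x. This is the chart of a blow-up, the non-polynomial ingredient
    of the changes of coordinates. *)
Lemma birat_mul_std : exists phi : {rmorphism K -> K},
  [/\ bijective phi, forall c, phi (cst c) = cst c, phi fx = fx & phi fy = fx * fy].
Proof.
have [phi [hc hx hy _]] := lift_morph ev_x_xy_inj; exists phi; split=> //.
have sur p : exists z, phi z = tf p.
  exists (ev fx (fy / fx) p); rewrite morph_ev // rmorphM fmorphV hx hy.
  by rewrite mulrC mulKf ?fx_neq0 // ev_xy.
have sur2 z : exists w, phi w == z.
  have [a [b [b0 ->]]] := ffP z; have [z1 e1] := sur a; have [z2 e2] := sur b.
  by exists (z1 / z2); rewrite rmorphM fmorphV e1 e2.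
exists (fun z => xchoose (sur2 z)) => z; last exact/eqP/(xchooseP (sur2 z)).
by apply: (fmorph_inj phi); apply/eqP/(xchooseP (sur2 _)).
Qed.

Lemma birat_mul u v : birat u v -> birat u (u * v).
Proof.
move=> [phi [bij hc <- <-]]; have [psi [bij' hc' hx hy]] := birat_mul_std.
rewrite -rmorphM -{1}hx -hy; apply: (@birat_comp _ _ phi) => //.
by exists psi.
Qed.

Lemma inv_rmorph (psi : {rmorphism K -> K}) : bijective psi ->
  exists2 tau : {rmorphism K -> K}, cancel psi tau & cancel tau psi.
Proof.
move=> [psi' K1 K2].
have zm : zmod_morphism psi'.
  by move=> a b; apply: (can_inj K1); rewrite rmorphB !K2.
have mm : monoid_morphism psi'.
  split=> [|a b]; apply: (can_inj K1); first by rewrite rmorph1 K2.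
  by rewrite rmorphM !K2.
pose m1 := GRing.isZmodMorphism.Build K K psi' zm.
pose m2 := GRing.isMonoidMorphism.Build K K psi' mm.
by exists (HB.pack psi' m1 m2 : {rmorphism K -> K}).
Qed.

Lemma birat_div u v : birat u v -> birat u (v / u).
Proof.
move=> [phi [bij hc <- <-]]; have [psi [bij' hc' hx hy]] := birat_mul_std.
have [F FK KF] := inv_rmorph bij'.
have Fc c : F (cst c) = cst c by rewrite -[in LHS](hc' c) FK.
have Fx : F fx = fx by rewrite -[in LHS]hx FK.
have Fy : F fy = fy / fx.
  have : F (fx * fy) = fy by rewrite -[in LHS]hy FK.
  by rewrite rmorphM Fx => h; rewrite -{2}h [RHS]mulrC mulKf ?fx_neq0.
rewrite -fmorphV -rmorphM -Fy -{1}Fx; apply: (@birat_comp _ _ phi) => //.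
by exists F; split=> //; exists psi.
Qed.
End FunctionField.
Arguments fx {k M}.
Arguments fy {k M}.

(** * Regular local rings in terms of two parameters *)

Lemma loc_lin_aux (F : fieldType) (p q a b u v : F) : q != 0 -> b != 0 ->
  p / q * u + a / b * v = 0 -> p * b * u + a * q * v = 0.
Proof.
move=> q0 b0 e; have -> : p * b * u + a * q * v = (p / q * u + a / b * v) * (q * b).
  by field; rewrite q0 b0.
by rewrite e mul0r.
Qed.

Lemma lin_rel1 (F : comNzRingType) (u v s t a b c d e f : F) : u = a * s + b * t ->
  s = c * u + d * v -> t = e * u + f * v ->
  (a * c + b * e - 1) * u + (a * d + b * f) * v = 0.
Proof.
move=> eu es et; transitivity (a * (c * u + d * v) + b * (e * u + f * v) - u).
  by ring.
by rewrite -es -et -eu subrr.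
Qed.

Lemma lin_rel2 (F : comNzRingType) (u v s t a b c d e f : F) : v = a * s + b * t ->
  s = c * u + d * v -> t = e * u + f * v ->
  (a * c + b * e) * u + (a * d + b * f - 1) * v = 0.
Proof.
move=> eu es et; transitivity (a * (c * u + d * v) + b * (e * u + f * v) - v).
  by ring.
by rewrite -es -et -eu subrr.
Qed.

Section LocalRings.
Variables (k : fieldType) (M : funfield k).
Local Notation K := (ff M).
Local Notation tf := (tf M).
Local Notation cst := (cst M).
Local Notation ev := (@ev k M).
Local Notation birat := (@birat k M).
Local Notation mx := (@mx k M).

Lemma eqset_eq (A B : K -> Prop) : (forall z, A z <-> B z) -> A = B.
Proof. by move=> h; apply/funext => z; apply/propext. Qed.

Definition pe (a b : k) : {rmorphism {mpoly k[2]} -> k} := mev (@idfun k) a b.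

Lemma peE a b p : pe a b p = mev (@idfun k) a b p. Proof. by []. Qed.
Lemma peC a b c : pe a b c%:MP = c. Proof. exact: mevC. Qed.
Lemma peX a b : pe a b 'X_ord0 = a. Proof. exact: mevX. Qed.
Lemma peY a b : pe a b 'X_ord_max = b. Proof. exact: mevY. Qed.

(** Restrictions to the axes: [rX] to the line where the first variable is 0, with the second one as
    parameter, and [rY] the other way round. *)
Definition rX : {rmorphism {mpoly k[2]} -> {poly k}} := mev (@polyC k) 0 'X.
Definition rY : {rmorphism {mpoly k[2]} -> {poly k}} := mev (@polyC k) 'X 0.

Lemma rX_C c : rX c%:MP = c%:P. Proof. exact: mevC. Qed.
Lemma rX_X : rX 'X_ord0 = 0. Proof. exact: mevX. Qed.
Lemma rX_Y : rX 'X_ord_max = 'X. Proof. exact: mevY. Qed.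
Lemma rY_C c : rY c%:MP = c%:P. Proof. exact: mevC. Qed.
Lemma rY_X : rY 'X_ord0 = 'X. Proof. exact: mevX. Qed.
Lemma rY_Y : rY 'X_ord_max = 0. Proof. exact: mevY. Qed.

Lemma rX_horner p t : (rX p).[t] = pe 0 t p.
Proof.
pose f := [the {rmorphism _ -> _} of horner_eval t \o rX].
apply: (@mpoly2_ext k k f (pe 0 t)) => [c||] /=; rewrite /horner_eval.
- by rewrite rX_C hornerC peC.
- by rewrite rX_X horner0 peX.
- by rewrite rX_Y hornerX peY.
Qed.

Lemma rY_horner p t : (rY p).[t] = pe t 0 p.
Proof.
pose f := [the {rmorphism _ -> _} of horner_eval t \o rY].
apply: (@mpoly2_ext k k f (pe t 0)) => [c||] /=; rewrite /horner_eval.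
- by rewrite rY_C hornerC peC.
- by rewrite rY_X hornerX peX.
- by rewrite rY_Y horner0 peY.
Qed.
Opaque rX rY pe.

Lemma mpoly_split0 (p : {mpoly k[2]}) :
  exists A B, p = (pe 0 0 p)%:MP + 'X_ord0 * A + 'X_ord_max * B.
Proof.
elim/mpolyind: p => [|c m p _ _ [A [B e]]].
  by exists 0, 0; rewrite rmorph0 !mulr0 !addr0 mpolyC0.
suff [A' [B' e']] : exists A' B', c *: 'X_[m] =
    (pe 0 0 (c *: 'X_[m]))%:MP + 'X_ord0 * A' + 'X_ord_max * B'.
  exists (A + A'), (B + B'); rewrite {1}e {1}e' rmorphD mpolyCD !mulrDr; ring.
rewrite -mul_mpolyC (rmorphM (pe 0 0)) /= peC.
have [m0|m0] := eqVneq (m ord0) 0%N; last first.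
  exists (c%:MP * 'X_[m - U_(ord0)]), 0.
  have e0 : 'X_[m] = 'X_ord0 * 'X_[m - U_(ord0)] :> {mpoly k[2]}.
    by rewrite -mpolyXD addmC submK // lep1mP.
  by rewrite e0 (rmorphM (pe 0 0)) /= peX mul0r mulr0 mpolyC0 add0r mulr0 addr0 mulrCA.
have [m1|m1] := eqVneq (m ord_max) 0%N; last first.
  exists 0, (c%:MP * 'X_[m - U_(ord_max)]).
  have e0 : 'X_[m] = 'X_ord_max * 'X_[m - U_(ord_max)] :> {mpoly k[2]}.
    by rewrite -mpolyXD addmC submK // lep1mP.
  by rewrite e0 (rmorphM (pe 0 0)) /= peY mul0r mulr0 mpolyC0 add0r mulr0 add0r mulrCA.
exists 0, 0.
have -> : m = 0%MM.
  apply/mnmP => i; rewrite mnm0E.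
  have [->|->] : i = ord0 \/ i = ord_max; last by [].
    by case: i => [[|[|//]] hi]; [left|right]; apply/val_inj.
  exact: m0.
by rewrite mpolyX0 (rmorph1 (pe 0 0)) !mulr1 !mulr0 !addr0.
Qed.

(** Local k-subalgebras of K. Opposites come from the constant -1; the last clause, on sums of
    non-units, is locality. *)
Definition lring (S : K -> Prop) : Prop :=
  [/\ forall c, S (cst c), forall a b, S a -> S b -> S (a + b),
      forall a b, S a -> S b -> S (a * b)
    & forall a b, mx S a -> mx S b -> mx S (a + b)].

(** The function z takes the value c at the point S. The rules for sums, products and quotients of
    values replace computations in residue fields. *)
Definition vl (S : K -> Prop) (z : K) (c : k) := mx S (z - cst c).

Section Theory.
Variable S : K -> Prop.
Hypothesis lS : lring S.

Lemma lrC c : S (cst c). Proof. by case: lS. Qed.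
Lemma lrD a b : S a -> S b -> S (a + b). Proof. by case: lS => ? h ? ?; apply: h. Qed.
Lemma lrM a b : S a -> S b -> S (a * b). Proof. by case: lS => ? ? h ?; apply: h. Qed.
Lemma lr0 : S 0. Proof. by rewrite -(rmorph0 cst); apply: lrC. Qed.
Lemma lr1 : S 1. Proof. by rewrite -(rmorph1 cst); apply: lrC. Qed.
Lemma lrN a : S a -> S (- a).
Proof. by move=> h; rewrite -mulN1r -(rmorphN1 cst); apply: lrM => //; apply: lrC. Qed.
Lemma lrB a b : S a -> S b -> S (a - b).
Proof. by move=> h1 h2; apply: lrD => //; apply: lrN. Qed.
Lemma lrX a n : S a -> S (a ^+ n).
Proof.
by move=> h; elim: n => [|n ih]; rewrite ?expr0 ?exprS; [apply: lr1|apply: lrM].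
Qed.

Lemma lr_sum (I : Type) (r : seq I) (P : pred I) (F : I -> K) :
  (forall i, P i -> S (F i)) -> S (\sum_(i <- r | P i) F i).
Proof. by move=> h; apply: big_ind => //; [apply: lr0|apply: lrD]. Qed.

Lemma mx_in z : mx S z -> S z. Proof. by move/mxE => []. Qed.

Lemma mx0 : mx S 0.
Proof. by apply/mxE; split=> //; apply: lr0. Qed.

Lemma mxD a b : mx S a -> mx S b -> mx S (a + b).
Proof. by case: lS => ? ? ? h; apply: h. Qed.

Lemma mxMl a b : S a -> mx S b -> mx S (a * b).
Proof.
move=> ha /mxE[hb hb']; apply/mxE; split; first exact: lrM.
have [->|a0] := eqVneq a 0; first by rewrite mul0r.
have [->|b0] := eqVneq b 0; first by rewrite mulr0.
move=> h; rewrite hb' ?mulr0 //.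
have -> : b^-1 = a * (a * b)^-1 by rewrite invfM mulrA divff // mul1r.
exact: lrM.
Qed.

Lemma mxMr a b : mx S a -> S b -> mx S (a * b).
Proof. by move=> h1 h2; rewrite mulrC; apply: mxMl. Qed.

Lemma mxN a : mx S a -> mx S (- a).
Proof. by rewrite -mulN1r; apply: mxMl; apply: lrN; apply: lr1. Qed.

Lemma mxB a b : mx S a -> mx S b -> mx S (a - b).
Proof. by move=> h1 h2; apply: mxD => //; apply: mxN. Qed.

Lemma unitP z : S z -> ~ mx S z -> S z^-1 /\ z != 0.
Proof.
move=> h1 h2; have z0 : z != 0 by apply/eqP => e; apply: h2; rewrite e; apply: mx0.
split=> //; apply: contrapT => h3; apply: h2; apply/mxE; split=> // /h3.
Qed.

Lemma mx_unitF z : mx S z -> S z^-1 -> z = 0.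
Proof. by move/mxE => [_]. Qed.

Lemma mx_cst c : mx S (cst c) -> c = 0.
Proof.
move/mx_unitF => h; apply/eqP; rewrite -(fmorph_eq0 cst); apply/eqP/h.
by rewrite -fmorphV; apply: lrC.
Qed.

Lemma vl_in z c : vl S z c -> S z.
Proof. by move/mx_in => h; rewrite -[z](subrK (cst c)); apply: lrD => //; apply: lrC. Qed.

Lemma vl0 z : vl S z 0 <-> mx S z.
Proof. by rewrite /vl rmorph0 subr0. Qed.

Lemma vlC c : vl S (cst c) c.
Proof. by rewrite /vl subrr; apply: mx0. Qed.

Lemma vl1 : vl S 1 1. Proof. by rewrite -(rmorph1 cst); apply: vlC. Qed.

Lemma vlD z w c d : vl S z c -> vl S w d -> vl S (z + w) (c + d).
Proof.
by move=> h1 h2; rewrite /vl rmorphD opprD addrACA; apply: mxD.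
Qed.

Lemma vlN z c : vl S z c -> vl S (- z) (- c).
Proof. by move=> h; rewrite /vl rmorphN -opprD; apply: mxN. Qed.

Lemma vlB z w c d : vl S z c -> vl S w d -> vl S (z - w) (c - d).
Proof. by move=> h1 h2; apply: vlD => //; apply: vlN. Qed.

Lemma vlM z w c d : vl S z c -> vl S w d -> vl S (z * w) (c * d).
Proof.
move=> h1 h2; rewrite /vl rmorphM.
have -> : z * w - cst c * cst d = (z - cst c) * w + cst c * (w - cst d).
  by rewrite mulrBl mulrBr addrA subrK.
by apply: mxD; [apply: mxMr => //; apply: vl_in h2|apply: mxMl => //; apply: lrC].
Qed.

Lemma vlX z c n : vl S z c -> vl S (z ^+ n) (c ^+ n).
Proof.
by move=> h; elim: n => [|n ih]; rewrite ?expr0 ?exprS; [apply: vl1|apply: vlM].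
Qed.

Lemma vl_uniq z c d : vl S z c -> vl S z d -> c = d.
Proof.
move=> h1 h2; apply/eqP; rewrite -subr_eq0; apply/eqP/mx_cst.
have -> : cst (c - d) = (z - cst d) - (z - cst c).
  by rewrite rmorphB opprB [RHS]addrC addrA subrK.
exact: mxB.
Qed.

Lemma vl_nmx z c : vl S z c -> c != 0 -> ~ mx S z.
Proof. by move=> h c0 /vl0 h2; rewrite (vl_uniq h h2) eqxx in c0. Qed.

Lemma vl_neq0 z c : vl S z c -> c != 0 -> z != 0.
Proof. by move=> h c0; apply/eqP => e; apply: (vl_nmx h c0); rewrite e; apply: mx0. Qed.

Lemma vl_inv z c : vl S z c -> c != 0 -> S z^-1.
Proof. by move=> h c0; case: (unitP (vl_in h) (vl_nmx h c0)). Qed.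

Lemma vlV z c : vl S z c -> c != 0 -> vl S z^-1 c^-1.
Proof.
move=> h c0; rewrite /vl fmorphV.
have z0 := vl_neq0 h c0; have c1 : cst c != 0 by rewrite (fmorph_eq0 cst).
have -> : z^-1 - (cst c)^-1 = - (z^-1 * (cst c)^-1 * (z - cst c)).
  by rewrite mulrBr mulrAC mulVf // mul1r -mulrA mulVf // mulr1 opprB.
apply: mxN; apply: mxMl => //; apply: lrM; first exact: vl_inv h c0.
by rewrite -fmorphV; apply: lrC.
Qed.

Lemma vl_div z w c d : vl S z c -> vl S w d -> d != 0 -> vl S (z / w) (c / d).
Proof. by move=> h1 h2 d0; apply: vlM => //; apply: vlV. Qed.

Lemma vl_eq z c d : vl S z c -> c = d -> vl S z d.
Proof. by move=> h <-. Qed.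

Lemma vl_sum (I : Type) (r : seq I) (F : I -> K) (G : I -> k) :
  (forall i, vl S (F i) (G i)) -> vl S (\sum_(i <- r) F i) (\sum_(i <- r) G i).
Proof.
move=> h; elim: r => [|i r ih]; first by rewrite !big_nil -(rmorph0 cst); apply: vlC.
by rewrite !big_cons; apply: vlD.
Qed.

Lemma vl_ev u v a b p : vl S u a -> vl S v b -> vl S (ev u v p) (pe a b p).
Proof.
move=> hu hv; rewrite evE mevE peE mevE; apply: vl_sum => m.
by apply: vlM; [apply: vlC|apply: vlM; apply: vlX].
Qed.

Lemma horner_in (P : {poly K}) q : (forall i, S P`_i) -> S q -> S P.[q].
Proof.
move=> hP hq; rewrite horner_coef; apply: lr_sum => i _.
by apply: lrM => //; apply: lrX.
Qed.

Lemma horner_vl (P : {poly K}) q : (forall i, S P`_i) -> mx S q -> mx S (P.[q] - P`_0).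
Proof.
elim/poly_ind: P => [|P c ih] hP hq.
  by rewrite horner0 coef0 subr0; apply: mx0.
rewrite hornerMXaddC coefD coefMX coefC /= add0r addrK.
apply: mxMl => //; apply: horner_in; last exact: mx_in.
by move=> i; have := hP i.+1; rewrite coefD coefMX coefC /= addr0.
Qed.
End Theory.

(** A subring of a local ring that contains the inverses of its elements outside the big maximal
    ideal is local, with the intersection as maximal ideal. Quadratic transforms and composite rings
    are first known only as such subrings. *)
Lemma sub_lring (S S' : K -> Prop) : lring S -> (forall z, S' z -> S z) ->
  (forall c, S' (cst c)) -> (forall a b, S' a -> S' b -> S' (a + b)) ->
  (forall a b, S' a -> S' b -> S' (a * b)) ->
  (forall z, S' z -> ~ mx S z -> S' z^-1) ->
  lring S' /\ (forall z, mx S' z <-> (S' z /\ mx S z)).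
Proof.
move=> lS sub hC hD hM hV.
have e z : mx S' z <-> (S' z /\ mx S z).
  split=> [h|[h1 h2]].
    have h1 : S' z by move/mxE: h => [].
    split=> //; apply: contrapT => h2; have h3 := hV _ h1 h2.
    by move/mxE: h => [_ /(_ h3) z0]; apply: h2; rewrite z0; apply: mx0.
  by apply/mxE; split=> // /sub; apply: mx_unitF.
split=> //; split=> // a b /e[a1 a2] /e[b1 b2]; apply/e; split; first exact: hD.
exact: mxD.
Qed.

Definition dom (S W : K -> Prop) := (forall z, S z -> W z) /\ (forall z, mx S z -> mx W z).

Lemma dom_vl S W z c : dom S W -> vl S z c -> vl W z c.
Proof. by move=> [_ h] /h. Qed.

(** The localization of k[u, v] at the origin. Every point of the plane or of a blow-up has this
    form for suitable parameters. *)
Definition loc (u v z : K) := exists P Q, pe 0 0 Q != 0 /\ z = ev u v P / ev u v Q.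

Lemma loc_sub S u v : lring S -> mx S u -> mx S v -> forall z, loc u v z -> S z.
Proof.
move=> lS /(vl0 S) hu /(vl0 S) hv z [P [Q [Q0 ->]]].
exact: vl_in lS _ _ (vl_div lS (vl_ev lS P hu hv) (vl_ev lS Q hu hv) Q0).
Qed.

Section Loc.
Variables u v : K.
Hypothesis buv : birat u v.

Let inj := birat_inj buv.

Lemma ev_neq0 Q : Q != 0 -> ev u v Q != 0.
Proof. exact: ev_inj_neq0. Qed.

Lemma pe_neq0 a b Q : pe a b Q != 0 -> Q != 0.
Proof. by apply: contraNneq => ->; rewrite rmorph0. Qed.

Lemma mx_loc_frac P Q : pe 0 0 Q != 0 ->
  (mx (loc u v) (ev u v P / ev u v Q) <-> pe 0 0 P = 0).
Proof.
move=> Q0; split=> [/mxE[_ h]|P0].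
  apply/eqP/negPn/negP => P0; have := h _.
  rewrite invf_div => /(_ _)/eqP; rewrite mulf_eq0 invr_eq0.
  rewrite (negPf (ev_neq0 (pe_neq0 P0))) (negPf (ev_neq0 (pe_neq0 Q0))) /=.
  by move=> h'; have : False by move: (h' (ex_intro _ Q (ex_intro _ P (conj P0 erefl)))).
apply/mxE; split; first by exists P, Q.
have [->|Pn0] := eqVneq P 0; first by rewrite rmorph0 mul0r.
rewrite invf_div => -[A [B [B0 /eqP]]].
rewrite eqr_div ?ev_neq0 ?(pe_neq0 B0) // -!rmorphM => /eqP /inj /(congr1 (pe 0 0)).
rewrite !rmorphM P0 mulr0 => /eqP; rewrite mulf_eq0 => /orP[]; first by rewrite (negPf Q0).
by rewrite (negPf B0).
Qed.

Lemma loc_lring : lring (loc u v).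
Proof.
have hC c : loc u v (cst c).
  exists c%:MP, 1; rewrite (rmorph1 (pe 0 0)) oner_eq0; split=> //.
  by rewrite evC (rmorph1 (ev u v)) divr1.
split=> //.
- move=> a b [P [Q [Q0 ->]]] [A [B [B0 ->]]].
  exists (P * B + A * Q), (Q * B); split; first by rewrite rmorphM mulf_neq0.
  by rewrite addf_div ?ev_neq0 ?(pe_neq0 Q0) ?(pe_neq0 B0) // rmorphD !rmorphM.
- move=> a b [P [Q [Q0 ->]]] [A [B [B0 ->]]].
  exists (P * A), (Q * B); split; first by rewrite rmorphM mulf_neq0.
  by rewrite mulf_div !rmorphM.
move=> a b ha hb; have [[P [Q [Q0 e]]] _] := (mxE _ _).1 ha.
have [[A [B [B0 e']]] _] := (mxE _ _).1 hb.
move: ha hb; rewrite {}e {}e' => /(mx_loc_frac _ Q0) P0 /(mx_loc_frac _ B0) A0.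
rewrite addf_div ?ev_neq0 ?(pe_neq0 Q0) ?(pe_neq0 B0) // -!rmorphM -rmorphD.
apply/mx_loc_frac; first by rewrite rmorphM mulf_neq0.
by rewrite rmorphD !rmorphM P0 A0 !mul0r addr0.
Qed.

Lemma loc_ev P : loc u v (ev u v P).
Proof.
exists P, 1; split; first by rewrite rmorph1 oner_eq0.
by rewrite (rmorph1 (ev u v)) divr1.
Qed.

Lemma mx_loc_ev P : mx (loc u v) (ev u v P) <-> pe 0 0 P = 0.
Proof.
have := @mx_loc_frac P 1; rewrite (rmorph1 (ev u v)) divr1; apply.
by rewrite rmorph1 oner_eq0.
Qed.

Lemma mx_loc_u : mx (loc u v) u.
Proof. by rewrite -{2}(evX u v); apply/mx_loc_ev; rewrite peX. Qed.

Lemma mx_loc_v : mx (loc u v) v.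
Proof. by rewrite -{2}(evY u v); apply/mx_loc_ev; rewrite peY. Qed.

Lemma loc_res z : loc u v z -> exists c, vl (loc u v) z c.
Proof.
move=> [P [Q [Q0 ->]]]; exists (pe 0 0 P / pe 0 0 Q).
have vu := (vl0 _ _).2 mx_loc_u; have vv := (vl0 _ _).2 mx_loc_v.
by apply: (vl_div loc_lring _ _ Q0); apply: (vl_ev loc_lring).
Qed.

Lemma mx_loc_gen z : mx (loc u v) z <->
  exists a b, [/\ loc u v a, loc u v b & z = a * u + b * v].
Proof.
split=> [h|[a [b [ha hb ->]]]]; last first.
  by apply: (mxD loc_lring); apply: (mxMl loc_lring) => //;
    [apply: mx_loc_u|apply: mx_loc_v].
have [[P [Q [Q0 e]]] _] := (mxE _ _).1 h.
move: h; rewrite {}e => /(mx_loc_frac _ Q0) P0.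
have [A [B e]] := mpoly_split0 P.
exists (ev u v A / ev u v Q), (ev u v B / ev u v Q); split; [by exists A, Q|by exists B, Q|].
rewrite e P0 mpolyC0 add0r rmorphD !rmorphM evX evY mulrDl.
by rewrite ![u * _]mulrC ![v * _]mulrC !(mulrAC _ _ (_^-1)).
Qed.

(** The parameters are independent modulo the square of the maximal ideal: restricting a relation to
    one axis kills one of its two terms, and the parameter left over can be cancelled. *)
Lemma loc_lin c1 c2 : loc u v c1 -> loc u v c2 -> c1 * u + c2 * v = 0 ->
  mx (loc u v) c1 /\ mx (loc u v) c2.
Proof.
move=> [P [Q [Q0 ->]]] [A [B [B0 ->]]].
have q0 := ev_neq0 (pe_neq0 Q0); have b0 := ev_neq0 (pe_neq0 B0).
move=> /(loc_lin_aux q0 b0) e1.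
have : ev u v (P * B * 'X_ord0 + A * Q * 'X_ord_max) = ev u v 0.
  by rewrite rmorph0 rmorphD !rmorphM evX evY.
move/inj => e2.
have eP : pe 0 0 (P * B) = 0.
  move: (congr1 rY e2); rewrite rmorphD (rmorphM rY _ 'X_ord0) (rmorphM rY _ 'X_ord_max) rY_X rY_Y.
  rewrite mulr0 addr0 (rmorph0 rY) => /eqP; rewrite mulf_eq0 polyX_eq0 orbF => /eqP h.
  by rewrite -rY_horner h horner0.
have eA : pe 0 0 (A * Q) = 0.
  move: (congr1 rX e2); rewrite rmorphD (rmorphM rX _ 'X_ord0) (rmorphM rX _ 'X_ord_max) rX_X rX_Y.
  rewrite mulr0 add0r (rmorph0 rX) => /eqP; rewrite mulf_eq0 polyX_eq0 orbF => /eqP h.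
  by rewrite -rX_horner h horner0.
split; apply/mx_loc_frac => //; apply/eqP.
  by move/eqP: eP; rewrite rmorphM mulf_eq0 (negPf B0) orbF.
by move/eqP: eA; rewrite rmorphM mulf_eq0 (negPf Q0) orbF.
Qed.

Lemma loc_in_inv Q : pe 0 0 Q != 0 -> loc u v (ev u v Q)^-1.
Proof.
move=> Q0; exists 1, Q; split=> //.
by rewrite (rmorph1 (ev u v)) div1r.
Qed.
End Loc.

Lemma loc_eq u v u' v' : birat u v -> birat u' v' ->
  mx (loc u v) u' -> mx (loc u v) v' -> mx (loc u' v') u -> mx (loc u' v') v ->
  loc u v = loc u' v'.
Proof.
move=> b1 b2 h1 h2 h3 h4; apply: eqset_eq => z; split.
  exact: loc_sub (loc_lring b2) h3 h4 z.
exact: loc_sub (loc_lring b1) h1 h2 z.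
Qed.

Lemma loc_swap u v : birat u v -> loc u v = loc v u.
Proof.
move=> b; have b' := birat_swap b.
by apply: loc_eq => //; [apply: mx_loc_v|apply: mx_loc_u|apply: mx_loc_v|apply: mx_loc_u].
Qed.

Lemma loc_dom S u v : birat u v -> lring S -> mx S u -> mx S v -> dom (loc u v) S.
Proof.
move=> b lS hu hv; split; first exact: loc_sub.
move=> z /(mx_loc_gen b)[a [c [ha hc ->]]].
by apply: (mxD lS); apply: (mxMl lS) => //; apply: (loc_sub lS hu hv).
Qed.

Lemma blowup_dom u v c : birat u v -> birat u (v / u - cst c) /\
  dom (loc u v) (loc u (v / u - cst c)).
Proof.
move=> b; have b1 : birat u (v / u - cst c).
  by apply/birat_swap; rewrite -rmorphN; apply/birat_addC/birat_swap/birat_div.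
split=> //; have l1 := loc_lring b1; have hu := mx_loc_u b1.
apply: loc_dom => //.
have e : v = u * (v / u) by rewrite mulrCA divff ?mulr1 //; case: (birat_neq0 b).
move: (v / u) e b1 l1 hu => w -> b1 l1 hu.
have [u0 _] := birat_neq0 b1; rewrite mulrC; apply: (mxMl l1) => //.
have : loc u (w - cst c) (w - cst c + cst c).
  by apply: (lrD l1); [exact: (mx_in (mx_loc_v b1))|apply: (lrC l1)].
by rewrite subrK.
Qed.
Section Quadratic.
Variables (u v s t a11 a12 a21 a22 : K) (A21 A22 : k).
Hypothesis buv : birat u v.
Let O := loc u v.
Hypothesis gen : forall z, mx O z <-> exists a b, [/\ O a, O b & z = a * s + b * t].
Hypotheses (h11 : O a11) (h12 : O a12) (v21 : vl O a21 A21) (v22 : vl O a22 A22).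
Hypotheses (es : s = a11 * u + a12 * v) (et : t = a21 * u + a22 * v).
Hypothesis A22n0 : A22 != 0.
Let c := - (A21 / A22).

(** The linear part A21 u + A22 v of t fixes the direction: the curve t = 0 passes through the point
    v/u = c of the exceptional curve. As s, t and u, v generate the same ideal, t/s and v/u differ
    by an invertible homography with coefficients in O, and t/s vanishes where v/u = c. *)
Lemma quadratic_core z :
  (exists P Q : {poly K}, [/\ forall i, O P`_i, forall i, O Q`_i, ~ mx O Q`_0
           & z = P.[t / s] / Q.[t / s]]) <-> loc u (v / u - cst c) z.
Proof.
have lO : lring O by apply: loc_lring.
have [bb [sub msub]] := blowup_dom c buv.
set O1 := loc u (v / u - cst c) in sub msub *.
have lO1 : lring O1 by apply: loc_lring.
have [u0 v0] := birat_neq0 buv.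
have [A11 v11] := loc_res buv h11; have [A12 v12] := loc_res buv h12.
have [b11 [b12 [hb11 hb12 eu]]] := (gen u).1 (mx_loc_u buv).
have [b21 [b22 [hb21 hb22 ev']]] := (gen v).1 (mx_loc_v buv).
have [B11 w11] := loc_res buv hb11; have [B12 w12] := loc_res buv hb12.
have [B21 w21] := loc_res buv hb21; have [B22 w22] := loc_res buv hb22.
have h21 := vl_in lO v21; have h22 := vl_in lO v22.
have lin c1 c2 : O c1 -> O c2 -> c1 * u + c2 * v = 0 -> vl O c1 0 /\ vl O c2 0.
  by move=> x1 x2 /(loc_lin buv x1 x2)[y1 y2]; split; apply/vl0.
(* The b's express u, v by s, t. By [loc_lin] the product of the two matrices is the identity modulo
   the maximal ideal, hence [f1] to [f4]; Cramer's rule then gives that the determinant and B11 are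
   nonzero. *)
have [e1 e2] : vl O (b11 * a11 + b12 * a21 - 1) 0 /\ vl O (b11 * a12 + b12 * a22) 0.
  apply: lin; last first.
  + by apply: lin_rel1 eu es et.
  + by apply: (lrD lO); apply: (lrM lO).
  by apply: (lrB lO); [apply: (lrD lO); apply: (lrM lO)|apply: lr1].
have [e3 e4] : vl O (b21 * a11 + b22 * a21) 0 /\ vl O (b21 * a12 + b22 * a22 - 1) 0.
  apply: lin; last first.
  + by apply: lin_rel2 ev' es et.
  + by apply: (lrB lO); [apply: (lrD lO); apply: (lrM lO)|apply: lr1].
  by apply: (lrD lO); apply: (lrM lO).
have f1 : B11 * A11 + B12 * A21 - 1 = 0.
  by apply: (vl_uniq lO) e1; apply: (vlB lO _ (vl1 lO)); apply: (vlD lO); apply: (vlM lO).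
have f2 : B11 * A12 + B12 * A22 = 0.
  by apply: (vl_uniq lO) e2; apply: (vlD lO); apply: (vlM lO).
have f3 : B21 * A11 + B22 * A21 = 0.
  by apply: (vl_uniq lO) e3; apply: (vlD lO); apply: (vlM lO).
have f4 : B21 * A12 + B22 * A22 - 1 = 0.
  by apply: (vl_uniq lO) e4; apply: (vlB lO _ (vl1 lO)); apply: (vlD lO); apply: (vlM lO).
have detB : (A11 * A22 - A12 * A21) * B11 = A22.
  have -> : (A11 * A22 - A12 * A21) * B11 = A22 +
    A22 * (B11 * A11 + B12 * A21 - 1) - A21 * (B11 * A12 + B12 * A22) by ring.
  by rewrite f1 f2 !mulr0 addr0 subr0.
have det0 : A11 * A22 - A12 * A21 != 0.
  by apply/eqP => h; move: detB A22n0; rewrite h mul0r => <-; rewrite eqxx.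
have B110 : B11 != 0.
  by apply/eqP => h; move: detB A22n0; rewrite h mulr0 => <-; rewrite eqxx.
pose w := v / u; have vw : vl O1 w c by exact: mx_loc_v.
have vu : vl O1 u 0 by apply/vl0/mx_loc_u.
have D : dom O O1 by [].
have euw : v = u * w by rewrite /w mulrCA divff ?mulr1.
pose e := a11 + a12 * w; have ve : vl O1 e (A11 + A12 * c).
  by apply: (vlD lO1); [apply: dom_vl D v11|apply: (vlM lO1) => //; apply: dom_vl D v12].
have en0 : A11 + A12 * c != 0.
  apply: contra_neq det0 => h; transitivity (A22 * (A11 + A12 * c)); last by rewrite h mulr0.
  by rewrite /c; field.
pose e' := a21 + a22 * w; have ve' : vl O1 e' 0.
  apply: (@vl_eq _ _ (A21 + A22 * c)); last by rewrite /c; field.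
  by apply: (vlD lO1); [apply: dom_vl D v21|apply: (vlM lO1) => //; apply: dom_vl D v22].
have es' : s = u * e by rewrite es {1}euw /e; ring.
have et' : t = u * e' by rewrite et {1}euw /e'; ring.
pose q := t / s; have eq : q = e' / e.
  by rewrite /q es' et' -mulf_div divff // mul1r.
have mq : mx O1 q.
  by apply/vl0; rewrite eq; apply: (vl_eq (vl_div lO1 ve' ve en0)); rewrite mul0r.
have hq := mx_in mq.
have sub1 (P : {poly K}) : (forall i, O P`_i) -> O1 P.[q].
  by move=> hP; apply: horner_in => // i; apply/sub/hP.
have nmx (P : {poly K}) : (forall i, O P`_i) -> ~ mx O P`_0 -> ~ mx O1 P.[q].
  move=> hP h h2; have h3 : mx O1 (P.[q] - P`_0).
    by apply: horner_vl => // i; apply/sub/hP.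
  have h4 : mx O1 P`_0.
    by rewrite -[P`_0](subKr P.[q]); apply: mxB.
  have [d hd] := loc_res buv (hP 0%N).
  have d0 : d != 0 by apply/eqP => d0; apply/h/vl0; rewrite -d0.
  exact: (vl_nmx lO1 (dom_vl D hd) d0) h4.
pose O' z := exists P Q : {poly K}, [/\ forall i, O P`_i, forall i, O Q`_i, ~ mx O Q`_0
           & z = P.[q] / Q.[q]].
rewrite -/(O' z).
have O'sub y : O' y -> O1 y.
  move=> [P [Q [hP hQ Q0 ->]]]; apply: (lrM lO1); first exact: sub1.
  by have [] := unitP lO1 (sub1 _ hQ) (nmx _ hQ Q0).
have qn0 (Q : {poly K}) : (forall i, O Q`_i) -> ~ mx O Q`_0 -> Q.[q] != 0.
  by move=> hQ Q0; have [] := unitP lO1 (sub1 _ hQ) (nmx _ hQ Q0).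
have nmxM x y : O x -> O y -> ~ mx O x -> ~ mx O y -> ~ mx O (x * y).
  move=> hx hy nx ny h; have [hx' x0] := unitP lO hx nx.
  by apply: ny; rewrite -[y](mulKf x0); apply: mxMl.
have OP (P R : {poly K}) : (forall i, O P`_i) -> (forall i, O R`_i) -> forall i, O (P * R)`_i.
  by move=> hP hR i; rewrite coefM; apply: lr_sum => // j _; apply: (lrM lO).
have OD (P R : {poly K}) : (forall i, O P`_i) -> (forall i, O R`_i) -> forall i, O (P + R)`_i.
  by move=> hP hR i; rewrite coefD; apply: (lrD lO).
have OC x : O x -> forall i, O (x%:P)`_i.
  by move=> hx i; rewrite coefC; case: eqP => _ //; apply: lr0.
have nmx1 : ~ mx O 1 by apply: (vl_nmx lO (vl1 lO)); rewrite oner_eq0.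
have O'O x : O x -> O' x.
  move=> hx; exists x%:P, 1; split; first exact: OC.
  + by move=> i; rewrite coef1; case: (i == 0%N); [exact: lr1|exact: lr0].
  + by rewrite coef1.
  by rewrite !hornerE divr1.
have [lO' mO'] : lring O' /\ (forall z, mx O' z <-> (O' z /\ mx O1 z)).
  apply: (sub_lring lO1) => //.
  + by move=> d; apply: O'O; exact: (lrC lO).
  + move=> x y [P [Q [hP hQ Q0 ->]]] [P' [Q' [hP' hQ' Q0' ->]]].
    exists (P * Q' + P' * Q), (Q * Q'); split; [by apply: OD; apply: OP|exact: OP| |].
      by rewrite coef0M; apply: nmxM.
    by rewrite addf_div ?qn0 // !hornerE.
  + move=> x y [P [Q [hP hQ Q0 ->]]] [P' [Q' [hP' hQ' Q0' ->]]].
    exists (P * P'), (Q * Q'); split; [exact: OP|exact: OP| |].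
      by rewrite coef0M; apply: nmxM.
    by rewrite mulf_div !hornerE.
  move=> x [P [Q [hP hQ Q0 ->]]] nx; exists Q, P; split=> //; last by rewrite invf_div.
  move=> P0; apply: nx; apply: (mxMr lO1); last first.
    by have [] := unitP lO1 (sub1 _ hQ) (nmx _ hQ Q0).
  rewrite -[P.[q]](subrK P`_0); apply: (mxD lO1); last exact: msub.
  by apply: horner_vl => // i; apply/sub/hP.
split; first exact: O'sub.
apply: loc_sub => //.
  apply/mO'; split; [exact: (O'O _ (mx_in (mx_loc_u buv)))|exact: (mx_loc_u bb)].
apply/mO'; split; last exact: (mx_loc_v bb).
rewrite -rmorphN; case: lO' => hC hD _ _; apply: hD; last exact: hC.
have nb11 : ~ mx O b11 by apply: (vl_nmx lO w11).
have cP x y : O x -> O y -> forall i, O (x%:P + y%:P * 'X)`_i.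
  by move=> hx hy [|i]; rewrite coefD coefMX !coefC /= ?addr0 ?add0r //; case: i => //= i; apply: lr0.
have cP0 x y : (x%:P + y%:P * 'X)`_0 = x :> K by rewrite coefD coefMX !coefC /= addr0.
(* The inverse homography v/u = (b21 + b22 q) / (b11 + b12 q), whose denominator has the unit b11 as
   constant coefficient. *)
exists (b21%:P + b22%:P * 'X), (b11%:P + b12%:P * 'X); split; rewrite ?cP0 //; try exact: cP.
have hE x y r : (x%:P + y%:P * 'X).[r] = x + y * r :> K.
  by rewrite hornerD hornerM !hornerC hornerX.
have s0 : s != 0.
  by rewrite es' mulf_neq0 //; apply: (vl_neq0 lO1 ve).
have Qn0 : b11 + b12 * q != 0.
  have := qn0 (b11%:P + b12%:P * 'X); rewrite cP0 hE; apply=> //; exact: cP.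
rewrite -/q !hE; apply/eqP; rewrite eqr_div //; apply/eqP.
have eu2 : u = s * (b11 + b12 * q) by rewrite {1}eu /q; field.
have ev2 : v = s * (b21 + b22 * q) by rewrite {1}ev' /q; field.
by rewrite {1}ev2 [in RHS]eu2; ring.
Qed.
End Quadratic.

(** The closed points of the exceptional curve: v/u takes a value c, or u/v takes the value 0. Which
    one occurs depends on the linear part of t. *)
Lemma qtrans_loc u v O' : birat u v ->
  (qtrans (loc u v) O' <->
   (exists c, O' = loc u (v / u - cst c)) \/ O' = loc v (u / v)).
Proof.
move=> b; have b' := birat_swap b; have lO := loc_lring b.
have gsw s t : (forall z, mx (loc u v) z <->
    exists a b, [/\ loc u v a, loc u v b & z = a * s + b * t]) ->
  (forall z, mx (loc u v) z <-> exists a b, [/\ loc u v a, loc u v b & z = a * t + b * s]).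
  move=> h z; rewrite h; split=> -[x [y [hx hy ->]]]; exists y, x; split=> //; exact: addrC.
split.
  move=> [s [t [gen eO']]].
  have ms : mx (loc u v) s.
    by apply/gen; exists 1, 0; split; [apply: lr1|apply: lr0|rewrite mul1r mul0r addr0].
  have mt : mx (loc u v) t.
    by apply/gen; exists 0, 1; split; [apply: lr0|apply: lr1|rewrite mul1r mul0r add0r].
  have [a11 [a12 [h11 h12 es]]] := (mx_loc_gen b _).1 ms.
  have [a21 [a22 [h21 h22 et]]] := (mx_loc_gen b _).1 mt.
  have [A21 v21] := loc_res b h21; have [A22 v22] := loc_res b h22.
  have [A220|A22n0] := eqVneq A22 0; last first.
    left; exists (- (A21 / A22)); apply: eqset_eq => z; rewrite eO'.
    exact: (quadratic_core b gen h11 h12 v21 v22 es et A22n0).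
  have [A210|A21n0] := eqVneq A21 0; last first.
    right; apply: eqset_eq => z; rewrite eO'; rewrite (loc_swap b) in gen h11 h12 v21 v22 *.
    rewrite addrC in es; rewrite addrC in et.
    have := quadratic_core b' gen h12 h11 v22 v21 es et A21n0 z.
    by rewrite A220 mul0r oppr0 rmorph0 subr0.
  (* With a zero linear part, t lies in the square of the maximal ideal. Then s alone would have to
     generate both linear forms: C A11 = 1, E A11 = 0 and E A12 = 1 contradict each other. *)
  exfalso; have [c [d [hc hd eu]]] := (gen u).1 (mx_loc_u b).
  have [e [f [he hf ev']]] := (gen v).1 (mx_loc_v b).
  have m21 : mx (loc u v) a21 by apply/vl0; rewrite -A210.
  have m22 : mx (loc u v) a22 by apply/vl0; rewrite -A220.
  have [] := loc_lin b (c1 := c * a11 + d * a21 - 1) (c2 := c * a12 + d * a22).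
  + by apply: (lrB lO); [apply: (lrD lO); apply: (lrM lO)|apply: lr1].
  + by apply: (lrD lO); apply: (lrM lO).
  + by apply: lin_rel1 eu es et.
  move=> x1 x2.
  have [] := loc_lin b (c1 := e * a11 + f * a21) (c2 := e * a12 + f * a22 - 1).
  + by apply: (lrD lO); apply: (lrM lO).
  + by apply: (lrB lO); [apply: (lrD lO); apply: (lrM lO)|apply: lr1].
  + by apply: lin_rel2 ev' es et.
  move=> x3 x4.
  have [A12 v12] := loc_res b h12; have [A11 v11] := loc_res b h11.
  have [E vE] := loc_res b he; have [C vC] := loc_res b hc.
  have y4 : E * A12 = 1.
    have : vl (loc u v) (e * a12 + f * a22 - 1) (E * A12 + 0 - 1).
      apply: (vlB lO _ (vl1 lO)); apply: (vlD lO); first exact: vlM.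
      by apply/vl0; apply: mxMl.
    move/(vl_uniq lO) => /(_ 0 ((vl0 _ _).2 x4)) /eqP; rewrite addr0 subr_eq0 => /eqP.
    by [].
  have y3 : E * A11 = 0.
    have : vl (loc u v) (e * a11 + f * a21) (E * A11 + 0).
      apply: (vlD lO); first exact: vlM.
      by apply/vl0; apply: mxMl.
    by move/(vl_uniq lO) => /(_ 0 ((vl0 _ _).2 x3)); rewrite addr0.
  have y1 : C * A11 = 1.
    have : vl (loc u v) (c * a11 + d * a21 - 1) (C * A11 + 0 - 1).
      apply: (vlB lO _ (vl1 lO)); apply: (vlD lO); first exact: vlM.
      by apply/vl0; apply: mxMl.
    move/(vl_uniq lO) => /(_ 0 ((vl0 _ _).2 x1)) /eqP; rewrite addr0 subr_eq0 => /eqP.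
    by [].
  have : (E * A12) * (C * A11) = (E * A11) * (C * A12) by ring.
  by rewrite y4 y1 y3 mul0r mulr1 => /eqP; rewrite oner_eq0.
case=> [[c ->]|->].
  exists u, (v - cst c * u); split.
    move=> z; rewrite (mx_loc_gen b); split=> -[x [y [hx hy ->]]].
      exists (x + y * cst c), y; split=> //; last by ring.
      by apply: (lrD lO) => //; apply: (lrM lO) => //; apply: lrC.
    exists (x - y * cst c), y; split=> //; last by ring.
    by apply: (lrB lO) => //; apply: (lrM lO) => //; apply: lrC.
  move=> z; symmetry.
  have := @quadratic_core u v u (v - cst c * u) 1 0 (cst (- c)) 1 (- c) 1 b.
  rewrite invr1 mulr1 opprK; apply; rewrite ?oner_eq0 //.
  + move=> {}z; rewrite (mx_loc_gen b); split=> -[x [y [hx hy ->]]].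
      exists (x + y * cst c), y; split=> //; last by ring.
      by apply: (lrD lO) => //; apply: (lrM lO) => //; apply: lrC.
    exists (x - y * cst c), y; split=> //; last by ring.
    by apply: (lrB lO) => //; apply: (lrM lO) => //; apply: lrC.
  + exact: lr1.
  + exact: lr0.
  + exact: vlC.
  + exact: vl1.
  + by rewrite mul1r mul0r addr0.
  + by rewrite rmorphN mulNr mul1r addrC.
exists v, u; split.
  move=> z; rewrite (mx_loc_gen b); split=> -[x [y [hx hy ->]]]; exists y, x; split=> //; exact: addrC.
move=> z; symmetry; rewrite (loc_swap b).
have lO' := loc_lring b'.
have := @quadratic_core v u v u 1 0 0 1 0 1 b'.
rewrite divr1 oppr0 rmorph0 subr0; apply; rewrite ?oner_eq0 //.
- by move=> {}z; rewrite (mx_loc_gen b').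
- exact: lr1.
- exact: lr0.
- by rewrite -{1}(rmorph0 cst); apply: vlC.
- exact: vl1.
- by rewrite mul1r mul0r addr0.
- by rewrite mul1r mul0r add0r.
Qed.
End LocalRings.
Opaque pe rX rY.
Arguments rX {k}.
Arguments rY {k}.

(** * The points of the surface *)

Ltac vls l :=
  first [match goal with H : vl _ ?z _ |- vl _ ?z _ => exact H end | lazymatch goal with
  | |- vl _ (_ + _) _ => eapply (vlD l); [vls l | vls l]
  | |- vl _ (- _) _ => eapply (vlN l); vls l
  | |- vl _ (_ / _) _ => eapply (vl_div l); [vls l | vls l | ]
  | |- vl _ (_ * _) _ => eapply (vlM l); [vls l | vls l]
  | |- vl _ (_ ^-1) _ => eapply (vlV l); [vls l | ]
  | |- vl _ (_ ^+ _) _ => eapply (vlX l); vls l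
  | |- vl _ 1 _ => exact (vl1 l)
  | |- vl _ (cst _ _) _ => exact (vlC l _)
  end].
Ltac vlq l := eapply vl_eq; [vls l | ].

Section Homogenize.
Variables (k : fieldType) (S : comNzRingType) (h : {rmorphism k -> S}).

(** Homogenization of P(U, V) to degree N by means of Z; it is used when N bounds the degree of P,
    so that the subtraction is not truncated. *)
Definition hsub (N : nat) (P : {mpoly k[2]}) (Z U V : S) : S :=
  \sum_(m <- msupp P) h P@_m * (U ^+ m ord0 * V ^+ m ord_max * Z ^+ (N - mdeg m)).

Lemma mdeg2 (m : 'X_{1..2}) : mdeg m = (m ord0 + m ord_max)%N.
Proof. by rewrite mdegE !big_ord_recl big_ord0 addn0 lift_ord2. Qed.
End Homogenize.

Lemma hsub_morph (k : fieldType) (S S' : comNzRingType) (h : {rmorphism k -> S})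
    (h' : {rmorphism k -> S'}) (f : {rmorphism S -> S'}) N P Z U V :
  (forall c, f (h c) = h' c) -> f (hsub h N P Z U V) = hsub h' N P (f Z) (f U) (f V).
Proof.
move=> hh; rewrite /hsub rmorph_sum; apply: eq_bigr => m _.
by rewrite !rmorphM !rmorphXn hh.
Qed.

Lemma hsub_scale (k : fieldType) (S : comNzRingType) (h : {rmorphism k -> S}) N P (Z u v : S) :
  (msize P <= N.+1)%N -> hsub h N P Z (Z * u) (Z * v) = Z ^+ N * mev h u v P.
Proof.
move=> hP; rewrite mevE /hsub mulr_sumr; apply: eq_big_seq => m hm.
have dm : (mdeg m <= N)%N by have := leq_trans (msize_mdeg_lt hm) hP.
rewrite [RHS]mulrCA; congr (_ * _); rewrite -[in RHS](subnK dm) {3}mdeg2 !exprMn !exprD; ring.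
Qed.

Lemma hsub_field (k F : fieldType) (h : {rmorphism k -> F}) N P (Z U V : F) :
  (msize P <= N.+1)%N -> Z != 0 ->
  hsub h N P Z U V = Z ^+ N * mev h (U / Z) (V / Z) P.
Proof.
move=> hP Z0; rewrite -hsub_scale //.
by rewrite ![Z * _]mulrC !divfK.
Qed.

Ltac nz1 := match goal with
  | |- is_true true => exact: isT
  | |- is_true (1 != 0) => exact: oner_neq0
  | H : is_true (?B != 0) |- is_true (?A != 0) =>
    first [ exact: H | (have -> : A = B by ring); exact: H
          | (have -> : A = - B by ring); rewrite oppr_eq0; exact: H ]
  end.
Ltac nzs := rewrite /=; repeat (apply/andP; split); nz1.

Section Plane.
Variables (k : fieldType) (M : funfield k).
Local Notation K := (ff M).
Local Notation tf := (tf M).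
Local Notation cst := (cst M).
Local Notation ev := (@ev k M).
Local Notation birat := (@birat k M).
Local Notation mx := (@mx k M).
Local Notation x := (@fx k M).
Local Notation y := (@fy k M).
Local Notation loc := (@loc k M).

HB.instance Definition _ := GRing.RMorphism.copy (@dh k M)
  (tf \o comp_mpoly [tuple 1; 'X_ord0; 'X_ord_max]).

Lemma dhM A B : dh M (A * B) = dh M A * dh M B. Proof. exact: rmorphM. Qed.
Lemma dhB A B : dh M (A - B) = dh M A - dh M B. Proof. exact: rmorphB. Qed.
Lemma dhZ c A : dh M (c *: A) = cst c * dh M A.
Proof. by rewrite -mul_mpolyC dhM /dh comp_mpolyC. Qed.

Definition i0 : 'I_3 := inord 0.
Definition i1 : 'I_3 := inord 1.
Definition i2 : 'I_3 := inord 2.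

Lemma ord3P (i : 'I_3) : [\/ i = i0, i = i1 | i = i2].
Proof.
case: i => [[|[|[|//]]] hi].
- by apply: Or31; apply/val_inj; rewrite /= inordK.
- by apply: Or32; apply/val_inj; rewrite /= inordK.
- by apply: Or33; apply/val_inj; rewrite /= inordK.
Qed.

Definition pt3 (T : Type) (a b c : T) (i : 'I_3) : T :=
  if i == i0 then a else if i == i1 then b else c.

Lemma pt3_0 T (a b c : T) : pt3 a b c i0 = a. Proof. by rewrite /pt3 eqxx. Qed.
Lemma pt3_1 T (a b c : T) : pt3 a b c i1 = b.
Proof. by rewrite /pt3 -val_eqE /= !inordK //= eqxx. Qed.
Lemma pt3_2 T (a b c : T) : pt3 a b c i2 = c.
Proof. by rewrite /pt3 -!val_eqE /= !inordK. Qed.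

Definition hom_eval (X : 'I_3 -> K) : {rmorphism {mpoly k[3]} -> K} := mmap cst X.

Lemma dhE_hom A : dh M A = hom_eval (pt3 1 x y) A.
Proof.
rewrite /dh /hom_eval /= /comp_mpoly /mmap rmorph_sum; apply: eq_bigr => m _.
rewrite rmorphM; congr (_ * _); rewrite /mmap1 rmorph_prod; apply: eq_bigr => i _.
rewrite rmorphXn; congr (_ ^+ _); rewrite (tnth_nth 0).
case: (ord3P i) => ->; rewrite ?pt3_0 ?pt3_1 ?pt3_2 inordK //=.
- by rewrite rmorph1.
- by rewrite fxE.
by rewrite fyE.
Qed.

Lemma dh_x0 : dh M x0 = 1.
Proof. by rewrite dhE_hom /hom_eval /= mmapX mmap1U pt3_0. Qed.
Lemma dh_x1 : dh M x1 = x.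
Proof. by rewrite dhE_hom /hom_eval /= mmapX mmap1U pt3_1. Qed.
Lemma dh_x2 : dh M x2 = y.
Proof. by rewrite dhE_hom /hom_eval /= mmapX mmap1U pt3_2. Qed.

Lemma TTE : TT M = x * y * (1 - x) / ((1 - x - y) * (1 - y)).
Proof.
by rewrite /TT !dhM !dhB dh_x0 dh_x1 dh_x2 mul1r.
Qed.

Lemma hom_eval_scale X A (c : K) d : A \is d.-homog ->
  hom_eval (fun i => c * X i) A = c ^+ d * hom_eval X A.
Proof.
move=> hA; rewrite /hom_eval /= /mmap mulr_sumr; apply: eq_big_seq => m hm.
rewrite mulrCA; congr (_ * _); rewrite /mmap1.
under eq_bigr do rewrite exprMn.
by rewrite big_split /= prodrXr -mdegE (dhomog_mf hA hm).
Qed.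

Lemma meval_scale (A : {mpoly k[3]}) (a : 'I_3 -> k) c d : A \is d.-homog ->
  A.@[fun i => c * a i] = c ^+ d * A.@[a].
Proof.
move=> hA; rewrite !mevalE mulr_sumr; apply: eq_big_seq => m hm.
rewrite mulrCA; congr (_ * _).
under eq_bigr do rewrite exprMn.
by rewrite big_split /= prodrXr -mdegE (dhomog_mf hA hm).
Qed.

Lemma vl_hom_eval S X a A : lring S -> (forall i, vl S (X i) (a i)) -> vl S (hom_eval X A) A.@[a].
Proof.
move=> lS hX; rewrite /hom_eval /= mevalE /mmap; apply: (vl_sum lS) => m.
apply: (vlM lS); first exact: vlC; rewrite /mmap1.
elim: (index_enum _) => [|i r ih]; first by rewrite !big_nil; apply: vl1.
by rewrite !big_cons; apply: (vlM lS) => //; apply: vlX.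
Qed.

Lemma hsub_homog N P (Z U V : {mpoly k[3]}) : (msize P <= N.+1)%N ->
  Z \is 1.-homog -> U \is 1.-homog -> V \is 1.-homog ->
  hsub (@mpolyC 3 k) N P Z U V \is N.-homog.
Proof.
move=> hP hZ hU hV; rewrite /hsub big_seq; apply: rpred_sum => m hm.
have dm : (mdeg m <= N)%N by have := leq_trans (msize_mdeg_lt hm) hP.
rewrite mul_mpolyC; apply: dhomogZ.
have := dhomogM (dhomogM (dhomogMn (m ord0) hU) (dhomogMn (m ord_max) hV))
  (dhomogMn (N - mdeg m) hZ).
by rewrite !mul1n -mdeg2 subnKC.
Qed.

(** Three linear forms with Z nonzero and U = V = 0 at the point give the parameters U/Z and V/Z.
    Homogeneous fractions are rewritten by dividing by powers of Z; conversely numerator and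
    denominator are homogenized to one common degree. *)
Lemma planeloc_eq (a : 'I_3 -> k) (Z U V : {mpoly k[3]}) (c : k) u v :
  Z \is 1.-homog -> U \is 1.-homog -> V \is 1.-homog -> c != 0 ->
  dh M Z != 0 -> Z.@[a] != 0 -> U.@[a] = 0 -> V.@[a] = 0 -> birat u v ->
  u = dh M U / dh M Z -> v = dh M V / dh M Z ->
  (forall i, vl (loc u v) (pt3 1 x y i / dh M Z) (c * a i)) ->
  @planeloc k M a = loc u v.
Proof.
move=> hZ hU hV c0 Z0 Za Ua Va b eu ev' hX; have lO := loc_lring b.
apply: eqset_eq => z; split=> [[d [A [B [hA hB B0 ->]]]]|[P [Q [Q0 ->]]]].
  have e : pt3 1 x y = (fun i => dh M Z * (pt3 1 x y i / dh M Z)).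
    by apply/funext => i; rewrite mulrCA divff // mulr1.
  rewrite !dhE_hom e (hom_eval_scale _ _ hA) (hom_eval_scale _ _ hB) -mulf_div divff ?expf_neq0 // mul1r.
  have vA := vl_hom_eval A lO hX; have vB := vl_hom_eval B lO hX.
  apply: (vl_in lO (vl_div lO vA vB _)).
  by rewrite (meval_scale _ _ hB) mulf_neq0 // expf_neq0.
pose N := maxn (msize P) (msize Q).
have hP : (msize P <= N.+1)%N by rewrite leqW // leq_maxl.
have hQ : (msize Q <= N.+1)%N by rewrite leqW // leq_maxr.
exists N, (hsub (@mpolyC 3 k) N P Z U V), (hsub (@mpolyC 3 k) N Q Z U V).
split; [exact: hsub_homog|exact: hsub_homog| |].
  have -> : (hsub (@mpolyC 3 k) N Q Z U V).@[a] = hsub (@idfun k) N Q Z.@[a] U.@[a] V.@[a].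
    by apply: (@hsub_morph _ _ _ _ (@idfun k) (meval a)) => d; rewrite /= mevalC.
  by rewrite Ua Va hsub_field // !mul0r mulf_neq0 // expf_neq0.
rewrite !(@hsub_morph _ _ _ _ cst (@dh k M)); try by move=> d; rewrite /= /dh comp_mpolyC.
rewrite !hsub_field // -eu -ev' -!evE -mulf_div divff ?mul1r //.
by rewrite expf_neq0.
Qed.

Lemma b_xy : birat x y. Proof. exact: birat_xy. Qed.

Lemma birat_addC2 u v c : birat u v -> birat u (v + cst c).
Proof. by move=> h; apply/birat_swap/birat_addC/birat_swap. Qed.

Lemma birat_subC u v c : birat u v -> birat (u - cst c) v.
Proof. by move=> h; rewrite -rmorphN; apply/birat_addC. Qed.

Lemma birat_subC2 u v c : birat u v -> birat u (v - cst c).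
Proof. by move=> h; rewrite -rmorphN; apply/birat_addC2. Qed.

Lemma birat_opp u v : birat u v -> birat (- u) v.
Proof.
by move=> h; rewrite -mulN1r -(rmorphN1 cst); apply/birat_scale; rewrite ?oppr_eq0 ?oner_eq0.
Qed.

Lemma birat_opp2 u v : birat u v -> birat u (- v).
Proof. by move=> h; apply/birat_swap/birat_opp/birat_swap. Qed.

Lemma birat_add u v : birat u v -> birat (u + v) v.
Proof. by move=> h; rewrite -[v in u + v]mul1r -(rmorph1 cst); apply/birat_shear. Qed.

Lemma birat_inv1 u v : birat u v -> birat u^-1 v.
Proof.
move=> h; have [u0 v0] := birat_neq0 h.
have h1 : birat (v * u) v by apply/birat_swap/birat_mul/birat_swap.
have h2 := birat_div h1.
have e : v / (v * u) = u^-1 by rewrite invfM mulrA divff // mul1r.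
rewrite e in h2; have h3 := birat_mul (birat_swap h2).
by move: h3; rewrite mulrC mulfK.
Qed.

Lemma birat_inv2 u v : birat u v -> birat u v^-1.
Proof. by move=> h; apply/birat_swap/birat_inv1/birat_swap. Qed.

Lemma birat_1y : birat (1 / y) (x / y).
Proof.
rewrite div1r; have h := birat_inv1 (birat_swap b_xy).
by have := birat_mul h; rewrite mulrC.
Qed.

Lemma birat_1x : birat (1 / x) (y / x).
Proof.
rewrite div1r; have h := birat_inv1 b_xy.
by have := birat_mul h; rewrite mulrC.
Qed.

Lemma x0_homog : x0 \is [in k[3], 1.-homog].
Proof. by rewrite dhomogX; apply/eqP/mdeg1. Qed.
Lemma x1_homog : x1 \is [in k[3], 1.-homog].
Proof. by rewrite dhomogX; apply/eqP/mdeg1. Qed.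
Lemma x2_homog : x2 \is [in k[3], 1.-homog].
Proof. by rewrite dhomogX; apply/eqP/mdeg1. Qed.

Lemma meval_x0 (a : 'I_3 -> k) : x0.@[a] = a i0. Proof. exact: mevalXU. Qed.
Lemma meval_x1 (a : 'I_3 -> k) : x1.@[a] = a i1. Proof. exact: mevalXU. Qed.
Lemma meval_x2 (a : 'I_3 -> k) : x2.@[a] = a i2. Proof. exact: mevalXU. Qed.

Let x_0 : x != 0 := fx_neq0 M.
Let y_0 : y != 0 := fy_neq0 M.

Lemma planeloc0 (a : 'I_3 -> k) : a i0 != 0 ->
  @planeloc k M a = loc (x - cst (a i1 / a i0)) (y - cst (a i2 / a i0)).
Proof.
move=> a0; have b : birat (x - cst (a i1 / a i0)) (y - cst (a i2 / a i0)).
  by apply/birat_subC/birat_subC2/b_xy.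
apply: (@planeloc_eq a x0 (x1 - (a i1 / a i0) *: x0) (x2 - (a i2 / a i0) *: x0) (a i0)^-1);
  rewrite ?dh_x0 ?oner_neq0 ?invr_eq0 //.
- exact: x0_homog.
- by rewrite rpredB ?x1_homog // dhomogZ // x0_homog.
- by rewrite rpredB ?x2_homog // dhomogZ // x0_homog.
- by rewrite meval_x0.
- by rewrite mevalB mevalZ meval_x1 meval_x0 divfK // subrr.
- by rewrite mevalB mevalZ meval_x2 meval_x0 divfK // subrr.
- by rewrite divr1 dhB dhZ dh_x0 dh_x1 mulr1.
- by rewrite divr1 dhB dhZ dh_x0 dh_x2 mulr1.
move=> i; rewrite divr1 [_^-1 * a i]mulrC.
case: (ord3P i) => ->; rewrite ?pt3_0 ?pt3_1 ?pt3_2.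
- by rewrite divff //; apply: vl1; apply: loc_lring.
- exact: mx_loc_u.
exact: mx_loc_v.
Qed.

Lemma planeloc2 (a : 'I_3 -> k) : a i0 = 0 -> a i2 != 0 ->
  @planeloc k M a = loc (1 / y) (x / y - cst (a i1 / a i2)).
Proof.
move=> a0 a2; have b : birat (1 / y) (x / y - cst (a i1 / a i2)).
  by apply/birat_subC2/birat_1y.
apply: (@planeloc_eq a x2 x0 (x1 - (a i1 / a i2) *: x2) (a i2)^-1);
  rewrite ?dh_x2 ?invr_eq0 ?dh_x0 //.
- exact: x2_homog.
- exact: x0_homog.
- by rewrite rpredB ?x1_homog // dhomogZ // x2_homog.
- by rewrite meval_x2.
- by rewrite meval_x0.
- by rewrite mevalB mevalZ meval_x1 meval_x2 divfK // subrr.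
- by rewrite dhB dhZ dh_x2 dh_x1 mulrBl mulfK.
move=> i; rewrite [_^-1 * _]mulrC.
case: (ord3P i) => ->; rewrite ?pt3_0 ?pt3_1 ?pt3_2.
- by rewrite a0 mul0r; apply/vl0; apply: mx_loc_u.
- exact: mx_loc_v.
by rewrite !divff //; apply: vl1; apply: loc_lring.
Qed.

Lemma planeloc1 (a : 'I_3 -> k) : a i0 = 0 -> a i2 = 0 -> a i1 != 0 ->
  @planeloc k M a = loc (1 / x) (y / x).
Proof.
move=> a0 a2 a1; have b := birat_1x.
apply: (@planeloc_eq a x1 x0 x2 (a i1)^-1);
  rewrite ?dh_x1 ?dh_x2 ?invr_eq0 ?dh_x0 //.
- exact: x1_homog.
- exact: x0_homog.
- exact: x2_homog.
- by rewrite meval_x1.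
- by rewrite meval_x0.
- by rewrite meval_x2.
move=> i; rewrite [_^-1 * _]mulrC.
case: (ord3P i) => ->; rewrite ?pt3_0 ?pt3_1 ?pt3_2.
- by rewrite a0 mul0r; apply/vl0; apply: mx_loc_u.
- by rewrite !divff //; apply: vl1; apply: loc_lring.
by rewrite a2 mul0r; apply/vl0; apply: mx_loc_v.
Qed.

(** Parameters at Q1, Q2, Q3, Q4 in this order, chosen so that the infinitely near base point lies
    in the direction v = 0. The remaining point Q5 has parameters 1 - x and 1 - y. *)
Inductive typeII : K -> K -> Prop :=
| TypeII1 : typeII (x / y) (1 / y)
| TypeII2 : typeII y (x + y - 1)
| TypeII3 : typeII (1 / x) (y / x)
| TypeII4 : typeII (1 - y) x.

Definition unitv (O : K -> Prop) (e : K) := exists2 c, c != 0 & vl O e c.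

Lemma typeII_birat u v : typeII u v -> birat u v.
Proof.
case.
- exact/birat_swap/birat_1y.
- rewrite -(rmorph1 cst); apply/birat_subC2/birat_swap/birat_add/b_xy.
- exact: birat_1x.
rewrite -(rmorph1 cst) addrC; apply/birat_addC/birat_opp/birat_swap/b_xy.
Qed.

Lemma typeI_birat : birat (1 - x) (1 - y).
Proof.
rewrite -(rmorph1 cst) addrC [cst 1 - y]addrC.
by apply/birat_addC/birat_opp/birat_addC2/birat_opp2/b_xy.
Qed.

Lemma birat_neq (u v : K) : birat u v -> [/\ u != 0, v != 0, u != v, u + v != 0 & 
   forall c d, u + cst c * v + cst d != 0].
Proof.
move=> b; have [u0 v0] := birat_neq0 b.
have h c d : u + cst c * v + cst d != 0.
  by have [] := birat_neq0 (birat_addC d (birat_shear c b)).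
split=> //.
- by rewrite -subr_eq0; have := h (-1) 0; rewrite rmorph0 addr0 rmorphN1 mulN1r.
- by have := h 1 0; rewrite rmorph0 addr0 rmorph1 mul1r.
Qed.

Lemma unitvV O e : lring O -> unitv O e -> unitv O e^-1.
Proof. by move=> lO [c c0 h]; exists c^-1; rewrite ?invr_eq0 //; apply: vlV. Qed.

(** All four points have the same local form, with T possibly inverted. Putting v = u w turns u (u -
    v) / v into u (1 - w) / w, so one base point is left on the exceptional curve, at w = 0; a
    second blow-up removes it. *)
Lemma typeII_T u v : typeII u v -> exists e, unitv (loc u v) e /\
  (TT M = e * (u * (u - v) / v) \/ (TT M)^-1 = e * (u * (u - v) / v)).
Proof.
move=> t; have b := typeII_birat t; have lO := loc_lring b.
have vu : vl (loc u v) u 0 by apply/vl0/mx_loc_u.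
have vv : vl (loc u v) v 0 by apply/vl0/mx_loc_v.
have [_ _ xy xpy hxy] := birat_neq b_xy.
have h1 : 1 - x != 0 by have [+ _] := birat_neq0 typeI_birat.
have h2 : 1 - y != 0 by have [_] := birat_neq0 typeI_birat.
have h3 : 1 - x - y != 0.
  have := hxy 1 (-1); rewrite rmorph1 mul1r rmorphN1 => h; rewrite -oppr_eq0 !opprD !opprK.
  by rewrite -addrA addrC.
have uI z c : vl (loc u v) z c -> c != 0 -> unitv (loc u v) z by move=> ? ?; exists c.
case: t b lO vu vv uI => b lO vu vv uI.
- exists (- (1 / ((1 / y - x / y - 1) * (1 / y - 1)))); split.
    apply: uI; first by vls lO; rewrite !sub0r !oppr0 !add0r mulrNN mulr1 oner_eq0.
    by rewrite !sub0r !oppr0 !add0r mulrNN mulr1 divr1 oppr_eq0 oner_eq0.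
  left; rewrite TTE; field; nzs.
- exists (- ((x + y - 1 - y + 1) / (1 - y))); split.
    apply: uI; first by vls lO; rewrite subr0 oner_eq0.
    by rewrite !subr0 !add0r divr1 oppr_eq0 oner_eq0.
  left; rewrite TTE; field; nzs.
- exists ((1 / x - 1 - y / x) / (1 / x - 1)); split.
    apply: uI; first by vls lO; rewrite sub0r oppr_eq0 oner_eq0.
    by rewrite !sub0r subr0 divff ?oppr_eq0 oner_eq0.
  right; rewrite TTE; field; nzs.
exists (1 / ((1 - (1 - y)) * (1 - x))); split.
  apply: uI; first by vls lO; rewrite !subr0 mulr1 oner_eq0.
  by rewrite !subr0 mulr1 divr1 oner_eq0.
right; rewrite TTE; field; nzs.
Qed.

Lemma typeI_T : exists e, unitv (loc (1 - x) (1 - y)) e /\ TT M = e * ((1 - x) / (1 - y)).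
Proof.
have b := typeI_birat; have lO := loc_lring b.
have vu : vl (loc (1 - x) (1 - y)) (1 - x) 0 by apply/vl0/mx_loc_u.
have vv : vl (loc (1 - x) (1 - y)) (1 - y) 0 by apply/vl0/mx_loc_v.
have [_ _ xy xpy hxy] := birat_neq b_xy.
have h1 : 1 - x != 0 by have [+ _] := birat_neq0 typeI_birat.
have h2 : 1 - y != 0 by have [_] := birat_neq0 typeI_birat.
have h3 : 1 - x - y != 0.
  have := hxy 1 (-1); rewrite rmorph1 mul1r rmorphN1 => h; rewrite -oppr_eq0 !opprD !opprK.
  by rewrite -addrA addrC.
exists ((1 - (1 - x)) * (1 - (1 - y)) / ((1 - x) + (1 - y) - 1)); split.
  eexists; last by vls lO; rewrite addr0 sub0r oppr_eq0 oner_eq0.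
  by rewrite !subr0 mulr1 addr0 sub0r invrN1 mul1r oppr_eq0 oner_eq0.
rewrite TTE; field; nzs.
Qed.

(* The points of the exceptional curves over a base point with two infinitely
   near base points, the second one in the direction of the curve v = 0. *)
Definition chartII (u v : K) (O : K -> Prop) : Prop :=
  [\/ O = loc v (u / v),
     exists2 c, c != 0 & O = loc u (v / u - cst c),
     exists c, O = loc u (v / u ^+ 2 - cst c)
   | O = loc (v / u) (u ^+ 2 / v)].

Definition chartI (u v : K) (O : K -> Prop) : Prop :=
  O = loc v (u / v) \/ exists c, O = loc u (v / u - cst c).

Definition affine_base (a b : k) : Prop :=
  [\/ a = 1 /\ b = 0, a = 0 /\ b = 1 | a = 1 /\ b = 1].

(** The points of X made explicit: affine points other than Q2, Q4, Q5, points of the line x0 = 0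
    other than Q1 and Q3, points over Q1 to Q4, points over Q5. *)
Definition XL (O : K -> Prop) : Prop :=
  [\/ exists a b, ~ affine_base a b /\ O = loc (x - cst a) (y - cst b),
     exists2 c, c != 0 & O = loc (1 / y) (x / y - cst c),
     exists u v, typeII u v /\ chartII u v O
   | chartI (1 - x) (1 - y) O].

(** The nine points that get blown up: Q1 to Q4, the points infinitely near to them, and Q5. *)
Definition XBase (O : K -> Prop) : Prop :=
  [\/ exists u v, typeII u v /\ O = loc u v,
     exists u v, typeII u v /\ O = loc u (v / u)
   | O = loc (1 - x) (1 - y)].

Lemma unitv_in O e z : lring O -> unitv O e -> O z -> O (e * z).
Proof. by move=> lO [c c0 h] hz; apply: (lrM lO) => //; apply: vl_in h. Qed.

Lemma unitv_cancel O e z : lring O -> unitv O e -> O (e * z) -> O z.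
Proof.
move=> lO [c c0 h] hz; have e0 := vl_neq0 lO h c0.
by rewrite -[z](mulKf e0); apply: (lrM lO) => //; apply: vl_inv h c0.
Qed.

Lemma dom_unitv O O' e : dom O O' -> unitv O e -> unitv O' e.
Proof. by move=> D [c c0 h]; exists c => //; apply: dom_vl h. Qed.

(** The denominator vanishes along the axis v = 0 and the numerator does not, so the quotient has a
    pole along a curve through the origin. *)
Lemma not_in_loc u v P Q : birat u v -> rY Q = 0 -> rY P != 0 -> Q != 0 -> P != 0 ->
  ~ loc u v (ev u v P / ev u v Q).
Proof.
move=> b hQ hP Q0 P0 [A [B [B0 /eqP]]].
rewrite eqr_div ?(ev_inj_neq0 (birat_inj b)) ?(pe_neq0 B0) // -!rmorphM.
move=> /eqP/(birat_inj b)/(congr1 (@rY k)); rewrite !rmorphM hQ mulr0 => /eqP.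
rewrite mulf_eq0 (negPf hP) orFb => /eqP h.
by move: B0; rewrite -rY_horner h horner0 eqxx.
Qed.

Lemma not_in_locX u v P Q : birat u v -> rX Q = 0 -> rX P != 0 -> Q != 0 -> P != 0 ->
  ~ loc u v (ev u v P / ev u v Q).
Proof.
move=> b hQ hP Q0 P0 [A [B [B0 /eqP]]].
rewrite eqr_div ?(ev_inj_neq0 (birat_inj b)) ?(pe_neq0 B0) // -!rmorphM.
move=> /eqP/(birat_inj b)/(congr1 (@rX k)); rewrite !rmorphM hQ mulr0 => /eqP.
rewrite mulf_eq0 (negPf hP) orFb => /eqP h.
by move: B0; rewrite -rX_horner h horner0 eqxx.
Qed.

Lemma basept_unit t O e g : lring O -> unitv O e -> (TT M = t \/ (TT M)^-1 = t) ->
  t = e * g -> ~ O g -> ~ O g^-1 -> basept (TT M) O.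
Proof.
move=> lO ue ht et h1 h2.
have n1 : ~ O t by rewrite et => /(unitv_cancel lO ue).
have n2 : ~ O t^-1 by rewrite et invfM => /(unitv_cancel lO (unitvV lO ue)).
by case: ht => h; rewrite -h ?invrK in n1 n2.
Qed.

Lemma nbasept_in t (O : K -> Prop) : (TT M = t \/ (TT M)^-1 = t) -> O t \/ O t^-1 ->
  ~ basept (TT M) O.
Proof.
move=> ht h [n1 n2]; case: ht h => <-; rewrite ?invrK; first by move=> [/n1|/n2].
by move=> [/n2|/n1].
Qed.

Let XY : {mpoly k[2]} := 'X_ord0 - 'X_ord_max.

Let rYXY : rY XY = 'X. Proof. by rewrite rmorphB rY_X rY_Y subr0. Qed.
Let rXXY : rX XY = - 'X. Proof. by rewrite rmorphB rX_X rX_Y sub0r. Qed.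
Let XY_neq0 : XY != 0.
Proof.
by apply/eqP => /(congr1 rY); rewrite rYXY rmorph0 => /eqP; rewrite polyX_eq0.
Qed.

Let Y1 : {mpoly k[2]} := 1 - 'X_ord_max.
Let rYY1 : rY Y1 = 1. Proof. by rewrite rmorphB rmorph1 rY_Y subr0. Qed.
Let rXY1 : rX Y1 = 1 - 'X. Proof. by rewrite rmorphB rmorph1 rX_Y. Qed.
Let Y1_neq0 : Y1 != 0.
Proof.
by apply/eqP => /(congr1 rY); rewrite rYY1 rmorph0 => /eqP; rewrite oner_eq0.
Qed.

Lemma base_typeII u v : typeII u v -> basept (TT M) (loc u v).
Proof.
move=> t; have b := typeII_birat t; have lO := loc_lring b.
have [e [ue ht]] := typeII_T t.
have eg : u * (u - v) / v = ev u v ('X_ord0 * XY) / ev u v 'X_ord_max.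
  by rewrite rmorphM rmorphB evX evY.
apply: (basept_unit lO ue ht erefl); rewrite eg ?invf_div.
  apply: not_in_loc; rewrite ?rY_Y ?mulf_neq0 ?X0_neq0 ?X1_neq0 //.
  by rewrite rmorphM rY_X rYXY mulf_neq0 ?polyX_eq0.
apply: not_in_locX; rewrite ?rX_Y ?polyX_eq0 ?mulf_neq0 ?X0_neq0 ?X1_neq0 //.
by rewrite rmorphM rX_X mul0r.
Qed.

Lemma base_typeII2 u v : typeII u v -> basept (TT M) (loc u (v / u)).
Proof.
move=> t; have b := typeII_birat t; have b1 := birat_div b; have lO := loc_lring b1.
have [e [ue ht]] := typeII_T t; have [u0 v0] := birat_neq0 b.
have D : dom (loc u v) (loc u (v / u)).
  by have [_] := blowup_dom 0 b; rewrite rmorph0 subr0.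
have eg : u * (u - v) / v = ev u (v / u) ('X_ord0 * Y1) / ev u (v / u) 'X_ord_max.
  by rewrite rmorphM rmorphB rmorph1 evX evY; field; nzs.
apply: (basept_unit lO (dom_unitv D ue) ht erefl); rewrite eg ?invf_div.
  apply: not_in_loc; rewrite ?rY_Y ?mulf_neq0 ?X0_neq0 ?X1_neq0 //.
  by rewrite rmorphM rY_X rYY1 mulr1 polyX_eq0.
apply: not_in_locX; rewrite ?rX_Y ?polyX_eq0 ?mulf_neq0 ?X0_neq0 ?X1_neq0 //.
by rewrite rmorphM rX_X mul0r.
Qed.

Lemma base_typeI : basept (TT M) (loc (1 - x) (1 - y)).
Proof.
have b := typeI_birat; have lO := loc_lring b; have [e [ue ht]] := typeI_T.
have eg : (1 - x) / (1 - y) = ev (1 - x) (1 - y) 'X_ord0 / ev (1 - x) (1 - y) 'X_ord_max.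
  by rewrite evX evY.
apply: (basept_unit lO ue (or_introl erefl) ht); rewrite eg ?invf_div.
  by apply: not_in_loc; rewrite ?rY_Y ?rY_X ?polyX_eq0 ?X0_neq0 ?X1_neq0.
by apply: not_in_locX; rewrite ?rX_Y ?rX_X ?polyX_eq0 ?X0_neq0 ?X1_neq0.
Qed.

Lemma dom_trans S1 S2 S3 : @dom k M S1 S2 -> dom S2 S3 -> dom S1 S3.
Proof. by move=> [h1 h2] [h3 h4]; split=> z; [move/h1/h3|move/h2/h4]. Qed.

Lemma blowup_dom2 u v : birat u v -> birat v (u / v) /\ dom (loc u v) (loc v (u / v)).
Proof.
move=> b; have [] := blowup_dom 0 (birat_swap b).
by rewrite rmorph0 subr0 (loc_swap b).
Qed.


Lemma chartII_props u v O : birat u v -> chartII u v O ->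
  [/\ exists p q, birat p q /\ O = loc p q, dom (loc u v) O,
      O (u / v) \/ O (v / u) & O (u * (u - v) / v) \/ O (u * (u - v) / v)^-1].
Proof.
move=> b; have [u0 v0] := birat_neq0 b.
have bd := birat_div b.
case=> [->|[c c0 ->]|[c ->]|->].
- have [b1 D] := blowup_dom2 b; have lO := loc_lring b1; split=> //.
  + by exists v, (u / v).
  + by left; apply: mx_in; apply: mx_loc_v.
  left; have -> : u * (u - v) / v = v * (u / v) * (u / v - 1) by field; nzs.
  have h1 := mx_in (mx_loc_u b1); have h2 := mx_in (mx_loc_v b1).
  by apply: (lrM lO); [apply: (lrM lO)|apply: (lrB lO) => //; apply: lr1].
- have [b1 D] := blowup_dom c b; have lO := loc_lring b1.
  have hw : vl (loc u (v / u - cst c)) (v / u) c by exact: mx_loc_v.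
  split=> //; first by exists u, (v / u - cst c).
    by right; apply: vl_in hw.
  have w0 : v / u != 0 by rewrite mulf_neq0 ?invr_eq0.
  left; have -> : u * (u - v) / v = u * (1 - v / u) / (v / u) by field; nzs.
  apply: (lrM lO); last exact: vl_inv hw c0.
  apply: (lrM lO); first exact: mx_in (mx_loc_u b1).
  by apply: (lrB lO); [apply: lr1|apply: vl_in hw].
- have [b1 D1] := blowup_dom 0 b; rewrite rmorph0 subr0 in b1 D1.
  have [b2 D2] := blowup_dom c b1.
  rewrite (_ : v / u / u = v / u ^+ 2) in b2 D2; last by field; nzs.
  have lO := loc_lring b2.
  have hw : vl (loc u (v / u ^+ 2 - cst c)) (v / u ^+ 2) c by exact: mx_loc_v.
  have hu : vl (loc u (v / u ^+ 2 - cst c)) u 0 by apply/vl0/mx_loc_u.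
  split=> //; [by exists u, (v / u ^+ 2 - cst c)|exact: dom_trans D1 D2| |].
    right; have -> : v / u = u * (v / u ^+ 2) by field; nzs.
    by apply: (lrM lO); [apply: vl_in hu|apply: vl_in hw].
  have uv0 : u - v != 0 by rewrite subr_eq0; have [_ _ ?] := birat_neq b.
  right; have -> : (u * (u - v) / v)^-1 = (v / u ^+ 2) / (1 - u * (v / u ^+ 2)).
    by field; nzs.
  apply: (lrM lO); first exact: vl_in hw.
  have h1 : vl (loc u (v / u ^+ 2 - cst c)) (1 - u * (v / u ^+ 2)) 1.
    by vlq lO; rewrite mul0r subr0.
  exact: vl_inv h1 (oner_neq0 _).
have [b1 D1] := blowup_dom 0 b; rewrite rmorph0 subr0 in b1 D1.
have [b2 D2] := blowup_dom2 b1.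
rewrite (_ : u / (v / u) = u ^+ 2 / v) in b2 D2; last by field; nzs.
have lO := loc_lring b2.
have hp : vl (loc (v / u) (u ^+ 2 / v)) (v / u) 0 by apply/vl0/mx_loc_u.
have hq : vl (loc (v / u) (u ^+ 2 / v)) (u ^+ 2 / v) 0 by apply/vl0/mx_loc_v.
split=> //; [by exists (v / u), (u ^+ 2 / v)|exact: dom_trans D1 D2| |].
  by right; apply: vl_in hp.
left; have -> : u * (u - v) / v = u ^+ 2 / v * (1 - v / u) by field; nzs.
apply: (lrM lO); first exact: vl_in hq.
by apply: (lrB lO); [apply: lr1|apply: vl_in hp].
Qed.

Lemma chartI_props u v O : birat u v -> chartI u v O ->
  [/\ exists p q, birat p q /\ O = loc p q, dom (loc u v) O
    & O (u / v) \/ O (v / u)].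
Proof.
move=> b; case=> [->|[c ->]].
  have [b1 D] := blowup_dom2 b; split=> //; first by exists v, (u / v).
  by left; apply: mx_in; apply: mx_loc_v.
have [b1 D] := blowup_dom c b.
have hw : vl (loc u (v / u - cst c)) (v / u) c by exact: mx_loc_v.
split=> //; first by exists u, (v / u - cst c).
by right; apply: vl_in (loc_lring b1) _ _ hw.
Qed.

Lemma nbase_chartII u v O : typeII u v -> chartII u v O -> ~ basept (TT M) O.
Proof.
move=> t h; have b := typeII_birat t; have [[p [q [bpq eO]]] D _ h2] := chartII_props b h.
have [e [ue ht]] := typeII_T t; have lO : lring O by rewrite eO; apply: loc_lring.
apply: nbasept_in ht _; have ue' := dom_unitv D ue.
case: h2 => h2; [left|right]; first exact: unitv_in.
by rewrite invfM; apply: unitv_in => //; apply: unitvV.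
Qed.

Lemma nbase_chartI O : chartI (1 - x) (1 - y) O -> ~ basept (TT M) O.
Proof.
move=> h; have b := typeI_birat; have [[p [q [bpq eO]]] D h2] := chartI_props b h.
have [e [ue ht]] := typeI_T; have lO : lring O by rewrite eO; apply: loc_lring.
apply: nbasept_in (or_introl ht) _; have ue' := dom_unitv D ue.
case: h2 => h2; [left|right]; first exact: unitv_in.
by rewrite invfM invf_div; apply: unitv_in => //; apply: unitvV.
Qed.

Lemma eq_birat (u u' v v' : K) : birat u v -> u = u' -> v = v' -> birat u' v'.
Proof. by move=> h <- <-. Qed.

Lemma affine_typeII2 : loc (x - cst 1) (y - cst 0) = loc y (x + y - 1).
Proof.
have b1 : birat (x - cst 1) (y - cst 0) by apply/birat_subC/birat_subC2/b_xy.
have b2 := typeII_birat TypeII2; have l1 := loc_lring b1; have l2 := loc_lring b2.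
apply: (loc_eq b1 b2); apply: (vl0 _ _).1.
- have h2 : vl (loc (x - cst 1) (y - cst 0)) y 0 by exact: mx_loc_v.
  exact: h2.
- have h1 : vl (loc (x - cst 1) (y - cst 0)) x 1 by exact: mx_loc_u.
  have h2 : vl (loc (x - cst 1) (y - cst 0)) y 0 by exact: mx_loc_v.
  by vlq l1; rewrite addr0 subrr.
- have h1 : vl (loc y (x + y - 1)) y 0 by apply: (vl0 _ _).2; exact: mx_loc_u.
  have h2 : vl (loc y (x + y - 1)) (x + y - 1) 0 by apply: (vl0 _ _).2; exact: mx_loc_v.
  have -> : x - cst 1 = (x + y - 1) - y by rewrite rmorph1; ring.
  by vlq l2; rewrite subr0.
have h1 : vl (loc y (x + y - 1)) y 0 by apply: (vl0 _ _).2; exact: mx_loc_u.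
by rewrite [cst 0]rmorph0 subr0.
Qed.

Lemma affine_typeII4 : loc (x - cst 0) (y - cst 1) = loc (1 - y) x.
Proof.
have b1 : birat (x - cst 0) (y - cst 1) by apply/birat_subC/birat_subC2/b_xy.
have b2 := typeII_birat TypeII4; have l1 := loc_lring b1; have l2 := loc_lring b2.
have h1 : vl (loc (x - cst 0) (y - cst 1)) x 0 by exact: mx_loc_u.
have h2 : vl (loc (x - cst 0) (y - cst 1)) y 1 by exact: mx_loc_v.
have h3 : vl (loc (1 - y) x) (1 - y) 0 by apply/vl0/mx_loc_u.
have h4 : vl (loc (1 - y) x) x 0 by apply/vl0/mx_loc_v.
apply: (loc_eq b1 b2); apply: (vl0 _ _).1.
- by vlq l1; rewrite subrr.
- exact: h1.
- by rewrite [cst 0]rmorph0 subr0.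
have -> : y - cst 1 = - (1 - y) by rewrite rmorph1; ring.
by vlq l2; rewrite oppr0.
Qed.

Lemma affine_typeI : loc (x - cst 1) (y - cst 1) = loc (1 - x) (1 - y).
Proof.
have b1 : birat (x - cst 1) (y - cst 1) by apply/birat_subC/birat_subC2/b_xy.
have b2 := typeI_birat; have l1 := loc_lring b1; have l2 := loc_lring b2.
have h1 : vl (loc (x - cst 1) (y - cst 1)) x 1 by exact: mx_loc_u.
have h2 : vl (loc (x - cst 1) (y - cst 1)) y 1 by exact: mx_loc_v.
have h3 : vl (loc (1 - x) (1 - y)) (1 - x) 0 by apply/vl0/mx_loc_u.
have h4 : vl (loc (1 - x) (1 - y)) (1 - y) 0 by apply/vl0/mx_loc_v.
apply: (loc_eq b1 b2); apply: (vl0 _ _).1.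
- by vlq l1; rewrite subrr.
- by vlq l1; rewrite subrr.
- have -> : x - cst 1 = - (1 - x) by rewrite rmorph1; ring.
  by vlq l2; rewrite oppr0.
have -> : y - cst 1 = - (1 - y) by rewrite rmorph1; ring.
by vlq l2; rewrite oppr0.
Qed.

Lemma typeII_plane u v : typeII u v -> nearp (TT M) (loc u v).
Proof.
have pl a b c : [|| a != 0, b != 0 | c != 0] ->
    nearp (TT M) (@planeloc k M (pt3 a b c)).
  move=> h; apply: nearp_plane; case/or3P: h => h.
  - by exists i0; rewrite pt3_0.
  - by exists i1; rewrite pt3_1.
  by exists i2; rewrite pt3_2.
case.
- rewrite loc_swap; last exact: typeII_birat TypeII1.
  have <- : @planeloc k M (pt3 0 0 1) = loc (1 / y) (x / y).
    rewrite planeloc2 ?pt3_0 ?pt3_1 ?pt3_2 ?oner_neq0 //.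
    by rewrite mul0r rmorph0 subr0.
  by apply: pl; rewrite oner_neq0 !orbT.
- rewrite -affine_typeII2.
  have <- : @planeloc k M (pt3 1 1 0) = loc (x - cst 1) (y - cst 0).
    by rewrite planeloc0 ?pt3_0 ?pt3_1 ?pt3_2 ?oner_neq0 // divr1 mul0r.
  by apply: pl; rewrite oner_neq0.
- have <- : @planeloc k M (pt3 0 1 0) = loc (1 / x) (y / x).
    by rewrite planeloc1 ?pt3_0 ?pt3_1 ?pt3_2 ?oner_neq0.
  by apply: pl; rewrite oner_neq0 !orbT.
rewrite -affine_typeII4.
have <- : @planeloc k M (pt3 1 0 1) = loc (x - cst 0) (y - cst 1).
  by rewrite planeloc0 ?pt3_0 ?pt3_1 ?pt3_2 ?oner_neq0 // mul0r divr1.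
by apply: pl; rewrite oner_neq0.
Qed.

Lemma typeI_plane : nearp (TT M) (loc (1 - x) (1 - y)).
Proof.
rewrite -affine_typeI.
have <- : @planeloc k M (pt3 1 1 1) = loc (x - cst 1) (y - cst 1).
  by rewrite planeloc0 ?pt3_0 ?pt3_1 ?pt3_2 ?oner_neq0 // !divr1.
by apply: nearp_plane; exists i0; rewrite pt3_0 oner_neq0.
Qed.

Lemma affine_nbase a b : ~ affine_base a b -> ~ basept (TT M) (loc (x - cst a) (y - cst b)).
Proof.
move=> h; have b1 : birat (x - cst a) (y - cst b) by apply/birat_subC/birat_subC2/b_xy.
have l1 := loc_lring b1.
have h1 : vl (loc (x - cst a) (y - cst b)) x a by exact: mx_loc_u.
have h2 : vl (loc (x - cst a) (y - cst b)) y b by exact: mx_loc_v.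
apply: (nbasept_in (or_introl erefl)); rewrite TTE.
have hF : vl (loc (x - cst a) (y - cst b)) (x * y * (1 - x)) (a * b * (1 - a)) by vls l1.
have hG : vl (loc (x - cst a) (y - cst b)) ((1 - x - y) * (1 - y)) ((1 - a - b) * (1 - b)).
  by vls l1.
have [G0|G0] := eqVneq ((1 - a - b) * (1 - b)) 0; last first.
  by left; apply: vl_in l1 _ _ (vl_div l1 hF hG G0).
right; rewrite invf_div.
have [F0|F0] := eqVneq (a * b * (1 - a)) 0; last by apply: vl_in l1 _ _ (vl_div l1 hG hF F0).
exfalso; apply: h; move/eqP: G0; move/eqP: F0.
rewrite !mulf_eq0 !subr_eq0 => /orP[/orP[]|] /eqP e1 /orP[] /eqP e2.
- by apply: Or32; rewrite e1 subr0 in e2 *.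
- by apply: Or32.
- by apply: Or31; split=> //; move/eqP: e2; rewrite e1 subr_eq0 => /eqP.
- by move/eqP: e2; rewrite e1 oner_eq0.
- by apply: Or31; rewrite -e2 e1 subrr.
by apply: Or33.
Qed.

Lemma lines_neq0 : [/\ 1 - x != 0, 1 - y != 0, 1 - x - y != 0 & x - y != 0].
Proof.
have [_ _ xy xpy hxy] := birat_neq b_xy.
have h1 : 1 - x != 0 by have [+ _] := birat_neq0 typeI_birat.
have h2 : 1 - y != 0 by have [_] := birat_neq0 typeI_birat.
split=> //; last by rewrite subr_eq0.
have := hxy 1 (-1); rewrite rmorph1 mul1r rmorphN1 => h; rewrite -oppr_eq0 !opprD !opprK.
by rewrite -addrA addrC.
Qed.

Lemma infinity_nbase c : c != 0 -> ~ basept (TT M) (loc (1 / y) (x / y - cst c)).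
Proof.
move=> c0; have b1 : birat (1 / y) (x / y - cst c) by apply/birat_subC2/birat_1y.
have l1 := loc_lring b1.
have h1 : vl (loc (1 / y) (x / y - cst c)) (1 / y) 0 by apply/vl0/mx_loc_u.
have h2 : vl (loc (1 / y) (x / y - cst c)) (x / y) c by exact: mx_loc_v.
apply: (nbasept_in (or_introl erefl)); right.
have [_ _ xy xpy hxy] := birat_neq b_xy.
have [n1 n2 n3 n4] := lines_neq0.
have -> : (TT M)^-1 = (1 / y - x / y - 1) * (1 / y - 1) * (1 / y) / (x / y * (1 / y - x / y)).
  by rewrite TTE; field; nzs.
have hd : vl (loc (1 / y) (x / y - cst c)) (x / y * (1 / y - x / y)) (c * (0 - c)) by vls l1.
have d0 : c * (0 - c) != 0 by rewrite sub0r mulf_neq0 ?oppr_eq0.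
have : vl (loc (1 / y) (x / y - cst c)) ((1 / y - x / y - 1) * (1 / y - 1) * (1 / y))
  ((0 - c - 1) * (0 - 1) * 0) by vls l1.
by move=> hn; apply: vl_in l1 _ _ (vl_div l1 hn hd d0).
Qed.

Lemma blowup_trans t u v O' : birat u v -> nearp t (loc u v) -> basept t (loc u v) ->
  (exists c, O' = loc u (v / u - cst c)) \/ O' = loc v (u / v) -> nearp t O'.
Proof. by move=> b h1 h2 h; apply: nearp_inf h1 h2 _; apply/qtrans_loc. Qed.

(** Induction on near points with the invariant [XL] or [XBase]. Points of [XL] are not base points,
    so only those of [XBase] are blown up, and [qtrans_loc] lists the results. *)
Lemma XX_XL (O : K -> Prop) : XX O <-> XL O.
Proof.
split=> [[hn hb]|].
  suff : XL O \/ XBase O.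
    case=> // -[[u [v [t e]]]|[u [v [t e]]]|e]; exfalso; apply: hb; rewrite e.
    - exact: base_typeII.
    - exact: base_typeII2.
    exact: base_typeI.
  apply: (hn (fun O => XL O \/ XBase O)) => {O hb hn}.
    move=> a ha; have [a0|a0] := eqVneq (a i0) 0; last first.
      rewrite planeloc0 //.
      have [hb|hb] := pselect (affine_base (a i1 / a i0) (a i2 / a i0)); last first.
        by left; apply: Or41; exists (a i1 / a i0), (a i2 / a i0).
      right; case: hb => -[-> ->].
      - by apply: Or31; exists y, (x + y - 1); split; [exact: TypeII2|exact: affine_typeII2].
      - by apply: Or31; exists (1 - y), x; split; [exact: TypeII4|exact: affine_typeII4].
      by apply: Or33; exact: affine_typeI.
    have [a2|a2] := eqVneq (a i2) 0; last first.
      rewrite planeloc2 //; have [a1|a1] := eqVneq (a i1 / a i2) 0.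
        right; apply: Or31; exists (x / y), (1 / y); split; first exact: TypeII1.
        by rewrite a1 rmorph0 subr0; apply: loc_swap; apply: birat_1y.
      by left; apply: Or42; exists (a i1 / a i2).
    have a1 : a i1 != 0.
      by case: ha => i; case: (ord3P i) => ->; rewrite ?a0 ?a2 ?eqxx.
    right; rewrite planeloc1 //; apply: Or31; exists (1 / x), (y / x); split=> //.
    exact: TypeII3.
  move=> O O' [h|h] hb hq.
    exfalso; case: h hb => [[a [b [hab ->]]]|[c c0 ->]|[u [v [t h]]]|h].
    - exact: affine_nbase.
    - exact: infinity_nbase.
    - exact: nbase_chartII t h.
    exact: nbase_chartI.
  case: h hb hq => [[u [v [t ->]]]|[u [v [t ->]]]|->] hb hq.
  - have b := typeII_birat t; move: hq => /(qtrans_loc _ b) [[c ->]|->].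
      have [->|c0] := eqVneq c 0.
        by right; apply: Or32; exists u, v; rewrite rmorph0 subr0.
      by left; apply: Or43; exists u, v; split=> //; apply: Or42; exists c.
    by left; apply: Or43; exists u, v; split=> //; apply: Or41.
  - have b := typeII_birat t; have [u0 v0] := birat_neq0 b.
    move: hq => /(qtrans_loc _ (birat_div b)) [[c ->]|->].
      left; apply: Or43; exists u, v; split=> //; apply: Or43; exists c.
      by rewrite (_ : v / u / u = v / u ^+ 2) //; field; nzs.
    left; apply: Or43; exists u, v; split=> //; apply: Or44.
    by rewrite (_ : u / (v / u) = u ^+ 2 / v) //; field; nzs.
  left; apply: Or44; move: hq => /(qtrans_loc _ typeI_birat) [[c ->]|->]; last by left.
  by right; exists c.
move=> h; split; last first.
  case: h => [[a [b [hab ->]]]|[c c0 ->]|[u [v [t h]]]|h].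
  - exact: affine_nbase.
  - exact: infinity_nbase.
  - exact: nbase_chartII t h.
  exact: nbase_chartI.
case: h => [[a [b [hab ->]]]|[c c0 ->]|[u [v [t h]]]|h].
- have <- : @planeloc k M (pt3 1 a b) = loc (x - cst a) (y - cst b).
    by rewrite planeloc0 ?pt3_0 ?pt3_1 ?pt3_2 ?oner_neq0 // !divr1.
  by apply: nearp_plane; exists i0; rewrite pt3_0 oner_neq0.
- have <- : @planeloc k M (pt3 0 c 1) = loc (1 / y) (x / y - cst c).
    by rewrite planeloc2 ?pt3_0 ?pt3_1 ?pt3_2 ?oner_neq0 // divr1.
  by apply: nearp_plane; exists i2; rewrite pt3_2 oner_neq0.
- have b := typeII_birat t; have [u0 v0] := birat_neq0 b.
  have n1 := typeII_plane t; have n2 : nearp (TT M) (loc u (v / u)).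
    apply: (blowup_trans b n1 (base_typeII t)).
    by left; exists 0; rewrite rmorph0 subr0.
  have B2 := base_typeII2 t; have b2 := birat_div b.
  case: h => [->|[c c0 ->]|[c ->]|->].
  + by apply: (blowup_trans b n1 (base_typeII t)); right.
  + by apply: (blowup_trans b n1 (base_typeII t)); left; exists c.
  + apply: (blowup_trans b2 n2 B2); left; exists c.
    by rewrite (_ : v / u / u = v / u ^+ 2) //; field; nzs.
  apply: (blowup_trans b2 n2 B2); right.
  by rewrite (_ : u / (v / u) = u ^+ 2 / v) //; field; nzs.
apply: (blowup_trans typeI_birat typeI_plane base_typeI).
by case: h => [->|[c ->]]; [right|left; exists c].
Qed.
End Plane.
Arguments pt3 {T}.

(** * Places of the function field *)

Section Places.
Variables (k : closedFieldType) (M : funfield k).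
Local Notation K := (ff M).
Local Notation F := (rf M).
Local Notation pf := (pf M).
Local Notation cst := (cst M).
Local Notation mx := (@mx k M).

Lemma pf_eq0 p : (pf p == 0) = (p == 0).
Proof. by rewrite -(rmorph0 pf) (inj_eq (@pf_inj k M)). Qed.

Lemma pf_frac_eq (a b c d : {poly k}) : b != 0 -> d != 0 -> pf a / pf b = pf c / pf d ->
  a * d = c * b.
Proof.
move=> b0 d0 /eqP; rewrite eqr_div ?pf_eq0 // -!rmorphM => /eqP; exact: pf_inj.
Qed.

Lemma pf_coprime (q : F) : exists a b, [/\ b != 0, coprimep a b & q = pf a / pf b].
Proof.
have [a [b [b0 ->]]] := pfP q; pose g := gcdp a b.
have g0 : g != 0 by rewrite gcdp_eq0 negb_and b0 orbT.
have hg d : d %| a -> d %| b -> d %| g by move=> h1 h2; rewrite dvdp_gcd h1.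
have [a' ea] := dvdpP _ _ (dvdp_gcdl a b : g %| a).
have [b' eb] := dvdpP _ _ (dvdp_gcdr a b : g %| b).
move: g g0 hg ea eb => g g0 hg ea eb; subst a b.
have b'0 : b' != 0 by apply: contraNneq b0 => ->; rewrite mul0r.
exists a', b'; split=> //; last first.
  by rewrite !rmorphM -mulf_div divff ?mulr1 // pf_eq0.
have : g * gcdp a' b' %| g.
  by apply: hg; rewrite [_ * g]mulrC dvdp_mul // ?dvdp_gcdl ?dvdp_gcdr.
by rewrite -{2}[g]mulr1 dvdp_mul2l // dvdp1.
Qed.

Lemma pf_sub (a b : {poly k}) c : b != 0 -> pf a / pf b - pf c%:P = pf (a - c%:P * b) / pf b.
Proof. by move=> b0; rewrite rmorphB rmorphM mulrBl mulfK ?pf_eq0. Qed.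

(** Valuation rings of k(t) over k. The last clause gives every element a value: q - c is zero or
    not invertible in R. *)
Definition place (R : F -> Prop) : Prop :=
  [/\ forall c, R (pf c%:P), forall a b, R a -> R b -> R (a + b),
      forall a b, R a -> R b -> R (a * b), forall q, R q \/ R q^-1
    & forall q, R q -> exists c, R (q - pf c%:P)^-1 -> q = pf c%:P].

Definition Rat (t : k) (q : F) : Prop :=
  exists a b, b.[t] != 0 /\ q = pf a / pf b.

Definition Rinf (q : F) : Prop :=
  exists a b : {poly k}, [/\ b != 0, (size a <= size b)%N & q = pf a / pf b].

Lemma horner_neq0 (p : {poly k}) t : p.[t] != 0 -> p != 0.
Proof. by apply: contraNneq => ->; rewrite horner0. Qed.

Lemma coprime_not_root (a b : {poly k}) t : coprimep a b -> b.[t] = 0 -> a.[t] != 0.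
Proof.
by move=> cab bt; apply: coprimep_root (_ : root b t); rewrite 1?coprimep_sym // rootE bt.
Qed.

Lemma place_at t : place (Rat t).
Proof.
split.
- by move=> c; exists c%:P, 1; rewrite hornerC oner_eq0 rmorph1 divr1.
- move=> _ _ [a [b [b0 ->]]] [c [d [d0 ->]]]; exists (a * d + c * b), (b * d).
  rewrite hornerM mulf_neq0 //; split=> //.
  by rewrite addf_div ?pf_eq0 ?(horner_neq0 b0) ?(horner_neq0 d0) // rmorphD !rmorphM.
- move=> _ _ [a [b [b0 ->]]] [c [d [d0 ->]]]; exists (a * c), (b * d).
  by rewrite hornerM mulf_neq0 // mulf_div !rmorphM.
- move=> q; have [a [b [b0 cab ->]]] := pf_coprime q.
  have [bt|bt] := eqVneq b.[t] 0; last by left; exists a, b.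
  by right; exists b, a; rewrite (coprime_not_root cab bt) invf_div.
move=> _ [a [b [b0 ->]]]; exists (a.[t] / b.[t]).
have bn := horner_neq0 b0; set c := _.[t] / _.
have e : pf a / pf b - pf c%:P = pf (a - c%:P * b) / pf b.
  exact: pf_sub.
have v0 : (a - c%:P * b).[t] = 0 by rewrite !hornerE divfK // subrr.
rewrite e invf_div => -[a' [b' [b'0 h]]].
have [z|z] := eqVneq (a - c%:P * b) 0.
  by apply/eqP; rewrite -subr_eq0 e z rmorph0 mul0r.
have := pf_frac_eq z (horner_neq0 b'0) h => /(congr1 (horner^~ t)) /eqP.
by rewrite !hornerM v0 mulr0 mulf_eq0 (negPf b0) (negPf b'0).
Qed.

Lemma place_inf : place Rinf.
Proof.
have szM (a b c d : {poly k}) : b != 0 -> d != 0 -> (size a <= size b)%N -> (size c <= size d)%N ->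
    (size (a * c)%R <= size (b * d)%R)%N.
  move=> b0 d0 h1 h2; rewrite (size_mul b0 d0).
  by apply: leq_trans (size_polyMleq _ _) _; rewrite -!subn1 leq_sub2r // leq_add.
split.
- by move=> c; exists c%:P, 1; rewrite oner_eq0 size_poly1 size_polyC_leq1 rmorph1 divr1.
- move=> _ _ [a [b [b0 h ->]]] [c [d [d0 h' ->]]]; exists (a * d + c * b), (b * d).
  rewrite mulf_neq0 //; split=> //; last by rewrite addf_div ?pf_eq0 // rmorphD !rmorphM.
  apply: leq_trans (size_polyD _ _) _; rewrite geq_max szM //= [b * d]mulrC szM //.
- move=> _ _ [a [b [b0 h ->]]] [c [d [d0 h' ->]]]; exists (a * c), (b * d).
  by rewrite mulf_neq0 // mulf_div !rmorphM szM.
- move=> q; have [a [b [b0 ->]]] := pfP q.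
  have [h|h] := leqP (size a) (size b); first by left; exists a, b.
  right; exists b, a; rewrite invf_div ltnW //; split=> //.
  by rewrite -size_poly_eq0 -lt0n (leq_ltn_trans _ h).
move=> _ [a [b [b0 h ->]]]; pose n := (size b).-1; exists (a`_n / lead_coef b).
have lb : lead_coef b != 0 by rewrite lead_coef_eq0.
set c := _ / lead_coef b.
have e : pf a / pf b - pf c%:P = pf (a - c%:P * b) / pf b.
  exact: pf_sub.
rewrite e invf_div => -[a' [b' [b'0 h' e']]].
have [z|z] := eqVneq (a - c%:P * b) 0.
  by apply/eqP; rewrite -subr_eq0 e z rmorph0 mul0r.
have sz : (size (a - c%:P * b)%R < size b)%N.
  have sb : size b = n.+1 by rewrite prednK // lt0n size_poly_eq0.
  rewrite sb ltnS; apply/leq_sizeP => j hj; rewrite coefB coefCM.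
  move: hj; rewrite leq_eqVlt => /orP[/eqP <-|hj].
    by rewrite /c lead_coefE divfK ?subrr // -lead_coefE.
  by rewrite !nth_default ?mulr0 ?subr0 // ?sb // (leq_trans h) // sb.
have := pf_frac_eq z b'0 e'.
move=> /(congr1 (fun p : {poly k} => size p)).
have b0' : (0 < size b)%N by rewrite lt0n size_poly_eq0.
have b'0' : (0 < size b')%N by rewrite lt0n size_poly_eq0.
rewrite size_mul // => e3.
have := size_polyMleq a' (a - c%:P * b); rewrite -e3.
move: (size (a - _)%R) sz => s3 sz hh; exfalso.
move: (size a) (size a') (size b) (size b') b0' b'0' sz h' hh => *; lia.
Qed.

(** In lowest terms a nonconstant denominator would have a root and q a pole there; regularity at
    infinity then bounds the degree of the numerator by 0. *)
Lemma all_places_const (q : F) : (forall t, Rat t q) -> Rinf q -> exists c, q = pf c%:P.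
Proof.
move=> hR [c [d [d0 hs e']]]; have [a [b [b0 cab e]]] := pf_coprime q.
have sb : size b == 1%N.
  apply/negPn/negP => /closed_rootP [t /eqP bt].
  have at0 := coprime_not_root cab bt.
  have [a' [b' [b'0 e2]]] := hR t; rewrite e in e2.
  have /(congr1 (horner^~ t)) /eqP := pf_frac_eq b0 (horner_neq0 b'0) e2.
  by rewrite !hornerM bt mulr0 mulf_eq0 (negPf at0) (negPf b'0).
have [r r0 eb] := size_poly1P _ sb; rewrite e in e'.
have e2 := pf_frac_eq b0 d0 e'.
have sa : (size a <= 1)%N.
  have [->|a0] := eqVneq a 0; first by rewrite size_poly0.
  have := congr1 (fun p : {poly k} => size p) e2.
  rewrite eb mulrC size_mul // [c * _]mulrC mul_polyC size_scale // => e3.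
  by move: (size a) (size d) (size c) d0 a0 e3 hs => s1 s2 s3 *; lia.
exists (a`_0 / r); rewrite e eb [a]size1_polyC // coefC /=.
rewrite polyCM rmorphM; congr (_ * _).
apply: (mulIf (_ : pf r%:P != 0)); first by rewrite pf_eq0 polyC_eq0.
by rewrite mulVf ?pf_eq0 ?polyC_eq0 // -rmorphM -polyCM mulVf // rmorph1.
Qed.

Definition resmap (V : K -> Prop) (rho : K -> F) : Prop :=
  [/\ forall x y, V x -> V y -> rho (x + y) = rho x + rho y /\ rho (x * y) = rho x * rho y,
      forall c, rho (cst c) = pf c%:P
    & forall x, V x -> (rho x = 0 <-> mx V x)].

Definition vring (W : K -> Prop) : Prop :=
  [/\ lring W, forall z, W z \/ W z^-1 & forall z, W z -> exists c, vl W z c].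

(** The composite of V with a place of its residue field. It turns a point of the normalization of a
    curve into a valuation ring of K with residue field k. *)
Definition comp (V : K -> Prop) (rho : K -> F) (R : F -> Prop) (z : K) : Prop :=
  V z /\ R (rho z).

Section Comp.
Variables (V : K -> Prop) (rho : K -> F) (R : F -> Prop).
Hypotheses (lV : lring V) (tV : forall z, V z \/ V z^-1) (hrho : resmap V rho) (pR : place R).
Let W := comp V rho R.

Lemma rhoD x y : V x -> V y -> rho (x + y) = rho x + rho y.
Proof. by case: hrho => h _ _ hx hy; case: (h x y hx hy). Qed.
Lemma rhoM x y : V x -> V y -> rho (x * y) = rho x * rho y.
Proof. by case: hrho => h _ _ hx hy; case: (h x y hx hy). Qed.
Lemma rhoC c : rho (cst c) = pf c%:P. Proof. by case: hrho. Qed.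
Lemma rho0P x : V x -> (rho x = 0 <-> mx V x). Proof. by case: hrho => _ _; apply. Qed.
Lemma rho1 : rho 1 = 1. Proof. by rewrite -(rmorph1 cst) rhoC rmorph1. Qed.

Lemma rhoV x : V x -> rho x != 0 -> V x^-1 /\ rho x^-1 = (rho x)^-1.
Proof.
move=> hx x0; have nx : ~ mx V x by move/(rho0P hx)/eqP; apply/negP.
have [hx' xn0] := unitP lV hx nx; split=> //.
by apply: (mulIf x0); rewrite -rhoM // mulVf // mulVf // rho1.
Qed.

Lemma placeC c : R (pf c%:P). Proof. by case: pR. Qed.
Lemma placeD a b : R a -> R b -> R (a + b). Proof. by case: pR => _ h _ _ _; apply: h. Qed.
Lemma placeM a b : R a -> R b -> R (a * b). Proof. by case: pR => _ _ h _ _; apply: h. Qed.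
Lemma place1 : R 1. Proof. by rewrite -(rmorph1 pf) -polyC1; apply: placeC. Qed.

Lemma mx_comp z : mx W z <-> (W z /\ (rho z = 0 \/ ~ R (rho z)^-1)).
Proof.
split=> [[[hz hR] h]|[[hz hR] h]].
  split=> //; have [e|n0] := eqVneq (rho z) 0; first by left.
  right=> hR'; have [hz' e] := rhoV hz n0.
  have z0 : z = 0 by apply: h; split; rewrite ?e.
  by move: n0; rewrite z0 -(rmorph0 cst) rhoC rmorph0 eqxx.
split=> // -[hz' hR'].
have [//|z0] := eqVneq z 0.
have e1 : rho z * rho z^-1 = 1 by rewrite -rhoM // divff // rho1.
have n0 : rho z != 0 by apply/eqP => e; move/eqP: e1; rewrite e mul0r eq_sym oner_eq0.
case: h => [e|]; first by rewrite e eqxx in n0.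
by case; have -> : (rho z)^-1 = rho z^-1 by rewrite -[LHS]mulr1 -e1 mulKf.
Qed.

(** Of a/b and b/a one is in R, say a/b; then b^-1 = (a/b + 1) (a + b)^-1 would be in R along with
    the inverse of the sum. *)
Lemma place_nonunit a b : (a = 0 \/ ~ R a^-1) -> (b = 0 \/ ~ R b^-1) ->
  a + b = 0 \/ ~ R (a + b)^-1.
Proof.
have key x y : x != 0 -> y != 0 -> R (x / y) -> R (x + y)^-1 -> x + y = 0 \/ R y^-1.
  move=> x0 y0 h1 h2; have [e|n0] := eqVneq (x + y) 0; [by left|right].
  have -> : y^-1 = (x / y + 1) * (x + y)^-1 by field; rewrite n0 y0.
  by apply: placeM => //; apply: placeD => //; exact: place1.
move=> ha hb; have [/eqP|n0] := eqVneq (a + b) 0; [by left; apply/eqP|right=> hR].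
have [a0|a0] := eqVneq a 0.
  by rewrite a0 add0r in hR n0; case: hb => // hb; rewrite hb eqxx in n0.
have [b0|b0] := eqVneq b 0.
  by rewrite b0 addr0 in hR n0; case: ha => // ha; rewrite ha eqxx in n0.
case: ha => [ha|ha]; first by rewrite ha eqxx in a0.
case: hb => [hb|hb]; first by rewrite hb eqxx in b0.
case: pR => _ _ _ /(_ (a / b)) [] h _.
  by case: (key a b a0 b0 h hR) => // e; rewrite e eqxx in n0.
rewrite invf_div in h; rewrite addrC in hR n0.
by case: (key b a b0 a0 h hR) => // e; rewrite e eqxx in n0.
Qed.

Lemma comp_vring : vring W.
Proof.
split.
- split.
  + by move=> c; split; [apply: (lrC lV)|rewrite rhoC; apply: placeC].
  + by move=> a b [a1 a2] [b1 b2]; split; [apply: (lrD lV)|rewrite rhoD //; apply: placeD].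
  + by move=> a b [a1 a2] [b1 b2]; split; [apply: (lrM lV)|rewrite rhoM //; apply: placeM].
  move=> a b /mx_comp[[a1 a2] a3] /mx_comp[[b1 b2] b3]; apply/mx_comp; split.
    by split; [apply: (lrD lV)|rewrite rhoD //; apply: placeD].
  by rewrite rhoD //; apply: place_nonunit.
- have key z : V z -> W z \/ W z^-1.
    move=> hz; have [e|n0] := eqVneq (rho z) 0.
      by left; split=> //; rewrite e -(rmorph0 pf) -polyC0; apply: placeC.
    have [hz' e] := rhoV hz n0.
    case: pR => _ _ _ /(_ (rho z)) [h|h] _; first by left.
    by right; split; rewrite ?e.
  move=> z; case: (tV z) => /key [] h; [by left|by right| |].
    by right.
  by left; rewrite invrK in h.
move=> z [hz hR]; case: pR => _ _ _ _ /(_ _ hR) [c hc]; exists c.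
have hc' : V (cst c) by apply: (lrC lV).
have e : rho (z - cst c) = rho z - pf c%:P.
  have -> : z - cst c = z + cst (- c) by rewrite rmorphN.
  have hcN : V (cst (- c)) by apply: (lrC lV).
  by rewrite rhoD // rhoC polyCN rmorphN.
apply/mx_comp; split.
  split; first exact: (lrB lV).
  by rewrite e -rmorphN -polyCN; apply: placeD => //; apply: placeC.
rewrite e; have [/hc ->|h] := pselect (R (rho z - pf c%:P)^-1); last by right.
by left; rewrite subrr.
Qed.
End Comp.

Section VringTheory.
Variable W : K -> Prop.
Hypothesis vW : vring W.
Let lW : lring W. Proof. by case: vW. Qed.

Lemma vrT z : W z \/ W z^-1. Proof. by case: vW. Qed.
Lemma vrR z : W z -> exists c, vl W z c. Proof. by case: vW => _ _; apply. Qed.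

Lemma vr_nonunit z : ~ W z^-1 -> mx W z.
Proof.
move=> h; have hz : W z by case: (vrT z).
by split=> // /h.
Qed.

End VringTheory.
End Places.

(** * Factorization of polynomials *)

(** Divisibility, not a discrete valuation ring. In particular [dvr a 1] says that a is a unit. *)
Definition dvr (A : comNzRingType) (c a : A) := exists e, a = c * e.

Definition irr (A : comNzRingType) (c : A) :=
  [/\ c != 0, ~ dvr c 1 & forall a b, c = a * b -> dvr a 1 \/ dvr b 1].

Section DvrTheory.
Variable A : comNzRingType.
Implicit Types a b c : A.

Lemma dvr_refl c : dvr c c. Proof. by exists 1; rewrite mulr1. Qed.
Lemma dvr0 c : dvr c 0. Proof. by exists 0; rewrite mulr0. Qed.
Lemma dvrMl c a b : dvr c b -> dvr c (a * b).
Proof. by move=> [e ->]; exists (a * e); rewrite mulrCA. Qed.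
Lemma dvrMr c a b : dvr c a -> dvr c (a * b).
Proof. by move=> h; rewrite mulrC; apply: dvrMl. Qed.
Lemma dvrD c a b : dvr c a -> dvr c b -> dvr c (a + b).
Proof. by move=> [e ->] [f ->]; exists (e + f); rewrite mulrDr. Qed.
Lemma dvr_trans a b c : dvr a b -> dvr b c -> dvr a c.
Proof. by move=> [e ->] [f ->]; exists (e * f); rewrite mulrA. Qed.
Lemma dvr_unit_mul a b c : dvr b 1 -> dvr (b * a) c <-> dvr a c.
Proof.
move=> [e e1]; split=> [[f ->]|[f ->]]; first by exists (b * f); rewrite mulrCA mulrA.
by exists (e * f); rewrite mulrACA -e1 mul1r.
Qed.
End DvrTheory.

Section DvrIso.
Variables (A B : comNzRingType) (f : {rmorphism A -> B}) (g : {rmorphism B -> A}).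
Hypotheses (fK : cancel f g) (gK : cancel g f).

Lemma dvr_iso a b : dvr (f a) (f b) <-> dvr a b.
Proof.
split=> [[e h]|[e ->]]; last by exists (f e); rewrite rmorphM.
by exists (g e); apply: (can_inj fK); rewrite h rmorphM gK.
Qed.

Lemma irr_iso c : irr c -> irr (f c).
Proof.
move=> [c0 c1 c2]; split.
- by rewrite -(rmorph0 f) (inj_eq (can_inj fK)).
- by rewrite -(rmorph1 f) => /dvr_iso.
have hu z : dvr (g z) 1 -> dvr z 1 by move=> /dvr_iso; rewrite gK (rmorph1 f).
move=> a b h; have := c2 (g a) (g b); move=> h2; case: h2 => [|/hu|/hu]; [|by left|by right].
by apply: (can_inj fK); rewrite h rmorphM !gK.
Qed.
End DvrIso.

Section RingAux.
Variable A : comNzRingType.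
Implicit Types a b c g q s u v w : A.

Lemma lin_comb a c s u1 v1 q u v :
  s * (u1 * c + v1 * a) - q * (u * c + v * a) = (s * u1 - q * u) * c + (s * v1 - q * v) * a.
Proof. ring. Qed.

Lemma cross_mul a c g s s' q q' : s * c = g * q -> s' * a = g * q' -> q * s' * a = c * (s * q').
Proof.
by move=> e1 e2; rewrite -mulrA e2 mulrA [q * g]mulrC -e1; ring.
Qed.

Lemma lin_comb_dvr a b c u v w : a * b = c * w -> (u * c + v * a) * b = c * (u * b + v * w).
Proof. by move=> e; rewrite mulrDl -[v * a * b]mulrA e; ring. Qed.

Lemma frac_cancel c e f a' b' : e * b' = a' * f -> c * e * b' = a' * (c * f).
Proof. by move=> e1; rewrite -mulrA e1; ring. Qed.
End RingAux.

(** * Gauss's lemma over k[X] *)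

Section Gauss.
Variable k : closedFieldType.
Local Notation R := {poly k}.
Local Notation lin t := (('X - t%:P)%:P : {poly R}).

Lemma polyCC_inv (r : k) : r != 0 -> (r^-1)%:P%:P * r%:P%:P = 1 :> {poly R}.
Proof. by move=> r0; rewrite -polyCM -polyCM mulVf. Qed.

Lemma dvr_lin t (P : {poly R}) : map_poly (horner_eval t) P = 0 -> dvr (lin t) P.
Proof.
move=> h; exists (map_poly (fun p : R => p %/ ('X - t%:P)) P).
apply/polyP => i; rewrite coefCM.
have hi : root P`_i t.
  by move/polyP/(_ i): h; rewrite coef_map coef0 /= /horner_eval => h; apply/rootP.
have [hs|hs] := leqP (size P) i.
  by rewrite nth_default // coef_map_id0 ?div0p // (nth_default _ hs) div0p mulr0.
rewrite coef_map_id0 ?div0p // mulrC divpK //.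
by rewrite dvdp_XsubCl.
Qed.

(** Evaluating the coefficients at t maps to the domain k[Y], and the kernel consists of the
    multiples of X - t. *)
Lemma lin_prime t (a b : {poly R}) : dvr (lin t) (a * b) -> dvr (lin t) a \/ dvr (lin t) b.
Proof.
move=> [e h]; have : map_poly (horner_eval t) (a * b) = 0.
  by rewrite h rmorphM /= map_polyC /= /horner_eval hornerXsubC subrr mul0r.
rewrite rmorphM => /eqP; rewrite mulf_eq0 => /orP[]/eqP /dvr_lin h'; by [left|right].
Qed.

Lemma lin_neq0 t : lin t != 0.
Proof. by rewrite polyC_eq0 polyXsubC_eq0. Qed.

Lemma size_lin t (P : {poly R}) : size (lin t * P) = size P.
Proof. by rewrite mul_polyC size_scale // polyXsubC_eq0. Qed.

Lemma poly_split_root (s : R) : s != 0 -> (size s <= 1)%N \/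
  exists t s', s = ('X - t%:P) * s' /\ (size s' < size s)%N /\ s' != 0.
Proof.
move=> s0; have [h|h] := leqP (size s) 1; [by left|right].
have /closed_rootP [t /factor_theorem [s' e]] : size s != 1%N by rewrite gtn_eqF.
have s'0 : s' != 0 by apply: contraNneq s0 => z; rewrite e z mul0r.
exists t, s'; split; first by rewrite mulrC.
by rewrite e size_Mmonic ?monicXsubC // size_XsubC addn2.
Qed.

(** The linear factors of s are removed one by one. Each is prime, so it divides g or e, and
    dividing by it does not change the degree in the outer variable. *)
Lemma cancel_content (s : R) (c g e : {poly R}) : s != 0 -> s%:P * c = g * e ->
  exists g' e', [/\ c = g' * e', size g' = size g & dvr g' g].
Proof.
have [n] := ubnP (size s); elim: n s g e => // n ih s g e; rewrite ltnS => hn s0 h.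
case: (poly_split_root s0) => [h1|[t [s' [es [hs s'0]]]]].
  have [r er] : exists r : k, s = r%:P by exists s`_0; rewrite [LHS]size1_polyC.
  have r0 : r != 0 by apply: contraNneq s0 => z; rewrite er z polyC0.
  exists g, ((r^-1)%:P%:P * e); split=> //; last exact: dvr_refl.
  by rewrite mulrCA -h er mulrA polyCC_inv // mul1r.
have h2 : dvr (lin t) (g * e) by exists (s'%:P * c); rewrite -h es polyCM mulrA.
case: (lin_prime h2) => [[g1 eg]|[e1 ee]].
  have [|g' [e' [e1 e2 e3]]] := ih s' g1 e (leq_trans hs hn) s'0.
    by apply: (mulfI (lin_neq0 t)); rewrite !mulrA -polyCM -es -eg.
  exists g', e'; rewrite eg size_lin; split=> //; exact: dvrMl.
have [|g' [e' [e1' e2 e3]]] := ih s' g e1 (leq_trans hs hn) s'0.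
  by apply: (mulfI (lin_neq0 t)); rewrite [RHS]mulrCA -ee !mulrA -polyCM -es.
by exists g', e'.
Qed.

Lemma dvr1_size (P : {poly R}) : dvr P 1 -> size P = 1%N.
Proof.
move=> [e h]; have : size (P * e) = 1%N by rewrite -h size_poly1.
have nz : P * e != 0 by rewrite -h oner_eq0.
move: nz; rewrite mulf_eq0 negb_or => /andP[P0 e0]; rewrite size_mul //.
by rewrite (polySpred P0) (polySpred e0) addSn addnS /= => -[] /eqP; rewrite addn_eq0 => /andP[/eqP -> _].
Qed.

(** Each linear factor of s divides c or e. It cannot divide the irreducible c, whose degree in the
    outer variable is positive, so it is cancelled against e. *)
Lemma irr_cancel (c a e : {poly R}) (s : R) : irr c -> (1 < size c)%N -> s != 0 ->
  s%:P * a = c * e -> dvr c a.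
Proof.
move=> [c0 c1 ic] sc; have [n] := ubnP (size s); elim: n s e => // n ih s e.
rewrite ltnS => hn s0 h; case: (poly_split_root s0) => [h1|[t [s' [es [hs s'0]]]]].
  have [r er] : exists r : k, s = r%:P by exists s`_0; rewrite [LHS]size1_polyC.
  have r0 : r != 0 by apply: contraNneq s0 => z; rewrite er z polyC0.
  exists ((r^-1)%:P%:P * e).
  by rewrite mulrCA -h er mulrA polyCC_inv // mul1r.
have h2 : dvr (lin t) (c * e) by exists (s'%:P * a); rewrite -h es polyCM mulrA.
case: (lin_prime h2) => [[g1 eg]|[e1 ee]].
  exfalso; case: (ic _ _ eg) => /dvr1_size hh; last first.
    by move: sc; rewrite eg size_lin hh.
  have [w /(congr1 (map_poly (horner_eval t)))] : dvr (lin t) 1.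
    case: (ic _ _ eg) => // /dvr1_size h3; by move: sc; rewrite eg size_lin h3.
  rewrite rmorph1 rmorphM /= map_polyC /= /horner_eval hornerXsubC subrr mul0r => /eqP.
  by rewrite oner_eq0.
apply: (ih s' e1 (leq_trans hs hn) s'0).
by apply: (mulfI (lin_neq0 t)); rewrite [RHS]mulrCA -ee !mulrA -polyCM -es.
Qed.

(** The element g has least degree among the nonzero elements of the ideal (c, a); pseudo-division
    by g leaves no remainder. The factors s and s' are the powers of the leading coefficient that
    pseudo-division introduces. *)
Lemma ideal_gcd (c a : {poly R}) : c != 0 -> exists (g u v : {poly R}) (s s' : R),
  [/\ g = u * c + v * a, g != 0, s != 0, s' != 0 &
    exists q q' : {poly R}, s%:P * c = g * q /\ s'%:P * a = g * q'].
Proof.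
move=> c0; pose I n := `[< exists g : {poly R}, [/\ g != 0, size g = n &
  exists u v : {poly R}, g = u * c + v * a] >].
have ex : exists n, I n.
  exists (size c); apply/asboolP; exists c; split=> //; exists 1, 0.
  by rewrite mul1r mul0r addr0.
case: (ex_minnP ex) => n /asboolP [g [g0 sg [u [v eg]]]] hmin.
have red (P : {poly R}) : (exists u v : {poly R}, P = u * c + v * a) ->
    exists (s : R) (q : {poly R}), s != 0 /\ s%:P * P = g * q.
  move=> [u1 [v1 eP]]; have := Pdiv.WeakIdomain.divp_eq P g; set m := scalp P g => e.
  exists (lead_coef g ^+ m), (divp P g); split; first by rewrite expf_neq0 // lead_coef_eq0.
  rewrite mul_polyC e; have [->|r0] := eqVneq (modp P g) 0; first by rewrite addr0 mulrC.
  have : I (size (modp P g)).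
    apply/asboolP; exists (modp P g); split=> //.
    exists ((lead_coef g ^+ m)%:P * u1 - divp P g * u), ((lead_coef g ^+ m)%:P * v1 - divp P g * v).
    have -> : modp P g = (lead_coef g ^+ m)%:P * P - divp P g * g by rewrite mul_polyC e addrAC subrr add0r.
    by rewrite -lin_comb -eP -eg.
  by move/hmin; rewrite -sg leqNgt ltn_modp g0.
have [s [q [s0 e1]]] : exists (s : R) (q : {poly R}), s != 0 /\ s%:P * c = g * q.
  by apply: red; exists 1, 0; rewrite mul1r mul0r addr0.
have [s' [q' [s'0 e2]]] : exists (s : R) (q : {poly R}), s != 0 /\ s%:P * a = g * q.
  by apply: red; exists 0, 1; rewrite mul1r mul0r add0r.
by exists g, u, v, s, s'; split=> //; exists q, q'.
Qed.

(** If g from [ideal_gcd] had positive degree, irreducibility of c would make g and c of equal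
    degree, and c would divide a. *)
Lemma irr_elim (c a : {poly R}) : irr c -> ~ dvr c a ->
  exists (h : R) (u v : {poly R}), h != 0 /\ h%:P = u * c + v * a.
Proof.
move=> ic hca; have [c0 c1 c2] := ic; have [sc|sc] := leqP (size c) 1.
  have e : c = (c`_0)%:P by rewrite [LHS]size1_polyC.
  exists c`_0, 1, 0; rewrite -e mul1r mul0r addr0; split=> //.
  by apply: contraNneq c0 => z; rewrite e z polyC0.
have [g [u [v [s [s' [eg g0 s0 s'0 [q [q' [e1 e2]]]]]]]]] := ideal_gcd a c0.
have [sg|sg] := leqP (size g) 1.
  have e : g = (g`_0)%:P by rewrite [LHS]size1_polyC.
  exists g`_0, u, v; rewrite -e; split=> //.
  by apply: contraNneq g0 => z; rewrite e z polyC0.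
exfalso; have [g' [e' [ec hs hd]]] := cancel_content s0 e1.
case: (c2 _ _ ec) => /dvr1_size; first by rewrite hs => h; rewrite h in sg.
move=> se'; have e'0 : e' != 0 by rewrite -size_poly_eq0 se'.
have hsz : size c = size g.
  have g'0 : g' != 0 by rewrite -size_poly_eq0 hs size_poly_eq0.
  by rewrite ec size_mul // hs se' addn1.
have q0 : q != 0.
  by apply: contraNneq c0 => z; move/eqP: e1; rewrite z mulr0 mulf_eq0 polyC_eq0 (negPf s0).
have sq : size q = 1%N.
  have := congr1 (fun p : {poly R} => size p) e1.
  rewrite mul_polyC size_scale // size_mul // hsz.
  by rewrite (polySpred q0) (polySpred g0) addSn addnS /= => -[]; lia.
have eq : q = (q`_0)%:P by rewrite [LHS]size1_polyC ?sq.
have q00 : q`_0 != 0 by apply: contraNneq q0 => z; rewrite eq z polyC0.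
apply: hca; apply: (@irr_cancel c a (s%:P * q') (q`_0 * s') ic sc).
  by rewrite mulf_neq0.
by rewrite polyCM -eq; exact: cross_mul e1 e2.
Qed.

(** When c does not divide a, elimination gives h = u c + v a with h in k[X]; then h b is a multiple
    of c and h can be cancelled. An irreducible c of degree 0 is linear over the closed field and is
    handled by [lin_prime]. *)
Lemma irr_prime_poly (c a b : {poly R}) : irr c -> dvr c (a * b) -> dvr c a \/ dvr c b.
Proof.
move=> ic hab; have [h|hca] := pselect (dvr c a); [by left|right].
have [c0 c1 c2] := ic; have [sc|sc] := leqP (size c) 1.
  have ec : c = (c`_0)%:P by rewrite [LHS]size1_polyC.
  have c00 : c`_0 != 0 by apply: contraNneq c0 => z; rewrite ec z polyC0.
  case: (poly_split_root c00) => [h1|[t [s' [es [hs s'0]]]]].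
    have [r er] : exists r : k, c`_0 = r%:P by exists (c`_0)`_0; rewrite [LHS]size1_polyC.
    have r0 : r != 0 by apply: contraNneq c00 => z; rewrite er z polyC0.
    by case: c1; exists (r^-1)%:P%:P; rewrite ec er mulrC polyCC_inv.
  rewrite es polyCM in ec; have us : dvr s'%:P 1.
    case: (c2 _ _ ec) => // -[w /(congr1 (map_poly (horner_eval t)))].
    rewrite rmorph1 rmorphM /= map_polyC /= /horner_eval hornerXsubC subrr mul0r => /eqP.
    by rewrite oner_eq0.
  rewrite ec mulrC in hab hca *.
  by move: hab => /(dvr_unit_mul _ _ us)/lin_prime [] /(dvr_unit_mul _ _ us).
have [h [u [v [h0 e]]]] := irr_elim ic hca.
have [w ew] := hab; apply: (@irr_cancel c b (u * b + v * w) h ic sc h0).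
by rewrite e; exact: lin_comb_dvr.
Qed.
End Gauss.

(** * Irreducible polynomials in two variables *)

Section MPoly2.
Variable k : closedFieldType.
Local Notation A := {mpoly k[2]}.
Local Notation B := {poly {poly k}}.
Local Notation X := ('X_ord0 : A).
Local Notation Y := ('X_ord_max : A).

Definition cc : {rmorphism k -> B} := (@polyC {poly k} \o @polyC k).
Definition toB : {rmorphism A -> B} := mev cc ('X%:P) 'X.
Definition evx : {rmorphism {poly k} -> A} := (horner_eval X \o map_poly (@mpolyC 2 k)).
Definition toA : {rmorphism B -> A} := (horner_eval Y \o map_poly evx).

Lemma evxC c : evx c%:P = c%:MP.
Proof. by rewrite /evx /= map_polyC /= /horner_eval hornerC. Qed.
Lemma evxX : evx 'X = X.
Proof. by rewrite /evx /= map_polyX /horner_eval hornerX. Qed.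
Lemma toAC p : toA p%:P = evx p.
Proof. by rewrite {1}/toA /= map_polyC /= /horner_eval hornerC. Qed.
Lemma toAX : toA 'X = Y.
Proof. by rewrite {1}/toA /= map_polyX /horner_eval hornerX. Qed.
Lemma toBC c : toB c%:MP = c%:P%:P. Proof. by rewrite /toB /= mevC. Qed.
Lemma toBX : toB X = 'X%:P. Proof. by rewrite /toB /= mevX. Qed.
Lemma toBY : toB Y = 'X. Proof. by rewrite /toB /= mevY. Qed.
Opaque toA toB evx.

Lemma toBK : cancel toB toA.
Proof.
move=> p; pose f := [the {rmorphism _ -> _} of toA \o toB].
apply: (@mpoly2_ext k A f idfun) => [c||] /=.
- by rewrite toBC toAC evxC.
- by rewrite toBX toAC evxX.
- by rewrite toBY toAX.
Qed.

Lemma toAK : cancel toA toB.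
Proof.
have h (p : {poly k}) : toB (evx p) = p%:P.
  elim/poly_ind: p => [|p c ih]; first by rewrite rmorph0 rmorph0 polyC0.
  by rewrite !rmorphD !rmorphM evxC evxX ih toBC toBX.
elim/poly_ind => [|p c ih]; first by rewrite rmorph0 rmorph0.
by rewrite !rmorphD !rmorphM toAC toAX ih toBY h.
Qed.

Lemma irr_prime (c a b : A) : irr c -> dvr c (a * b) -> dvr c a \/ dvr c b.
Proof.
move=> /(irr_iso toBK toAK) hc /(dvr_iso toBK toAK c (a * b)).2; rewrite rmorphM.
by move=> /(irr_prime_poly hc) [] /(dvr_iso toBK toAK) h; [left|right].
Qed.

(** The curves c = 0 and a = 0 have no common component, so their common zeros have finitely many
    abscissas, the roots of h. *)
Lemma irr_elimX (c a : A) : irr c -> ~ dvr c a ->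
  exists (h : {poly k}) (u v : A), h != 0 /\ evx h = u * c + v * a.
Proof.
move=> hc hca; have [|h [u [v [h0 e]]]] := @irr_elim k (toB c) (toB a) (irr_iso toBK toAK hc).
  by move/(dvr_iso toBK toAK).
exists h, (toA u), (toA v); split=> //.
by rewrite -toAC e rmorphD !rmorphM !toBK.
Qed.

Definition swapA : {rmorphism A -> A} := mev (@mpolyC 2 k) Y X.
Lemma swapC c : swapA c%:MP = c%:MP. Proof. by rewrite /swapA /= mevC. Qed.
Lemma swapX : swapA X = Y. Proof. by rewrite /swapA /= mevX. Qed.
Lemma swapY : swapA Y = X. Proof. by rewrite /swapA /= mevY. Qed.
Opaque swapA.
Lemma swapK : involutive swapA.
Proof.
move=> p; pose f := [the {rmorphism _ -> _} of swapA \o swapA].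
apply: (@mpoly2_ext k A f idfun) => [c||] /=.
- by rewrite !swapC.
- by rewrite swapX swapY.
- by rewrite swapY swapX.
Qed.

Definition evy : {rmorphism {poly k} -> A} := (horner_eval Y \o map_poly (@mpolyC 2 k)).
Lemma evyC c : evy c%:P = c%:MP.
Proof. by rewrite /evy /= map_polyC /= /horner_eval hornerC. Qed.
Lemma evyX : evy 'X = Y.
Proof. by rewrite /evy /= map_polyX /horner_eval hornerX. Qed.
Opaque evy.

Lemma swap_evx h : swapA (evx h) = evy h.
Proof.
elim/poly_ind: h => [|p c ih]; first by rewrite !rmorph0.
by rewrite !rmorphD !rmorphM evxC evxX evyC evyX swapC swapX ih.
Qed.

Lemma irr_elimY (c a : A) : irr c -> ~ dvr c a ->
  exists (h : {poly k}) (u v : A), h != 0 /\ evy h = u * c + v * a.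
Proof.
move=> hc hca; have [|h [u [v [h0 e]]]] := @irr_elimX (swapA c) (swapA a) (irr_iso swapK swapK hc).
  by move/(dvr_iso swapK swapK).
exists h, (swapA u), (swapA v); split=> //; rewrite -swap_evx e rmorphD.
by congr (_ + _); rewrite rmorphM; congr (_ * _); apply: swapK.
Qed.

Lemma dvr1_msize (p : A) : dvr p 1 <-> msize p = 1%N.
Proof.
split=> [[e h]|h].
  have : msize (p * e) = 1%N by rewrite -h msize1.
  have nz : p * e != 0 by rewrite -h oner_eq0.
  move: nz; rewrite mulf_eq0 negb_or => /andP[P0 e0]; rewrite msizeM //.
  by move: P0 e0; rewrite -!msize_poly_eq0; case: (msize p) => [//|n]; case: (msize e) => [//|m];
    rewrite addSn addnS => _ _ /= -[] /eqP; rewrite addn_eq0 => /andP[/eqP -> _].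
have [c ec] : exists c, p = c%:MP.
  by exists p@_0; apply: msize1_polyC; rewrite h.
have c0 : c != 0.
  apply/eqP => z; have : msize p = 0%N by rewrite ec z mpolyC0 msize0.
  by rewrite h.
by exists (c^-1)%:MP; rewrite ec -mpolyCM mulfV.
Qed.

(** Here Q is vanishing at a point, vanishing along a valuation, or failing to be a unit; the factor
    found keeps the property. *)
Lemma irr_factor (Q : A -> Prop) (p : A) : (forall a b, Q (a * b) -> Q a \/ Q b) ->
  (forall a, dvr a 1 -> ~ Q a) -> p != 0 -> Q p -> exists c, [/\ irr c, dvr c p & Q c].
Proof.
move=> hQ h1; have [n] := ubnP (msize p); elim: n p => // n ih p hn p0 qp.
have [hi|hi] := pselect (irr p); first by exists p; split=> //; exact: dvr_refl.
have [a [b [e na nb]]] : exists a b, [/\ p = a * b, ~ dvr a 1 & ~ dvr b 1].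
  apply: contrapT => h; apply: hi; split=> //; first by move/h1.
  move=> a b e; apply: contrapT => /not_orP[na nb]; apply: h; by exists a, b.
have ab : a * b != 0 by rewrite -e.
move: (ab); rewrite mulf_eq0 negb_or => /andP[a0 b0].
have sz : msize p = (msize a + msize b).-1 by rewrite e msizeM.
have sa : (1 < msize a)%N.
  have : msize a <> 1%N by move/dvr1_msize.
  by move: a0; rewrite -msize_poly_eq0; case: (msize a) => [|[|]].
have sb : (1 < msize b)%N.
  have : msize b <> 1%N by move/dvr1_msize.
  by move: b0; rewrite -msize_poly_eq0; case: (msize b) => [|[|]].
rewrite sz in hn; rewrite e in qp; case: (hQ _ _ qp) => [q|q].
  have [|c [c1 c2 c3]] := ih a _ a0 q; first by move: (msize a) (msize b) sa sb hn => *; lia.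
  by exists c; split=> //; rewrite e; apply: dvrMr.
have [|c [c1 c2 c3]] := ih b _ b0 q; first by move: (msize a) (msize b) sa sb hn => *; lia.
by exists c; split=> //; rewrite e; apply: dvrMl.
Qed.

Lemma lowest_terms (a b : A) : b != 0 -> exists a' b', [/\ b' != 0, a * b' = a' * b &
  forall c, irr c -> dvr c a' -> dvr c b' -> False].
Proof.
have [n] := ubnP (msize b); elim: n a b => // n ih a b hn b0.
have [[c [hc [e ea] [f ef]]]|h] := pselect (exists c, [/\ irr c, dvr c a & dvr c b]).
  have [c0 c1 _] := hc; have f0 : f != 0 by apply: contraNneq b0 => z; rewrite ef z mulr0.
  have [|a' [b' [b'0 h1 h2]]] := ih e f _ f0.
    move: hn; rewrite ef msizeM //.
    have : msize c <> 1%N by move/dvr1_msize.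
    move: c0 f0; rewrite -!msize_poly_eq0.
    by move: (msize c) (msize f) => *; lia.
  by exists a', b'; split=> //; rewrite ea ef; exact: frac_cancel.
exists a, b; split=> // c c1 c2 c3; apply: h; by exists c.
Qed.
End MPoly2.
Opaque evx evy swapA toA toB.
Arguments evx {k}.
Arguments evy {k}.

(** * Curves as discrete valuation rings *)

Section Curves.
Variables (k : closedFieldType) (M : funfield k).
Local Notation K := (ff M).
Local Notation cst := (cst M).
Local Notation ev := (@ev k M).
Local Notation birat := (@birat k M).
Local Notation mx := (@mx k M).
Local Notation loc := (@loc k M).
Local Notation A2 := {mpoly k[2]}.

(** The localization of k[u, v] at the prime (c): the discrete valuation ring of the curve c = 0 in
    the coordinates u, v. *)
Definition Wc (u v : K) (c : A2) (z : K) : Prop :=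
  exists P Q : A2, ~ dvr c Q /\ z = ev u v P / ev u v Q.

Lemma ndvr_neq0 (c Q : A2) : ~ dvr c Q -> Q != 0.
Proof. by move=> h; apply/eqP => e; apply: h; rewrite e; apply: dvr0. Qed.

Lemma pe0_prime (a b : A2) : pe 0 0 (a * b) = 0 -> pe 0 0 a = 0 \/ pe 0 0 b = 0.
Proof. by rewrite rmorphM => /eqP; rewrite mulf_eq0 => /orP[]/eqP; [left|right]. Qed.

Lemma pe0_unit (a : A2) : dvr a 1 -> pe 0 0 a <> 0.
Proof.
move=> [e /(congr1 (pe 0 0))]; rewrite rmorph1 rmorphM => h a0.
by move/eqP: h; rewrite a0 mul0r oner_eq0.
Qed.

Lemma pe0_dvr (c Q : A2) : pe 0 0 c = 0 -> pe 0 0 Q != 0 -> ~ dvr c Q.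
Proof. by move=> c0 Q0 [e h]; move: Q0; rewrite h rmorphM c0 mul0r eqxx. Qed.

Lemma irr_factor0 (P : A2) : P != 0 -> pe 0 0 P = 0 ->
  exists c : A2, [/\ irr c, pe 0 0 c = 0 & dvr c P].
Proof.
move=> P0 h; have [c [hc dc c0]] :=
  @irr_factor k (fun a => pe 0 0 a = 0) P pe0_prime pe0_unit P0 h.
by exists c.
Qed.

Section Wring.
Variables (u v : K) (c : A2).
Hypotheses (b : birat u v) (hc : irr c).

Let inj := birat_inj b.
Let ev0 (Q : A2) : ~ dvr c Q -> ev u v Q != 0.
Proof. by move=> h; apply: (ev_inj_neq0 inj (ndvr_neq0 h)). Qed.

Lemma ndvrM (P Q : A2) : ~ dvr c P -> ~ dvr c Q -> ~ dvr c (P * Q).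
Proof. by move=> h1 h2 /(irr_prime hc) []. Qed.

Lemma Wc_ev (P : A2) : Wc u v c (ev u v P).
Proof.
exists P, 1; split; first by case: hc.
by rewrite (rmorph1 (ev u v)) divr1.
Qed.

Lemma mx_Wc_frac (P Q : A2) : ~ dvr c Q -> (mx (Wc u v c) (ev u v P / ev u v Q) <-> dvr c P).
Proof.
move=> Q0; split=> [[_ h]|[e ->]].
  apply: contrapT => P0; have := h _.
  have -> : (ev u v P / ev u v Q)^-1 = ev u v Q / ev u v P by rewrite invf_div.
  move=> h2; have : ev u v P / ev u v Q = 0 by apply: h2; exists Q, P.
  by apply/eqP; rewrite mulf_neq0 ?invr_eq0 ?ev0.
split; first by exists (c * e), Q.
move=> [A [B [B0 /eqP]]]; have [->|e0] := eqVneq e 0; first by rewrite mulr0 rmorph0 mul0r.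
have ce0 : ev u v (c * e) != 0.
  by apply: (ev_inj_neq0 inj); rewrite mulf_neq0 //; case: hc.
rewrite invf_div eqr_div ?(ev0 B0) // => /eqP.
rewrite -!rmorphM => /inj h.
by case: (ndvrM Q0 B0); rewrite h; apply/dvrMl/dvrMr/dvr_refl.
Qed.

Lemma mx_Wc_ev (P : A2) : mx (Wc u v c) (ev u v P) <-> dvr c P.
Proof.
have := @mx_Wc_frac P 1; rewrite (rmorph1 (ev u v)) divr1; apply.
by case: hc.
Qed.

Lemma Wc_lring : lring (Wc u v c).
Proof.
split.
- by move=> d; have := Wc_ev d%:MP; rewrite evC.
- move=> _ _ [P [Q [Q0 ->]]] [P' [Q' [Q0' ->]]].
  exists (P * Q' + P' * Q), (Q * Q'); split; first exact: ndvrM.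
  by rewrite addf_div ?ev0 // rmorphD !rmorphM.
- move=> _ _ [P [Q [Q0 ->]]] [P' [Q' [Q0' ->]]].
  exists (P * P'), (Q * Q'); split; first exact: ndvrM.
  by rewrite mulf_div !rmorphM.
move=> z w hz hw; have [[P [Q [Q0 ez]]] _] := hz; have [[P' [Q' [Q0' ew]]] _] := hw.
move: hz hw; rewrite ez ew => /(mx_Wc_frac P Q0) h1 /(mx_Wc_frac P' Q0') h2.
have -> : ev u v P / ev u v Q + ev u v P' / ev u v Q' =
    ev u v (P * Q' + P' * Q) / ev u v (Q * Q').
  by rewrite addf_div ?ev0 // rmorphD !rmorphM.
apply/mx_Wc_frac; first exact: ndvrM.
by apply: dvrD; apply: dvrMr.
Qed.

Lemma fracP z : exists P Q : A2, [/\ Q != 0, z = ev u v P / ev u v Q &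
  forall c, irr c -> dvr c P -> dvr c Q -> False].
Proof.
have [phi [[psi psiK phiK] hk hx hy]] := b.
have [A [B [B0 e]]] := ffP (psi z).
have [P [Q [Q0 e2 h]]] := lowest_terms A B0.
exists P, Q; split=> //; rewrite -[z]phiK e rmorphM fmorphV !morph_tf // hx hy.
by apply/eqP; rewrite eqr_div ?ev_inj_neq0 // -!rmorphM e2.
Qed.

Lemma Wc_total z : Wc u v c z \/ Wc u v c z^-1.
Proof.
have [P [Q [Q0 -> h]]] := fracP z; have [hQ|hQ] := pselect (dvr c Q); last by left; exists P, Q.
right; exists Q, P; rewrite invf_div; split=> // hP; exact: h hc hP hQ.
Qed.

Lemma Wc_gen z : mx (Wc u v c) z <-> exists2 w, Wc u v c w & z = w * ev u v c.
Proof.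
split=> [h|[w hw ->]]; last first.
  by apply: (mxMl Wc_lring) => //; apply/mx_Wc_ev/dvr_refl.
have [[P [Q [Q0 ez]]] _] := h; move: h; rewrite ez => /(mx_Wc_frac P Q0) [e ->].
by exists (ev u v e / ev u v Q); [by exists e, Q|rewrite rmorphM [ev u v c * _]mulrC mulrAC].
Qed.

Lemma Wc_loc z : pe 0 0 c = 0 -> loc u v z -> Wc u v c z.
Proof. by move=> c0 [P [Q [Q0 ->]]]; exists P, Q; split=> //; apply: pe0_dvr. Qed.

(** A discrete valuation ring is maximal among proper subrings of its field; asking that c remain a
    non-unit excludes the whole field. *)
Lemma Wc_max W : lring W -> (forall z, Wc u v c z -> W z) -> mx W (ev u v c) ->
  forall z, W z <-> Wc u v c z.
Proof.
move=> lW sub hcW z; split; last exact: sub.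
move=> hz; case: (Wc_total z) => // hz'.
have [/(Wc_gen _) [w hw e]|h] := pselect (mx (Wc u v c) z^-1).
  have : mx W z^-1 by rewrite e; apply: (mxMl lW) => //; apply: sub.
  move=> [_]; rewrite invrK => /(_ hz) /eqP; rewrite invr_eq0 => /eqP ->.
  by rewrite -(rmorph0 cst); apply: (lrC Wc_lring).
by have [] := unitP Wc_lring hz' h; rewrite invrK.
Qed.

End Wring.

(** A function regular along all curves through a point is regular there: a denominator in lowest
    terms that vanishes at the point has an irreducible factor through it, along which z has a
    pole. *)
Lemma Wc_hartogs u v z : birat u v ->
  (loc u v z <-> forall c, irr c -> pe 0 0 c = 0 -> Wc u v c z).
Proof.
move=> b; split=> [h c hc c0|h]; first exact: Wc_loc.
have [P [Q [Q0 ez hl]]] := fracP b z; exists P, Q; split=> //; apply/eqP => Q00.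
have [c [hc c0 dc]] := irr_factor0 Q0 Q00.
have [A [B [B0 /eqP]]] := h c hc c0; have inj := birat_inj b.
rewrite ez eqr_div ?(ev_inj_neq0 inj) ?(ndvr_neq0 B0) // -!rmorphM => /eqP/inj e.
have : dvr c (P * B) by rewrite e; apply: dvrMl.
by case/(irr_prime hc) => // hP; apply: hl hc hP dc.
Qed.
End Curves.

Lemma div_assoc_eq (F : fieldType) (w z c t : F) : z = c * t -> z != 0 -> w / c = w / z * t.
Proof. by move=> ->; rewrite mulf_eq0 negb_or => /andP[c0 t0]; field; rewrite c0 t0. Qed.

(** * Curves on the surface and components of general fibres *)

Section CurvesOnX.
Variables (k : closedFieldType) (M : funfield k).
Local Notation K := (ff M).
Local Notation cst := (cst M).
Local Notation ev := (@ev k M).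
Local Notation birat := (@birat k M).
Local Notation mx := (@mx k M).
Local Notation x := (@fx k M).
Local Notation y := (@fy k M).
Local Notation loc := (@loc k M).
Local Notation Wc := (@Wc k M).
Local Notation A2 := {mpoly k[2]}.
Local Notation X := ('X_ord0 : A2).
Local Notation Y := ('X_ord_max : A2).

Lemma dvr_irr_sym (c c' : A2) : irr c -> irr c' -> dvr c c' -> dvr c' c.
Proof.
move=> [_ hc _] [_ _ hc'] [e he]; case: (hc' _ _ he) => [/hc //|[e' e1]].
by exists e'; rewrite he -mulrA -e1 mulr1.
Qed.

Lemma Wc_assoc u v (c c' : A2) : dvr c c' -> dvr c' c -> Wc u v c = Wc u v c'.
Proof.
move=> h1 h2; apply: eqset_eq => z; split=> -[P [Q [Q0 ez]]]; exists P, Q; split=> // h; apply: Q0.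
  exact: dvr_trans h1 h.
exact: dvr_trans h2 h.
Qed.

Lemma loc_div u v (c P Q : A2) : birat u v -> irr c -> pe 0 0 c = 0 -> pe 0 0 Q != 0 ->
  (loc u v (ev u v P / ev u v Q / ev u v c) <-> dvr c P).
Proof.
move=> b hc c0 Q0; have inj := birat_inj b; have cn0 : c != 0 by case: hc.
split=> [[A [B [B0 /eqP]]]|[e ->]]; last first.
  exists e, Q; split=> //; rewrite rmorphM [ev u v c * _]mulrC mulrAC mulfK //.
  exact: ev_inj_neq0.
rewrite -mulrA -invfM eqr_div ?mulf_neq0 ?(ev_inj_neq0 inj) ?(pe_neq0 Q0) ?(pe_neq0 B0) //.
rewrite -!rmorphM => /eqP/inj e.
have : dvr c (P * B) by rewrite e; apply/dvrMl/dvrMl/dvr_refl.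
by case/(irr_prime hc) => // h; case: (pe0_dvr c0 B0).
Qed.

Lemma Wc_localization u v (c : A2) z : birat u v -> irr c -> pe 0 0 c = 0 ->
  (Wc u v c z <-> exists a b, [/\ loc u v a, loc u v b, ~ loc u v (b / ev u v c) & z = a / b]).
Proof.
move=> b hc c0; split=> [[P [Q [Q0 ->]]]|[s [t [[P [Q [Q0 ->]]] [A [B [B0 ->]]] h ->]]]].
  exists (ev u v P), (ev u v Q); split; [exact: loc_ev|exact: loc_ev| |by []].
  have := @loc_div u v c Q 1 b hc c0; rewrite (rmorph1 (pe 0 0)) oner_eq0 (rmorph1 (ev u v)) divr1.
  by move=> h /(h isT).
exists (P * B), (Q * A); split; last by rewrite invf_div mulf_div !rmorphM.
move=> /(irr_prime hc) [h2|h2]; first exact: pe0_dvr c0 Q0 h2.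
exact/h/loc_div.
Qed.

Lemma irr_prime_in u v (c : A2) : birat u v -> irr c -> pe 0 0 c = 0 ->
  prime_in (loc u v) (ev u v c).
Proof.
move=> b hc c0; split; first exact/mx_loc_ev.
  by apply: (ev_inj_neq0 (birat_inj b)); case: hc.
move=> _ _ [P [Q [Q0 ->]]] [A [B [B0 ->]]]; rewrite mulf_div -!rmorphM.
have n0 : pe 0 0 (Q * B) != 0 by rewrite rmorphM mulf_neq0.
by move=> /(loc_div _ b hc c0 n0) /(irr_prime hc) [] h; [left|right]; apply/loc_div.
Qed.

(** The numerator of z has an irreducible factor c through the origin. Primality of z makes the
    cofactor a unit, so z and c are associated. *)
Lemma prime_in_irr u v z : birat u v -> prime_in (loc u v) z ->
  exists c, [/\ irr c, pe 0 0 c = 0 & forall w, loc u v (w / z) <-> loc u v (w / ev u v c)].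
Proof.
move=> b [mz z0 hp]; have lO := loc_lring b; have [P [Q [Q0 ez]]] := mx_in mz.
have P0 : pe 0 0 P = 0 by apply/(mx_loc_frac b P Q0); rewrite -ez.
have Pn0 : P != 0.
  by apply: contraNneq z0 => h; rewrite ez h rmorph0 mul0r.
have [c [hc c0 [e he]]] := irr_factor0 Pn0 P0.
have inj := birat_inj b.
have cn0 : ev u v c != 0 by apply: (ev_inj_neq0 inj); case: hc.
have Qn0 : ev u v Q != 0 := ev_inj_neq0 inj (pe_neq0 Q0).
have ez' : z = ev u v c * (ev u v e / ev u v Q) by rewrite ez he rmorphM mulrA.
have oe : loc u v (ev u v e / ev u v Q) by exists e, Q.
have occ : loc u v (ev u v c / z).
  case: (hp (ev u v c) _ (loc_ev _ _ _) oe); rewrite -?ez' ?divff //; first exact: lr1.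
  move=> h; exfalso; have mc : mx (loc u v) (ev u v c) by apply/mx_loc_ev.
  suff : ev u v c = 0 by apply/eqP.
  apply: (mx_unitF mc); move: h; rewrite ez' invfM mulrCA divff ?mulr1 //.
  by apply/eqP => h; move: z0; rewrite ez' h mulr0 eqxx.
exists c; split=> // w; split=> h.
  have -> : w / ev u v c = w / z * (ev u v e / ev u v Q).
    exact: div_assoc_eq.
  exact: (lrM lO).
have -> : w / z = w / ev u v c * (ev u v c / z) by rewrite mulrA divfK.
exact: (lrM lO).
Qed.

Lemma XX_loc O : XX O -> exists u v, birat u v /\ O = loc u v.
Proof.
move/XX_XL => [[a [b [_ ->]]]|[c _ ->]|[u [v [t h]]]|h].
- by exists (x - cst a), (y - cst b); split=> //; apply/birat_subC/birat_subC2/b_xy.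
- by exists (1 / y), (x / y - cst c); split=> //; apply/birat_subC2/birat_1y.
- by have [] := chartII_props (typeII_birat t) h.
by have [] := chartI_props (typeI_birat M) h.
Qed.

Lemma curveP V : curve V <-> exists u v c,
  [/\ birat u v, XX (loc u v), irr c, pe 0 0 c = 0 & V = Wc u v c].
Proof.
split=> [[O [p [hO hp hV]]]|[u [v [c [b hO hc c0 ->]]]]]; last first.
  exists (loc u v), (ev u v c); split=> //; first exact: irr_prime_in.
  by move=> z; apply: Wc_localization.
have [u [v [b eO]]] := XX_loc hO; rewrite eO in hO hp hV.
have [c [hc c0 h]] := prime_in_irr b hp; exists u, v, c; split=> //.
apply: eqset_eq => z; rewrite hV Wc_localization //.
by split=> -[s [t [h1 h2 h3 ->]]]; exists s, t; split=> // h4; apply: h3; apply/h.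
Qed.

Lemma subst_morph (P Q : A2) : exists s : {rmorphism A2 -> A2},
  [/\ forall c, s c%:MP = c%:MP, s X = P & s Y = Q].
Proof.
exists (mev (@mpolyC 2 k) P Q); split; [exact: mevC|exact: mevX|exact: mevY].
Qed.

Lemma translation_morph (a b : k) : exists s s' : {rmorphism A2 -> A2},
  [/\ cancel s s', cancel s' s & forall u v P, ev (u - cst a) (v - cst b) P = ev u v (s P)].
Proof.
have [s [sC sX sY]] := subst_morph (X - a%:MP) (Y - b%:MP).
have [s' [s'C s'X s'Y]] := subst_morph (X + a%:MP) (Y + b%:MP).
exists s, s'; split.
- move=> p; pose f := [the {rmorphism _ -> _} of s' \o s].
  apply: (@mpoly2_ext k A2 f idfun) => [c||] /=; first by rewrite sC s'C.
    by rewrite sX rmorphB s'X s'C addrK.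
  by rewrite sY rmorphB s'Y s'C addrK.
- move=> p; pose f := [the {rmorphism _ -> _} of s \o s'].
  apply: (@mpoly2_ext k A2 f idfun) => [c||] /=; first by rewrite s'C sC.
    by rewrite s'X rmorphD sX sC subrK.
  by rewrite s'Y rmorphD sY sC subrK.
move=> u v P; pose f := [the {rmorphism _ -> _} of ev u v \o s].
apply: (@mpoly2_ext k K (ev (u - cst a) (v - cst b)) f) => [c||] /=.
- by rewrite sC !evC.
- by rewrite sX evX rmorphB evX evC.
- by rewrite sY evY rmorphB evY evC.
Qed.

Lemma Wc_translate u v a b c : irr c ->
  exists2 c', irr c' & Wc (u - cst a) (v - cst b) c = Wc u v c'.
Proof.
have [s [s' [sK s'K evs]]] := translation_morph a b.
move=> hc; exists (s c); first exact: irr_iso sK s'K _ hc.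
apply: eqset_eq => z; split=> -[P [Q [Q0 ->]]].
  exists (s P), (s Q); rewrite !evs; split=> // h; apply: Q0.
  exact/(dvr_iso sK s'K).
exists (s' P), (s' Q); split; last by rewrite !evs !s'K.
by move=> h; apply: Q0; have := (dvr_iso sK s'K c (s' Q)).2 h; rewrite s'K.
Qed.

Definition coordsII (u v : K) : seq (K * K) :=
  [:: (v, u / v); (u, v / u); (u, v / u ^+ 2); (v / u, u ^+ 2 / v)].

(* Every point of X has a system of parameters which is, up to translation,
   one of these pairs. *)
Definition coords : seq (K * K) :=
  [:: (x, y); (1 / y, x / y); (1 - y, (1 - x) / (1 - y)); (1 - x, (1 - y) / (1 - x))] ++
  coordsII (x / y) (1 / y) ++ coordsII y (x + y - 1) ++
  coordsII (1 / x) (y / x) ++ coordsII (1 - y) x.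

Lemma coordsII_birat u v p : birat u v -> p \in coordsII u v -> birat p.1 p.2.
Proof.
move=> b; have [u0 v0] := birat_neq0 b; have b1 := birat_div b.
have b2 := birat_div b1; rewrite (_ : v / u / u = v / u ^+ 2) in b2; last by field; nzs.
rewrite !inE => /or4P[] /eqP -> //=; first exact/birat_div/birat_swap.
have := birat_div (birat_swap b1); rewrite (_ : u / (v / u) = u ^+ 2 / v) //; by field; nzs.
Qed.

Lemma coords_birat p : p \in coords -> birat p.1 p.2.
Proof.
rewrite /coords !mem_cat => /or4P[|h|h|/orP[h|h]]; last first.
- exact: coordsII_birat (typeII_birat (TypeII4 M)) h.
- exact: coordsII_birat (typeII_birat (TypeII3 M)) h.
- exact: coordsII_birat (typeII_birat (TypeII2 M)) h.
- exact: coordsII_birat (typeII_birat (TypeII1 M)) h.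
rewrite !inE => /or4P[] /eqP -> /=.
- exact: b_xy.
- exact: birat_1y.
- exact/birat_div/birat_swap/typeI_birat.
exact/birat_div/typeI_birat.
Qed.

Lemma coordsII_mem u v p : typeII u v -> p \in coordsII u v -> p \in coords.
Proof.
by rewrite /coords !mem_cat; case=> ->; rewrite ?orbT.
Qed.

Lemma XX_coords O : XX O -> exists p a b, p \in coords /\ O = loc (p.1 - cst a) (p.2 - cst b).
Proof.
have m0 : cst 0 = 0 by rewrite rmorph0.
move/XX_XL => [[a [b [_ ->]]]|[c _ ->]|[u [v [t h]]]|h].
- by exists (x, y), a, b; rewrite inE eqxx.
- by exists (1 / y, x / y), 0, c; rewrite m0 subr0 !inE eqxx orbT.
- case: h => [->|[c c0 ->]|[c ->]|->].
  + exists (v, u / v), 0, 0; rewrite m0 !subr0; split=> //.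
    by apply: (coordsII_mem t); rewrite inE eqxx.
  + exists (u, v / u), 0, c; rewrite m0 !subr0; split=> //.
    by apply: (coordsII_mem t); rewrite !inE eqxx orbT.
  + exists (u, v / u ^+ 2), 0, c; rewrite m0 !subr0; split=> //.
    by apply: (coordsII_mem t); rewrite !inE eqxx !orbT.
  exists (v / u, u ^+ 2 / v), 0, 0; rewrite m0 !subr0; split=> //.
  by apply: (coordsII_mem t); rewrite !inE eqxx !orbT.
case: h => [->|[c ->]].
  by exists (1 - y, (1 - x) / (1 - y)), 0, 0; rewrite m0 !subr0 !inE eqxx !orbT.
by exists (1 - x, (1 - y) / (1 - x)), 0, c; rewrite m0 !subr0 !inE eqxx !orbT.
Qed.

Lemma loc_translate_birat u v a b : birat u v -> birat (u - cst a) (v - cst b).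
Proof. by move=> h; apply/birat_subC/birat_subC2. Qed.

(** Translations of a chart are absorbed in the equation, so finitely many charts suffice for all
    curves of X. The finiteness statements on fibres below rest on this. *)
Lemma curve_coords V : curve V -> exists p c, [/\ p \in coords, irr c & V = Wc p.1 p.2 c].
Proof.
move=> [O [z [hO hp hV]]]; have [p [a [b [hc eO]]]] := XX_coords hO.
have hb := loc_translate_birat a b (coords_birat hc); rewrite eO in hp hV.
have [c [ic c0 h]] := prime_in_irr hb hp; have [c' ic' e] := Wc_translate p.1 p.2 a b ic.
exists p, c'; split=> //; rewrite -e; apply: eqset_eq => w; rewrite hV Wc_localization //.
by split=> -[s [t [h1 h2 h3 ->]]]; exists s, t; split=> // h4; apply: h3; apply/h.
Qed.

Lemma curve_lring (V : K -> Prop) : curve V -> lring V.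
Proof. by move=> /curveP [u [v [c [b _ hc _ ->]]]]; apply: Wc_lring. Qed.

Lemma curve_total (V : K -> Prop) z : curve V -> V z \/ V z^-1.
Proof. by move=> /curveP [u [v [c [b _ hc _ ->]]]]; apply: Wc_total. Qed.

(** Otherwise c divides u - a and v - b; having degree 1, u - a is then associated to c, while v - b
    does not vanish at the point (a, b + 1) of the line u = a. *)
Lemma residues_not_const u v (c : A2) a b : birat u v -> irr c ->
  mx (Wc u v c) (u - cst a) -> mx (Wc u v c) (v - cst b) -> False.
Proof.
move=> bi hc.
have -> : u - cst a = ev u v (X - a%:MP) by rewrite rmorphB evX evC.
have -> : v - cst b = ev u v (Y - b%:MP) by rewrite rmorphB evY evC.
move=> /mx_Wc_ev [] // e1 h1 /mx_Wc_ev [] // e2 h2.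
have n0 : X - a%:MP != 0.
  apply/eqP => h; have := congr1 (pe (a + 1) 0) h.
  by rewrite rmorphB rmorph0 peX peC addrAC subrr add0r => /eqP; rewrite oner_eq0.
have ue : dvr e1 1.
  apply/dvr1_msize; have [c0 c1 _] := hc.
  have sc : (1 < msize c)%N.
    have : msize c <> 1%N by move/dvr1_msize.
    by move: c0; rewrite -msize_poly_eq0; case: (msize c) => [|[|]].
  have e10 : e1 != 0 by apply: contraNneq n0 => z; rewrite h1 z mulr0.
  have : (msize (X - a%:MP) <= 2)%N.
    apply: leq_trans (mmeasureD_le _ _ _) _; rewrite geq_max mmeasureN mmeasureC.
    have -> : msize X = 2%N by rewrite msizeX mdeg1.
    by case: (a != 0).
  rewrite h1 msizeM //; move: e10; rewrite -msize_poly_eq0.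
  by move: (msize e1) (msize c) sc => *; lia.
have : pe a (b + 1) (c * e1) = 0 by rewrite -h1 rmorphB peX peC subrr.
rewrite rmorphM => /eqP; rewrite mulf_eq0 => /orP[] /eqP h; last first.
  move: ue => [w /(congr1 (pe a (b + 1)))]; rewrite rmorph1 rmorphM h mul0r => /eqP.
  by rewrite oner_eq0.
have := congr1 (pe a (b + 1)) h2; rewrite rmorphB rmorphM peY peC h mul0r addrAC subrr add0r.
by move/eqP; rewrite oner_eq0.
Qed.

(** Along each of the finitely many irreducible factors of N the function f takes at most one
    constant value. *)
Lemma finite_bad_fibres f u v (N : A2) : birat u v -> N != 0 ->
  exists s : seq k, forall t, t \notin s -> forall c, irr c -> dvr c N -> ~ mx (Wc u v c) (f - cst t).
Proof.
move=> b; have [n] := ubnP (msize N); elim: n N => // n ih N hn N0.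
have [[c0 [hc0 [N1 eN]]]|h] := pselect (exists c, irr c /\ dvr c N); last first.
  by exists [::] => t _ c hc dc; case: h; exists c.
have N10 : N1 != 0 by apply: contraNneq N0 => z; rewrite eN z mulr0.
have [c00 nc _] := hc0.
have [|s hs] := ih N1 _ N10.
  move: hn; rewrite eN msizeM //.
  have : msize c0 <> 1%N by move/dvr1_msize.
  move: c00 N10; rewrite -!msize_poly_eq0.
  by move: (msize c0) (msize N1) => *; lia.
have key c : irr c -> dvr c N -> (Wc u v c = Wc u v c0 \/ dvr c N1).
  move=> hc; rewrite eN => /(irr_prime hc) [] h; [left|by right].
  by apply: Wc_assoc => //; apply: dvr_irr_sym.
have [[t0 h0]|h0] := pselect (exists t0, mx (Wc u v c0) (f - cst t0)).
  exists (t0 :: s) => t; rewrite inE negb_or => /andP[tt ts] c hc dc.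
  case: (key c hc dc) => [->|h]; last exact: hs.
  move=> h1; move/eqP: tt; apply; exact: (vl_uniq (Wc_lring b hc0) h1 h0).
exists s => t ts c hc dc; case: (key c hc dc) => [->|h]; last exact: hs.
by move=> h1; apply: h0; exists t.
Qed.

Lemma generic_unit1 f g u v : birat u v -> g != 0 -> exists s : seq k, forall t, t \notin s ->
  forall c, irr c -> mx (Wc u v c) (f - cst t) -> Wc u v c g /\ Wc u v c g^-1.
Proof.
move=> b g0; have [P [Q [Q0 eg _]]] := fracP b g.
have P0 : P != 0 by apply: contraNneq g0 => z; rewrite eg z rmorph0 mul0r.
have [s hs] := finite_bad_fibres f b (mulf_neq0 P0 Q0).
exists s => t ts c hc h; have n1 : ~ dvr c (P * Q) by move=> h'; apply: (hs t ts c hc h') h.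
split; first by exists P, Q; split=> // h2; apply: n1; apply: dvrMl.
by exists Q, P; rewrite eg invf_div; split=> // h2; apply: n1; apply: dvrMr.
Qed.

(** In each chart g has zeros and poles along finitely many curves only, and each of them lies on at
    most one fibre. *)
Lemma generic_unit f g : g != 0 -> exists s : seq k, forall t, t \notin s ->
  forall V, curve V -> mx V (f - cst t) -> V g /\ V g^-1.
Proof.
move=> g0.
suff [s hs] : exists s : seq k, forall t, t \notin s -> forall p c, p \in coords -> irr c ->
    mx (Wc p.1 p.2 c) (f - cst t) -> Wc p.1 p.2 c g /\ Wc p.1 p.2 c g^-1.
  exists s => t ts V /curve_coords [p [c [hp hc ->]]]; exact: hs.
have := coords_birat; elim: coords => [|p r ih] hb; first by exists [::].
have [q hq|s1 h1] := ih; first by apply: hb; rewrite inE hq orbT.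
have [|s2 h2] := @generic_unit1 f g p.1 p.2 _ g0; first by apply: hb; rewrite inE eqxx.
exists (s1 ++ s2) => t; rewrite mem_cat negb_or => /andP[t1 t2] q c.
rewrite inE => /orP[/eqP ->|hq] hc; first exact: h2.
exact: h1.
Qed.

Lemma generic_units f (G : seq K) : (forall g, g \in G -> g != 0) -> exists s : seq k,
  forall t, t \notin s -> forall V, curve V -> mx V (f - cst t) ->
  forall g, g \in G -> V g /\ V g^-1.
Proof.
elim: G => [|g G ih] hG; first by exists [::].
have [h hh|s1 h1] := ih; first by apply: hG; rewrite inE hh orbT.
have [|s2 h2] := @generic_unit f g; first by apply: hG; rewrite inE eqxx.
exists (s1 ++ s2) => t; rewrite mem_cat negb_or => /andP[t1 t2] V hV hm g'.
rewrite inE => /orP[/eqP ->|hg]; first exact: h2 hm.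
exact: h1 hm _ hg.
Qed.

(** The list D contains denominators that express all chart coordinates by x and y. On a general
    fibre they are units; if x and y were constant there, so would be the coordinates of the chart
    that shows the curve. *)
Lemma generic_not_const f : exists s : seq k, forall t, t \notin s ->
  forall V, curve V -> mx V (f - cst t) -> forall a b, mx V (x - cst a) -> mx V (y - cst b) -> False.
Proof.
have [D hD0 hD] : exists2 D : seq K, (forall g, g \in D -> g != 0) & forall p, p \in coords ->
    exists P Q P' Q', [/\ ev x y Q \in D, ev x y Q' \in D,
      p.1 = ev x y P / ev x y Q & p.2 = ev x y P' / ev x y Q'].
  elim: coords => [|p r [D hD0 ih]]; first by exists [::].
  have [P [Q [Q0 e1 _]]] := fracP (b_xy M) p.1; have [P' [Q' [Q'0 e2 _]]] := fracP (b_xy M) p.2.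
  have inj := birat_inj (b_xy M).
  exists (ev x y Q :: ev x y Q' :: D) => [g|q].
    by rewrite !inE => /or3P[/eqP ->|/eqP ->|/hD0 //]; apply: ev_inj_neq0.
  rewrite inE => /orP[/eqP ->|hq]; first by exists P, Q, P', Q'; rewrite !inE !eqxx orbT.
  by have [A [B [A' [B' [h1 h2 h3 h4]]]]] := ih q hq; exists A, B, A', B'; rewrite !inE h1 h2 !orbT.
have [s hs] := generic_units f hD0; exists s => t ts V hV hm a b ha hb.
have lV := curve_lring hV; have {}hs := hs t ts V hV hm.
have [p [c [hp hc eV]]] := curve_coords hV.
have [P [Q [P' [Q' [h1 h2 h3 h4]]]]] := hD p hp.
have key A B : ev x y B \in D -> exists d, vl V (ev x y A / ev x y B) d.
  move=> hB; have B0 : pe a b B != 0.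
    apply/eqP => B0; have := hD0 _ hB; have [_ hi] := hs _ hB.
    have /vl0 m : vl V (ev x y B) 0 by rewrite -B0; apply: (vl_ev lV).
    by rewrite (mx_unitF m hi) eqxx.
  by exists (pe a b A / pe a b B); apply: (vl_div lV) => //; apply: (vl_ev lV).
have [d1 e1] := key P Q h1; have [d2 e2] := key P' Q' h2.
rewrite -h3 in e1; rewrite -h4 in e2; rewrite eV in e1 e2.
exact: residues_not_const (coords_birat hp) hc e1 e2.
Qed.

Lemma mx_prime (W : K -> Prop) z w : lring W -> W z -> W w -> mx W (z * w) -> mx W z \/ mx W w.
Proof.
move=> lW hz hw h; apply: contrapT => /not_orP[n1 n2].
have [z1 z0] := unitP lW hz n1; apply: n2; rewrite -[w](mulKf z0).
exact: mxMl.
Qed.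

(** Over the closed field h splits into linear factors, and one of them must lie in the maximal
    ideal. The map g stands for evaluation at u. *)
Lemma mx_ev_uni (W : K -> Prop) u (g : {poly k} -> K) (h : {poly k}) : lring W -> W u ->
  (forall c, g c%:P = cst c) -> (forall p q, g (p * q) = g p * g q) ->
  (forall c, g ('X - c%:P) = u - cst c) -> (forall p, W (g p)) -> h != 0 -> mx W (g h) ->
  exists c, mx W (u - cst c).
Proof.
move=> lW hu gC gM gX gW; have [n] := ubnP (size h); elim: n h => // n ih h hn h0 hm.
case: (poly_split_root h0) => [h1|[t [s' [es [hs s'0]]]]].
  exfalso; move: hm h0; rewrite [h]size1_polyC // gC => /(mx_cst lW) ->.
  by rewrite polyC0 eqxx.
move: hm; rewrite es gM => /(mx_prime lW (gW _) (gW _)) [|h2].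
  by rewrite gX => ?; exists t.
by apply: (ih s') => //; apply: leq_trans hs hn.
Qed.
End CurvesOnX.

(** * The generic member of a pencil *)

Lemma mpoly2_ind (k : fieldType) (Q : {mpoly k[2]} -> Prop) : (forall c, Q c%:MP) ->
  Q 'X_ord0 -> Q 'X_ord_max -> (forall a b, Q a -> Q b -> Q (a + b)) ->
  (forall a b, Q a -> Q b -> Q (a * b)) -> forall p, Q p.
Proof.
move=> hC hX hY hD hM p.
have hE a n : Q a -> Q (a ^+ n).
  move=> ha; elim: n => [|n ih]; first by rewrite expr0 -mpolyC1.
  by rewrite exprS; apply: hM.
elim/mpolyind: p => [|c m p _ _ hp]; first by rewrite -mpolyC0.
apply: (hD) hp; rewrite -mul_mpolyC; apply: (hM) => //.
by rewrite mpolyXE_id !big_ord_recl big_ord0 mulr1 lift_ord2; apply: (hM); apply: hE.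
Qed.

Lemma mul_split (R : comNzRingType) (x u v c d b : R) : b = v + x * d ->
  (u + x * c) * b = u * v + x * (c * b + u * d).
Proof. by move=> ->; ring. Qed.

Section Residues.
Variables (k : closedFieldType) (M : funfield k).
Local Notation K := (ff M).
Local Notation F := (rf M).
Local Notation pf := (pf M).
Local Notation cst := (cst M).
Local Notation ev := (@ev k M).
Local Notation birat := (@birat k M).
Local Notation mx := (@mx k M).
Local Notation x := (@fx k M).
Local Notation y := (@fy k M).
Local Notation loc := (@loc k M).
Local Notation Wc := (@Wc k M).
Local Notation A2 := {mpoly k[2]}.
Local Notation X := ('X_ord0 : A2).
Local Notation Y := ('X_ord_max : A2).

Lemma rX_evy h : rX (evy h) = h :> {poly k}.
Proof.
elim/poly_ind: h => [|p c ih]; first by rewrite !rmorph0.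
by rewrite !rmorphD !rmorphM evyC evyX ih rX_C rX_Y.
Qed.

Lemma rX_split (P : A2) : exists C, P = evy (rX P) + X * C.
Proof.
elim/mpoly2_ind: P => [c|||a b [C1 e1] [C2 e2]|a b [C1 e1] [C2 e2]].
- by exists 0; rewrite rX_C evyC mulr0 addr0.
- by exists 1; rewrite rX_X rmorph0 add0r mulr1.
- by exists 0; rewrite rX_Y evyX mulr0 addr0.
- by exists (C1 + C2); rewrite {1}e1 {1}e2 !rmorphD addrACA mulrDr.
exists (C1 * b + evy (rX a) * C2); rewrite !rmorphM {1}e1; exact: mul_split.
Qed.

Lemma dvrX_rX (P : A2) : dvr X P <-> rX P = 0.
Proof.
split=> [[e ->]|h]; first by rewrite rmorphM rX_X mul0r.
by have [C ->] := rX_split P; rewrite h rmorph0 add0r; exists C.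
Qed.

Lemma irr_X : irr X.
Proof.
split; first exact: X0_neq0.
  by move=> /dvrX_rX; rewrite rmorph1 => /eqP; rewrite oner_eq0.
move=> a b e; have : rX (a * b) = 0 by rewrite -e rX_X.
have key (c d : A2) : X = c * d -> rX c = 0 -> dvr d 1.
  move=> e1 /dvrX_rX [f ef]; exists f; apply: (mulfI (X0_neq0 k)).
  by rewrite mulr1 {1}e1 ef mulrAC mulrA.
rewrite rmorphM => /eqP; rewrite mulf_eq0 => /orP[] /eqP h; [right|left].
  exact: key e h.
by rewrite mulrC in e; apply: key e h.
Qed.

Lemma lr_ev (W : K -> Prop) u v P : lring W -> W u -> W v -> W (ev u v P).
Proof.
move=> lW hu hv; elim/mpoly2_ind: P => [c|||a b|a b].
- by rewrite evC; apply: (lrC lW).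
- by rewrite evX.
- by rewrite evY.
- by rewrite rmorphD; apply: (lrD lW).
by rewrite rmorphM; apply: (lrM lW).
Qed.

Lemma Wc_param u v (W : K -> Prop) : birat u v -> lring W -> mx W u -> W v ->
  (forall c, ~ mx W (v - cst c)) -> forall z, W z <-> Wc u v X z.
Proof.
move=> b lW hu hv hc; apply: (Wc_max b irr_X lW); last by rewrite evX.
move=> _ [P [Q [Q0 ->]]]; have hP := lr_ev P lW (mx_in hu) hv.
have hQ := lr_ev Q lW (mx_in hu) hv; apply: (lrM lW) => //.
suff n : ~ mx W (ev u v Q) by have [] := unitP lW hQ n.
move=> h; have [C eQ] := rX_split Q.
have : mx W (ev u v (evy (rX Q))).
  have -> : ev u v (evy (rX Q)) = ev u v Q - u * ev u v C.
    by rewrite {2}eQ rmorphD rmorphM evX addrK.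
  apply: (mxB lW) => //; rewrite mulrC; apply: (mxMl lW) => //.
  exact: lr_ev (mx_in hu) hv.
have Qn0 : rX Q != 0 by apply/eqP => /dvrX_rX.
move=> /(mx_ev_uni (u := v) (g := fun p => ev u v (evy p)) lW hv) [] //.
- by move=> c; rewrite evyC evC.
- by move=> p q; rewrite !rmorphM.
- by move=> c; rewrite rmorphB evyX evyC rmorphB evY evC.
by move=> p; apply: lr_ev (mx_in hu) hv.
Qed.

(** If some Q prime to q also vanished on W, elimination would give nonzero polynomials in x alone
    and in y alone that vanish there, and x and y would both be constant on W. *)
Lemma same_curve (q : A2) (W : K -> Prop) : irr q -> lring W -> W x -> W y -> mx W (ev x y q) ->
  (forall a b, mx W (x - cst a) -> mx W (y - cst b) -> False) ->
  forall z, W z <-> Wc x y q z.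
Proof.
move=> hq lW hx hy hm hn; apply: (Wc_max (b_xy M) hq lW _ hm).
move=> _ [P [Q [Q0 ->]]]; have hP := lr_ev P lW hx hy; have hQ := lr_ev Q lW hx hy.
apply: (lrM lW) => //; suff n : ~ mx W (ev x y Q) by have [] := unitP lW hQ n.
move=> h; have [h1 [u [v [h10 e1]]]] := irr_elimX hq Q0.
have [h2 [u' [v' [h20 e2]]]] := irr_elimY hq Q0.
have m1 : mx W (ev x y (evx h1)).
  by rewrite e1 rmorphD !rmorphM; apply: (mxD lW); apply: (mxMl lW) => //; apply: lr_ev.
have m2 : mx W (ev x y (evy h2)).
  by rewrite e2 rmorphD !rmorphM; apply: (mxD lW); apply: (mxMl lW) => //; apply: lr_ev.
have [||||a ha] := mx_ev_uni (u := x) (g := fun p => ev x y (evx p)) lW hx _ _ _ _ h10 m1.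
- by move=> c; rewrite evxC evC.
- by move=> p p'; rewrite !rmorphM.
- by move=> c; rewrite rmorphB evxX evxC rmorphB evX evC.
- by move=> p; apply: lr_ev.
have [||||b hb] := mx_ev_uni (u := y) (g := fun p => ev x y (evy p)) lW hy _ _ _ _ h20 m2.
- by move=> c; rewrite evyC evC.
- by move=> p p'; rewrite !rmorphM.
- by move=> c; rewrite rmorphB evyX evyC rmorphB evY evC.
- by move=> p; apply: lr_ev.
exact: hn ha hb.
Qed.

Lemma residue_map u v : birat u v -> exists rho : K -> F, [/\ resmap (Wc u v X) rho,
  forall q, exists2 z, Wc u v X z & rho z = q
  & forall P Q : A2, rX Q != 0 -> rho (ev u v P / ev u v Q) = pf (rX P) / pf (rX Q)].
Proof.
move=> b; have inj := birat_inj b; have lW := Wc_lring b irr_X.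
have ex z : exists r : F, forall P Q : A2, rX Q != 0 -> z = ev u v P / ev u v Q ->
    r = pf (rX P) / pf (rX Q).
  have [[P [Q [Q0 ez]]]|h] := pselect (exists P Q, rX Q != 0 /\ z = ev u v P / ev u v Q).
    exists (pf (rX P) / pf (rX Q)) => P' Q' Q'0; rewrite ez => /eqP.
    have n0 (R : A2) : rX R != 0 -> ev u v R != 0.
      by move=> h; apply: (ev_inj_neq0 inj); apply: contraNneq h => ->; rewrite rmorph0.
    rewrite eqr_div ?n0 // -!rmorphM => /eqP/inj e; apply/eqP.
    by rewrite eqr_div ?pf_eq0 // -!rmorphM e.
  by exists 0 => P Q Q0 e; case: h; exists P, Q.
pose rho z := sval (cid (ex z)).
have rhoE P Q : rX Q != 0 -> rho (ev u v P / ev u v Q) = pf (rX P) / pf (rX Q).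
  by move=> Q0; apply: (svalP (cid (ex (ev u v P / ev u v Q)))).
have nz (Q : A2) : ~ dvr X Q -> rX Q != 0 by move=> h; apply/eqP => /dvrX_rX.
have n0 (R : A2) : rX R != 0 -> ev u v R != 0.
  by move=> h; apply: (ev_inj_neq0 inj); apply: contraNneq h => ->; rewrite rmorph0.
exists rho; split; [split| |by []].
- move=> _ _ [P [Q [/nz Q0 ->]]] [P' [Q' [/nz Q0' ->]]].
  have e1 : ev u v P / ev u v Q + ev u v P' / ev u v Q' =
     ev u v (P * Q' + P' * Q) / ev u v (Q * Q').
    by rewrite addf_div ?n0 // rmorphD !rmorphM.
  have e2 : ev u v P / ev u v Q * (ev u v P' / ev u v Q') = ev u v (P * P') / ev u v (Q * Q').
    by rewrite mulf_div !rmorphM.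
  rewrite e1 e2 !rhoE ?(rmorphM rX) ?mulf_neq0 //; split; last by rewrite mulf_div !rmorphM.
  by rewrite addf_div ?pf_eq0 // !rmorphD !rmorphM.
- move=> c; have := rhoE c%:MP 1; rewrite rX_C !rmorph1 !divr1 evC; apply; exact: oner_neq0.
- move=> _ [P [Q [Q0 ->]]]; rewrite (mx_Wc_frac b irr_X P Q0) dvrX_rX rhoE ?nz //.
  split=> [/eqP|->]; last by rewrite rmorph0 mul0r.
  by rewrite mulf_eq0 invr_eq0 !pf_eq0 (negPf (nz _ Q0)) orbF => /eqP.
move=> q; have [s [t [t0 ->]]] := pfP q; exists (ev u v (evy s) / ev u v (evy t)).
  by exists (evy s), (evy t); split=> // /dvrX_rX; rewrite rX_evy; apply/eqP.
by rewrite rhoE !rX_evy.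
Qed.

Lemma ratcurve_Wc u v : birat u v -> ratcurve (Wc u v X).
Proof. by move=> /residue_map [rho [[h1 h2 h3] h4 _]]; exists rho; split. Qed.

Section Center.
Variable W : K -> Prop.
Hypothesis vW : vring W.
Let lW : lring W. Proof. by case: vW. Qed.

Lemma center_typeII u v : typeII u v -> mx W u -> mx W v -> exists2 O, XX O & dom O W.
Proof.
move=> t hu hv; have b := typeII_birat t; have [u0 v0] := birat_neq0 b.
suff [O hO D] : exists2 O, chartII u v O & dom O W.
  by exists O => //; apply/XX_XL; apply: Or43; exists u, v.
have bc p h := @coordsII_birat k M u v p b h.
have [h|h] := pselect (W (u / v)).
  have [c hc] := vrR vW h; have [c0|c0] := eqVneq c 0.
    exists (loc v (u / v)); first exact: Or41.
    apply: (loc_dom _ lW hv); first by apply: (bc (v, u / v)); rewrite inE eqxx.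
    by apply/vl0; rewrite -c0.
  have hw : vl W (v / u) c^-1 by rewrite -invf_div; apply: (vlV lW hc).
  exists (loc u (v / u - cst c^-1)); first by apply: Or42; exists c^-1; rewrite ?invr_eq0.
  apply: (loc_dom _ lW hu hw); apply: birat_subC2; exact: birat_div.
have m1 : mx W (v / u) by apply: (vr_nonunit vW); rewrite invf_div.
have [h2|h2] := pselect (W (v / u ^+ 2)).
  have [c hc] := vrR vW h2; exists (loc u (v / u ^+ 2 - cst c)); first by apply: Or43; exists c.
  apply: (loc_dom _ lW hu hc); apply: birat_subC2.
  by apply: (bc (u, v / u ^+ 2)); rewrite !inE eqxx !orbT.
exists (loc (v / u) (u ^+ 2 / v)); first exact: Or44.
apply: (loc_dom _ lW m1); first by apply: (bc (v / u, u ^+ 2 / v)); rewrite !inE eqxx !orbT.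
by apply: (vr_nonunit vW); rewrite invf_div.
Qed.

Lemma center_typeI : mx W (1 - x) -> mx W (1 - y) -> exists2 O, XX O & dom O W.
Proof.
move=> hu hv; have b := typeI_birat M.
suff [O hO D] : exists2 O, chartI (1 - x) (1 - y) O & dom O W.
  by exists O => //; apply/XX_XL; apply: Or44.
have [h|h] := pselect (W ((1 - y) / (1 - x))).
  have [c hc] := vrR vW h; exists (loc (1 - x) ((1 - y) / (1 - x) - cst c)); first by right; exists c.
  by apply: (loc_dom _ lW hu hc); apply/birat_subC2/birat_div.
exists (loc (1 - y) ((1 - x) / (1 - y))); first by left.
apply: (loc_dom _ lW hv); first exact/birat_div/birat_swap.
by apply: (vr_nonunit vW); rewrite invf_div.
Qed.

(** The valuative criterion of properness: the centre is found first in the plane, by comparing the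
    values of x, y and x/y, and then followed through the blow-ups. *)
Lemma center_exists : exists2 O, XX O & dom O W.
Proof.
have [[hx hy]|h] := pselect (W x /\ W y).
  have [a ha] := vrR vW hx; have [b hb] := vrR vW hy.
  have [hab|hab] := pselect (affine_base a b); last first.
    exists (loc (x - cst a) (y - cst b)); first by apply/XX_XL; apply: Or41; exists a, b.
    by apply: (loc_dom _ lW ha hb); apply/birat_subC/birat_subC2/b_xy.
  case: hab => -[ea eb]; rewrite ea in ha; rewrite eb in hb.
  - apply: (center_typeII (TypeII2 M)); apply: (vl0 _ _).1; first exact: hb.
    by vlq lW; rewrite addr0 subrr.
  - apply: (center_typeII (TypeII4 M)); apply: (vl0 _ _).1; last exact: ha.
    by vlq lW; rewrite subrr.
  by apply: center_typeI; apply: (vl0 _ _).1; vlq lW; rewrite subrr.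
have x_0 := fx_neq0 M; have y_0 := fy_neq0 M.
have [hxy|hxy] := pselect (W (x / y)).
  have my : mx W (1 / y).
    apply: (vr_nonunit vW); rewrite invf_div divr1 => hy; apply: h; split=> //.
    by rewrite -(divfK y_0 x); apply: (lrM lW).
  have [c hc] := vrR vW hxy; have [c0|c0] := eqVneq c 0.
    by apply: (center_typeII (TypeII1 M)) => //; apply: (vl0 _ _).1; rewrite -c0.
  exists (loc (1 / y) (x / y - cst c)); first by apply/XX_XL; apply: Or42; exists c.
  by apply: (loc_dom _ lW my hc); apply/birat_subC2/birat_1y.
have myx : mx W (y / x) by apply: (vr_nonunit vW); rewrite invf_div.
apply: (center_typeII (TypeII3 M)) => //.
apply: (vr_nonunit vW); rewrite invf_div divr1 => hx; apply: h; split=> //.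
by rewrite -(divfK x_0 y); apply: (lrM lW) => //; apply: mx_in.
Qed.
End Center.

(** Compose the valuation along u = 0 with the place v = 0 of its residue field. *)
Lemma dominating_vring u v : birat u v -> exists2 W, vring W & dom (loc u v) W.
Proof.
move=> b; have [rho [hr _ rhoE]] := residue_map b.
have lW := Wc_lring b irr_X; have [h1 h2 h4] := hr.
have tW z := Wc_total b irr_X z; have pR := @place_at k M 0.
exists (comp (Wc u v X) rho (Rat 0)); first exact: comp_vring.
have [l _ _] := comp_vring lW tW hr pR.
apply: loc_dom => //.
  have mu : mx (Wc u v X) u by rewrite -{2}(evX u v); apply/(mx_Wc_ev b irr_X)/dvr_refl.
  apply/mx_comp => //; rewrite /comp ((h4 u (mx_in mu)).2 mu); split; last by left.
  by split; [exact: mx_in|rewrite -(rmorph0 pf) -polyC0; case: pR].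
have hv : Wc u v X v by rewrite -{2}(evY u v); apply: (Wc_ev _ _ irr_X).
have ev : rho v = pf 'X.
  have := rhoE Y 1; rewrite (rmorph1 rX) oner_eq0 (rmorph1 pf) (rmorph1 (ev u v)) !divr1.
  by rewrite evY rX_Y; apply.
apply/mx_comp => //; rewrite /comp ev; split.
  by split=> //; exists 'X, 1; rewrite hornerC oner_eq0 rmorph1 divr1.
right=> -[A [B [B0 /eqP]]]; rewrite -div1r -(rmorph1 pf).
rewrite eqr_div ?pf_eq0 ?polyX_eq0 ?(horner_neq0 B0) // -!rmorphM => /eqP/(@pf_inj k M) e.
by move: B0; rewrite -[B]mul1r e hornerM hornerX mulr0 eqxx.
Qed.
End Residues.

(** * Regular maps to the projective line *)

Section RegularMaps.
Variables (k : closedFieldType) (M : funfield k).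
Local Notation K := (ff M).
Local Notation cst := (cst M).
Local Notation ev := (@ev k M).
Local Notation birat := (@birat k M).
Local Notation mx := (@mx k M).
Local Notation x := (@fx k M).
Local Notation y := (@fy k M).
Local Notation loc := (@loc k M).

(* z is a morphism to P^1 at the point O *)
Definition regular_at (O : K -> Prop) (z : K) := O z \/ O z^-1.

Lemma regular_inv O z : regular_at O z^-1 -> regular_at O z.
Proof. by rewrite /regular_at invrK => -[]; [right|left]. Qed.

Lemma regular_unit O e z : lring O -> unitv O e -> regular_at O z -> regular_at O (e * z).
Proof.
move=> lO ue [h|h]; [left|right]; first exact: unitv_in.
by rewrite invfM; apply: unitv_in => //; apply: unitvV.
Qed.

Lemma regular_sub1 u v z : birat u v -> regular_at (loc u v) z -> regular_at (loc u v) (z - 1).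
Proof.
move=> b; have lO := loc_lring b; case=> h.
  by left; apply: (lrB lO) => //; apply: lr1.
have [z0|z0] := eqVneq z 0; first by left; rewrite z0; apply: (lrB lO); [apply: lr0|apply: lr1].
have [c hc] := loc_res b h; have [c1|c1] := eqVneq c 1.
  have hz : loc u v z by rewrite -[z]invrK; apply: vl_inv hc _ => //; rewrite c1 oner_neq0.
  by left; apply: (lrB lO) => //; apply: lr1.
right; have d0 : 1 - c != 0 by rewrite subr_eq0 eq_sym.
have hd : vl (loc u v) (1 - z^-1) (1 - c) by apply: (vlB lO) => //; apply: vl1.
have -> : (z - 1)^-1 = z^-1 / (1 - z^-1).
  have n := vl_neq0 lO hd d0; have e : z - 1 = (1 - z^-1) * z by rewrite mulrBl mul1r mulVf.
  by rewrite e invfM mulrC.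
by apply: (vl_in lO); apply: (vl_div lO hc hd d0).
Qed.

Lemma regular_frac O P Q c d : lring O -> vl O P c -> vl O Q d -> (c != 0) || (d != 0) ->
  regular_at O (P / Q).
Proof.
move=> lO hP hQ /orP[c0|d0]; last by left; apply: vl_in lO _ _ (vl_div lO hP hQ d0).
by right; rewrite invf_div; apply: vl_in lO _ _ (vl_div lO hQ hP c0).
Qed.

(** Local shapes which, up to a unit, become regular maps to the projective line once the two points
    over a base point of type II are blown up. The last one is the shape of T itself. *)
Inductive formII (u v : K) : K -> Prop :=
| FormReg g : loc u v g -> formII u v g
| FormDiv : formII u v (u / v)
| FormDiv1 : formII u v (u / v - 1)
| FormDiv2 : formII u v (v / u - 1)
| FormT : formII u v (u * (u - v) / v).

Definition monoII (u v z : K) := exists e g,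
  [/\ unitv (loc u v) e, formII u v g & z = e * g \/ z^-1 = e * g].

Lemma monoII_regular u v z O : typeII u v -> monoII u v z -> chartII u v O -> regular_at O z.
Proof.
move=> t [e [g [ue fg hz]]] h; have b := typeII_birat t.
have [[p [q [bpq eO]]] D h1 h2] := chartII_props b h.
have lO : lring O by rewrite eO; apply: loc_lring.
have rd : regular_at O (u / v) by case: h1; [left|right; rewrite invf_div].
have rg : regular_at O g.
  case: fg => [g' hg||||//]; first by left; apply: D.1.
  - by [].
  - by move: rd; rewrite eO; apply: regular_sub1.
  by have : regular_at O (v / u); [apply: regular_inv; rewrite invf_div|
    rewrite eO; apply: regular_sub1].
have re := regular_unit lO (dom_unitv D ue) rg.
by case: hz => hz; [rewrite hz|apply: regular_inv; rewrite hz].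
Qed.

Definition monoI (u v z : K) := exists e g, [/\ unitv (loc u v) e,
  loc u v g \/ g = u / v & z = e * g \/ z^-1 = e * g].

Lemma monoI_regular z O : monoI (1 - x) (1 - y) z -> chartI (1 - x) (1 - y) O -> regular_at O z.
Proof.
move=> [e [g [ue fg hz]]] h.
have [[p [q [bpq eO]]] D h1] := chartI_props (typeI_birat M) h.
have lO : lring O by rewrite eO; apply: loc_lring.
have rg : regular_at O g.
  case: fg => [hg|->]; first by left; apply: D.1.
  by case: h1; [left|right; rewrite invf_div].
have re := regular_unit lO (dom_unitv D ue) rg.
by case: hz => hz; [rewrite hz|apply: regular_inv; rewrite hz].
Qed.

(** One presentation P / Q serves for the affine plane and another, P' / Q', for the line x0 = 0:
    away from base points the two terms never vanish together. Base points are treated through the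
    local shapes. *)
Lemma regular_everywhere z P Q P' Q' : z = P / Q -> z = P' / Q' ->
  (forall S a b, lring S -> vl S x a -> vl S y b -> affine_base a b \/
     exists c d, [/\ vl S P c, vl S Q d & (c != 0) || (d != 0)]) ->
  (forall S w, lring S -> w != 0 -> vl S (1 / y) 0 -> vl S (x / y) w ->
     exists c d, [/\ vl S P' c, vl S Q' d & (c != 0) || (d != 0)]) ->
  (forall u v, typeII u v -> monoII u v z) -> monoI (1 - x) (1 - y) z ->
  forall O, XX O -> regular_at O z.
Proof.
move=> e1 e2 h1 h2 h3 h4 O /XX_XL [[a [b [nb ->]]]|[c c0 ->]|[u [v [t h]]]|h].
- have bi : birat (x - cst a) (y - cst b) by apply/birat_subC/birat_subC2/b_xy.
  have lO := loc_lring bi; have hu := mx_loc_u bi; have hv := mx_loc_v bi.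
  case: (h1 _ a b lO hu hv) => // -[c [d [hc hd cd]]]; rewrite e1; exact: regular_frac hc hd cd.
- have bi : birat (1 / y) (x / y - cst c) by apply/birat_subC2/birat_1y.
  have lO := loc_lring bi; have hu := (vl0 _ _).2 (mx_loc_u bi); have hv := mx_loc_v bi.
  case: (h2 _ c lO c0 hu hv) => // c' [d [hc hd cd]]; rewrite e2; exact: regular_frac hc hd cd.
- exact: monoII_regular t (h3 _ _ t) h.
exact: monoI_regular.
Qed.

Lemma unitvI (O : K -> Prop) e c : vl O e c -> c != 0 -> unitv O e.
Proof. by move=> h c0; exists c. Qed.

Lemma unitv1 (O : K -> Prop) : lring O -> unitv O 1.
Proof. by move=> lO; exists 1; [apply: oner_neq0|apply: vl1]. Qed.

Lemma mono_reg u v z : birat u v -> loc u v z -> monoII u v z.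
Proof.
move=> b h; exists 1, z; split; [exact: unitv1 (loc_lring b)|exact: FormReg|by left; rewrite mul1r].
Qed.

Lemma mono_inv u v z : birat u v -> loc u v z^-1 -> monoII u v z.
Proof.
move=> b h; exists 1, z^-1; split; [exact: unitv1 (loc_lring b)|exact: FormReg|by right; rewrite mul1r].
Qed.

Lemma monoI_reg u v z : birat u v -> loc u v z -> monoI u v z.
Proof.
move=> b h; exists 1, z; split; [exact: unitv1 (loc_lring b)|by left|by left; rewrite mul1r].
Qed.

Lemma monoI_inv u v z : birat u v -> loc u v z^-1 -> monoI u v z.
Proof.
move=> b h; exists 1, z^-1; split; [exact: unitv1 (loc_lring b)|by left|by right; rewrite mul1r].
Qed.

(** The functions [h1] to [h5] form the orbit of x under the translation of order 5: the lines
    through Q1, Q2, Q3, Q4, and the conics through these four points. The functions of B2 and B3 are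
    [g2] and [g3]. *)
Definition h1 : K := x.
Definition h2 : K := y / (x + y - 1).
Definition h3 : K := 1 / (1 - y).
Definition h4 : K := (1 - x - y) / (1 - y).
Definition h5 : K := (1 - x) * (1 - y) / (1 - x - y).
Definition g2 : K := x * y / (y - 1).
Definition g3 : K := (x - 1) * y / (y - 1).

Let x0' : x != 0 := fx_neq0 M.
Let y0' : y != 0 := fy_neq0 M.

Lemma nz_lines : [/\ 1 - x != 0, 1 - y != 0, 1 - x - y != 0, x - y != 0 & x + y - 1 != 0].
Proof.
have [n1 n2 n3 n4] := lines_neq0 M; split=> //.
by rewrite -oppr_eq0 (_ : - (x + y - 1) = 1 - x - y) //; ring.
Qed.

Lemma nz_y1 : y - 1 != 0.
Proof. by have [_ n _ _ _] := nz_lines; rewrite -oppr_eq0 opprB. Qed.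

Lemma vl_or (S : K -> Prop) P Q (a b c d : k) : vl S P c -> vl S Q d ->
  (c = 0 -> d = 0 -> affine_base a b) ->
  affine_base a b \/ exists c d, [/\ vl S P c, vl S Q d & (c != 0) || (d != 0)].
Proof.
move=> hc hd h; have [c0|c0] := eqVneq c 0; last by right; exists c, d; rewrite c0.
have [d0|d0] := eqVneq d 0; first by left; apply: h.
by right; exists c, d; rewrite d0 orbT.
Qed.

Lemma vl_typeII u v : typeII u v -> [/\ birat u v, lring (loc u v), vl (loc u v) u 0 & vl (loc u v) v 0].
Proof.
move=> t; have b := typeII_birat t; split=> //; first exact: loc_lring.
  by apply/vl0/mx_loc_u.
by apply/vl0/mx_loc_v.
Qed.

Lemma vl_typeI : [/\ birat (1 - x) (1 - y), lring (loc (1 - x) (1 - y)),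
  vl (loc (1 - x) (1 - y)) (1 - x) 0 & vl (loc (1 - x) (1 - y)) (1 - y) 0].
Proof.
have b := typeI_birat M; split=> //; first exact: loc_lring.
  by apply/vl0/mx_loc_u.
by apply/vl0/mx_loc_v.
Qed.



Lemma typeII_ind4 (P : K -> K -> Prop) :
  (forall u v, birat u v -> lring (loc u v) -> vl (loc u v) u 0 -> vl (loc u v) v 0 ->
    u = x / y -> v = 1 / y -> P u v) ->
  (forall u v, birat u v -> lring (loc u v) -> vl (loc u v) u 0 -> vl (loc u v) v 0 ->
    u = y -> v = x + y - 1 -> P u v) ->
  (forall u v, birat u v -> lring (loc u v) -> vl (loc u v) u 0 -> vl (loc u v) v 0 ->
    u = 1 / x -> v = y / x -> P u v) ->
  (forall u v, birat u v -> lring (loc u v) -> vl (loc u v) u 0 -> vl (loc u v) v 0 ->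
    u = 1 - y -> v = x -> P u v) ->
  forall u v, typeII u v -> P u v.
Proof.
move=> p1 p2 p3 p4 u v t; have [b lO hu hv] := vl_typeII t.
by case: t b lO hu hv => b lO hu hv; [apply: p1|apply: p2|apply: p3|apply: p4].
Qed.

Lemma typeI_ind (P : K -> K -> Prop) :
  (forall u v, birat u v -> lring (loc u v) -> vl (loc u v) u 0 -> vl (loc u v) v 0 ->
    u = 1 - x -> v = 1 - y -> P u v) -> P (1 - x) (1 - y).
Proof. by move=> h; have [b lO hu hv] := vl_typeI; apply: h. Qed.

Ltac nzk1 := match goal with |- is_true (?A != 0) =>
  first [ exact: oner_neq0 | (have -> : A = 1 by ring); exact: oner_neq0
        | (have -> : A = - 1 by ring); rewrite oppr_eq0; exact: oner_neq0 ] end.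
Ltac nzk := rewrite ?(mulf_eq0, invr_eq0, negb_or); repeat (apply/andP; split); nzk1.
Ltac uvsubst := match goal with e1 : ?u = _, e2 : ?v = _ |- _ => rewrite ?e1 ?e2 end.
Ltac fieldz := rewrite /h1 /h2 /h3 /h4 /h5 /g2 /g3; uvsubst; field; nzs.
Ltac inloc lO := eapply vl_in; [exact: lO | vls lO; nzk].
Ltac unitl lO := eapply unitvI; [vls lO; nzk | nzk].
Ltac inlocE lO E := match goal with |- ?S ?z => (have -> : z = E by fieldz); inloc lO end.
Ltac reg lO E := apply: mono_reg => //; inlocE lO E.
Ltac inv lO E := apply: mono_inv => //; inlocE lO E.
Ltac regI lO E := apply: monoI_reg => //; inlocE lO E.
Ltac invI lO E := apply: monoI_inv => //; inlocE lO E.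
Ltac form := first [exact: FormDiv | exact: FormDiv1 | exact: FormDiv2 | exact: FormT].
Ltac typeIcase := match goal with |- monoI _ _ ?z => apply: (@typeI_ind (fun u v => monoI u v z)) end.
Ltac mon lO e g := exists e, g; split; [unitl lO | form | left; fieldz].
Ltac moni lO e g := exists e, g; split; [unitl lO | form | right; fieldz].
Ltac monI lO e := eexists e, _; split; [unitl lO | right; reflexivity | left; fieldz].
Ltac vlsplit lS := eexists _, _; split; [vls lS; nzk | vls lS; nzk | ].

Lemma regular_h1 O : XX O -> regular_at O h1.
Proof.
have [n1 n2 n3 n4 n5] := nz_lines; have n6 := nz_y1.
apply: (@regular_everywhere h1 x 1 (x / y) (1 / y)).
- by rewrite divr1.
- by rewrite /h1; field; nzs.
- by move=> S a b lS ha hb; right; vlsplit lS; rewrite oner_neq0 orbT.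
- by move=> S w lS w0 hu hw; vlsplit lS; rewrite w0.
- apply: typeII_ind4 => u v b lO hu hv e1 e2.
  + by mon lO (1 : K) (u / v).
  + by reg lO (1 + v - u).
  + by inv lO u.
  by reg lO v.
typeIcase => u v b lO hu hv e1 e2; regI lO (1 - u).
Qed.

Lemma regular_h2 O : XX O -> regular_at O h2.
Proof.
have [n1 n2 n3 n4 n5] := nz_lines; have n6 := nz_y1.
apply: (@regular_everywhere h2 y (x + y - 1) 1 (x / y + 1 - 1 / y)).
- by [].
- by rewrite /h2; field; nzs.
- move=> S a b lS ha hb; eapply vl_or; [vls lS|vls lS|] => h h'; apply: Or31.
  by rewrite h addr0 in h' *; move/eqP: h'; rewrite subr_eq0 => /eqP.
- by move=> S w lS w0 hu hw; vlsplit lS; rewrite oner_neq0.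
- apply: typeII_ind4 => u v b lO hu hv e1 e2.
  + by reg lO (1 / (u + 1 - v)).
  + by mon lO (1 : K) (u / v).
  + by reg lO (v / (1 + v - u)).
  by inv lO ((v - u) / (1 - u)).
typeIcase => u v b lO hu hv e1 e2; regI lO ((1 - v) / (1 - u - v)).
Qed.

Lemma regular_h3 O : XX O -> regular_at O h3.
Proof.
have [n1 n2 n3 n4 n5] := nz_lines; have n6 := nz_y1.
apply: (@regular_everywhere h3 1 (1 - y) (1 / y) (1 / y - 1)).
- by [].
- by rewrite /h3; field; nzs.
- by move=> S a b lS ha hb; right; vlsplit lS; rewrite oner_neq0.
- by move=> S w lS w0 hu hw; vlsplit lS; rewrite !sub0r !oppr_eq0 oner_neq0 orbT.
- apply: typeII_ind4 => u v b lO hu hv e1 e2.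
  + by reg lO (v / (v - 1)).
  + by reg lO (1 / (1 - u)).
  + by moni lO (-1 : K) (v / u - 1).
  by inv lO u.
typeIcase => u v b lO hu hv e1 e2; invI lO v.
Qed.

Lemma regular_h4 O : XX O -> regular_at O h4.
Proof.
have [n1 n2 n3 n4 n5] := nz_lines; have n6 := nz_y1.
apply: (@regular_everywhere h4 (1 - x - y) (1 - y) (1 / y - x / y - 1) (1 / y - 1)).
- by [].
- by rewrite /h4; field; nzs.
- move=> S a b lS ha hb; eapply vl_or; [vls lS|vls lS|] => h h'; apply: Or32.
  move/eqP: h'; rewrite subr_eq0 => /eqP h'; rewrite -h' in h *.
  by move/eqP: h; rewrite addrAC subrr add0r oppr_eq0 => /eqP.
- by move=> S w lS w0 hu hw; vlsplit lS; rewrite !sub0r !oppr_eq0 oner_neq0 orbT.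
- apply: typeII_ind4 => u v b lO hu hv e1 e2.
  + by reg lO ((v - u - 1) / (v - 1)).
  + by reg lO (- v / (1 - u)).
  + by inv lO ((u - v) / (u - 1 - v)).
  by mon lO (-1 : K) (v / u - 1).
typeIcase => u v b lO hu hv e1 e2; invI lO (v / (u + v - 1)).
Qed.

Lemma regular_h5 O : XX O -> regular_at O h5.
Proof.
have [n1 n2 n3 n4 n5] := nz_lines; have n6 := nz_y1.
apply: (@regular_everywhere h5 ((1 - x) * (1 - y)) (1 - x - y)
  ((1 / y - x / y) * (1 / y - 1)) (1 / y * (1 / y - x / y - 1))).
- by [].
- by rewrite /h5; field; nzs.
- move=> S a b lS ha hb; eapply vl_or; [vls lS|vls lS|] => /eqP.
  rewrite mulf_eq0 !subr_eq0 => /orP[/eqP <-|/eqP <-] h'.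
    by apply: Or31; split=> //; move/eqP: h'; rewrite subrr sub0r oppr_eq0 => /eqP.
  by apply: Or32; split=> //; move/eqP: h'; rewrite addrAC subrr sub0r oppr_eq0 => /eqP.
- by move=> S w lS w0 hu hw; vlsplit lS; rewrite !sub0r mulrNN mulr1 w0.
- apply: typeII_ind4 => u v b lO hu hv e1 e2.
  + by mon lO ((1 - v) / (v - u - 1)) (u / v - 1).
  + by mon lO (u - 1) (u / v - 1).
  + by mon lO (- (u - 1) / (u - 1 - v)) (v / u - 1).
  by moni lO (- 1 / (1 - v)) (v / u - 1).
typeIcase => u v b lO hu hv e1 e2; regI lO (u * v / (u + v - 1)).
Qed.

Lemma regular_g2 O : XX O -> regular_at O g2.
Proof.
have [n1 n2 n3 n4 n5] := nz_lines; have n6 := nz_y1.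
apply: (@regular_everywhere g2 (x * y) (y - 1) (x / y) (1 / y * (1 - 1 / y))).
- by [].
- by rewrite /g2; field; nzs.
- move=> S a b lS ha hb; eapply vl_or; [vls lS|vls lS|] => h h'; apply: Or32.
  move/eqP: h'; rewrite subr_eq0 => /eqP h'; rewrite h' in h *.
  by rewrite mulr1 in h.
- by move=> S w lS w0 hu hw; vlsplit lS; rewrite w0.
- apply: typeII_ind4 => u v b lO hu hv e1 e2.
  + by mon lO (1 / (1 - v)) (u / v).
  + by reg lO ((1 + v - u) * u / (u - 1)).
  + by moni lO (-1 : K) (u * (u - v) / v).
  by moni lO (-1 / (1 - u)) (u / v).
typeIcase => u v b lO hu hv e1 e2; invI lO (- v / ((1 - u) * (1 - v))).
Qed.

Lemma regular_g3 O : XX O -> regular_at O g3.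
Proof.
have [n1 n2 n3 n4 n5] := nz_lines; have n6 := nz_y1.
have n7 : x - 1 != 0 by rewrite -oppr_eq0 opprB.
apply: (@regular_everywhere g3 ((x - 1) * y) (y - 1) (x / y - 1 / y) (1 / y * (1 - 1 / y))).
- by [].
- by rewrite /g3; field; nzs.
- move=> S a b lS ha hb; eapply vl_or; [vls lS|vls lS|] => h h'; apply: Or33.
  move/eqP: h'; rewrite subr_eq0 => /eqP h'; rewrite h' in h *.
  by move/eqP: h; rewrite mulr1 subr_eq0 => /eqP.
- by move=> S w lS w0 hu hw; vlsplit lS; rewrite subr0 w0.
- apply: typeII_ind4 => u v b lO hu hv e1 e2.
  + by mon lO (1 / (1 - v)) (u / v - 1).
  + by reg lO ((v - u) * u / (u - 1)).
  + by moni lO (1 / (u - 1)) (u * (u - v) / v).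
  by inv lO (- u / ((v - 1) * (1 - u))).
typeIcase => u v b lO hu hv e1 e2; monI lO (1 - v).
Qed.

Lemma regular_T O : XX O -> regular_at O (TT M).
Proof.
move=> [_ h]; have [h1|h1] := pselect (O (TT M)); [by left|right].
by apply: contrapT => h2; apply: h.
Qed.
End RegularMaps.

(** * Automorphisms of the surface *)

Section Automorphisms.
Variables (k : closedFieldType) (M : funfield k).
Local Notation K := (ff M).
Local Notation cst := (cst M).
Local Notation ev := (@ev k M).
Local Notation birat := (@birat k M).
Local Notation mx := (@mx k M).
Local Notation x := (@fx k M).
Local Notation y := (@fy k M).
Local Notation loc := (@loc k M).

(** Subalgebras closed under those inverses that lie in W. A local ring dominated by W has this
    property, and the property survives intersections, so there is a smallest such S containing
    given elements. *)
Record closed_for (W S : K -> Prop) : Prop := ClosedFor {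
  cfC : forall c, S (cst c);
  cfD : forall a b, S a -> S b -> S (a + b);
  cfM : forall a b, S a -> S b -> S (a * b);
  cfV : forall a, S a -> W a^-1 -> S a^-1 }.

(** Seen from W, z is a map to the projective line at S: whichever of z and 1/z is regular at W
    belongs to S. Asking this for all of [hs] describes the local ring of the image point in a
    product of six lines. *)
Definition meets (W S : K -> Prop) (z : K) : Prop := (W z -> S z) /\ (W z^-1 -> S z^-1).

Definition hs : seq K := [:: h1 M; h2 M; h3 M; h4 M; h5 M; TT M].

Section Closed.
Variables W S : K -> Prop.
Hypotheses (vW : vring W) (cS : closed_for W S).
Let lW : lring W. Proof. by case: vW. Qed.

Lemma cfN a : S a -> S (- a).
Proof.
move=> h; rewrite -mulN1r -(rmorphN1 cst); apply: (cfM cS) => //; exact: (cfC cS).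
Qed.
Lemma cf1 : S 1. Proof. by rewrite -(rmorph1 cst); apply: (cfC cS). Qed.
Lemma cfB a b : S a -> S b -> S (a - b).
Proof. by move=> ha hb; apply: (cfD cS) => //; apply: cfN. Qed.

Lemma meets_inv z : meets W S z <-> meets W S z^-1.
Proof. by rewrite /meets invrK; split=> -[h1 h2]. Qed.

Lemma meets_addC z c : meets W S z -> meets W S (z + cst c).
Proof.
move=> [h1 h2]; split=> h.
  have : W (z + cst c - cst c) by apply: (lrB lW) => //; apply: lrC.
  by rewrite addrK => /h1 h3; apply: (cfD cS) => //; apply: (cfC cS).
have [/h1 hz|hz] := pselect (W z).
  by apply: (cfV cS) => //; apply: (cfD cS) => //; apply: (cfC cS).
have mz : mx W z^-1 by apply: (vr_nonunit vW); rewrite invrK.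
have z0 : z != 0.
  by apply: contra_notN hz => /eqP ->; apply: lr0.
have vz : vl W z^-1 0 by apply/vl0.
have hv : vl W (1 + cst c * z^-1) 1.
  by have := vlD lW (vl1 lW) (vlM lW (vlC lW c) vz); rewrite mulr0 addr0.
have n0 := vl_neq0 lW hv (oner_neq0 _).
have -> : (z + cst c)^-1 = z^-1 / (1 + cst c * z^-1).
  have -> : z + cst c = (1 + cst c * z^-1) * z by rewrite mulrDl mul1r mulfVK.
  by rewrite invfM mulrC.
apply: (cfM cS); first exact: h2 (mx_in mz).
apply: (cfV cS); last exact: vl_inv hv (oner_neq0 _).
apply: (cfD cS); first exact: cf1.
apply: (cfM cS); [exact: (cfC cS)|exact: h2 (mx_in mz)].
Qed.

Lemma meets_opp z : meets W S z -> meets W S (- z).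
Proof.
move=> [h1 h2]; have wN a : W (- a) -> W a by move=> h; rewrite -[a]opprK; apply: (lrN lW).
by split; rewrite ?invrN => /wN h; apply: cfN; [apply: h1|apply: h2].
Qed.

Lemma meets_compl z : meets W S z -> meets W S (1 - z).
Proof. by move=> h; rewrite addrC -(rmorph1 cst); apply/meets_addC/meets_opp. Qed.

Lemma meets_cst c : meets W S (cst c).
Proof. by split=> _; rewrite -?fmorphV; apply: (cfC cS). Qed.

(** The involution z / (z - 1) of the projective line is a composite of inversion and translations.
    It occurs in the action of [aut4]. *)
Lemma meets_tilt z : meets W S (z / (z - 1)) <-> meets W S z.
Proof.
have key w : meets W S w -> meets W S (w / (w - 1)).
  move=> h; have [e|n0] := eqVneq (w - 1) 0.
    by rewrite e invr0 mulr0 -(rmorph0 cst); apply: meets_cst.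
  have -> : w / (w - 1) = (w - cst 1)^-1 + cst 1.
    by rewrite rmorph1 -{1}(subrK 1 w) mulrDl divff // div1r addrC.
  by apply/meets_addC/meets_inv; rewrite invrK -rmorphN; apply: meets_addC.
split; last exact: key; have [/eqP|n0] := eqVneq (z - 1) 0.
  by rewrite subr_eq0 => /eqP -> _; rewrite -(rmorph1 cst); apply: meets_cst.
move/key; suff -> : z / (z - 1) / (z / (z - 1) - 1) = z by [].
have -> : z / (z - 1) - 1 = (z - 1)^-1 by rewrite -{2}(divff n0) -mulrBl opprB addrC subrK mul1r.
by rewrite invrK divfK.
Qed.

Lemma closed_loc p q : birat p q -> mx W p -> mx W q -> S p -> S q ->
  forall z, loc p q z -> S z.
Proof.
move=> b mp mq hp hq z [P [Q [Q0 ->]]].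
have hS R : S (ev p q R).
  elim/mpoly2_ind: R => [c|||r s|r s]; rewrite ?evC ?evX ?evY //; first exact: (cfC cS).
    by rewrite rmorphD; apply: (cfD cS).
  by rewrite rmorphM; apply: (cfM cS).
apply: (cfM cS) => //; apply: (cfV cS) => //.
by apply: (loc_sub lW mp mq); apply: loc_in_inv.
Qed.

Hypothesis hH : forall h, h \in hs -> meets W S h.

Let m1 : meets W S x. Proof. by apply: (hH (h := h1 M)); rewrite inE eqxx. Qed.
Let m2 : meets W S (h2 M). Proof. by apply: hH; rewrite !inE eqxx !orbT. Qed.
Let m3 : meets W S (h3 M). Proof. by apply: hH; rewrite !inE eqxx !orbT. Qed.
Let m4 : meets W S (h4 M). Proof. by apply: hH; rewrite !inE eqxx !orbT. Qed.
Let m6 : meets W S (TT M). Proof. by apply: hH; rewrite !inE eqxx !orbT. Qed.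
Let m1y : meets W S (1 - y).
Proof. by apply/meets_inv; rewrite -div1r. Qed.
Let my : meets W S y.
Proof. by have := meets_compl m1y; rewrite opprB addrC subrK. Qed.

Let x0' : x != 0 := fx_neq0 M.
Let y0' : y != 0 := fy_neq0 M.

Lemma meets_typeII u v : typeII u v -> mx W u -> mx W v -> [/\ S u, S v & meets W S (u / v)].
Proof.
have [n1 n2 n3 n4 n5] := nz_lines M.
move=> t /vl0 hu /vl0 hv; case: t hu hv => hu hv.
- have sv : S (1 / y) by rewrite div1r; apply: my.2; rewrite -div1r; apply: vl_in lW _ _ hv.
  split=> //; last by have -> : x / y / (1 / y) = x by field; nzs.
  have e : x / y = (h2 M)^-1 - 1 + 1 / y by rewrite /h2; field; nzs.
  rewrite e; apply: (cfD cS) => //; apply: cfB; last exact: cf1.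
  apply: m2.2; rewrite (_ : (h2 M)^-1 = x / y + 1 - 1 / y); last by rewrite /h2; field; nzs.
  by eapply vl_in; [exact: lW|vls lW].
- have wx : vl W x 1 by rewrite (_ : x = (x + y - 1) - y + 1); [vlq lW; ring|ring].
  have sy : S y by apply: my.1; apply: vl_in lW _ _ hu.
  split=> //; apply: cfB; last exact: cf1.
  by apply: (cfD cS) => //; apply: m1.1; apply: vl_in lW _ _ wx.
- have sx : S (1 / x) by rewrite div1r; apply: m1.2; rewrite -div1r; apply: vl_in lW _ _ hu.
  split=> //; last by have -> : 1 / x / (y / x) = y^-1; [field; nzs|apply/meets_inv; rewrite invrK].
  have e : h2 M = y / x / (1 + y / x - 1 / x) by rewrite /h2; field; nzs.
  have hh : vl W (h2 M) 0.
    by rewrite e; vlq lW; [rewrite addr0 subr0 oner_neq0|rewrite mul0r].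
  have s2 : S (h2 M) by apply: m2.1; apply: vl_in lW _ _ hh.
  have hd : vl W (1 - h2 M) 1 by vlq lW; rewrite subr0.
  have nd := vl_neq0 lW hd (oner_neq0 _).
  have nx1 : x - 1 != 0 by rewrite -oppr_eq0 opprB.
  have -> : y / x = h2 M * (1 - 1 / x) / (1 - h2 M).
    rewrite /h2; field; nzs.
  apply: (cfM cS); last first.
    by apply: (cfV cS); [apply: cfB => //; exact: cf1|exact: vl_inv hd (oner_neq0 _)].
  by apply: (cfM cS) => //; apply: cfB => //; exact: cf1.
split.
- by apply: m1y.1; apply: vl_in lW _ _ hu.
- by apply: m1.1; apply: vl_in lW _ _ hv.
apply/meets_inv; rewrite (_ : _^-1 = 1 - h4 M); last by rewrite /h4; field; nzs.
exact: meets_compl.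
Qed.

Lemma meets_typeI : mx W (1 - x) -> mx W (1 - y) ->
  [/\ S (1 - x), S (1 - y) & meets W S ((1 - x) / (1 - y))].
Proof.
move=> mu mv; have su : S (1 - x) by apply: (meets_compl m1).1; apply: mx_in.
have sv : S (1 - y) by apply: m1y.1; apply: mx_in.
split=> //; have b := typeI_birat M; have lO := loc_lring b.
have [e [ue eT]] := typeI_T M; have [c c0 hc] := ue.
have D := loc_dom b lW mu mv; have e0 := vl_neq0 lO hc c0.
have se : S e by apply: (closed_loc b mu mv su sv); apply: vl_in lO _ _ hc.
have se' : S e^-1 by apply: (closed_loc b mu mv su sv); apply: vl_inv hc c0.
have we : W e by apply: D.1; apply: vl_in lO _ _ hc.
have we' : W e^-1 by apply: D.1; apply: vl_inv hc c0.
have -> : (1 - x) / (1 - y) = e^-1 * TT M by rewrite eT mulKf.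
split; [|rewrite (invfM e^-1 (TT M)) invrK] => h.
  apply: (cfM cS) => //; apply: m6.1; rewrite -(mulVKf e0 (TT M)); exact: (lrM lW).
apply: (cfM cS) => //; apply: m6.2; rewrite -(mulKf e0 (TT M)^-1); exact: (lrM lW).
Qed.

(** In each chart the parameters are expressions in the six functions whose denominators are units
    at W, so S contains them. Where two blow-ups take place, T supplies the coordinate of the second
    exceptional curve. *)
Lemma XX_closed O : XX O -> dom O W -> forall z, O z -> S z.
Proof.
have [n1 n2 n3 n4 n5] := nz_lines M.
move=> /XX_XL [[a [b [_ ->]]]|[c c0 ->]|[u [v [t h]]]|h] D.
- have bi : birat (x - cst a) (y - cst b) by apply/birat_subC/birat_subC2/b_xy.
  have hu : vl W x a by apply: D.2; apply: mx_loc_u.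
  have hv : vl W y b by apply: D.2; apply: mx_loc_v.
  apply: closed_loc => //; apply: cfB; try exact: (cfC cS).
    by apply: m1.1; apply: vl_in lW _ _ hu.
  by apply: my.1; apply: vl_in lW _ _ hv.
- have bi : birat (1 / y) (x / y - cst c) by apply/birat_subC2/birat_1y.
  have mu : mx W (1 / y) by apply: D.2; apply: mx_loc_u.
  have hu := (vl0 _ _).2 mu; have hv : vl W (x / y) c by apply: D.2; apply: mx_loc_v.
  have su : S (1 / y) by rewrite div1r; apply: my.2; rewrite -div1r; apply: mx_in.
  apply: closed_loc => //; apply: cfB; last exact: (cfC cS).
  have e : x / y = (h2 M)^-1 - 1 + 1 / y by rewrite /h2; field; nzs.
  rewrite e; apply: (cfD cS) => //; apply: cfB; last exact: cf1.
  apply: m2.2; rewrite (_ : (h2 M)^-1 = x / y + 1 - 1 / y); last by rewrite /h2; field; nzs.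
  by eapply vl_in; [exact: lW|vls lW].
- have b := typeII_birat t; have [u0 v0] := birat_neq0 b; have lO := loc_lring b.
  have [_ D2 _ _] := chartII_props b h.
  have DW := dom_trans D2 D; have mu : mx W u by apply: DW.2; apply: mx_loc_u.
  have mv : mx W v by apply: DW.2; apply: mx_loc_v.
  have [su sv sr] := meets_typeII t mu mv; have bc p hp := @coordsII_birat k M u v p b hp.
  have sr' : meets W S (v / u) by apply/meets_inv; rewrite invf_div.
  have [e [[d d0 hd] ht]] := typeII_T t.
  have e0 := vl_neq0 lO hd d0; have he := vl_in lO hd; have he' := vl_inv lO hd d0.
  have se := closed_loc b mu mv su sv he; have se' := closed_loc b mu mv su sv he'.
  have we := DW.1 _ he; have we' := DW.1 _ he'.
  have mg : meets W S (u * (u - v) / v).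
    have mt : meets W S (e * (u * (u - v) / v)).
      by case: ht => <- //; apply/meets_inv; rewrite invrK.
    split=> hh; [have h3 := mt.1|have h3 := mt.2; rewrite invfM in h3].
      rewrite -(mulKf e0 (_ / v)); apply: (cfM cS) => //; apply: h3; exact: (lrM lW).
    rewrite -(mulVKf e0 (_ / v)^-1); apply: (cfM cS) => //; apply: h3; exact: (lrM lW).
  case: h D => [->|[c c0 ->]|[c ->]|->] D.
  + have bi : birat v (u / v) by apply: (bc (v, u / v)); rewrite inE eqxx.
    have mw : mx W (u / v) by apply: D.2; apply: mx_loc_v.
    by apply: closed_loc => //; apply: sr.1; apply: mx_in.
  + have bi : birat u (v / u - cst c) by apply/birat_subC2/birat_div.
    have mw : vl W (v / u) c by apply: D.2; apply: mx_loc_v.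
    apply: closed_loc => //; apply: cfB; last exact: (cfC cS).
    by apply: sr'.1; apply: vl_in lW _ _ mw.
  + have bi : birat u (v / u ^+ 2 - cst c).
      by apply/birat_subC2; apply: (bc (u, v / u ^+ 2)); rewrite !inE eqxx !orbT.
    have mw : vl W (v / u ^+ 2) c by apply: D.2; apply: mx_loc_v.
    apply: closed_loc => //; apply: cfB; last exact: (cfC cS).
    have vu : vl W u 0 by apply/vl0.
    have nuv : u - v != 0 by rewrite subr_eq0; have [_ _ ?] := birat_neq b.
    (* With w = v / u^2 and g = u (u - v) / v, one has 1/g = w / (1 - u w), hence w = (1/g) / (1 +
       u/g): the coordinate w is recovered from T, which is g or 1/g up to a unit. *)
    have eg : (u * (u - v) / v)^-1 = v / u ^+ 2 / (1 - u * (v / u ^+ 2)) by field; nzs.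
    have hd1 : vl W (1 - u * (v / u ^+ 2)) 1 by vlq lW; rewrite mul0r subr0.
    have vg : vl W (u * (u - v) / v)^-1 c.
      by rewrite eg; vlq lW; [exact: oner_neq0|rewrite divr1].
    have sg : S (u * (u - v) / v)^-1 by apply: mg.2; apply: vl_in lW _ _ vg.
    have hd2 : vl W (1 + u * (u * (u - v) / v)^-1) 1.
      by have := vlD lW (vl1 lW) (vlM lW vu vg); rewrite mul0r addr0.
    have nd2 := vl_neq0 lW hd2 (oner_neq0 _).
    have -> : v / u ^+ 2 = (u * (u - v) / v)^-1 / (1 + u * (u * (u - v) / v)^-1).
      have -> : 1 + u * (u * (u - v) / v)^-1 = u / (u - v) by field; nzs.
      by field; nzs.
    apply: (cfM cS) => //; apply: (cfV cS); last exact: vl_inv hd2 (oner_neq0 _).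
    by apply: (cfD cS); [exact: cf1|apply: (cfM cS)].
  have bi : birat (v / u) (u ^+ 2 / v).
    by apply: (bc (v / u, u ^+ 2 / v)); rewrite !inE eqxx !orbT.
  have mp : mx W (v / u) by apply: D.2; apply: mx_loc_u.
  have mw : mx W (u ^+ 2 / v) by apply: D.2; apply: mx_loc_v.
  apply: closed_loc => //; first by apply: sr'.1; apply: mx_in.
  have -> : u ^+ 2 / v = u * (u - v) / v + u by field; nzs.
  apply: (cfD cS) => //; apply: mg.1.
  have -> : u * (u - v) / v = u ^+ 2 / v - u by field; nzs.
  by apply: (lrB lW); apply: mx_in.
have b := typeI_birat M; have [_ D2 _] := chartI_props b h.
have DW := dom_trans D2 D; have mu : mx W (1 - x) by apply: DW.2; apply: mx_loc_u.
have mv : mx W (1 - y) by apply: DW.2; apply: mx_loc_v.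
have [su sv sr] := meets_typeI mu mv.
case: h D => [->|[c ->]] D.
  have bi : birat (1 - y) ((1 - x) / (1 - y)) by apply/birat_div/birat_swap.
  have mw : mx W ((1 - x) / (1 - y)) by apply: D.2; apply: mx_loc_v.
  by apply: closed_loc => //; apply: sr.1; apply: mx_in.
have bi : birat (1 - x) ((1 - y) / (1 - x) - cst c) by apply/birat_subC2/birat_div.
have mw : vl W ((1 - y) / (1 - x)) c by apply: D.2; apply: mx_loc_v.
apply: closed_loc => //; apply: cfB; last exact: (cfC cS).
rewrite -invf_div; apply: sr.2; rewrite invf_div; apply: vl_in lW _ _ mw.
Qed.
End Closed.

Lemma hs_regular O h : XX O -> h \in hs -> regular_at O h.
Proof.
move=> hO; rewrite !inE => /or4P[/eqP ->|/eqP ->|/eqP ->|/or3P[] /eqP ->].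
- exact: regular_h1.
- exact: regular_h2.
- exact: regular_h3.
- exact: regular_h4.
- exact: regular_h5.
exact: regular_T.
Qed.

Lemma XX_lring (O : K -> Prop) : XX O -> lring O.
Proof. by move/XX_loc => [p [q [b ->]]]; apply: loc_lring. Qed.

(* A point of X is recovered from any valuation ring W dominating it. *)
Lemma XX_determined O W z : XX O -> vring W -> dom O W ->
  (O z <-> forall S, closed_for W S -> (forall h, h \in hs -> meets W S h) -> S z).
Proof.
move=> hO vW D; have lW : lring W by case: vW.
have lO := XX_lring hO.
split=> [hz S cS hS|h]; first exact: (XX_closed vW cS hS hO D hz).
have inv a : O a -> W a^-1 -> O a^-1.
  move=> ha hw; have [ma|ma] := pselect (mx O a); last by have [] := unitP lO ha ma.
  by rewrite (mx_unitF (D.2 _ ma) hw) invr0; apply: lr0.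
apply: h; first by split=> //; [exact: lrC|exact: (lrD lO)|exact: (lrM lO)].
move=> h hh; case: (hs_regular hO hh) => ho; split=> hw //.
- exact: inv.
- by rewrite -[h]invrK; apply: inv; rewrite ?invrK.
Qed.

Lemma vring_comp (sigma : {rmorphism K -> K}) W : bijective sigma ->
  (forall c, sigma (cst c) = cst c) -> vring W -> vring (fun z => W (sigma z)).
Proof.
move=> _ hc [[w1 w2 w3 w4] w5 w6].
have mxs z : mx (fun z => W (sigma z)) z <-> mx W (sigma z).
  split=> -[h1 h2]; split=> // h.
    by apply/eqP; rewrite fmorph_eq0; apply/eqP/h2; rewrite fmorphV.
  by apply/eqP; rewrite -(fmorph_eq0 sigma); apply/eqP/h2; rewrite -fmorphV.
split; first split.
- by move=> c; rewrite hc.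
- by move=> a b ha hb; rewrite rmorphD; apply: w2.
- by move=> a b ha hb; rewrite rmorphM; apply: w3.
- by move=> a b /mxs ha /mxs hb; apply/mxs; rewrite rmorphD; apply: w4.
- by move=> z; rewrite fmorphV.
by move=> z /w6 [c h]; exists c; apply/mxs; rewrite rmorphB hc.
Qed.

(** This holds when sigma permutes the six functions up to homographies, a finite check on
    formulas. *)
Definition stable (sigma : {rmorphism K -> K}) := forall W S, vring W -> closed_for W S ->
  ((forall h, h \in hs -> meets W S h) <-> (forall h, h \in hs -> meets W S (sigma h))).

Lemma meets_comp (sigma : {rmorphism K -> K}) W S z :
  meets (fun z => W (sigma z)) (fun z => S (sigma z)) z <-> meets W S (sigma z).
Proof. by rewrite /meets fmorphV. Qed.

Lemma closed_comp (sigma : {rmorphism K -> K}) W S : (forall c, sigma (cst c) = cst c) ->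
  closed_for W S -> closed_for (fun z => W (sigma z)) (fun z => S (sigma z)).
Proof.
move=> hc [s1 s2 s3 s4]; split.
- by move=> c; rewrite hc.
- by move=> a b ha hb; rewrite rmorphD; apply: s2.
- by move=> a b ha hb; rewrite rmorphM; apply: s3.
by move=> a ha; rewrite fmorphV; apply: s4.
Qed.

Section StableXX.
Variables sigma tau : {rmorphism K -> K}.
Hypotheses (sK : cancel sigma tau) (tK : cancel tau sigma).
Hypothesis hc : forall c, sigma (cst c) = cst c.
Hypothesis hst : stable sigma.

Let hc' c : tau (cst c) = cst c. Proof. by rewrite -{1}(hc c) sK. Qed.
Let bs : bijective sigma. Proof. by exists tau. Qed.
Let bt : bijective tau. Proof. by exists sigma. Qed.

Lemma stable_inv : stable tau.
Proof.
move=> W S vW cS; have := hst (vring_comp bt hc' vW) (closed_comp hc' cS).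
have e z : meets (fun z => W (tau z)) (fun z => S (tau z)) (sigma z) <-> meets W S z.
  by rewrite meets_comp sK.
move=> [h1 h2]; split=> h z hz.
  by apply/meets_comp; apply: h2 => // w hw; apply/e/h.
by apply/e; apply: h1 => // w hw; apply/meets_comp/h.
Qed.

(** Pull back a valuation ring W dominating O and let O' be its centre on X. By [XX_determined] both
    O' and the pull-back of O are the smallest closed set meeting the six functions, so they
    coincide. *)
Lemma stable_XX O : XX O -> XX (fun z => O (sigma z)).
Proof.
move=> hO; have [p [q [b eO]]] := XX_loc hO.
have [W vW D] := dominating_vring b; rewrite -eO in D.
have vW' := vring_comp bs hc vW; have [O' hO' D'] := center_exists vW'.
suff -> : (fun z => O (sigma z)) = O' by [].
apply: eqset_eq => z; rewrite (XX_determined (sigma z) hO vW D) (XX_determined z hO' vW' D').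
split=> h S cS hS.
  have cS' : closed_for W (fun z => S (tau z)).
    have := closed_comp hc' cS; suff -> : (fun z => W (sigma (tau z))) = W by [].
    by apply: eqset_eq => w; rewrite tK.
  have := h _ cS'; rewrite sK; apply; apply/(hst vW cS') => w hw.
  by apply/(meets_comp sigma); have := hS w hw; rewrite /meets /= !sK fmorphV.
apply: (h (fun z => S (sigma z)) (closed_comp hc cS)) => w hw.
by apply/meets_comp; apply: (hst vW cS).1.
Qed.
End StableXX.

Lemma stable_autX (sigma : {rmorphism K -> K}) : bijective sigma ->
  (forall c, sigma (cst c) = cst c) -> stable sigma -> autX sigma.
Proof.
move=> bs hc hst; split=> // O; have [tau sK tK] := inv_rmorph bs.
split=> h; last exact: (stable_XX sK tK hc hst h).
have hc' c : tau (cst c) = cst c by rewrite -{1}(hc c) sK.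
have := stable_XX tK sK hc' (stable_inv sK tK hc hst) h.
by congr XX; apply: eqset_eq => z; rewrite tK.
Qed.

Lemma aut_of_birat u v : birat u v ->
  (forall phi : {rmorphism K -> K}, (forall c, phi (cst c) = cst c) -> phi x = u -> phi y = v ->
     stable phi) ->
  exists sigma : {rmorphism K -> K}, [/\ autX sigma, sigma x = u & sigma y = v].
Proof.
move=> [phi [b hc hx hy]] h; exists phi; split=> //; apply: stable_autX => //; exact: h.
Qed.

Let x0' : x != 0 := fx_neq0 M.
Let y0' : y != 0 := fy_neq0 M.

Lemma nz_lines2 : [/\ x - 1 != 0, y - 1 != 0, 1 - x != 0, 1 - y != 0 & 1 - x - y != 0] /\
  [/\ x - y != 0, x + y - 1 != 0, x != 0 & y != 0].
Proof.
have [n1 n2 n3 n4 n5] := nz_lines M; have n6 := nz_y1 M.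
by have n7 : x - 1 != 0 by rewrite -oppr_eq0 opprB.
Qed.

Lemma hs_all (P : K -> Prop) : (forall h, h \in hs -> P h) <->
  [/\ P (h1 M), P (h2 M), P (h3 M) & P (h4 M) /\ P (h5 M) /\ P (TT M)].
Proof.
split=> [h|[p1 p2 p3 [p4 [p5 p6]]] h].
  by split; last repeat split; apply: h; rewrite !inE eqxx ?orbT.
by rewrite !inE => /or4P[/eqP ->|/eqP ->|/eqP ->|/or3P[] /eqP ->].
Qed.

Ltac nzc := match goal with |- is_true (?A != 0) =>
  first [ nz1 | (have -> : A = 1 by ring); exact: oner_neq0
        | (have -> : A = - 1 by ring); rewrite oppr_eq0; exact: oner_neq0 ] end.
Ltac fieldc := field; rewrite /=; repeat (apply/andP; split); nzc.
Ltac morph hc hx hy := rewrite ?TTE /h1 /h2 /h3 /h4 /h5 ?(rmorphM, rmorphD, rmorphB, rmorphN, fmorphV, rmorph1) ?hx ?hy.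

(** It fixes T, hence acts on each fibre, and permutes the pencils in the cycle [h1], [h2], [h4],
    [h5], [h3]. *)
Lemma aut5 : exists sigma : {rmorphism K -> K},
  [/\ autX sigma, sigma x = y / (x + y - 1) & sigma y = (x - 1) / x].
Proof.
have [[n1 n2 n3 n4 n5] [n6 n7 n8 n9]] := nz_lines2.
apply: aut_of_birat.
  have b1 : birat (x - 1) (y / (x - 1)).
    by apply: birat_div; rewrite -(rmorph1 cst); apply/birat_subC/b_xy.
  have b2 := birat_inv1 (birat_addC 1 b1); rewrite rmorph1 subrK in b2.
  have b3 := birat_addC 1 (birat_opp b2); rewrite rmorph1 in b3.
  have b4 := birat_inv2 (birat_addC2 1 (birat_inv2 b3)); rewrite rmorph1 in b4.
  apply: (eq_birat (birat_swap b4)); field; nzs.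
move=> phi hc hx hy W S vW cS.
have n10 : (x - 1) * (y - 1) != 0 by rewrite mulf_neq0.
have n11 : x * y != 0 by rewrite mulf_neq0.
have e1 : phi (h1 M) = h2 M by morph hc hx hy.
have e2 : phi (h2 M) = h4 M by morph hc hx hy; fieldc.
have e3 : phi (h3 M) = h1 M by morph hc hx hy; fieldc.
have e4 : phi (h4 M) = h5 M by morph hc hx hy; fieldc.
have e5 : phi (h5 M) = h3 M by morph hc hx hy; fieldc.
have e6 : phi (TT M) = TT M by morph hc hx hy; fieldc.
by rewrite !hs_all e1 e2 e3 e4 e5 e6; split=> -[? ? ? [? [? ?]]].
Qed.

(** It exchanges the two fibres of type I5, T becoming -1/T. Up to z / (z - 1) it permutes [h1],
    [h4], [h2], [h3] cyclically and fixes [h5]. *)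
Lemma aut4 : exists sigma : {rmorphism K -> K},
  [/\ autX sigma, sigma x = (x + y - 1) / x & sigma y = 1 / x].
Proof.
have [[n1 n2 n3 n4 n5] [n6 n7 n8 n9]] := nz_lines2.
apply: aut_of_birat.
  have b1 : birat x ((y - 1) / x).
    by apply: birat_div; rewrite -(rmorph1 cst); apply/birat_subC2/b_xy.
  have b2 := birat_addC 1 (birat_swap (birat_inv1 b1)); rewrite rmorph1 in b2.
  apply: (eq_birat b2); field; nzs.
move=> phi hc hx hy W S vW cS.
have n10 : (x - 1) * (y - 1) != 0 by rewrite mulf_neq0.
have n11 : x * y != 0 by rewrite mulf_neq0.
have e1 : phi (h1 M) = h4 M / (h4 M - 1) by morph hc hx hy; fieldc.
have e2 : phi (h2 M) = h3 M / (h3 M - 1) by morph hc hx hy; fieldc.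
have e3 : phi (h3 M) = h1 M / (h1 M - 1) by morph hc hx hy; fieldc.
have e4 : phi (h4 M) = h2 M / (h2 M - 1) by morph hc hx hy; fieldc.
have e5 : phi (h5 M) = h5 M / (h5 M - 1) by morph hc hx hy; fieldc.
have e6 : phi (TT M) = - (TT M)^-1 by morph hc hx hy; fieldc.
have mt := meets_tilt vW cS; rewrite !hs_all e1 e2 e3 e4 e5 e6.
have e : meets W S (- (TT M)^-1) <-> meets W S (TT M).
  split=> [/(meets_opp vW cS)|h]; first by rewrite opprK => h; apply/meets_inv.
  by apply: (meets_opp vW cS); apply/meets_inv; rewrite invrK.
split=> -[q1 q2 q3 [q4 [q5 q6]]].
  by split; [apply/mt|apply/mt|apply/mt|split; [apply/mt|split; [apply/mt|apply/e]]].
move: q1 q2 q3 q4 q5 q6 => /mt q1 /mt q2 /mt q3 /mt q4 /mt q5 /e q6.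
by split.
Qed.

Lemma autX_id : autX (@idfun K).
Proof. by split=> //; exists idfun. Qed.

Lemma autX_comp (s t : {rmorphism K -> K}) : autX s -> autX t ->
  autX [the {rmorphism K -> K} of s \o t].
Proof.
move=> [s1 s2 s3] [t1 t2 t3]; split=> /=; first exact: bij_comp.
  by move=> c; rewrite t2 s2.
move=> O; rewrite -[X in _ <-> X]s3; exact: (t3 (fun z => O (s z))).
Qed.

Lemma autX_inv (s : {rmorphism K -> K}) : autX s ->
  exists t : {rmorphism K -> K}, [/\ autX t, cancel s t & cancel t s].
Proof.
move=> [s1 s2 s3]; have [t sK tK] := inv_rmorph s1; exists t; split=> //; split.
- by exists s.
- by move=> c; rewrite -{1}(s2 c) sK.
by move=> O; rewrite -(s3 (fun z => O (t z))); split; congr XX;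
  apply: eqset_eq => z; rewrite sK.
Qed.

Lemma samep_nz f g a b c d : a * d - b * c != 0 ->
  g * (cst c * f + cst d) = cst a * f + cst b -> cst c * f + cst d != 0.
Proof.
move=> det e; apply/eqP => z; rewrite z mulr0 in e.
have : cst (a * d - b * c) = 0.
  have -> : cst (a * d - b * c) = cst a * (cst c * f + cst d) - cst c * (cst a * f + cst b).
    by rewrite rmorphB !rmorphM; ring.
  by rewrite z -e !mulr0 subr0.
by apply/eqP; rewrite (fmorph_eq0 cst).
Qed.

Lemma samep_trans (f g h : K) : samep f g -> samep g h -> samep f h.
Proof.
move=> [a [b [c [d [det e]]]]] [a' [b' [c' [d' [det' e']]]]].
exists (a' * a + b' * c), (a' * b + b' * d), (c' * a + d' * c), (c' * b + d' * d); split.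
  have -> : (a' * a + b' * c) * (c' * b + d' * d) - (a' * b + b' * d) * (c' * a + d' * c) =
    (a * d - b * c) * (a' * d' - b' * c') by ring.
  by rewrite mulf_neq0.
have e2 : h * (cst c' * g + cst d') * (cst c * f + cst d) =
    (cst a' * g + cst b') * (cst c * f + cst d) by rewrite e'.
rewrite !rmorphD !rmorphM; move: (cst a) (cst b) (cst c) (cst d) e e2 => A B C D e e2.
have -> : h * ((cst c' * A + cst d' * C) * f + (cst c' * B + cst d' * D)) =
  h * (cst c' * (A * f + B) + cst d' * (C * f + D)) by ring.
rewrite -e; have -> : h * (cst c' * (g * (C * f + D)) + cst d' * (C * f + D)) =
  h * (cst c' * g + cst d') * (C * f + D) by ring.
rewrite e2; have -> : (cst a' * g + cst b') * (C * f + D) =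
   cst a' * (g * (C * f + D)) + cst b' * (C * f + D) by ring.
by rewrite e; ring.
Qed.

Lemma samep_sym (f g : K) : samep f g -> samep g f.
Proof.
move=> [a [b [c [d [det e]]]]]; exists (- d), b, c, (- a); split.
  by rewrite mulrNN mulrC.
rewrite !rmorphN; apply/eqP; rewrite -subr_eq0.
have -> : f * (cst c * g + - cst a) - (- cst d * g + cst b) =
   g * (cst c * f + cst d) - (cst a * f + cst b) by ring.
by rewrite e subrr.
Qed.

Lemma samep_refl (f : K) : samep f f.
Proof.
by exists 1, 0, 0, 1; rewrite !rmorph0 rmorph1 mul0r subr0 mulr1 oner_neq0 mul0r mul1r add0r addr0 mulr1.
Qed.

Lemma samep_morph (s : {rmorphism K -> K}) f g : (forall c, s (cst c) = cst c) ->
  samep f g -> samep (s f) (s g).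
Proof.
move=> hc [a [b [c [d [det e]]]]]; exists a, b, c, d; split=> //.
by have := congr1 s e; rewrite !(rmorphM, rmorphD) !hc.
Qed.

Lemma eqaut_samep (f g : K) : samep f g -> eqaut f g.
Proof. by move=> h; exists (@idfun K); split; [exact: autX_id|]. Qed.

Lemma eqaut_trans (f g h : K) : eqaut f g -> eqaut g h -> eqaut f h.
Proof.
move=> [s [hs1 h1]] [t [ht h2]]; exists [the {rmorphism K -> K} of t \o s].
split; first exact: autX_comp.
by have [_ hc _] := ht; apply: samep_trans (samep_morph hc h1) h2.
Qed.

Lemma eqaut_sym (f g : K) : eqaut f g -> eqaut g f.
Proof.
move=> [s [ss h]]; have [t [ht sK tK]] := autX_inv ss; exists t; split=> //.
by have [_ hc _] := ht; have := samep_sym (samep_morph hc h); rewrite sK.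
Qed.

End Automorphisms.

(** * The three conic bundles *)

(** A root of 1 plus the product of all X - a is not in s. This polynomial can be a nonzero constant
    only for empty s, where 0 will do. *)
Lemma fresh_elt (k : closedFieldType) (s : seq k) : exists b, b \notin s.
Proof.
pose p := \prod_(a <- s) ('X - a%:P) + 1 : {poly k}.
have [/closed_rootP [b rb]|/negPn /size_poly1P [c c0 e]] := boolP (size p != 1%N).
  exists b; apply/negP => hb; move: rb; rewrite /p rootE hornerD hornerC.
  have /eqP -> : (\prod_(a <- s) ('X - a%:P)).[b] == 0 by rewrite -rootE root_prod_XsubC.
  by rewrite add0r oner_eq0.
exists 0; apply/negP => h0; have : size (\prod_(a <- s) ('X - a%:P)) = (size s).+1 by rewrite size_prod_XsubC.
have -> : \prod_(a <- s) ('X - a%:P) = (c - 1)%:P by rewrite polyCB -e polyC1 /p addrK.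
have : (0 < size s)%N by rewrite lt0n size_eq0; apply: contraTneq h0 => ->.
by rewrite size_polyC; case: (_ != _) => // + [] => /[swap] <-.
Qed.

Section ConicBundles.
Variables (k : closedFieldType) (M : funfield k).
Local Notation K := (ff M).
Local Notation cst := (cst M).
Local Notation ev := (@ev k M).
Local Notation birat := (@birat k M).
Local Notation mx := (@mx k M).
Local Notation x := (@fx k M).
Local Notation y := (@fy k M).
Local Notation loc := (@loc k M).
Local Notation Wc := (@Wc k M).

Lemma vl_unit_neq0 (W : K -> Prop) z c : vl W z c -> W z^-1 -> z != 0 -> c != 0.
Proof.
move=> h hi z0; apply/eqP => c0; move: h; rewrite c0 => /vl0 h.
by move: z0; rewrite (mx_unitF h hi) eqxx.
Qed.

(** If f and y generate K, the curve f = t is rational with parameter y. On any other component of a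
    general fibre y would be constant, hence x too, which [generic_not_const] excludes. The equality
    of local rings exhibits a point of X on the curve. *)
Lemma cbundle_crit f (s0 : seq k) : (forall O, XX O -> regular_at O f) -> birat f y ->
  (forall W t b, lring W -> vl W f t -> vl W y b -> b != 0 -> exists a, vl W x a) ->
  (forall t, t \notin s0 -> exists a b, ~ affine_base a b /\
     loc (x - cst a) (y - cst b) = loc (f - cst t) (y - cst b)) ->
  cbundle f.
Proof.
move=> hreg bfy hx hpt; split=> //; have y0 : y != 0 := fy_neq0 M.
have [|s1 h1] := @generic_units k M f [:: y].
  by move=> g; rewrite inE => /eqP ->.
have [s2 h2] := generic_not_const f.
exists (s0 ++ s1 ++ s2) => t; rewrite !mem_cat !negb_or => /and3P[t0 t1 t2].
have [a [b [nb e]]] := hpt t t0.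
have bi : birat (f - cst t) (y - cst b) by apply/birat_subC/birat_subC2.
exists (Wc (f - cst t) (y - cst b) 'X_ord0); split.
- apply/curveP; exists (f - cst t), (y - cst b), 'X_ord0; split=> //.
  + by apply/XX_XL; apply: Or41; exists a, b; rewrite e.
  + exact: irr_X.
  by rewrite peX.
- exact: ratcurve_Wc.
- move=> W hW hm; have lW := curve_lring hW.
  have [wy wy'] : W y /\ W y^-1 by apply: (h1 t t1 W hW hm); rewrite inE eqxx.
  apply: Wc_param => //; first by apply: (lrB lW) => //; apply: lrC.
  move=> c hc; have hy : vl W y (c + b) by rewrite /vl rmorphD opprD addrA addrAC.
  have [a' ha'] := hx W t _ lW hm hy (vl_unit_neq0 hy wy' y0).
  exact: h2 t t2 W hW hm _ _ ha' hy.
move=> z; have := Wc_gen bi (@irr_X k) z; by rewrite evX.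
Qed.

Lemma cbundle_x : cbundle x.
Proof.
(* The line x = t is tested at its point (t, 0), which is a base point, namely Q2, only for t =
   1. *)
apply: (@cbundle_crit x [:: 1]).
- exact: regular_h1.
- exact: b_xy.
- by move=> W t b lW hf _ _; exists t.
move=> t; rewrite inE => /eqP t1; exists t, 0; split=> // -[[]//|[_]|[_]] /esym /eqP;
  by rewrite oner_eq0.
Qed.

Lemma vl_solve_x W f (e t b : k) : x = f * (y - 1) / y + cst e -> lring W -> vl W f t ->
  vl W y b -> b != 0 -> vl W x (t * (b - 1) / b + e).
Proof.
move=> xE lW hf hy b0; rewrite xE; apply: (vlD lW); last exact: vlC.
by eapply (vl_div lW); [vls lW|vls lW|].
Qed.

(** The value e = 0 gives B2 and e = 1 gives B3. The equation of a member is linear in x, so x is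
    recovered from f and y as soon as y is nonzero. *)
Lemma cbundle_g (e : k) : (forall O, XX O -> regular_at O ((x - cst e) * y / (y - 1))) ->
  cbundle ((x - cst e) * y / (y - 1)).
Proof.
set f := (x - _) * y / _ => hreg.
have y0 : y != 0 := fy_neq0 M; have y1 := nz_y1 M.
have xE : x = f * (y - 1) / y + cst e by rewrite /f; field; nzs.
have vx W t b : lring W -> vl W f t -> vl W y b -> b != 0 -> vl W x (t * (b - 1) / b + e).
  exact: vl_solve_x xE.
apply: (@cbundle_crit f [::]) => //.
- have b1 : birat y (x - cst e) by apply/birat_subC2/birat_swap/b_xy.
  have b2 : birat (y - 1) (y * (x - cst e)).
    by rewrite -(rmorph1 cst); apply/birat_subC/birat_mul.
  have b3 := birat_addC 1 (birat_div b2); rewrite rmorph1 subrK in b3.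
  by apply/birat_swap; apply: eq_birat b3 _ _ => //; rewrite /f; field; nzs.
- by move=> W t b lW hf hy b0; exists (t * (b - 1) / b + e); apply: vx.
move=> t _; have [b hb] : exists b : k, b \notin [:: 0; 1] by exact: fresh_elt.
have [b0 b1] : b != 0 /\ b != 1 by move: hb; rewrite !inE negb_or => /andP[].
exists (t * (b - 1) / b + e), b; split.
  by case=> -[_ /eqP]; rewrite ?(negPf b0) ?(negPf b1).
have bi : birat (x - cst (t * (b - 1) / b + e)) (y - cst b).
  by apply/birat_subC/birat_subC2/b_xy.
have bi' : birat (f - cst t) (y - cst b).
  apply/birat_subC/birat_subC2.
  have b1' : birat y (x - cst e) by apply/birat_subC2/birat_swap/b_xy.
  have b2 : birat (y - 1) (y * (x - cst e)).
    by rewrite -(rmorph1 cst); apply/birat_subC/birat_mul.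
  have b3 := birat_addC 1 (birat_div b2); rewrite rmorph1 subrK in b3.
  by apply/birat_swap; apply: eq_birat b3 _ _ => //; rewrite /f; field; nzs.
have l1 := loc_lring bi; have l2 := loc_lring bi'.
apply: (loc_eq bi bi'); try exact: mx_loc_v.
  have hx1 : vl (loc (x - cst (t * (b - 1) / b + e)) (y - cst b)) x (t * (b - 1) / b + e).
    exact: mx_loc_u.
  have hy1 : vl (loc (x - cst (t * (b - 1) / b + e)) (y - cst b)) y b by exact: mx_loc_v.
  have n1 : b - 1 != 0 by rewrite subr_eq0.
  have hx2 := vlB l1 hx1 (vlC l1 e); rewrite addrK in hx2.
  have h : vl (loc (x - cst (t * (b - 1) / b + e)) (y - cst b)) f (t * (b - 1) / b * b / (b - 1)).
    by apply: (vl_div l1 _ _ n1); [apply: vlM|apply: vlB => //; apply: vl1].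
  by rewrite divfK // mulfK // in h.
by apply: vx => //; [exact: mx_loc_u|exact: mx_loc_v].
Qed.

Lemma cbundle_g2 : cbundle (g2 M).
Proof.
have e : g2 M = (x - cst 0) * y / (y - 1) by rewrite rmorph0 subr0.
by rewrite e; apply: cbundle_g; rewrite -e; apply: regular_g2.
Qed.

Lemma cbundle_g3 : cbundle (g3 M).
Proof.
have e : g3 M = (x - cst 1) * y / (y - 1) by rewrite rmorph1.
by rewrite e; apply: cbundle_g; rewrite -e; apply: regular_g3.
Qed.
End ConicBundles.

(** * Multiplicities of points of the members *)

Lemma size_X_mul_XaddC (k : fieldType) (c : k) :
  'X * ('X + c%:P) != 0 /\ size ('X * ('X + c%:P)) = 3%N.
Proof.
have m : 'X + c%:P \is monic by rewrite -[c]opprK polyCN monicXsubC.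
by rewrite mulf_neq0 ?polyX_eq0 ?monic_neq0 // mulrC size_mulX ?monic_neq0 // size_XaddC.
Qed.

Section Orders.
Variables (k : closedFieldType) (M : funfield k).
Local Notation K := (ff M).
Local Notation cst := (cst M).
Local Notation ev := (@ev k M).
Local Notation birat := (@birat k M).
Local Notation mx := (@mx k M).
Local Notation x := (@fx k M).
Local Notation y := (@fy k M).
Local Notation loc := (@loc k M).
Local Notation A2 := {mpoly k[2]}.

(* pw O n is the n-th power of the maximal ideal of O *)
Inductive pw (O : K -> Prop) : nat -> K -> Prop :=
| Pw0 z : O z -> pw O 0 z
| PwS n a b : mx O a -> pw O n b -> pw O n.+1 (a * b)
| PwD n a b : pw O n a -> pw O n b -> pw O n (a + b).

Lemma pw_in O n z : lring O -> pw O n z -> O z.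
Proof.
move=> lO; elim=> [//|{}n a b ha _ hb|{}n a b _ ha _ hb]; last exact: (lrD lO).
by apply: (lrM lO) => //; apply: mx_in.
Qed.

Lemma pw_mx O n z : lring O -> pw O n.+1 z -> mx O z.
Proof.
move=> lO; move e: n.+1 => m h; elim: h n e => [//|{}m a b ha hb _ n _|{}m a b _ ha _ hb n e].
  by apply: (mxMr lO) => //; apply: pw_in hb.
by apply: (mxD lO); [apply: ha e|apply: hb e].
Qed.

Lemma pwM O n a z : lring O -> O a -> pw O n z -> pw O n (a * z).
Proof.
move=> lO ha; elim=> [w hw|{}n b w hb hw ih|{}n w w' _ ih _ ih'].
- by apply: Pw0; apply: (lrM lO).
- by rewrite mulrA; apply: PwS => //; apply: mxMl.
by rewrite mulrDr; apply: PwD.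
Qed.

Lemma pw_zero O n : lring O -> pw O n 0.
Proof.
move=> lO; elim: n => [|n ih]; first by apply: Pw0; apply: lr0.
by rewrite -(mulr0 0); apply: PwS => //; apply: mx0.
Qed.

Lemma pw_comp (s : {rmorphism K -> K}) O n z : pw (fun w => O (s w)) n z -> pw O n (s z).
Proof.
elim=> [w hw|{}n a b [ha ha'] _ ih|{}n a b _ ha _ hb]; first exact: Pw0.
  rewrite rmorphM; apply: PwS => //; split=> // h; apply/eqP.
  by rewrite fmorph_eq0; apply/eqP/ha'; rewrite fmorphV.
by rewrite rmorphD; apply: PwD.
Qed.

(* some member of the pencil f vanishes to order n at O *)
Definition deep (O : K -> Prop) n f := (exists c, pw O n (f - cst c)) \/ pw O n f^-1.

Lemma deep_samep1 O n f g e : lring O -> samep f g -> pw O n.+1 (f - cst e) -> deep O n.+1 g.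
Proof.
move=> lO [a [b [c [d [det eg]]]]] h; have den := samep_nz det eg.
have hf : vl O f e := pw_mx lO h.
have gE : g = (cst a * f + cst b) / (cst c * f + cst d) by rewrite -eg mulfK.
have hn : vl O (cst a * f + cst b) (a * e + b) by apply: (vlD lO); [apply: vlM => //|]; apply: vlC.
have hd : vl O (cst c * f + cst d) (c * e + d) by apply: (vlD lO); [apply: vlM => //|]; apply: vlC.
have [z|nz] := eqVneq (c * e + d) 0; [right|left].
  have n0 : a * e + b != 0.
    apply: contra_neq det => z'; transitivity (a * (c * e + d) - c * (a * e + b)); first by ring.
    by rewrite z z' !mulr0 subr0.
  have -> : g^-1 = (cst a * f + cst b)^-1 * cst c * (f - cst e).
    rewrite gE invf_div mulrC -mulrA; congr (_ * _).
    by rewrite mulrBr -rmorphM (_ : c * e = - d) ?rmorphN ?opprK //; apply/eqP; rewrite -addr_eq0 z.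
  apply: pwM => //; apply: (lrM lO); [exact: vl_inv hn n0|exact: lrC].
exists ((a * e + b) / (c * e + d)).
have cn : cst (c * e + d) != 0 by rewrite (fmorph_eq0 cst).
have -> : g - cst ((a * e + b) / (c * e + d)) =
   cst (a * d - b * c) * (cst c * f + cst d)^-1 * cst (c * e + d)^-1 * (f - cst e).
  move: cn den; rewrite gE fmorph_div fmorphV !(rmorphD, rmorphN, rmorphM) => cn den.
  by field; rewrite cn den.
apply: pwM => //; apply: (lrM lO); last exact: lrC.
by apply: (lrM lO); [exact: lrC|exact: vl_inv hd nz].
Qed.

Lemma samep_inv (f : K) : f != 0 -> samep f^-1 f.
Proof.
move=> f0; exists 0, 1, 1, 0; rewrite !rmorph0 !rmorph1 mul0r mul1r sub0r oppr_eq0 oner_neq0.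
by rewrite addr0 mul1r mul0r add0r divff.
Qed.

Lemma deep_samep O n f g : lring O -> samep f g -> deep O n.+1 f -> deep O n.+1 g.
Proof.
move=> lO s [[e h]|h]; first exact: deep_samep1 lO s h.
have [f0|f0] := eqVneq f 0.
  by apply: (@deep_samep1 O n f g 0 lO s); rewrite rmorph0 subr0 f0 -invr0 -f0.
apply: (@deep_samep1 O n f^-1 g 0 lO); last by rewrite rmorph0 subr0.
exact: samep_trans (samep_inv f0) s.
Qed.

Lemma deep_eqaut n f g : eqaut f g -> (exists2 O, XX O & deep O n.+1 f) ->
  exists2 O, XX O & deep O n.+1 g.
Proof.
move=> [s [hs h]] [O hO hd]; have [t [ht sK tK]] := autX_inv hs; have [_ hc _] := hs.
have [_ _ ht'] := ht; have hO' := (ht' O).2 hO; exists (fun z => O (t z)) => //.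
apply: (deep_samep (XX_lring hO') h); have e : O = (fun z => O (t (s z))).
  by apply: eqset_eq => z; rewrite sK.
move: hd; rewrite {1}/deep {1 2}e => -[[c hp]|hp]; [left|right].
  by exists c; have := @pw_comp s (fun z => O (t z)) _ _ hp; rewrite rmorphB hc.
by have := @pw_comp s (fun z => O (t z)) _ _ hp; rewrite fmorphV.
Qed.

Section Line.
Variables (u v : K) (lam : {rmorphism A2 -> {poly k}}).
Hypotheses (b : birat u v) (lam0 : forall P, (lam P)`_0 = pe 0 0 P).

Lemma lam_ndvd Q : pe 0 0 Q != 0 -> coprimep 'X (lam Q).
Proof.
have := coprimep_XsubC (lam Q) 0; rewrite polyC0 subr0 coprimep_sym => ->.
by rewrite rootE horner_coef0 lam0.
Qed.

Lemma lam_dvd P : pe 0 0 P = 0 -> 'X %| lam P.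
Proof.
by move=> h; have := dvdp_XsubCl (lam P) 0; rewrite polyC0 subr0 rootE horner_coef0 lam0 h eqxx.
Qed.

(** The map [lam] restricts functions to a parametrized curve through the point, at parameter 0; the
    n-th power of the maximal ideal then goes to multiples of X^n. *)
Lemma pw_line n A B : pe 0 0 B != 0 -> pw (loc u v) n (ev u v A / ev u v B) -> 'X^n %| lam A.
Proof.
move=> B0; move e: (_ / _) => z h.
have [P [Q [Q0 e' hP]]] : exists P Q : A2, [/\ pe 0 0 Q != 0, z = ev u v P / ev u v Q & 'X^n %| lam P].
  elim: h {e} => [w [P [Q [Q0 ew]]]|m a c ha _ [P [Q [Q0 ew hP]]]|
      m a c _ [P [Q [Q0 ew hP]]] _ [P' [Q' [Q0' ew' hP']]]].
  - by exists P, Q; split=> //; rewrite expr0 dvd1p.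
  - have [P' [Q' [Q0' ea]]] := mx_in ha; exists (P' * P), (Q' * Q); split.
    + by rewrite rmorphM mulf_neq0.
    + by rewrite ea ew mulf_div !rmorphM.
    rewrite rmorphM exprS dvdp_mul // lam_dvd //.
    by apply/(mx_loc_frac b P' Q0'); rewrite -ea.
  exists (P * Q' + P' * Q), (Q * Q'); split.
  - by rewrite rmorphM mulf_neq0.
  - by rewrite ew ew' addf_div ?(ev_inj_neq0 (birat_inj b)) ?(pe_neq0 Q0) ?(pe_neq0 Q0') // rmorphD !rmorphM.
  by rewrite rmorphD !rmorphM dvdp_addr // dvdp_mulr.
move: e; rewrite e' => /eqP; rewrite eqr_div ?(ev_inj_neq0 (birat_inj b)) ?(pe_neq0 Q0) ?(pe_neq0 B0) //.
rewrite -!rmorphM => /eqP/(birat_inj b) e2.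
have : 'X^n %| lam A * lam Q by rewrite -rmorphM e2 rmorphM dvdp_mulr.
by rewrite mulrC Gauss_dvdpr // coprimep_expl // lam_ndvd.
Qed.
End Line.

(** Restriction to the diagonal, where a monomial p^i q^j becomes X^(i+j) and so shows its total
    order. *)
Definition dg : {rmorphism A2 -> {poly k}} := mev (@polyC k) 'X 'X.
Lemma dg_X : dg 'X_ord0 = 'X. Proof. exact: mevX. Qed.
Lemma dg_Y : dg 'X_ord_max = 'X. Proof. exact: mevY. Qed.
Lemma dg_C c : dg c%:MP = c%:P. Proof. exact: mevC. Qed.
Opaque dg.
Lemma dg0 P : (dg P)`_0 = pe 0 0 P.
Proof.
rewrite -horner_coef0; pose f := [the {rmorphism _ -> _} of horner_eval (0 : k) \o dg].
apply: (@mpoly2_ext k k f (pe 0 0)) => [c||] /=; rewrite /horner_eval.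
- by rewrite dg_C hornerC peC.
- by rewrite dg_X hornerX peX.
by rewrite dg_Y hornerX peY.
Qed.

Lemma rX0 (P : A2) : (rX P)`_0 = pe 0 0 P.
Proof. by rewrite -horner_coef0 rX_horner. Qed.

Definition shallow (O : K -> Prop) n f := ~ deep O n f.

Lemma shallow_val p q n f a : birat p q -> vl (loc p q) f a -> ~ pw (loc p q) n.+1 (f - cst a) ->
  shallow (loc p q) n.+1 f.
Proof.
move=> b ha hn; have lO := loc_lring b; case=> [[c hp]|hp].
  have hc : vl (loc p q) f c := pw_mx lO hp.
  by apply: hn; rewrite (vl_uniq lO ha hc).
have f0 : f^-1 = 0.
  by apply: (mx_unitF (pw_mx lO hp)); rewrite invrK; apply: vl_in ha.
have {}f0 : f = 0 by rewrite -[f]invrK f0 invr0.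
apply: hn; have -> : a = 0.
  by apply: (vl_uniq lO ha); rewrite f0; apply/vl0/mx0.
by rewrite f0 rmorph0 subr0; apply: pw_zero.
Qed.

Lemma shallow_inv p q n f : birat p q -> shallow (loc p q) n.+1 f^-1 -> shallow (loc p q) n.+1 f.
Proof.
move=> b h hd; apply: h; have [f0|f0] := eqVneq f 0; first by rewrite f0 invr0 -f0.
apply: deep_samep hd; first exact: loc_lring.
by have := samep_inv (_ : f^-1 != 0); rewrite invrK; apply; rewrite invr_eq0.
Qed.

Lemma npw_mono p q n z e i j : birat p q -> unitv (loc p q) e -> z = e * (p ^+ i * q ^+ j) ->
  (i + j < n)%N -> ~ pw (loc p q) n z.
Proof.
move=> b [c c0 he] ez hij h; have [P [Q [Q0 ee]]] := vl_in (loc_lring b) he.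
have P0 : pe 0 0 P != 0.
  apply: contraNneq c0 => P0; apply/eqP; apply: (vl_uniq (loc_lring b) he); apply/vl0.
  by rewrite ee; apply/mx_loc_frac.
have := @pw_line p q dg b dg0 n (P * ('X_ord0 ^+ i * 'X_ord_max ^+ j)) Q Q0.
rewrite !rmorphM !rmorphXn evX evY mulrAC -ee -ez => /(_ h).
rewrite dg_X dg_Y -exprD Gauss_dvdpr; last first.
  by apply: coprimep_expl; apply: lam_ndvd => //; exact: dg0.
move=> /(dvdp_leq (monic_neq0 (monicXn _ _))).
rewrite !size_polyXn ltnS leqNgt; by move/negP; apply.
Qed.

Lemma npw_rX p q n A B m r : birat p q -> pe 0 0 B != 0 -> rX A = r * 'X^m -> r`_0 != 0 ->
  (m < n)%N -> ~ pw (loc p q) n (ev p q A / ev p q B).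
Proof.
move=> b B0 eA r0 hm /(@pw_line p q rX b rX0 n A B B0).
rewrite eA Gauss_dvdpr; last first.
  apply: coprimep_expl; have := coprimep_XsubC r 0; rewrite polyC0 subr0 coprimep_sym => ->.
  by rewrite rootE horner_coef0.
move=> /(dvdp_leq (monic_neq0 (monicXn _ _))).
by rewrite !size_polyXn ltnS leqNgt => /negP; apply.
Qed.

Section Mono.
Variables (p q f e : K) (n i j : nat).
Hypotheses (b : birat p q) (ue : unitv (loc p q) e) (hij : (0 < i + j < n.+1)%N).

Lemma mono_vl z a : z - cst a = e * (p ^+ i * q ^+ j) -> vl (loc p q) z a.
Proof.
move=> h; rewrite /vl h; have lO := loc_lring b; have [c _ /(vl_in lO) he] := ue.
have hp := mx_in (mx_loc_u b); have hq := mx_in (mx_loc_v b).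
apply: (mxMl lO) => //; case: i hij => [|i'] /=; last first.
  by rewrite exprS -mulrA => _; apply: (mxMr lO); [exact: mx_loc_u|apply: (lrM lO); apply: lrX].
case: j => [//|j'] _; rewrite expr0 mul1r exprS; apply: (mxMr lO); first exact: mx_loc_v.
exact: lrX.
Qed.

Lemma shallow_mono a : f - cst a = e * (p ^+ i * q ^+ j) -> shallow (loc p q) n.+1 f.
Proof.
move=> h; have /andP[_ h2] := hij; apply: (shallow_val b (mono_vl h)); exact: npw_mono b ue h h2.
Qed.

Lemma shallow_mono0 : f = e * (p ^+ i * q ^+ j) -> shallow (loc p q) n.+1 f.
Proof. by move=> h; apply: (@shallow_mono 0); rewrite rmorph0 subr0. Qed.
Lemma shallow_mono1 : f - 1 = e * (p ^+ i * q ^+ j) -> shallow (loc p q) n.+1 f.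
Proof. by move=> h; apply: (@shallow_mono 1); rewrite rmorph1. Qed.
End Mono.

Lemma shallow_mono_inv p q f e n i j : birat p q -> unitv (loc p q) e -> (0 < i + j < n.+1)%N ->
  f^-1 = e * (p ^+ i * q ^+ j) -> shallow (loc p q) n.+1 f.
Proof. by move=> b ue hij h; apply: shallow_inv => //; apply: shallow_mono0 h. Qed.

Lemma shallow_mono_invC p q f e n i j a : birat p q -> unitv (loc p q) e -> (0 < i + j < n.+1)%N ->
  f^-1 - cst a = e * (p ^+ i * q ^+ j) -> shallow (loc p q) n.+1 f.
Proof. by move=> b ue hij h; apply: shallow_inv => //; apply: shallow_mono h. Qed.

(** The charts rewritten so that u and v are monomials in the parameters p, q and in w = q + c;
    multiplicities can then be read off after substitution. *)
Lemma chartII_ind u v (P : (K -> Prop) -> Prop) : birat u v ->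
  (forall p q, birat p q -> vl (loc p q) p 0 -> vl (loc p q) q 0 ->
     u = p * q -> v = p -> P (loc p q)) ->
  (forall p q w c, birat p q -> vl (loc p q) p 0 -> vl (loc p q) q 0 -> c != 0 ->
     vl (loc p q) w c -> w - cst c = q -> w != 0 -> u = p -> v = p * w -> P (loc p q)) ->
  (forall p q w c, birat p q -> vl (loc p q) p 0 -> vl (loc p q) q 0 ->
     vl (loc p q) w c -> w - cst c = q -> w != 0 -> u = p -> v = p ^+ 2 * w -> P (loc p q)) ->
  (forall p q, birat p q -> vl (loc p q) p 0 -> vl (loc p q) q 0 ->
     u = p * q -> v = p ^+ 2 * q -> P (loc p q)) ->
  forall O, chartII u v O -> P O.
Proof.
move=> b p1 p2 p3 p4 O h; have [u0 v0] := birat_neq0 b; have bc p hp := @coordsII_birat k M u v p b hp.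
have vu p q : birat p q -> vl (loc p q) p 0 by move=> ?; apply/vl0/mx_loc_u.
have vv p q : birat p q -> vl (loc p q) q 0 by move=> ?; apply/vl0/mx_loc_v.
case: h => [->|[c c0 ->]|[c ->]|->].
- have bi : birat v (u / v) by apply: (bc (v, u / v)); rewrite inE eqxx.
  apply: p1 => //; [exact: vu|exact: vv|by rewrite [RHS]mulrC divfK].
- have bi : birat u (v / u - cst c) by apply/birat_subC2/birat_div.
  apply: (p2 u _ (v / u) c) => //; [exact: vu|exact: vv|exact: mx_loc_v| |].
    by rewrite mulf_neq0 ?invr_eq0.
  by rewrite [RHS]mulrC divfK.
- have bi : birat u (v / u ^+ 2 - cst c).
    by apply/birat_subC2; apply: (bc (u, v / u ^+ 2)); rewrite !inE eqxx !orbT.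
  apply: (p3 u _ (v / u ^+ 2) c) => //; [exact: vu|exact: vv|exact: mx_loc_v| |].
    by rewrite mulf_neq0 ?invr_eq0 ?expf_neq0.
  by rewrite [RHS]mulrC divfK ?expf_neq0.
have bi : birat (v / u) (u ^+ 2 / v).
  by apply: (bc (v / u, u ^+ 2 / v)); rewrite !inE eqxx !orbT.
by apply: p4 => //; [exact: vu|exact: vv|field; nzs|field; nzs].
Qed.

Lemma typeII_cases (P : K -> K -> Prop) :
  (forall u v, birat u v -> x = u / v -> y = 1 / v -> P u v) ->
  (forall u v, birat u v -> x = 1 + v - u -> y = u -> P u v) ->
  (forall u v, birat u v -> x = 1 / u -> y = v / u -> P u v) ->
  (forall u v, birat u v -> x = v -> y = 1 - u -> P u v) ->
  forall u v, typeII u v -> P u v.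
Proof.
have x0' : x != 0 := fx_neq0 M; have y0' : y != 0 := fy_neq0 M.
move=> p1 p2 p3 p4 u v t; have b := typeII_birat t; case: t b => b.
- by apply: p1 => //; field; nzs.
- by apply: p2 => //; ring.
- by apply: p3 => //; field; nzs.
by apply: p4 => //; ring.
Qed.

Ltac nzh := rewrite ?(mulf_eq0, invr_eq0, oppr_eq0, negb_or); repeat (apply/andP; split);
  first [assumption | match goal with |- is_true (?A != 0) =>
  first [ exact: oner_neq0 | (have -> : A = 1 by ring); exact: oner_neq0
        | (have -> : A = - 1 by ring); rewrite oppr_eq0; exact: oner_neq0 ] end].
Ltac unith lO := eapply unitvI; [vls lO; nzh | nzh].
Ltac charts b := let p := fresh "p" in let q := fresh "q" in let w := fresh "w" in
  let c := fresh "c" in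
  apply: (chartII_ind b) =>
  [p q bpq hp hq eu ev|p q w c bpq hp hq c0 hw ew w0 eu ev
  |p q w c bpq hp hq hw ew w0 eu ev|p q bpq hp hq eu ev];
  have lO := loc_lring bpq; have [p0 q0] := birat_neq0 bpq.
Ltac fz eu ev := match goal with ex : fx = _, ey : fy = _ |- _ =>
  rewrite ?ex ?ey ?eu ?ev; field; nzs end.
Ltac sm lO eu ev L e i j := eapply (L _ _ _ e _ i j); [eassumption | unith lO | done | fz eu ev].

(** At every point the member through it is, up to a unit, a monomial p^i q^j of total degree at
    most 3. *)
Lemma shallow_x O : XX O -> shallow O 4 x.
Proof.
have x0' : x != 0 := fx_neq0 M; have y0' : y != 0 := fy_neq0 M.
move=> /XX_XL [[a [b [_ ->]]]|[c c0 ->]|[u [v [t h]]]|h].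
- have bi : birat (x - cst a) (y - cst b) by apply/birat_subC/birat_subC2/b_xy.
  apply: (@shallow_mono _ _ x 1 3 1 0 bi (unitv1 (loc_lring bi)) isT a).
  by rewrite expr1 expr0 mulr1 mul1r.
- have bi : birat (1 / y) (x / y - cst c) by apply/birat_subC2/birat_1y.
  have lO := loc_lring bi; have hw : vl (loc (1 / y) (x / y - cst c)) (x / y) c by exact: mx_loc_v.
  apply: (@shallow_mono_inv _ _ x (x / y)^-1 3 1 0 bi _ isT).
    by exists c^-1; [rewrite invr_eq0|apply: vlV].
  by field; nzs.
- move: u v t O h; apply: typeII_cases => u v b ex ey; have [u0 v0] := birat_neq0 b; charts b.
  + by sm lO eu ev (@shallow_mono0) (1 : K) 0%N 1%N.
  + by apply: (@shallow_mono_invC _ _ x 1 3 0 1 c bpq (unitv1 lO) isT); rewrite -ew ex ev eu; field; nzs.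
  + have [c0|c0] := eqVneq c 0.
      rewrite c0 rmorph0 subr0 in ew; rewrite ew in ev.
      by sm lO eu ev (@shallow_mono_inv) (1 : K) 1%N 1%N.
    by sm lO eu ev (@shallow_mono_inv) w 1%N 0%N.
  + by sm lO eu ev (@shallow_mono_inv) (1 : K) 1%N 0%N.
  + by sm lO eu ev (@shallow_mono1) (1 - q) 1%N 0%N.
  + have [c1|c1] := eqVneq c 1.
      rewrite c1 rmorph1 in ew; have ew' : w = q + 1 by rewrite -ew subrK.
      rewrite ew' in ev w0.
      by sm lO eu ev (@shallow_mono1) (1 : K) 1%N 1%N.
    have c1' : c - 1 != 0 by rewrite subr_eq0.
    by sm lO eu ev (@shallow_mono1) (w - 1) 1%N 0%N.
  + by sm lO eu ev (@shallow_mono1) (p * w - 1) 1%N 0%N.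
  + by sm lO eu ev (@shallow_mono1) (p - 1) 1%N 1%N.
  + by sm lO eu ev (@shallow_mono_inv) (1 : K) 1%N 1%N.
  + by sm lO eu ev (@shallow_mono_inv) (1 : K) 1%N 0%N.
  + by sm lO eu ev (@shallow_mono_inv) (1 : K) 1%N 0%N.
  + by sm lO eu ev (@shallow_mono_inv) (1 : K) 1%N 1%N.
  + by sm lO eu ev (@shallow_mono0) (1 : K) 1%N 0%N.
  + by sm lO eu ev (@shallow_mono0) w 1%N 0%N.
  + have [c0|c0] := eqVneq c 0.
      rewrite c0 rmorph0 subr0 in ew; rewrite ew in ev.
      by sm lO eu ev (@shallow_mono0) (1 : K) 2%N 1%N.
    by sm lO eu ev (@shallow_mono0) w 2%N 0%N.
  by sm lO eu ev (@shallow_mono0) (1 : K) 2%N 1%N.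
have b := typeI_birat M; have [u0 v0] := birat_neq0 b.
case: h => [->|[c ->]].
  have bi : birat (1 - y) ((1 - x) / (1 - y)) by apply/birat_div/birat_swap.
  have lO := loc_lring bi.
  eapply (@shallow_mono1 _ _ x (-1) 3 1 1 bi); [|by []|by field; nzs].
  by exists (-1); [rewrite oppr_eq0 oner_neq0|apply: vlN => //; apply: vl1].
have bi : birat (1 - x) ((1 - y) / (1 - x) - cst c) by apply/birat_subC2/birat_div.
have lO := loc_lring bi.
eapply (@shallow_mono1 _ _ x (-1) 3 1 0 bi); [|by []|by rewrite expr1 expr0; ring].
by exists (-1); [rewrite oppr_eq0 oner_neq0|apply: vlN => //; apply: vl1].
Qed.

Lemma npw_ev p q n f a A B r : birat p q -> pe 0 0 B != 0 -> f - cst a = ev p q A / ev p q B ->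
  rX A = r * 'X -> r`_0 != 0 -> vl (loc p q) f a -> shallow (loc p q) n.+2 f.
Proof.
move=> b B0 ef eA r0 hf; apply: (shallow_val b hf); rewrite ef.
by apply: (@npw_rX p q n.+2 A B 1 r) => //; rewrite expr1.
Qed.

Lemma pe_neg1 c : pe 0 0 ('X_ord0 * ('X_ord_max + c%:MP) - 1 : A2) != 0.
Proof. by rewrite rmorphB rmorphM rmorph1 peX mul0r sub0r oppr_eq0 oner_neq0. Qed.

Ltac nzu lO E := have ? : E != 0 by eapply (vl_neq0 lO); [vls lO; nzh | nzh].

(** Some members are not monomials in the parameters; there the multiplicity is bounded by
    restricting the equation to the diagonal in the affine plane, or to p = 0 over base points
    ([npw_ev]). *)
Lemma shallow_g2 O : XX O -> shallow O 3 (g2 M).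
Proof.
have x0' : x != 0 := fx_neq0 M; have y0' : y != 0 := fy_neq0 M; have y1' := nz_y1 M.
have pe1 : pe 0 0 (1 : A2) != 0 by rewrite rmorph1 oner_neq0.
move=> /XX_XL [[a [b [nb ->]]]|[c c0 ->]|[u [v [t h]]]|h].
- have bi : birat (x - cst a) (y - cst b) by apply/birat_subC/birat_subC2/b_xy.
  have lO := loc_lring bi.
  have hu : vl (loc (x - cst a) (y - cst b)) x a by exact: mx_loc_u.
  have hv : vl (loc (x - cst a) (y - cst b)) y b by exact: mx_loc_v.
  have [b1|b1] := eqVneq b 1.
    have a0 : a != 0 by apply/eqP => a0; apply: nb; apply: Or32.
    rewrite b1 in bi lO hu hv *.
    apply: (@shallow_mono_inv _ _ (g2 M) (x * y)^-1 2 0 1 bi _ isT).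
      by exists (a * 1)^-1; [rewrite mulr1 invr_eq0|apply: (vlV lO); rewrite ?mulr1 // -[a in vl _ _ a]mulr1;
        apply: (vlM lO)].
    by rewrite /g2 rmorph1; field; nzs.
  have n1 : b - 1 != 0 by rewrite subr_eq0.
  pose t := a * b / (b - 1).
  have hf : vl (loc (x - cst a) (y - cst b)) (g2 M) t.
    apply: (vl_div lO _ _ n1); first exact: vlM.
    by apply: (vlB lO) => //; apply: vl1.
  apply: (shallow_val bi hf).
  have [s es] : exists s, s = a - t by exists (a - t).
  have [d ed] : exists d, d = b - 1 by exists (b - 1).
  (* The numerator of [g2] minus its value, in coordinates centred at (a, b), with s = a - t. On the
     diagonal it becomes X (X + b + s), of degree 2 and so not a multiple of X^3. *)
  pose A : A2 := 'X_ord0 * 'X_ord_max + b%:MP * 'X_ord0 + s%:MP * 'X_ord_max.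
  pose B : A2 := 'X_ord_max + d%:MP.
  have -> : g2 M - cst t = ev (x - cst a) (y - cst b) A / ev (x - cst a) (y - cst b) B.
    rewrite /A /B !rmorphD !rmorphM !evC !evX !evY /g2.
    have -> : y - cst b + cst d = y - 1 by rewrite ed rmorphB rmorph1; ring.
    have et : cst t = cst a * cst b / (cst b - 1) by rewrite fmorph_div rmorphM rmorphB rmorph1.
    rewrite es rmorphB et.
    have n1' : cst b - 1 != 0 by rewrite -(rmorph1 cst) -rmorphB (fmorph_eq0 cst).
    by field; nzs.
  move=> /(@pw_line _ _ dg bi dg0 3 A B) hd.
  have {}hd : 'X^3 %| 'X * ('X + (b + s)%:P).
    have -> : 'X * ('X + (b + s)%:P) = dg A.
      rewrite polyCD /A !(rmorphD dg) !(rmorphM dg) dg_X dg_Y !dg_C.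
      by move: b%:P s%:P => r r'; ring.
    by apply: hd; rewrite /B rmorphD peY peC add0r ed.
  have m := size_X_mul_XaddC (b + s).
  by have := dvdp_leq m.1 hd; rewrite m.2 size_polyXn.
- have bi : birat (1 / y) (x / y - cst c) by apply/birat_subC2/birat_1y.
  have lO := loc_lring bi; have hw : vl (loc (1 / y) (x / y - cst c)) (x / y) c by exact: mx_loc_v.
  have hu : vl (loc (1 / y) (x / y - cst c)) (1 / y) 0 by apply/vl0/mx_loc_u.
  apply: (@shallow_mono_inv _ _ (g2 M) ((1 - 1 / y) / (x / y)) 2 1 0 bi _ isT).
    exists ((1 - 0) / c); first by rewrite subr0 mulf_neq0 ?invr_eq0 ?oner_neq0.
    by apply: (vl_div lO) => //; apply: (vlB lO) => //; apply: vl1.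
  by rewrite /g2; field; nzs.
- move: u v t O h; apply: typeII_cases => u v b ex ey; have [u0 v0] := birat_neq0 b;
    rewrite /g2; charts b.
  + nzu lO (1 - p).
    by sm lO eu ev (@shallow_mono0) (1 / (1 - p)) 0%N 1%N.
  + nzu lO (1 - p * w); apply: (shallow_inv bpq).
    have ef : (x * y / (y - 1))^-1 = w * (1 - p * w) by fz eu ev.
    have hf : vl (loc p q) (w * (1 - p * w)) c.
      by have := vlM lO hw (vlB lO (vl1 lO) (vlM lO hp hw)); rewrite mul0r subr0 mulr1.
    apply: (@npw_ev p q 1 _ c ('X_ord_max - 'X_ord0 * ('X_ord_max + c%:MP) ^+ 2) 1 1) => //.
    * rewrite ef rmorph1 divr1 rmorphB rmorphM rmorphXn rmorphD evX evY evC -ew; ring.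
    * by rewrite rmorphB rmorphM rX_X rX_Y mul0r subr0 mul1r.
    * by rewrite coef1 oner_neq0.
    by rewrite ef.
  + nzu lO (1 - p ^+ 2 * w); have [c0|c0] := eqVneq c 0.
      rewrite c0 rmorph0 subr0 in ew; rewrite ew in ev.
      nzu lO (1 - p ^+ 2 * q).
      by sm lO eu ev (@shallow_mono_inv) (1 - p ^+ 2 * q) 1%N 1%N.
    by sm lO eu ev (@shallow_mono_inv) (w * (1 - p ^+ 2 * w)) 1%N 0%N.
  + nzu lO (1 - p ^+ 2 * q).
    by sm lO eu ev (@shallow_mono_inv) (1 - p ^+ 2 * q) 1%N 0%N.
  + nzu lO (p * q - 1).
    by sm lO eu ev (@shallow_mono0) ((1 + p - p * q) / (p * q - 1)) 1%N 1%N.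
  + nzu lO (p - 1).
    by sm lO eu ev (@shallow_mono0) ((1 + p * w - p) / (p - 1)) 1%N 0%N.
  + nzu lO (p - 1).
    by sm lO eu ev (@shallow_mono0) ((1 + p ^+ 2 * w - p) / (p - 1)) 1%N 0%N.
  + nzu lO (p * q - 1).
    by sm lO eu ev (@shallow_mono0) ((1 + p ^+ 2 * q - p * q) / (p * q - 1)) 1%N 1%N.
  + nzu lO (1 - q).
    by sm lO eu ev (@shallow_mono_inv) (1 - q) 1%N 1%N.
  + have wu : w - 1 != 0.
      by move: y1'; rewrite ey ev eu; apply: contraNneq => /eqP; rewrite subr_eq0 => /eqP ->;
        rewrite mulr1 divff ?subrr.
    have [c1|c1] := eqVneq c 1.
      rewrite c1 rmorph1 in ew; have ew' : w = q + 1 by rewrite -ew subrK.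
      rewrite ew' in ev w0 wu.
      by sm lO eu ev (@shallow_mono_inv) (1 / (q + 1)) 1%N 1%N.
    have c1' : c - 1 != 0 by rewrite subr_eq0.
    by sm lO eu ev (@shallow_mono_inv) ((w - 1) / w) 1%N 0%N.
  + nzu lO (p * w - 1).
    have ef : x * y / (y - 1) = w / (p * w - 1) by fz eu ev.
    have hf : vl (loc p q) (w / (p * w - 1)) (- c).
      have := vl_div lO hw (vlB lO (vlM lO hp hw) (vl1 lO)).
      by rewrite mul0r sub0r oppr_eq0 oner_neq0 invrN1 mulrN1; apply.
    apply: (@npw_ev p q 1 _ (- c) ('X_ord_max + c%:MP * 'X_ord0 * ('X_ord_max + c%:MP))
      ('X_ord0 * ('X_ord_max + c%:MP) - 1) 1) => //.
    * exact: pe_neg1.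
    * rewrite ef !(rmorphB, rmorphD, rmorphM, rmorphN, rmorph1) evX evY evC -ew subrK opprK.
      by move: (cst c) => C; field; nzs.
    * by rewrite rmorphD !rmorphM rX_X rX_Y mulr0 mul0r addr0 mul1r.
    * by rewrite coef1 oner_neq0.
    by rewrite ef.
  + nzu lO (p - 1).
    by sm lO eu ev (@shallow_mono_inv) (p - 1) 0%N 1%N.
  + nzu lO (1 - p * q); have pq0 : p * q != 0 by rewrite mulf_neq0.
    by sm lO eu ev (@shallow_mono_inv) (-1 / (1 - p * q)) 0%N 1%N.
  + nzu lO (1 - p).
    have ef : x * y / (y - 1) = - (w * (1 - p)) by fz eu ev.
    have hf : vl (loc p q) (- (w * (1 - p))) (- c).
      by have := vlN lO (vlM lO hw (vlB lO (vl1 lO) hp)); rewrite subr0 mulr1.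
    apply: (@npw_ev p q 1 _ (- c) (- 'X_ord_max + 'X_ord0 * ('X_ord_max + c%:MP)) 1 (-1)) => //.
    * rewrite ef !(rmorphB, rmorphD, rmorphM, rmorphN, rmorph1) evX evY evC divr1 -ew subrK.
      by move: (cst c) => C; ring.
    * by rewrite rmorphD rmorphN rmorphM rX_X rX_Y mul0r addr0 mulN1r.
    * by rewrite coefN coef1 oppr_eq0 oner_neq0.
    by rewrite ef.
  + nzu lO (1 - p); have [c0|c0] := eqVneq c 0.
      rewrite c0 rmorph0 subr0 in ew; rewrite ew in ev.
      by sm lO eu ev (@shallow_mono0) (- (1 - p)) 1%N 1%N.
    by sm lO eu ev (@shallow_mono0) (- (w * (1 - p))) 1%N 0%N.
  nzu lO (1 - p * q); have pq0 : p * q != 0 by rewrite mulf_neq0.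
  by sm lO eu ev (@shallow_mono0) (- (1 - p * q)) 1%N 0%N.
have b := typeI_birat M; have [u0 v0] := birat_neq0 b.
case: h => [->|[c ->]].
  have bi : birat (1 - y) ((1 - x) / (1 - y)) by apply/birat_div/birat_swap.
  have lO := loc_lring bi; set p := 1 - y in bi lO *; set q := _ / p in bi lO *.
  have hp : vl (loc p q) p 0 by apply/vl0/mx_loc_u.
  have hq : vl (loc p q) q 0 by apply/vl0/mx_loc_v.
  have ex : x = 1 - p * q by rewrite /q mulrC divfK //; ring.
  have ey : y = 1 - p by rewrite /p; ring.
  nzu lO (1 - p * q); nzu lO (1 - p); have [p0 q0] := birat_neq0 bi.
  clearbody q p.
  eapply (@shallow_mono_inv _ _ (g2 M) (-1 / ((1 - p * q) * (1 - p))) 2 1 0 bi); [unith lO|by []|].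
  by rewrite /g2 ex ey; field; nzs.
have bi : birat (1 - x) ((1 - y) / (1 - x) - cst c) by apply/birat_subC2/birat_div.
have lO := loc_lring bi; set p := 1 - x in bi lO *; set w := (1 - y) / p in bi lO *.
set q := w - cst c in bi lO *.
have hp : vl (loc p q) p 0 by apply/vl0/mx_loc_u.
have hw : vl (loc p q) w c by apply: mx_loc_v.
have ex : x = 1 - p by rewrite /p; ring.
have ey : y = 1 - p * w by rewrite /w mulrC divfK //; ring.
have ew : w - cst c = q by [].
have hq : vl (loc p q) q 0 by apply/vl0/mx_loc_v.
have w0 : w != 0 by rewrite mulf_neq0 ?invr_eq0.
nzu lO (1 - p * w); nzu lO (1 - p); have [p0 q0] := birat_neq0 bi.
clearbody q w p.
have [c0|c0] := eqVneq c 0.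
  rewrite c0 rmorph0 subr0 in ew; rewrite ew in ey.
  nzu lO (1 - p * q); have pq0 : p * q != 0 by rewrite mulf_neq0.
  eapply (@shallow_mono_inv _ _ (g2 M) (-1 / ((1 - p) * (1 - p * q))) 2 1 1 bi); [unith lO|by []|].
  by rewrite /g2 ex ey; field; nzs.
have pw0 : p * w != 0 by rewrite mulf_neq0.
eapply (@shallow_mono_inv _ _ (g2 M) (- (w / ((1 - p) * (1 - p * w)))) 2 1 0 bi); [unith lO|by []|].
by rewrite /g2 ex ey; field; nzs.
Qed.

(** Where the two exceptional curves over Q4 meet, x = p^2 q. *)
Lemma deep_x : exists2 O, XX O & deep O 3 x.
Proof.
have t := TypeII4 M; have b := typeII_birat t; have [u0 v0] := birat_neq0 b.
exists (loc (x / (1 - y)) ((1 - y) ^+ 2 / x)).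
  by apply/XX_XL; apply: Or43; exists (1 - y), x; split=> //; apply: Or44.
have bi : birat (x / (1 - y)) ((1 - y) ^+ 2 / x).
  by apply: (@coordsII_birat k M _ _ (x / (1 - y), (1 - y) ^+ 2 / x) b); rewrite !inE eqxx !orbT.
left; exists 0; rewrite rmorph0 subr0; set p := x / (1 - y) in bi *.
set q := _ / x in bi *; have hp := mx_loc_u bi; have hq := mx_loc_v bi.
have e : x = p * (p * (q * 1)) by rewrite /p /q; field; nzs.
rewrite [X in pw _ _ X]e; apply: PwS => //; apply: PwS => //; apply: PwS => //.
by apply: Pw0; apply: lr1; apply: loc_lring.
Qed.

(** Where the two exceptional curves over Q2 meet, y = p q and [g3] is a unit times y^2. *)
Lemma deep_g3 : exists2 O, XX O & deep O 4 (g3 M).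
Proof.
have t := TypeII2 M; have b := typeII_birat t; have [u0 v0] := birat_neq0 b.
have bi : birat ((x + y - 1) / y) (y ^+ 2 / (x + y - 1)).
  by apply: (@coordsII_birat k M _ _ ((x + y - 1) / y, y ^+ 2 / (x + y - 1)) b);
    rewrite !inE eqxx !orbT.
exists (loc ((x + y - 1) / y) (y ^+ 2 / (x + y - 1))).
  by apply/XX_XL; apply: Or43; exists y, (x + y - 1); split=> //; apply: Or44.
have lO := loc_lring bi; have y1' := nz_y1 M.
left; exists 0; rewrite rmorph0 subr0; set p := (x + y - 1) / y in bi lO *.
set q := y ^+ 2 / _ in bi lO *.
have hp := mx_loc_u bi; have hq := mx_loc_v bi.
have -> : g3 M = (p - 1) / (p * q - 1) * (p * (p * (q * (q * 1)))).
  have e : p * q = y by rewrite /p /q; field; nzs.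
  have e2 : p * (p * (q * (q * 1))) = y ^+ 2 by rewrite -e; ring.
  by rewrite e2 e /g3 /p; field; nzs.
apply: (pwM lO).
  have vp := (vl0 _ _).2 hp; have vq := (vl0 _ _).2 hq.
  clearbody p q; eapply vl_in; [exact: lO|vls lO; nzh].
apply: PwS => //; apply: PwS => //; apply: PwS => //; apply: PwS => //.
by apply: Pw0; apply: lr1.
Qed.

Lemma x_neq_g2 : ~ eqaut x (g2 M).
Proof.
move=> /(@deep_eqaut 2 x (g2 M)) /(_ deep_x) [O hO]; exact: shallow_g2.
Qed.

Lemma pw_weak O n z : lring O -> pw O n.+1 z -> pw O n z.
Proof.
move=> lO; elim: n z => [|n ih] z h; first by apply: Pw0; exact: pw_in h.
move e: n.+2 h => m h; elim: h e => [//|{}m a b ha hb _ [em]|{}m a b _ h1 _ h2 e].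
  by subst m; apply: PwS => //; apply: ih.
by apply: PwD; [exact: h1|exact: h2].
Qed.

Lemma x_neq_g3 : ~ eqaut x (g3 M).
Proof.
move=> /eqaut_sym /(@deep_eqaut 3 (g3 M) x) /(_ deep_g3) [O hO]; exact: shallow_x.
Qed.

Lemma g2_neq_g3 : ~ eqaut (g2 M) (g3 M).
Proof.
move=> /eqaut_sym /(@deep_eqaut 3 (g3 M) (g2 M)) /(_ deep_g3) [O hO] h.
apply: (shallow_g2 hO); have lO := XX_lring hO.
by case: h => [[c h]|h]; [left; exists c|right]; apply: pw_weak.
Qed.
End Orders.

(** * Sections of a conic bundle *)

Lemma seq_argmin (T : eqType) (s : seq T) (f : T -> int) : s != [::] ->
  exists2 m, m \in s & forall m', m' \in s -> f m <= f m'.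
Proof.
elim: s => [//|a s IH] _; case: s IH => [_|b s IH].
  by exists a => [|m]; rewrite ?inE // => /eqP->.
have [m hm hmin] := IH isT; have [le|lt] := lerP (f a) (f m).
  exists a; rewrite ?mem_head // => m'; rewrite in_cons => /predU1P[->//|/hmin].
  exact: le_trans.
exists m; first by rewrite in_cons hm orbT.
by move=> m'; rewrite in_cons => /predU1P[->|/hmin//]; exact: ltW.
Qed.

Lemma det_inj (i i' j j' : int) (a b a' b' : nat) : i * j' - i' * j != 0 ->
  i * a%:Z + j * b%:Z = i * a'%:Z + j * b'%:Z -> i' * a%:Z + j' * b%:Z = i' * a'%:Z + j' * b'%:Z ->
  a = a' /\ b = b'.
Proof.
move=> h e1 e2; have ea : (i * j' - i' * j) * (a%:Z - a'%:Z) = 0.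
  have -> : (i * j' - i' * j) * (a%:Z - a'%:Z) =
    j' * ((i * a%:Z + j * b%:Z) - (i * a'%:Z + j * b'%:Z)) -
    j * ((i' * a%:Z + j' * b%:Z) - (i' * a'%:Z + j' * b'%:Z)) by ring.
  by rewrite e1 e2 !subrr !mulr0 subrr.
have eb : (i * j' - i' * j) * (b%:Z - b'%:Z) = 0.
  have -> : (i * j' - i' * j) * (b%:Z - b'%:Z) =
    i * ((i' * a%:Z + j' * b%:Z) - (i' * a'%:Z + j' * b'%:Z)) -
    i' * ((i * a%:Z + j * b%:Z) - (i * a'%:Z + j * b'%:Z)) by ring.
  by rewrite e1 e2 !subrr !mulr0 subrr.
move/eqP: ea; move/eqP: eb; rewrite !mulf_eq0 (negPf h) /= !subr_eq0.
by move=> /eqP[->] /eqP[->].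
Qed.

Section Orders.
Variables (k : closedFieldType) (M : funfield k).
Local Notation K := (ff M).
Local Notation F := (rf M).
Local Notation pf := (pf M).
Local Notation cst := (cst M).
Local Notation ev := (@ev k M).
Local Notation birat := (@birat k M).
Local Notation mx := (@mx k M).
Local Notation x := (@fx k M).
Local Notation y := (@fy k M).
Local Notation loc := (@loc k M).
Local Notation Wc := (@Wc k M).
Local Notation A2 := {mpoly k[2]}.
Local Notation X := ('X_ord0 : A2).
Local Notation Y := ('X_ord_max : A2).

Definition iu (W : K -> Prop) (e : K) : Prop := W e /\ W e^-1.

Lemma iuM (W : K -> Prop) a b : lring W -> iu W a -> iu W b -> iu W (a * b).
Proof. by move=> lW [h1 h2] [h3 h4]; rewrite /iu invfM; split; apply: (lrM lW). Qed.

Lemma iuX (W : K -> Prop) a (n : int) : lring W -> iu W a -> iu W (a ^ n).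
Proof.
move=> lW [h1 h2]; case: n => n; rewrite /iu.
  by rewrite -exprnP -exprVn; split; exact: lrX.
by rewrite NegzE -exprnN invrK -exprVn; split; exact: lrX.
Qed.

Lemma Wc_iu u v (P : A2) : birat u v -> rX P != 0 -> iu (Wc u v X) (ev u v P).
Proof.
move=> b h; have lW := Wc_lring b (irr_X k).
have hP : Wc u v X (ev u v P) by apply: Wc_ev; exact: irr_X.
have [||hi _] := @unitP _ _ _ lW (ev u v P) => //.
by move/(mx_Wc_ev b (irr_X k))/dvrX_rX/eqP; rewrite (negPf h).
Qed.

Lemma Wc_shift u v v' c z : birat u v -> v' = v - cst c -> (Wc u v' X z <-> Wc u v X z).
Proof.
move=> b ev'; have b1 : birat u v' by rewrite ev'; apply: birat_subC2.
have lW := Wc_lring b1 (irr_X k).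
have mu : mx (Wc u v' X) u.
  by have := (mx_Wc_ev b1 (irr_X k) X).2 (dvr_refl _); rewrite evX.
have hv : Wc u v' X v.
  rewrite -(subrK (cst c) v) -ev'; apply: lrD => //; last exact: lrC.
  by have := Wc_ev u v' (irr_X k) Y; rewrite evY.
apply: Wc_param => // e.
move=> he; apply: (residues_not_const (a := 0) (b := e - c) b1 (irr_X k)).
  by rewrite rmorph0 subr0.
have -> : v' - cst (e - c) = v - cst e by rewrite (rmorphB cst) opprB addrA ev' subrK.
by [].
Qed.

(** Along p = 0 the order of q(u, w) is the least weight of a monomial of q. Monomials of equal
    weight cannot cancel, since the nonzero determinant keeps their powers of v distinct. *)
Lemma mono_ord p v u w (i i' j j' : int) (q : A2) : birat p v ->
  u = p ^ i * v ^ i' -> w = p ^ j * v ^ j' -> i * j' - i' * j != 0 -> q != 0 ->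
  exists m0 : 'X_{1..2}, [/\ m0 \in msupp q,
    forall m : 'X_{1..2}, m \in msupp q -> i * (m0 ord0)%:Z + j * (m0 ord_max)%:Z <= i * (m ord0)%:Z + j * (m ord_max)%:Z
  & iu (Wc p v X) (ev u w q / p ^ (i * (m0 ord0)%:Z + j * (m0 ord_max)%:Z))].
Proof.
move=> b eu ew hd q0; have [p0 v0] := birat_neq0 b.
pose f (m : 'X_{1..2}) : int := i * (m ord0)%:Z + j * (m ord_max)%:Z.
pose t (m : 'X_{1..2}) : int := i' * (m ord0)%:Z + j' * (m ord_max)%:Z.
have s0 : (msupp q : seq _) != [::] by rewrite msupp_eq0.
(* The second minimum bounds the exponents of v. Factoring out both least powers leaves a polynomial
   Q in p and v that does not vanish on p = 0, and v is a unit there. *)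
have [m0 hm0 min0] := seq_argmin f s0; have [m1 hm1 min1] := seq_argmin t s0.
exists m0; split=> //; rewrite -/(f m0).
pose e1 (m : 'X_{1..2}) := `|f m - f m0|%N; pose e2 (m : 'X_{1..2}) := `|t m - t m1|%N.
pose Q : A2 := \sum_(m <- msupp q) (q@_m)%:MP * (X ^+ e1 m * Y ^+ e2 m).
have evQ : ev u w q = p ^ f m0 * (v ^ t m1 * ev p v Q).
  rewrite evE mevE /Q rmorph_sum !big_distrr; apply: eq_big_seq => m hm /=.
  rewrite !rmorphM !rmorphXn /= evC evX evY.
  have h1 : p ^ f m = p ^ f m0 * p ^+ e1 m.
    by rewrite exprnP -expfzDr // /e1 gez0_abs ?subr_ge0 ?min0 // addrCA subrr addr0.
  have h2 : v ^ t m = v ^ t m1 * v ^+ e2 m.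
    by rewrite exprnP -expfzDr // /e2 gez0_abs ?subr_ge0 ?min1 // addrCA subrr addr0.
  have -> : u ^+ m ord0 * w ^+ m ord_max = p ^ f m * v ^ t m.
    rewrite eu ew !exprMn !exprnP !exprz_exp /f /t !expfzDr //.
    by rewrite -!mulrA; congr (_ * _); rewrite mulrCA.
  change (tf M (q@_m)%:MP) with (cst q@_m); rewrite h1 h2; move: (cst _) (p ^ _) (p ^+ _) (v ^ _) (v ^+ _) => c A B C D; ring.
have rQ : rX Q != 0.
  apply/negP => /eqP/(congr1 (fun h : {poly k} => h`_(e2 m0))); rewrite coef0.
  rewrite /Q rmorph_sum /= coef_sum (bigD1_seq m0) ?msupp_uniq //= big_seq_cond big1.
    rewrite addr0 !rmorphM !rmorphXn /= rX_C rX_X rX_Y /e1 subrr expr0 mul1r.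
    by rewrite coefCM coefXn eqxx mulr1 => /eqP; rewrite mcoeff_eq0 hm0.
  move=> m /andP[hm nm]; rewrite !rmorphM !rmorphXn /= rX_C rX_X rX_Y expr0n.
  have [e|_] := eqVneq (e1 m) 0%N; last by rewrite mul0r mulr0 coef0.
  rewrite mul1r coefCM coefXn; case: eqVneq => [ee|]; last by rewrite mulr0.
  case/eqP: nm; have := min0 m hm; have := min1 m hm; have := min1 m0 hm0; move: e ee.
  rewrite /e1 /e2 => e ee l1 l2 l3; have [ea eb] : m ord0 = m0 ord0 /\ m ord_max = m0 ord_max.
    apply: (det_inj hd); rewrite -/(f m) -/(f m0) -/(t m) -/(t m0).
      move: e; lia.
    move: ee l1 l2; lia.
  apply/mnmP => r; case: r => [[|[|//]] hr].
    by rewrite (_ : Ordinal hr = ord0) //; apply/val_inj.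
  by rewrite (_ : Ordinal hr = ord_max) //; apply/val_inj.
have -> : ev u w q / p ^ f m0 = v ^ t m1 * ev p v Q.
  by rewrite evQ mulrC mulKf // expfz_neq0.
have lW := Wc_lring b (irr_X k).
apply: (iuM lW); last exact: Wc_iu.
have : iu (Wc p v X) (ev p v Y) by apply: Wc_iu => //; rewrite rX_Y polyX_eq0.
by rewrite evY => hv; apply: iuX.
Qed.

Lemma nonvanishing (P : A2) (s : seq k) : P != 0 ->
  exists a b, [/\ a \notin s, b \notin s & pe a b P != 0].
Proof.
move=> P0; have roots (h : {poly k}) : h != 0 -> exists2 a, a \notin s & h.[a] != 0.
  move=> h0; have [r er] := closed_field_poly_normal h; have [a ha] := fresh_elt (s ++ r).
  move: ha; rewrite mem_cat negb_or => /andP[h1 h2]; exists a => //.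
  rewrite er hornerZ mulf_neq0 ?lead_coef_eq0 //; apply/negP => /eqP/rootP.
  by rewrite root_prod_XsubC (negPf h2).
have t0 : toB k P != 0.
  by apply: contraNneq P0 => e; rewrite -(toBK P) e rmorph0.
have l0 : lead_coef (toB k P) != 0 by rewrite lead_coef_eq0.
have [a ha hl] := roots _ l0.
have [|b hb hP] := roots (map_poly (horner_eval a) (toB k P)).
  apply: contra_neq hl => /(congr1 (fun h : {poly k} => h`_(size (toB k P)).-1)).
  by rewrite coef_map coef0 /= /horner_eval.
exists a, b; split=> //.
have -> : pe a b P = (horner_eval b \o map_poly (horner_eval a) \o toB k) P; last exact: hP.
have E c : (horner_eval b \o map_poly (horner_eval a) \o toB k) c =
    (map_poly (horner_eval a) (toB k c)).[b] by [].
apply: mpoly2_ext => [c||]; apply: etrans (esym (E _)).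
- by rewrite peC toBC map_polyC hornerC /= /horner_eval hornerC.
- by rewrite peX toBX map_polyC hornerC /= /horner_eval hornerX.
by rewrite peY toBY map_polyX hornerX.
Qed.

(** Base points have both coordinates in {0, 1}. Without a zero elsewhere, c has no zero on the
    lines x = a and y = b with a, b outside {0, 1}; its restrictions to them are constant, and c
    would be constant. *)
Lemma irr_zero (c : A2) : irr c -> exists a b, pe a b c = 0 /\ ~ affine_base a b.
Proof.
move=> [c0 nc _]; pose s : seq k := [:: 0; 1].
have [a0 [b0 [ha0 hb0 _]]] := nonvanishing s c0.
have nb a b : (a \notin s) || (b \notin s) -> ~ affine_base a b.
  by rewrite !inE => h [] [ea eb]; move: h; rewrite ea eb !eqxx ?orbT.
apply: contrapT => H.
have pY a : exists h : {poly k}, forall b, h.[b] = pe a b c.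
  exists (mev (@polyC k) a%:P 'X c) => b.
  apply: (@mpoly2_ext _ _ (horner_eval b \o mev (@polyC k) a%:P 'X) (pe a b)) => [e||] /=.
  - by rewrite mevC peC /horner_eval hornerC.
  - by rewrite mevX peX /horner_eval hornerC.
  by rewrite mevY peY /horner_eval hornerX.
have pX b : exists h : {poly k}, forall a, h.[a] = pe a b c.
  exists (mev (@polyC k) 'X b%:P c) => a.
  apply: (@mpoly2_ext _ _ (horner_eval a \o mev (@polyC k) 'X b%:P) (pe a b)) => [e||] /=.
  - by rewrite mevC peC /horner_eval hornerC.
  - by rewrite mevX peX /horner_eval hornerX.
  by rewrite mevY peY /horner_eval hornerC.
have cstp (h : {poly k}) : (forall r, h.[r] != 0) -> forall r r', h.[r] = h.[r'].
  move=> hr r r'; have [e|/closed_rootP[r1 /rootP e]] := eqVneq (size h) 1%N.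
    by rewrite (size1_polyC (_ : size h <= 1)%N) ?e // !hornerC.
  by have := hr r1; rewrite e eqxx.
have eY a b b' : a \notin s -> pe a b c = pe a b' c.
  move=> ha; have [h hh] := pY a; rewrite -!hh; apply: cstp => r; rewrite hh.
  by apply/negP => /eqP e; apply: H; exists a, r; split=> //; apply: nb; rewrite ha.
have eX a a' b : b \notin s -> pe a b c = pe a' b c.
  move=> hb; have [h hh] := pX b; rewrite -!hh; apply: cstp => r; rewrite hh.
  by apply/negP => /eqP e; apply: H; exists r, b; split=> //; apply: nb; rewrite hb orbT.
have [e|ne] := eqVneq (c - (pe a0 b0 c)%:MP) 0.
  have ec : c = (pe a0 b0 c)%:MP by apply/eqP; rewrite -subr_eq0 e.
  apply: nc; exists ((pe a0 b0 c)^-1)%:MP; rewrite {1}ec -rmorphM divff ?rmorph1 //.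
  by apply: contraNneq c0 => h; rewrite ec h rmorph0.
have [a [b [ha hb]]] := nonvanishing s ne.
by rewrite rmorphB peC (eY a b b0) // (eX a a0 b0) // subrr eqxx.
Qed.

(** An irreducible factor of the denominator has a zero that is a point of X, which would give a
    pole; so w is a polynomial. Having no pole along the line at infinity, it has degree 0. *)
Lemma regular_const (w : K) : (forall O, XX O -> O w) -> exists c, w = cst c.
Proof.
move=> H; have b := b_xy M; have [P [Q [Q0 ew cop]]] := fracP b w.
have Qu : dvr Q 1.
  apply: contrapT => nQ.
  have [||c [ic dc _]] := @irr_factor k (fun a : A2 => ~ dvr a 1) Q _ _ Q0 nQ.
  - move=> r s h; apply: contrapT => /not_orP[/contrapT h1 /contrapT h2]; apply: h.
    by apply: dvr_trans h1; rewrite -{2}[r]mulr1; case: h2 => e ->; exists e; rewrite mulrA.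
  - by move=> a ha; apply.
  have [a1 [b1 [e1 nb]]] := irr_zero ic.
  have b' : birat (x - cst a1) (y - cst b1) by apply/birat_subC/birat_subC2.
  have XO : XX (loc (x - cst a1) (y - cst b1)) by apply/XX_XL; apply: Or41; exists a1, b1.
  have [s [s' [sK s'K hs]]] := translation_morph M a1 b1.
  have lO := loc_lring b'.
  have ec : ev (x - cst a1) (y - cst b1) (s' c) = ev x y c by rewrite hs s'K.
  have ic' : irr (s' c) by apply: irr_iso ic; [exact: s'K|exact: sK].
  have pc' : pe 0 0 (s' c) = 0.
    apply/(mx_loc_ev b'); rewrite ec; apply: (vl0 _ _).1; rewrite -e1.
    by apply: vl_ev => //; [exact: mx_loc_u|exact: mx_loc_v].
  have hW : Wc (x - cst a1) (y - cst b1) (s' c) w by apply: Wc_loc => //; exact: H.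
  have lW := Wc_lring b' ic'.
  have inW z e : Wc (x - cst a1) (y - cst b1) (s' c) (z - cst e) -> Wc (x - cst a1) (y - cst b1) (s' c) z.
    by move=> h; rewrite -(subrK (cst e) z); apply: (lrD lW h); exact: lrC.
  have hw : Wc x y c w.
    apply: (same_curve ic lW _ _ _ _ _).1 hW.
    - by apply: (inW _ a1); rewrite -{2}(evX (x - cst a1) (y - cst b1)); apply: Wc_ev.
    - by apply: (inW _ b1); rewrite -{2}(evY (x - cst a1) (y - cst b1)); apply: Wc_ev.
    - by rewrite -ec; apply/mx_Wc_ev => //; apply: dvr_refl.
    move=> a2 b2 h1 h2; apply: (residues_not_const (a := a2 - a1) (b := b2 - b1) b' ic').
      by rewrite (rmorphB cst) opprB addrA subrK.
    by rewrite (rmorphB cst) opprB addrA subrK.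
  have nP : ~ dvr c P by move=> h; apply: (cop c).
  have : mx (Wc x y c) (ev x y Q / ev x y P) by apply/mx_Wc_frac.
  move=> [_]; rewrite invf_div -ew => /(_ hw)/eqP; rewrite mulf_eq0 invr_eq0.
  by rewrite !(negPf (ev_neq0 b _)) // (ndvr_neq0 nP).
have [Q' eQ] := Qu; have {ew} ew : w = ev x y (P * Q').
  rewrite ew rmorphM; congr (_ * _); apply: (mulfI (ev_neq0 b Q0)).
  by rewrite divff ?ev_neq0 // -rmorphM -eQ rmorph1.
have [e0|n0] := eqVneq (P * Q') 0; first by exists 0; rewrite ew e0 !rmorph0.
have bi := birat_1y M; have [x_0 y_0] := (fx_neq0 M, fy_neq0 M).
(* Both x and y have weight -1 along the line at infinity 1/y = 0, so the order of the polynomial is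
   minus its degree. *)
have [|||//|m0 [hm0 min0 [_ hu]]] := @mono_ord (1 / y) (x / y) x y (-1) 1 (-1) 0 (P * Q') bi.
- by rewrite exprN1 div1r invrK !expr1z mulrC divfK.
- by rewrite exprN1 div1r invrK mulr1.
- by [].
have hw : Wc (1 / y) (x / y) X w.
  have b1 : birat (1 / y) (x / y - cst 1) by apply: birat_subC2.
  apply/(Wc_shift _ bi (erefl (x / y - cst 1))); have iX := irr_X k; apply: Wc_loc => //; first exact: peX.
  by apply: H; apply/XX_XL; apply: Or42; exists 1 => //; exact: oner_neq0.
have lW := Wc_lring bi (irr_X k).
have hpi : mx (Wc (1 / y) (x / y) X) (1 / y).
  by rewrite -{2}(evX (1 / y) (x / y)); apply/(mx_Wc_ev bi (irr_X k))/dvr_refl.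
have small : -1 * (m0 ord0)%:Z + -1 * (m0 ord_max)%:Z = 0.
  apply/eqP; rewrite eq_le; apply/andP; split; first by lia.
  rewrite leNgt; apply/negP => lt.
  move: hu; rewrite -ew invfM invrK => hu.
  have [n en] : exists n : nat, -1 * (m0 ord0)%:Z + -1 * (m0 ord_max)%:Z = - (n.+1)%:Z.
    exists (m0 ord0 + m0 ord_max).-1; lia.
  have w0 : w != 0 by rewrite ew ev_neq0.
  have := lrM lW hw hu; rewrite mulVKf // en -exprnN => hh.
  have : mx (Wc (1 / y) (x / y) X) ((1 / y) ^+ n.+1) by rewrite exprSr; apply: mxMl => //; apply: lrX => //; exact: mx_in.
  move/mx_unitF => /(_ hh)/eqP.
  by rewrite expf_eq0 /= div1r invr_eq0 (negPf y_0).
exists (\sum_(m <- msupp (P * Q')) (P * Q')@_m).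
rewrite ew evE mevE rmorph_sum; apply: eq_big_seq => m /min0 le.
have [-> ->] : m ord0 = 0%N /\ m ord_max = 0%N by move: small le; lia.
by rewrite !expr0 !mulr1.
Qed.

Lemma regular_subC u v z e : birat u v -> regular_at (loc u v) z ->
  regular_at (loc u v) (z - cst e).
Proof.
move=> b; have lO := loc_lring b; case=> h; first by left; apply: lrB => //; exact: lrC.
have [z0|z0] := eqVneq z 0; first by left; rewrite z0; apply: lrB => //; [exact: lr0|exact: lrC].
have [c hc] := loc_res b h; have [c1|c1] := eqVneq (1 - e * c) 0.
  left; apply: lrB; [by []| |exact: lrC]; rewrite -[z]invrK; apply: (vl_inv lO hc).
  by apply: contra_eq_neq c1 => ->; rewrite mulr0 subr0 oner_neq0.
right; have hd : vl (loc u v) (1 - cst e * z^-1) (1 - e * c).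
  by apply: vlB => //; [exact: vl1|apply: vlM => //; exact: vlC].
have -> : (z - cst e)^-1 = z^-1 / (1 - cst e * z^-1).
  have n := vl_neq0 lO hd c1.
  have {1}-> : z - cst e = (1 - cst e * z^-1) * z by rewrite mulrBl mul1r mulfVK.
  by rewrite invfM mulrC.
by apply: (vl_in lO); apply: (vl_div lO hc hd c1).
Qed.

Section Sections.
Variables (f : K) (tau : k) (V : K -> Prop) (rho : K -> F).
Hypothesis reg : forall O, XX O -> regular_at O f.
Hypotheses (cV : curve V) (hr : resmap V rho).
Hypothesis uV : forall W : K -> Prop, curve W -> mx W (f - cst tau) -> forall z, W z <-> V z.
Hypothesis gV : forall z, mx V z <-> exists2 w, V w & z = w * (f - cst tau).
Let g := f - cst tau.
Hypothesis g0 : f - cst tau != 0.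

(** Functions with at most a simple pole along the fibre C of equation g = 0: where 1/g is regular C
    is absent, and where g is regular it is a local equation of C. *)
Definition Lsec (s : K) := forall O, XX O -> (O g^-1 -> O s) /\ (O g -> O (s * g)).

Let lV : lring V := curve_lring cV.

Lemma mx_Vg : mx V g.
Proof. by apply/gV; exists 1; rewrite ?mul1r //; exact: lr1. Qed.

Lemma nVg : ~ V g^-1.
Proof. by move/(mx_unitF mx_Vg)/eqP; rewrite (negPf g0). Qed.

Lemma regular_g O : XX O -> O g \/ O g^-1.
Proof.
move=> h; have [u [v [b eO]]] := XX_loc h; have := reg h; rewrite eO.
exact: regular_subC.
Qed.

(** The restriction of s g to the rational curve C is regular at every place, since each place has a
    centre on X where g is regular; so it is a constant c. Then s - c/g has no pole along C, is
    regular on all of X, and is constant. *)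
Lemma two_sections s : Lsec s -> exists a b, s = cst a + cst b * g^-1.
Proof.
move=> hs; have tV z : V z \/ V z^-1 by apply: curve_total.
have vg := mx_Vg; have ng := nVg.
have Vsub O : XX O -> (forall z, O z -> V z) -> O g.
  by move=> h sub; case: (regular_g h) => // /sub /ng.
have Vt : V (s * g).
  have [u [v [c [b XO ic c0 eV]]]] := (curveP V).1 cV.
  have sub z : loc u v z -> V z by rewrite eV; apply: Wc_loc.
  have hg : loc u v g by apply: Vsub.
  exact: sub ((hs _ XO).2 hg).
have Rt R : place R -> R (rho (s * g)).
  move=> pR; have [O XO [D _]] := center_exists (comp_vring lV tV hr pR).
  have hg : O g by apply: Vsub => // z /D[].
  by have [_] := D _ ((hs O XO).2 hg).
have [c hc] : exists c, rho (s * g) = pf c%:P.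
  by apply: all_places_const => [t|]; apply: Rt; [exact: place_at|exact: place_inf].
have [w Vw ew] : exists2 w, V w & s * g - cst c = w * g.
  apply/gV; apply/(rho0P hr); first by apply: lrB => //; exact: lrC.
  rewrite -(rmorphN cst) (rhoD hr) //; last exact: lrC.
  by rewrite (rhoC hr) hc polyCN (rmorphN pf) subrr.
have es : s = cst c * g^-1 + w.
  by apply: (mulIf g0); rewrite mulrDl -mulrA mulVf // mulr1 -ew addrCA subrr addr0.
suff [a ha] : exists a, w = cst a by exists a, c; rewrite es ha addrC.
apply: regular_const => O XO; have lO := XX_lring XO; have [h1 h2] := hs O XO.
have [hg|hg] := regular_g XO; last first.
  have -> : w = s - cst c * g^-1 by rewrite es addrC addKr.
  by apply: lrB => //; [exact: h1|apply: lrM => //; exact: lrC].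
have [u [v [b eO]]] := XX_loc XO; rewrite eO; apply/(Wc_hartogs _ b) => q iq q0.
have lW := Wc_lring b iq; have cW : curve (Wc u v q) by apply/curveP; exists u, v, q; rewrite -eO.
have hO z : O z -> Wc u v q z by rewrite eO; apply: Wc_loc.
have [mg|ng'] := pselect (mx (Wc u v q) g); first exact/(uV cW mg).
have [gi _] := unitP lW (hO _ hg) ng'.
have -> : w = (s * g - cst c) * g^-1 by rewrite ew mulfK.
apply: lrM => //; apply: lrB => //; last exact: lrC.
exact/hO/h2.
Qed.
End Sections.
End Orders.

(** * Classes of curves *)

Section CurveList.
Variables (k : closedFieldType) (M : funfield k).
Local Notation K := (ff M).
Local Notation F := (rf M).
Local Notation cst := (cst M).
Local Notation ev := (@ev k M).
Local Notation birat := (@birat k M).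
Local Notation mx := (@mx k M).
Local Notation x := (@fx k M).
Local Notation y := (@fy k M).
Local Notation loc := (@loc k M).
Local Notation Wc := (@Wc k M).
Local Notation A2 := {mpoly k[2]}.
Local Notation X := ('X_ord0 : A2).
Local Notation Y := ('X_ord_max : A2).

Definition nonconst2 (W : K -> Prop) u v := forall a b, vl W u a -> vl W v b -> False.

(** The strict transform of the first exceptional curve, then the second one. In each pair the first
    member is an equation of the curve and the second a coordinate on it. With the line x0 = 0 and
    the curve over Q5, [exc] lists the ten curves outside the affine plane. *)
Definition excII u v : seq (K * K) := [:: (v, u / v); (u, v / u ^+ 2)].
Definition exc : seq (K * K) :=
  [:: (1 / y, x / y); (1 - y, (1 - x) / (1 - y))] ++ excII (x / y) (1 / y) ++
  excII y (x + y - 1) ++ excII (1 / x) (y / x) ++ excII (1 - y) x.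

Definition is_exc (W : K -> Prop) p := forall z, W z <-> Wc p.1 p.2 X z.

Section OneRing.
Variable W : K -> Prop.
Hypothesis lW : lring W.

Lemma vl_mx z : mx W z -> vl W z 0. Proof. by move/(vl0 W z).2. Qed.

Lemma nc_inv z : W z -> (forall c, ~ vl W z c) -> W z^-1 /\ (forall c, ~ vl W z^-1 c).
Proof.
move=> hz nz; have [|hi z0] := unitP lW hz; first by move/vl_mx; apply: nz.
split=> // c hc; have [c0|c0] := eqVneq c 0.
  rewrite c0 in hc; have := mx_unitF ((vl0 _ _).1 hc); rewrite invrK => /(_ hz)/eqP.
  by rewrite invr_eq0 (negPf z0).
by apply: (nz c^-1); rewrite -[z]invrK; apply: (vlV lW).
Qed.

Lemma exc_param p v : birat p v -> mx W p -> W v -> (forall c, ~ vl W v c) -> is_exc W (p, v).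
Proof. by move=> b mp hv nv z; apply: Wc_param. Qed.

Lemma nc2r u v : nonconst2 W u v -> mx W u -> forall c, ~ vl W v c.
Proof. by move=> h hu c hc; apply: (h 0 c) => //; apply: vl_mx. Qed.

Lemma nc2l u v : nonconst2 W u v -> mx W v -> forall c, ~ vl W u c.
Proof. by move=> h hv c hc; apply: (h c 0) => //; apply: vl_mx. Qed.

Section Chart.
Variables u v : K.
Hypothesis b : birat u v.
Let u0 : u != 0 := (birat_neq0 b).1.
Let v0 : v != 0 := (birat_neq0 b).2.
Let bE : birat v (u / v) := birat_div (birat_swap b).
Let bP : birat u (v / u ^+ 2).
Proof. by rewrite expr2 invfM mulrA; apply/birat_div/birat_div. Qed.

Definition excase := [/\ W u, W v & nonconst2 W u v \/ exists2 p, p \in excII u v & is_exc W p].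

Definition excase1 := [/\ W u, W v & nonconst2 W u v \/ is_exc W (v, u / v)].

Lemma excase1W : excase1 -> excase.
Proof.
case=> hu hv h; split=> //; case: h => h; [by left|right; exists (v, u / v) => //].
by rewrite mem_head.
Qed.

Lemma chart1 : W v -> W (u / v) -> nonconst2 W v (u / v) -> excase1.
Proof.
move=> hv hq nc; split=> //; first by rewrite -(divfK v0 u); apply: (lrM lW).
have [mv|nv] := pselect (mx W v).
  by right; apply: exc_param => //; apply: nc2r nc mv.
left=> a c ha hc; have [c0|c0] := eqVneq c 0; first by apply: nv; rewrite c0 in hc; apply: (vl0 _ _).1.
by apply: (nc c (a / c)) => //; apply: vl_div.
Qed.

Lemma chart2 : W u -> W (v / u) -> nonconst2 W u (v / u) -> excase1.
Proof.
move=> hu hq nc; have hv : W v by rewrite -(divfK u0 v); apply: (lrM lW).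
split=> //; have [mu|nu] := pselect (mx W u).
  have [] := nc_inv hq (nc2r nc mu); rewrite invf_div => h1 h2; right.
  by apply: exc_param => //; rewrite -(divfK u0 v); apply: mxMl.
left=> a c ha hc; have [a0|a0] := eqVneq a 0; first by apply: nu; rewrite a0 in ha; apply: (vl0 _ _).1.
by apply: (nc a (c / a)) => //; apply: vl_div.
Qed.

Lemma chart3 : W u -> W (v / u ^+ 2) -> nonconst2 W u (v / u ^+ 2) -> excase.
Proof.
move=> hu hq nc; have hv : W v.
  by rewrite -(divfK (expf_neq0 2 u0) v); apply: (lrM lW) => //; apply: lrX.
split=> //; have [mu|nu] := pselect (mx W u).
  right; exists (u, v / u ^+ 2); first by rewrite !inE eqxx orbT.
  by apply: exc_param => //; apply: nc2r nc mu.
left=> a c ha hc; have [a0|a0] := eqVneq a 0; first by apply: nu; rewrite a0 in ha; apply: (vl0 _ _).1.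
by apply: (nc a (c / a ^+ 2)) => //; apply: vl_div => //; [apply: vlX|rewrite expf_neq0].
Qed.

Lemma chart4 : W (v / u) -> W (u ^+ 2 / v) -> nonconst2 W (v / u) (u ^+ 2 / v) -> excase.
Proof.
move=> hp hq nc; have eu : u = v / u * (u ^+ 2 / v) by field; rewrite u0 v0.
have evv : v = (v / u) ^+ 2 * (u ^+ 2 / v) by field; rewrite u0 v0.
have hu : W u by rewrite eu; apply: lrM.
have hv : W v by rewrite evv; apply: lrM => //; apply: lrX.
split=> //; have [mp|np] := pselect (mx W (v / u)).
  right; exists (u, v / u ^+ 2); first by rewrite !inE eqxx orbT.
  have [] := nc_inv hq (nc2r nc mp); rewrite invf_div => h1 h2.
  by apply: exc_param => //; rewrite eu; apply: mxMr.
have [mq|nq] := pselect (mx W (u ^+ 2 / v)).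
  right; exists (v, u / v); first by rewrite mem_head.
  have [] := nc_inv hp (nc2l nc mq); rewrite invf_div => h1 h2.
  by apply: exc_param => //; rewrite evv; apply: mxMl => //; apply: lrX.
have nuv z : mx W z -> z = u \/ z = v -> False.
  move=> mz hz; have : mx W (v / u * (u ^+ 2 / v)) \/ mx W (v / u * (v / u * (u ^+ 2 / v))).
    by case: hz => ez; [left; rewrite -eu -ez|right; rewrite mulrA -expr2 -evv -ez].
  case=> /(mx_prime lW); first by case.
  by case=> // [|/(mx_prime lW) []] //; exact: lrM.
left=> a c ha hc; have [a0|a0] := eqVneq a 0.
  by apply: (nuv u); [apply: (vl0 _ _).1; rewrite -a0|left].
have [c0|c0] := eqVneq c 0; first by apply: (nuv v); [apply: (vl0 _ _).1; rewrite -c0|right].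
apply: (nc (c / a) (a ^+ 2 / c)); first exact: vl_div.
by apply: vl_div => //; apply: vlX.
Qed.
End Chart.

Definition affine_nc := [/\ W x, W y & nonconst2 W x y].

Let x_0 : x != 0 := fx_neq0 M.
Let y_0 : y != 0 := fy_neq0 M.

Lemma at_infinity1 : W (1 / y) -> W (x / y) -> nonconst2 W (1 / y) (x / y) ->
  affine_nc \/ is_exc W (1 / y, x / y).
Proof.
move=> h1 h2 nc; have [m1|n1] := pselect (mx W (1 / y)).
  by right; apply: exc_param => //; [exact: birat_1y|exact: nc2r nc m1].
have [hy _] := unitP lW h1 n1; rewrite invf_div divr1 in hy.
left; split=> //; first by rewrite -(divfK y_0 x); apply: lrM.
move=> a b ha hb; have b0 : b != 0.
  apply/eqP => b0; rewrite b0 in hb; have := mx_unitF ((vl0 _ _).1 hb).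
  by rewrite -div1r => /(_ h1)/eqP; rewrite (negPf y_0).
by apply: (nc (1 / b) (a / b)); apply: vl_div => //; exact: vl1.
Qed.

Lemma at_infinity2 : W (1 / x) -> W (y / x) -> nonconst2 W (1 / x) (y / x) ->
  affine_nc \/ is_exc W (1 / y, x / y).
Proof.
move=> h1 h2 nc; have [m1|n1] := pselect (mx W (1 / x)).
  have [] := nc_inv h2 (nc2r nc m1); rewrite invf_div => h3 h4.
  right; apply: exc_param => //; first exact: birat_1y.
  have -> : 1 / y = x / y * (1 / x) by field; rewrite x_0 y_0.
  exact: mxMl.
have [hx _] := unitP lW h1 n1; rewrite invf_div divr1 in hx.
left; split=> //; first by rewrite -(divfK x_0 y); apply: lrM.
move=> a b ha hb; have a0 : a != 0.
  apply/eqP => a0; rewrite a0 in ha; have := mx_unitF ((vl0 _ _).1 ha).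
  by rewrite -div1r => /(_ h1)/eqP; rewrite (negPf x_0).
by apply: (nc (1 / a) (b / a)); apply: vl_div => //; exact: vl1.
Qed.

Lemma affine_subst u v : W u -> W v -> nonconst2 W u v ->
  (W u -> W v -> W x /\ W y) ->
  (forall a b, vl W x a -> vl W y b -> exists c d, vl W u c /\ vl W v d) -> affine_nc.
Proof.
move=> hu hv nc h1 h2; have [hx hy] := h1 hu hv; split=> // a b ha hb.
by have [c [d [hc hd]]] := h2 a b ha hb; apply: (nc c d).
Qed.

Definition list_case := affine_nc \/ exists2 p, p \in exc & is_exc W p.

Lemma list_caseI : affine_nc \/ is_exc W (1 / y, x / y) -> list_case.
Proof. by case; [left|right; exists (1 / y, x / y) => //; rewrite inE eqxx]. Qed.

Lemma list_caseII u v : typeII u v -> excase u v -> list_case.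
Proof.
move=> t [hu hv [nc|[p hp eW]]]; last first.
  right; exists p => //; case: t hp; rewrite !inE => /orP[]/eqP->; rewrite eqxx ?orbT //.
case: t hu hv nc => hu hv nc.
- by apply/list_caseI/at_infinity1 => // a b ha hb; apply: nc hb ha.
- left; apply: (affine_subst hu hv nc) => [h1 h2|a b ha hb].
    split=> //; have -> : x = x + y - 1 - y + 1 by ring.
    by apply: lrD => //; [apply: lrB|apply: lr1].
  by exists b, (a + b - 1); split=> //; apply: vlB => //; [apply: vlD|apply: vl1].
- exact/list_caseI/at_infinity2.
left; apply: (affine_subst hu hv nc) => [h1 h2|a b ha hb].
  by split=> //; rewrite -[y](subKr 1); apply: lrB => //; apply: lr1.
by exists (1 - b), a; split=> //; apply: vlB => //; apply: vl1.
Qed.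

Lemma list_case5 : excase1 (1 - x) (1 - y) -> list_case.
Proof.
move=> [hu hv nc]; have h1 := lr1 lW; case: nc => [nc|eW]; last first.
  by right; exists (1 - y, (1 - x) / (1 - y)) => //; rewrite !inE eqxx orbT.
left; apply: (affine_subst hu hv nc) => [h3 h4|a b ha hb].
  by split; rewrite -[X in W X](subKr 1); apply: lrB.
by exists (1 - a), (1 - b); split; apply: vlB => //; apply: vl1.
Qed.
End OneRing.

(** In each chart, either x and y are regular and not both constant along W, so that W is an affine
    plane curve, or the equation of one of the ten curves of [exc] vanishes on W. *)
Lemma curve_list W : curve W -> list_case W.
Proof.
move=> cW; have [p [c [hp ic eW]]] := curve_coords cW.
have b := coords_birat hp; have lW := curve_lring cW.
have h1 : W p.1 by rewrite eW -{2}(evX p.1 p.2); apply: Wc_ev.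
have h2 : W p.2 by rewrite eW -{2}(evY p.1 p.2); apply: Wc_ev.
have nc : nonconst2 W p.1 p.2 by move=> a d; rewrite eW => ha hd; apply: (residues_not_const b ic ha hd).
have tII u v q : typeII u v -> q \in coordsII u v -> W q.1 -> W q.2 -> nonconst2 W q.1 q.2 -> list_case W.
  move=> t hq g1 g2 g3; apply: (list_caseII lW t); have bt := typeII_birat t.
  move: hq g1 g2 g3; rewrite !inE => /or4P[]/eqP-> /= *.
  - exact/excase1W/chart1.
  - exact/excase1W/chart2.
  - exact: chart3.
  exact: chart4.
move: hp; rewrite /coords !mem_cat => /orP[|/or4P[]] hp.
- move: hp h1 h2 nc; rewrite !inE => /or4P[]/eqP-> /= h1 h2 nc.
  + by left.
  + exact/list_caseI/at_infinity1.
  + by apply: (list_case5 lW); apply: chart1 => //; exact: typeI_birat.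
  by apply: (list_case5 lW); apply: chart2 => //; exact: typeI_birat.
- exact: (tII _ _ _ (TypeII1 M) hp).
- exact: (tII _ _ _ (TypeII2 M) hp).
- exact: (tII _ _ _ (TypeII3 M) hp).
exact: (tII _ _ _ (TypeII4 M) hp).
Qed.

Section Lines.
Variables (f : K) (tau : k) (q S : A2).
Hypothesis iq : irr q.
Let V := Wc x y q.
Hypothesis cV : curve V.
Hypothesis gV : forall z, mx V z <-> exists2 w, V w & z = w * (f - cst tau).
Hypothesis g0 : f - cst tau != 0.
Hypothesis hS : forall p, p \in exc -> Wc p.1 p.2 X (ev x y S / ev x y q).

Lemma section_on_curves W : curve W -> (forall z, W z <-> V z) \/ W (ev x y S / ev x y q).
Proof.
move=> cW; have lW := curve_lring cW; case: (curve_list cW) => [[hx hy nc]|[p hp eW]]; last first.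
  by right; apply/eW/hS.
have hq : W (ev x y q) by apply: lr_ev.
have [mq|nq] := pselect (mx W (ev x y q)).
  by left=> z; apply: same_curve => // a b ha hb; apply: (nc a b).
right; apply: (lrM lW); first exact: lr_ev.
by have [] := unitP lW hq nq.
Qed.

(** By [Wc_hartogs] it suffices to look along curves. An affine curve other than V makes q a unit,
    the curves of [exc] are covered by hypothesis, and on V one factor q is allowed in the
    denominator. *)
Lemma Lsec_lines : Lsec f tau (ev x y S / ev x y q).
Proof.
move=> O XO; have [u [v [b eO]]] := XX_loc XO.
have cW c : irr c -> pe 0 0 c = 0 -> curve (Wc u v c).
  by move=> ic c0; apply/curveP; exists u, v, c; rewrite -eO.
have hO c z : irr c -> pe 0 0 c = 0 -> O z -> Wc u v c z.
  by move=> ic c0; rewrite eO; apply: Wc_loc.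
split=> hg; rewrite eO; apply/(Wc_hartogs _ b) => c ic c0.
  case: (section_on_curves (cW c ic c0)) => // eW; exfalso.
  exact: (nVg cV gV g0) ((eW _).1 (hO _ _ ic c0 hg)).
have lW := curve_lring (cW c ic c0).
case: (section_on_curves (cW c ic c0)) => [eW|hs]; last exact/(lrM lW hs)/hO.
apply/eW; have [w Vw ->] : exists2 w, V w & f - cst tau = w * ev x y q.
  by apply/(Wc_gen (b_xy M) iq)/(mx_Vg cV gV).
rewrite mulrCA divfK ?(ev_neq0 (b_xy M)) //; last by case: iq.
by apply: (lrM (curve_lring cV)) => //; apply: Wc_ev.
Qed.
End Lines.
End CurveList.

Lemma mev_comp (k : fieldType) (S : comNzRingType) (h : {rmorphism k -> S}) u v (P Q q : {mpoly k[2]}) :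
  mev h u v (mev (@mpolyC 2 k) P Q q) = mev h (mev h u v P) (mev h u v Q) q.
Proof.
apply: (@mpoly2_ext _ _ (mev h u v \o mev (@mpolyC 2 k) P Q)
  (mev h (mev h u v P) (mev h u v Q))) => [c||]; rewrite -[LHS]/(mev h u v (mev _ _ _ _)).
- by rewrite mevC [RHS]mevC; exact: mevC.
- by rewrite [RHS]mevX; congr (mev h u v _); exact: mevX.
by rewrite [RHS]mevY; congr (mev h u v _); exact: mevY.
Qed.

Lemma mev_cong (k : fieldType) (S : comNzRingType) (h : {rmorphism k -> S}) u v u' v' (q : {mpoly k[2]}) :
  exists w1 w2, mev h u v q = mev h u' v' q + ((u - u') * w1 + (v - v') * w2).
Proof.
elim/mpoly2_ind: q => [c|||a b [w1 [w2 e1]] [w3 [w4 e2]]|a b [w1 [w2 e1]] [w3 [w4 e2]]].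
- by exists 0, 0; rewrite !mevC !mulr0 !addr0.
- by exists 1, 0; rewrite !mevX mulr0 mulr1 addr0 addrCA subrr addr0.
- by exists 0, 1; rewrite !mevY mulr0 mulr1 add0r addrCA subrr addr0.
- by exists (w1 + w3), (w2 + w4); rewrite !rmorphD /= e1 e2; ring.
exists (w1 * mev h u v b + w3 * mev h u' v' a), (w2 * mev h u v b + w4 * mev h u' v' a).
rewrite !rmorphM /= e1; move: e2; move: (mev h u v b) (mev h u' v' b) (mev h u' v' a) => B B' A' e2.
have -> : (A' + ((u - u') * w1 + (v - v') * w2)) * B =
  A' * B + ((u - u') * (w1 * B) + (v - v') * (w2 * B)) by ring.
by rewrite {1}e2; ring.
Qed.

Section PolyBounds.
Variable k : fieldType.
Implicit Types (g a b : {poly k}) (p : {mpoly k[2]}).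

Lemma restr_size p a b N : (forall m, m \in msupp p -> (size (a ^+ m ord0 * b ^+ m ord_max)%R <= N)%N) ->
  (size (mev (@polyC k) a b p) <= N)%N.
Proof.
move=> h; rewrite mevE; apply: (big_ind (fun g : {poly k} => (size g <= N)%N)) => [|f g hf hg|m _].
- by rewrite size_poly0.
- by apply: leq_trans (size_polyD _ _) _; rewrite geq_max hf hg.
have [hm|hm] := boolP (m \in msupp p); last by rewrite memN_msupp_eq0 // mul0r size_poly0.
by rewrite mul_polyC; apply: leq_trans (size_scale_leq _ _) (h m hm).
Qed.

Lemma restr_dvd p a b N : (forall m, m \in msupp p -> 'X^N %| (a ^+ m ord0 * b ^+ m ord_max)%R) ->
  'X^N %| mev (@polyC k) a b p.
Proof.
move=> h; rewrite mevE; apply: (big_ind (fun g : {poly k} => 'X^N %| g)) => [|f g hf hg|m _].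
- exact: dvdp0.
- exact: dvdp_add.
have [hm|hm] := boolP (m \in msupp p); last by rewrite memN_msupp_eq0 // mul0r dvdp0.
exact/dvdp_mull/h.
Qed.

(** The order at 0 plus the order at 1 is at most the degree, X^A and (1 - X)^B being coprime
    divisors of g. *)
Lemma zeros_le_degree g A B N : g != 0 -> 'X^A %| g -> 'X^B %| g \Po (1 - 'X) ->
  (size g <= N.+1)%N -> (A + B <= N)%N.
Proof.
move=> g0 hA hB hs; have h1 : (1 - 'X) \Po (1 - 'X) = 'X :> {poly k}.
  by rewrite rmorphB /= comp_polyX -polyC1 comp_polyC; ring.
have {hB}hB : (1 - 'X) ^+ B %| g.
  move: hB => /dvdpP[w ew]; apply/dvdpP; exists (w \Po (1 - 'X)).
  have : (g \Po (1 - 'X)) \Po (1 - 'X) = (w \Po (1 - 'X)) * (1 - 'X) ^+ B.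
    by rewrite ew rmorphM rmorphXn /= comp_polyX.
  by rewrite -comp_polyA h1 comp_polyXr.
have co : coprimep ('X^A : {poly k}) ((1 - 'X) ^+ B).
  apply/coprimep_expl/coprimep_expr; rewrite -opprB -scaleN1r.
  rewrite coprimepZr ?oppr_eq0 ?oner_neq0 // -[X in coprimep X _]subr0 -polyC0 -polyC1.
  by rewrite coprimep_XsubC2 // subr0 oner_neq0.
have : ('X^A : {poly k}) * (1 - 'X) ^+ B %| g by rewrite Gauss_dvdp // hA.
move/(dvdp_leq g0)/leq_trans/(_ hs); rewrite size_mul ?expf_neq0 ?polyX_eq0 //; last first.
  by rewrite -opprB oppr_eq0 -polyC1 polyXsubC_eq0.
have s2 : size (1 - 'X : {poly k}) = 2%N by rewrite -opprB size_polyN -polyC1 size_XsubC.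
have n0 : (1 - 'X : {poly k}) ^+ B != 0 by rewrite expf_neq0 // -size_poly_eq0 s2.
have := size_exp (1 - 'X : {poly k}) B; rewrite s2 mul1n.
by move: n0; rewrite -size_poly_gt0 size_polyXn; case: (size _) => // r _ /= ->; rewrite addnS.
Qed.

Lemma XnX_dvd N n (w : {poly k}) : (N <= n)%N -> 'X^N %| w * 'X^n.
Proof. by move=> h; apply: dvdp_mull; rewrite -(subnK h) exprD dvdp_mull. Qed.
Lemma size_linX (a : {poly k}) n : (size a <= 2)%N -> (size (a ^+ n) <= n.+1)%N.
Proof.
move=> h; apply: leq_trans (size_poly_exp_leq _ _) _; rewrite ltnS.
by rewrite -[n in (_ <= n)%N]mul1n leq_mul2r; move: h; case: (size a) => [|[|[]]] //=; rewrite ?orbT.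
Qed.

Lemma size_lin2 (a b : {poly k}) i j : (size a <= 2)%N -> (size b <= 2)%N ->
  (size (a ^+ i * b ^+ j)%R <= (i + j).+1)%N.
Proof.
move=> /(size_linX i) h1 /(size_linX j) h2; apply: leq_trans (size_polyMleq _ _) _.
move: h1 h2; move: (size _) (size _) => s t; lia.
Qed.
End PolyBounds.

Section LineRestriction.
Variable k : closedFieldType.
Local Notation A2 := {mpoly k[2]}.
Local Notation X := ('X_ord0 : A2).
Local Notation Y := ('X_ord_max : A2).
Implicit Types (q l : A2).

(** Modulo l one has X = a(t) and Y = b(t), where t is a polynomial function on the plane that
    parametrizes the line. If q(a, b) = 0, then l divides q and is associated to it. The point (e,
    f) shows that l is not a unit. *)
Lemma restr_neq0 q l (a b : {poly k}) (t w1 w2 : A2) (e f : k) : irr q -> ~ dvr q l ->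
  pe e f l = 0 -> X - mev (@mpolyC 2 k) t t (evx a) = l * w1 ->
  Y - mev (@mpolyC 2 k) t t (evx b) = l * w2 -> mev (@polyC k) a b q != 0.
Proof.
move=> [q0 nq iq] ndq l0 ea eb; apply/negP => /eqP e0.
pose s : A2 -> A2 := mev (@mpolyC 2 k) t t.
have [r1 [r2]] := mev_cong (@mpolyC 2 k) X Y (s (evx a)) (s (evx b)) q.
have -> : mev (@mpolyC 2 k) X Y q = q.
  by apply: (@mpoly2_ext _ _ (mev (@mpolyC 2 k) X Y) idfun) => [c||]; [exact: mevC|exact: mevX|exact: mevY].
have -> : mev (@mpolyC 2 k) (s (evx a)) (s (evx b)) q = s (evx (mev (@polyC k) a b q)).
  have := @mpoly2_ext k _ (mev (@mpolyC 2 k) (s (evx a)) (s (evx b)))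
    [the {rmorphism A2 -> A2} of mev (@mpolyC 2 k) t t \o @evx k \o mev (@polyC k) a b].
  apply=> [c||].
  - have h1 : mev (@polyC k) a b c%:MP = c%:P by exact: mevC.
    have h2 : s c%:MP = c%:MP by exact: mevC.
    by rewrite [LHS]mevC -[RHS]/(s (evx (mev (@polyC k) a b c%:MP))) h1 evxC h2.
  - by rewrite [LHS]mevX -[RHS]/(s (evx (mev (@polyC k) a b _))) [in RHS]mevX.
  by rewrite [LHS]mevY -[RHS]/(s (evx (mev (@polyC k) a b _))) [in RHS]mevY.
rewrite e0 rmorph0 /s rmorph0 add0r ea eb -!mulrA -mulrDr => eq.
case: (iq _ _ eq) => [[e' /(congr1 (pe e f))]|[e' h]].
  by rewrite rmorph1 rmorphM l0 mul0r => /eqP; rewrite oner_eq0.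
by apply: ndq; exists e'; rewrite eq -mulrA -h mulr1.
Qed.
End LineRestriction.

(* [:: d; m1; M1; m2; M2; m3; M3; m4; M4; m5] encodes the class of curves of
   degree d with multiplicity m_i at Q_i; M_i is the sum of the multiplicities
   at Q_i and at the point infinitely near to it.  The fifteen conditions are
   the intersections with the strict transforms of the six lines of the pencil
   and with the exceptional curves. *)
Definition nef (D : seq int) : bool :=
  let: (d, m1, M1, m2, M2) := (D`_0, D`_1, D`_2, D`_3, D`_4) in
  let: (m3, M3, m4, M4, m5) := (D`_5, D`_6, D`_7, D`_8, D`_9) in
  [&& M1 + m3 <= d, m1 + M4 <= d, m2 + M3 <= d, m1 + m2 + m5 <= d, m3 + m4 + m5 <= d,
      M2 + m4 <= d & [&& M1 <= 2 * m1, m1 <= M1, M2 <= 2 * m2, m2 <= M2 &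
      [&& M3 <= 2 * m3, m3 <= M3, M4 <= 2 * m4, m4 <= M4 & 0 <= m5]]].

Section ClassOfCurve.
Variables (k : closedFieldType) (M : funfield k).
Local Notation K := (ff M).
Local Notation cst := (cst M).
Local Notation ev := (@ev k M).
Local Notation birat := (@birat k M).
Local Notation mx := (@mx k M).
Local Notation x := (@fx k M).
Local Notation y := (@fy k M).
Local Notation Wc := (@Wc k M).
Local Notation A2 := {mpoly k[2]}.
Local Notation X := ('X_ord0 : A2).
Local Notation Y := ('X_ord_max : A2).
Variable q : A2.
Hypothesis iq : irr q.
Hypotheses (ndx : ~ dvr q X) (ndy : ~ dvr q Y) (nd1x : ~ dvr q (X - 1)) (nd1y : ~ dvr q (Y - 1))
  (ndxy : ~ dvr q (X + Y - 1)).

(** The equation of the curve in the parameters at Q2, Q4 and Q5. At Q1 and Q3 the coordinates x, y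
    are monomials in the parameters, so q itself can be used. *)
Definition q2 : A2 := mev (@mpolyC 2 k) (1 + Y - X) X q.
Definition q4 : A2 := mev (@mpolyC 2 k) Y (1 - X) q.
Definition q5 : A2 := mev (@mpolyC 2 k) (1 - X) (1 - Y) q.

Lemma ev_subst u v (P Q : A2) : ev u v (mev (@mpolyC 2 k) P Q q) = ev (ev u v P) (ev u v Q) q.
Proof. exact: mev_comp. Qed.

Lemma ev_q2 : ev y (x + y - 1) q2 = ev x y q.
Proof.
rewrite ev_subst evX; congr (ev _ y q).
by rewrite rmorphB rmorphD rmorph1 /= evX evY; ring.
Qed.

Lemma ev_q4 : ev (1 - y) x q4 = ev x y q.
Proof.
rewrite ev_subst evY; congr (ev x _ q).
by rewrite rmorphB rmorph1 /= evX; ring.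
Qed.

Lemma ev_q5 : ev (1 - x) (1 - y) q5 = ev x y q.
Proof. by rewrite ev_subst !rmorphB !rmorph1 /= evX evY !subKr. Qed.

Let q0 : q != 0. Proof. by case: iq. Qed.

Lemma ev_q_neq0 u v (p : A2) : ev u v p = ev x y q -> p != 0.
Proof.
move=> e; apply/eqP => p0; move: (ev_neq0 (b_xy M) q0).
by rewrite -e p0 rmorph0 eqxx.
Qed.

Lemma restr_comp (a b : {poly k}) (P Q : A2) : mev (@polyC k) a b (mev (@mpolyC 2 k) P Q q) =
  mev (@polyC k) (mev (@polyC k) a b P) (mev (@polyC k) a b Q) q.
Proof. exact: mev_comp. Qed.

(** Restrictions of q to the lines x = 0, y = 0, x = 1, y = 1, x + y = 1, parametrized so that the
    affine base points sit at 0 and, on the last three lines, also at 1. *)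
Definition tx0 : {poly k} := mev (@polyC k) 'X 0 q4.
Definition ty0 : {poly k} := mev (@polyC k) 0 'X q2.
Definition tx1 : {poly k} := mev (@polyC k) 'X 'X q2.
Definition ty1 : {poly k} := mev (@polyC k) 0 'X q4.
Definition txy : {poly k} := mev (@polyC k) 'X 'X q4.

Lemma tx0E : tx0 = mev (@polyC k) 0 (1 - 'X) q.
Proof. by rewrite /tx0 restr_comp mevY rmorphB rmorph1 /= mevX. Qed.
Lemma ty0E : ty0 = mev (@polyC k) (1 + 'X) 0 q.
Proof. by rewrite /ty0 restr_comp mevX rmorphB rmorphD rmorph1 /= mevX mevY subr0. Qed.
Lemma tx1E : tx1 = mev (@polyC k) 1 'X q.
Proof. by rewrite /tx1 restr_comp mevX rmorphB rmorphD rmorph1 /= mevX mevY addrK. Qed.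
Lemma ty1E : ty1 = mev (@polyC k) 'X 1 q.
Proof. by rewrite /ty1 restr_comp mevY rmorphB rmorph1 /= mevX subr0. Qed.
Lemma txyE : txy = mev (@polyC k) 'X (1 - 'X) q.
Proof. by rewrite /txy restr_comp mevY rmorphB rmorph1 /= mevX. Qed.

Lemma comp_restr (a b c : {poly k}) (p : A2) : mev (@polyC k) a b p \Po c = mev (@polyC k) (a \Po c) (b \Po c) p.
Proof.
apply: (@mpoly2_ext _ _ (comp_poly c \o mev (@polyC k) a b) (mev (@polyC k) (a \Po c) (b \Po c))) => [e||].
- by rewrite -[LHS]/(mev (@polyC k) a b _ \Po c) mevC [RHS]mevC; exact: comp_polyC.
- by rewrite -[LHS]/(mev (@polyC k) a b _ \Po c) mevX [RHS]mevX.
by rewrite -[LHS]/(mev (@polyC k) a b _ \Po c) mevY [RHS]mevY.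
Qed.

Let c1X : (1 : {poly k}) \Po (1 - 'X) = 1. Proof. by rewrite -polyC1 comp_polyC. Qed.

Lemma tx1_comp : tx1 \Po (1 - 'X) = mev (@polyC k) 0 'X q5.
Proof.
rewrite tx1E comp_restr /q5 restr_comp !rmorphB !rmorph1 /= mevX mevY subr0 comp_polyX.
by rewrite ?c1X.
Qed.

Lemma ty1_comp : ty1 \Po (1 - 'X) = mev (@polyC k) 'X 0 q5.
Proof.
rewrite ty1E comp_restr /q5 restr_comp !rmorphB !rmorph1 /= mevX mevY subr0 comp_polyX.
by rewrite ?c1X.
Qed.

Lemma txy_comp : txy \Po (1 - 'X) = mev (@polyC k) 'X 0 q2.
Proof.
rewrite txyE comp_restr /q2 restr_comp !rmorphB !rmorphD !rmorph1 /= mevX mevY addr0 comp_polyX.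
by rewrite ?c1X subKr.
Qed.

Lemma restr_all : [/\ tx0 != 0, ty0 != 0, tx1 != 0, ty1 != 0 & txy != 0].
Proof.
have E1 (t : A2) : evx (1 : {poly k}) = 1 by rewrite rmorph1.
split.
- rewrite tx0E; apply: (@restr_neq0 k q X _ _ (1 - Y) 1 0 0 0) => //; rewrite ?peX //.
    by rewrite !rmorph0 subr0 mulr1.
  by rewrite !rmorphB !rmorph1 evxX /= mevX subKr subrr mulr0.
- rewrite ty0E; apply: (@restr_neq0 k q Y _ _ (X - 1) 0 1 0 0) => //; rewrite ?peY //.
    by rewrite !rmorphD !rmorph1 evxX /= mevX addrCA subrr addr0 subrr mulr0.
  by rewrite !rmorph0 subr0 mulr1.
- rewrite tx1E; apply: (@restr_neq0 k q (X - 1) _ _ Y 1 0 1 0) => //; first by rewrite rmorphB rmorph1 /= peX subrr.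
    by rewrite !rmorph1 mulr1.
  by rewrite evxX /= mevX subrr mulr0.
- rewrite ty1E; apply: (@restr_neq0 k q (Y - 1) _ _ X 0 1 0 1) => //; first by rewrite rmorphB rmorph1 /= peY subrr.
    by rewrite evxX /= mevX subrr mulr0.
  by rewrite !rmorph1 mulr1.
rewrite txyE; apply: (@restr_neq0 k q (X + Y - 1) _ _ X 0 1 1 0) => //.
- by rewrite rmorphB rmorphD rmorph1 /= peX peY addr0 subrr.
- by rewrite evxX /= mevX subrr mulr0.
by rewrite !rmorphB !rmorph1 evxX /= mevX mulr1 opprB addrCA addrA.
Qed.

Definition lmon (nx ny n1x n1y nxy : nat) : A2 :=
  X ^+ nx * Y ^+ ny * (1 - X) ^+ n1x * (1 - Y) ^+ n1y * (X + Y - 1) ^+ nxy.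

Lemma ev_lmon nx ny n1x n1y nxy : ev x y (lmon nx ny n1x n1y nxy) =
  x ^+ nx * y ^+ ny * (1 - x) ^+ n1x * (1 - y) ^+ n1y * (x + y - 1) ^+ nxy.
Proof.
rewrite /lmon; move: (evX x y) (evY x y) (rmorph1 (ev x y)); move: (ev x y) => e eX eY e1.
by rewrite !rmorphM !rmorphXn !rmorphB rmorphD /= eX eY e1.
Qed.

Lemma order_mul (W : K -> Prop) p a b (m n : int) : lring W -> p != 0 ->
  W (a / p ^ m) -> W (b / p ^ n) -> W (a * b / p ^ (m + n)).
Proof.
move=> lW p0 h1 h2; have -> : a * b / p ^ (m + n) = a / p ^ m * (b / p ^ n).
  by rewrite expfzDr // invfM; ring.
exact: lrM.
Qed.

Lemma order_exp (W : K -> Prop) p a (m : int) n : lring W ->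
  W (a / p ^ m) -> W (a ^+ n / p ^ (m * n%:Z)).
Proof. by move=> lW h; rewrite -exprz_exp -exprnP -expr_div_n; apply: lrX. Qed.

Lemma lmon_order (W : K -> Prop) p (e1 e2 e3 e4 e5 m : int) (e : K) nx ny n1x n1y nxy :
  lring W -> p != 0 -> W p -> W (x / p ^ e1) -> W (y / p ^ e2) -> W ((1 - x) / p ^ e3) ->
  W ((1 - y) / p ^ e4) -> W ((x + y - 1) / p ^ e5) -> iu W (e / p ^ m) ->
  m <= e1 * nx%:Z + e2 * ny%:Z + e3 * n1x%:Z + e4 * n1y%:Z + e5 * nxy%:Z ->
  W (ev x y (lmon nx ny n1x n1y nxy) / e).
Proof.
move=> lW p0 hp h1 h2 h3 h4 h5 [_ he] le; rewrite ev_lmon.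
have := order_mul lW p0 (order_mul lW p0 (order_mul lW p0 (order_mul lW p0
  (order_exp nx lW h1) (order_exp ny lW h2)) (order_exp n1x lW h3)) (order_exp n1y lW h4)) (order_exp nxy lW h5).
set S := x ^+ nx * _ * _ * _ * _; set N := e1 * _ + _ + _ + _ + _ => hS.
have -> : S / e = S / p ^ N * p ^ (N - m) * (e / p ^ m)^-1.
  have {1}-> : N = N - m + m by rewrite subrK.
  rewrite expfzDr // invf_div; have := expfz_neq0 (N - m) p0; have := expfz_neq0 m p0.
  move: (p ^ _) (p ^ _) (e^-1) => a b c a0 b0; field; rewrite b0 a0 //.
apply: lrM => //; apply: lrM => //.
have -> : N - m = `|(N - m)%R|%N by rewrite gez0_abs // subr_ge0.
by rewrite -exprnP; apply: lrX.
Qed.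

(** The product of the six lines with exponents n has degree d and at least the prescribed order
    along each exceptional curve: up to fixed exceptional curves it belongs to the linear system of
    D. *)
Definition admissible (D : seq int) (n : seq nat) : bool :=
  let: (d, m1, M1, m2, M2) := (D`_0, D`_1, D`_2, D`_3, D`_4) in
  let: (m3, M3, m4, M4, m5) := (D`_5, D`_6, D`_7, D`_8, D`_9) in
  let: (n0, nx, ny) := (nth 0%N n 0, nth 0%N n 1, nth 0%N n 2) in
  let: (n1x, n1y, nxy) := (nth 0%N n 3, nth 0%N n 4, nth 0%N n 5) in
  [&& d == (n0 + nx + ny + n1x + n1y + nxy)%:Z, m1 <= (n0 + nx + n1x)%:Z,
    M1 <= (2 * n0 + nx + n1x)%:Z, m2 <= (ny + n1x + nxy)%:Z, M2 <= (ny + n1x + 2 * nxy)%:Z,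
    m3 <= (n0 + ny + n1y)%:Z & [&& M3 <= (n0 + 2 * ny + n1y)%:Z,
    m4 <= (nx + n1y + nxy)%:Z, M4 <= (2 * nx + n1y + nxy)%:Z & m5 <= (n1x + n1y)%:Z]].

Lemma exceptional_order p v u w (i i' j j' : int) (r : A2) : birat p v ->
  u = p ^ i * v ^ i' -> w = p ^ j * v ^ j' -> i * j' - i' * j != 0 -> ev u w r = ev x y q ->
  exists2 m0 : 'X_{1..2}, forall m : 'X_{1..2}, m \in msupp r ->
    i * (m0 ord0)%:Z + j * (m0 ord_max)%:Z <= i * (m ord0)%:Z + j * (m ord_max)%:Z
  & m0 \in msupp r /\ iu (Wc p v X) (ev x y q / p ^ (i * (m0 ord0)%:Z + j * (m0 ord_max)%:Z)).
Proof.
move=> b eu ew hd er; have r0 := ev_q_neq0 er.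
by have [m0 [h1 h2 h3]] := mono_ord b eu ew hd r0; exists m0 => //; rewrite -er.
Qed.

End ClassOfCurve.

Ltac nzq := match goal with |- is_true (?A != 0) =>
  first [ nz1 | (have -> : A = 1 by ring); exact: oner_neq0
        | (have -> : A = - 1 by ring); rewrite oppr_eq0; exact: oner_neq0 ] end.
Ltac fieldq := field; rewrite /=; repeat (apply/andP; split); nzq.

Ltac lrs lW := first [ done | apply: (lr1 lW) | apply: (lrB lW); lrs lW
  | apply: (lrD lW); lrs lW | apply: (lrM lW); lrs lW ].

Section ClassOfCurve2.
Variables (k : closedFieldType) (M : funfield k).
Local Notation K := (ff M).
Local Notation cst := (cst M).
Local Notation ev := (@ev k M).
Local Notation birat := (@birat k M).
Local Notation mx := (@mx k M).
Local Notation x := (@fx k M).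
Local Notation y := (@fy k M).
Local Notation Wc := (@Wc k M).
Local Notation A2 := {mpoly k[2]}.
Local Notation X := ('X_ord0 : A2).
Local Notation Y := ('X_ord_max : A2).
Variable q : A2.
Hypothesis iq : irr q.
Hypotheses (ndx : ~ dvr q X) (ndy : ~ dvr q Y) (nd1x : ~ dvr q (X - 1)) (nd1y : ~ dvr q (Y - 1))
  (ndxy : ~ dvr q (X + Y - 1)).

Definition line_mon (n : seq nat) : A2 :=
  lmon k (nth 0%N n 1) (nth 0%N n 2) (nth 0%N n 3) (nth 0%N n 4) (nth 0%N n 5).

(** The orders of q along the ten curves of [exc] are least weights of monomials ([mono_ord]). The
    same weights bound the orders and degrees of the restrictions to the lines, which gives nefness,
    and comparing orders of q with those of a product of lines gives the sections. *)
Lemma class_of_curve : exists D : seq int, [/\ size D = 10%N, nef D, 0 < D`_0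
  & forall n, admissible D n -> forall p, p \in exc M -> Wc p.1 p.2 X
    (ev x y (line_mon n) / ev x y q)].
Proof.
have x_0 := fx_neq0 M; have y_0 := fy_neq0 M.
have [[n1 n2 n3 n4 n5] [n6 n7 n8 n9]] := nz_lines2 M.
have bI := birat_1y M; have eqq : ev x y q = ev x y q by [].
have bE u v : birat u v -> birat v (u / v) by move=> b; apply/birat_div/birat_swap.
have bP u v : birat u v -> birat u (v / u ^+ 2).
  by move=> b; rewrite expr2 invfM mulrA; apply/birat_div/birat_div.
have b1 := typeII_birat (TypeII1 M); have b2 := typeII_birat (TypeII2 M).
have b3 := typeII_birat (TypeII3 M); have b4 := typeII_birat (TypeII4 M).
have b5 := typeI_birat M.

(* Orders of the equation along the ten curves outside the affine plane *)
have [|||mL hL [sL uL]] := @exceptional_order k M q iq (1 / y) (x / y) x y (-1) 1 (-1) 0 q bI _ _ _ eqq.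
- by rewrite exprN1 expr1z; fieldq.
- by rewrite exprN1 expr0z mulr1; fieldq.
- by [].
have [|||mE1 hE1 [sE1 uE1]] := @exceptional_order k M q iq _ _ x y 0 1 (-1) 0 q (bE _ _ b1) _ _ _ eqq.
- by rewrite expr0z expr1z; fieldq.
- by rewrite exprN1 expr0z; fieldq.
- by [].
have [|||mP1 hP1 [sP1 uP1]] := @exceptional_order k M q iq _ _ x y (-1) (-1) (-2) (-1) q (bP _ _ b1) _ _ _ eqq.
- by rewrite !exprN1; fieldq.
- by rewrite exprN1 -exprnN; fieldq.
- by [].
have [|||mE3 hE3 [sE3 uE3]] := @exceptional_order k M q iq _ _ x y (-1) (-1) 0 (-1) q (bE _ _ b3) _ _ _ eqq.
- by rewrite !exprN1; fieldq.
- by rewrite exprN1 expr0z; fieldq.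
- by [].
have [|||mP3 hP3 [sP3 uP3]] := @exceptional_order k M q iq _ _ x y (-1) 0 1 1 q (bP _ _ b3) _ _ _ eqq.
- by rewrite exprN1 expr0z; fieldq.
- by rewrite !expr1z; fieldq.
- by [].
have hEu (u v : K) : v != 0 -> u = v ^ 1 * (u / v) ^ 1 /\ v = v ^ 1 * (u / v) ^ 0.
  by move=> h; rewrite !expr1z expr0z mulr1 mulrC divfK.
have hPu (u v : K) : u != 0 -> u = u ^ 1 * (v / u ^+ 2) ^ 0 /\ v = u ^ 2 * (v / u ^+ 2) ^ 1.
  by move=> h; rewrite !expr1z expr0z mulr1 mulrC divfK // expf_neq0.
have [e1 e2] := hEu y _ n7; have [mE2 hE2 [sE2 uE2]] := exceptional_order iq (bE _ _ b2) e1 e2 isT (ev_q2 M q).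
have {e1 e2}[e1 e2] := hPu _ (x + y - 1) n9; have [mP2 hP2 [sP2 uP2]] := exceptional_order iq (bP _ _ b2) e1 e2 isT (ev_q2 M q).
have {e1 e2}[e1 e2] := hEu (1 - y) _ n8; have [mE4 hE4 [sE4 uE4]] := exceptional_order iq (bE _ _ b4) e1 e2 isT (ev_q4 M q).
have {e1 e2}[e1 e2] := hPu _ x n4; have [mP4 hP4 [sP4 uP4]] := exceptional_order iq (bP _ _ b4) e1 e2 isT (ev_q4 M q).
have {e1 e2}[e1 e2] := hEu (1 - x) _ n4; have [mE5 hE5 [sE5 uE5]] := exceptional_order iq (bE _ _ b5) e1 e2 isT (ev_q5 M q).
have [t1 t2 t3 t4 t5] := restr_all iq ndx ndy nd1x nd1y ndxy.
have bnd1 := zeros_le_degree t1; have bnd2 := zeros_le_degree t2; have bnd3 := zeros_le_degree t3.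
have bnd4 := zeros_le_degree t4; have bnd5 := zeros_le_degree t5.
pose d : int := (mL ord0)%:Z + (mL ord_max)%:Z.
(* Near Q1 and Q3 the curve has local equations q / y^d and q / x^d. On the two curves over Q1 the
   factor y^-d contributes d and 2 d, on both curves over Q3 the factor x^-d contributes d. At the
   other points q is a local equation. *)
pose m1 : int := d - (mE1 ord_max)%:Z.
pose M1 : int := 2 * d - (mP1 ord0)%:Z - 2 * (mP1 ord_max)%:Z.
pose m2 : int := (mE2 ord0)%:Z + (mE2 ord_max)%:Z.
pose M2 : int := (mP2 ord0)%:Z + 2 * (mP2 ord_max)%:Z.
pose m3 : int := d - (mE3 ord0)%:Z.
pose M3 : int := d - (mP3 ord0)%:Z + (mP3 ord_max)%:Z.
pose m4 : int := (mE4 ord0)%:Z + (mE4 ord_max)%:Z.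
pose M4 : int := (mP4 ord0)%:Z + 2 * (mP4 ord_max)%:Z.
pose m5 : int := (mE5 ord0)%:Z + (mE5 ord_max)%:Z.
have hd m : m \in msupp q -> (m ord0)%:Z + (m ord_max)%:Z <= d by move=> /hL; rewrite /d; clear; lia.
have hm1 m : m \in msupp q -> (m ord_max)%:Z <= d - m1 by move=> /hE1; rewrite /m1; clear; lia.
have hM1 m : m \in msupp q -> M1 <= 2 * d - (m ord0)%:Z - 2 * (m ord_max)%:Z by move=> /hP1; rewrite /M1; clear; lia.
have hm3 m : m \in msupp q -> (m ord0)%:Z <= d - m3 by move=> /hE3; rewrite /m3; clear; lia.
have hM3 m : m \in msupp q -> M3 <= d - (m ord0)%:Z + (m ord_max)%:Z by move=> /hP3; rewrite /M3; clear; lia.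
have hm2 m : m \in msupp (q2 q) -> m2 <= (m ord0)%:Z + (m ord_max)%:Z by move=> /hE2; rewrite /m2; clear; lia.
have hM2 m : m \in msupp (q2 q) -> M2 <= (m ord0)%:Z + 2 * (m ord_max)%:Z by move=> /hP2; rewrite /M2; clear; lia.
have hm4 m : m \in msupp (q4 q) -> m4 <= (m ord0)%:Z + (m ord_max)%:Z by move=> /hE4; rewrite /m4; clear; lia.
have hM4 m : m \in msupp (q4 q) -> M4 <= (m ord0)%:Z + 2 * (m ord_max)%:Z by move=> /hP4; rewrite /M4; clear; lia.
have hm5 m : m \in msupp (q5 q) -> m5 <= (m ord0)%:Z + (m ord_max)%:Z by move=> /hE5; rewrite /m5; clear; lia.
have eL := hd _ sL.

(* Intersections with the exceptional curves *)
have f1 := hd _ sE1; have f2 := hd _ sP1; have f3 := hd _ sE3; have f4 := hd _ sP3.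
have nE1 : 0 <= m1 by move: f1; rewrite /m1; clear; lia.
have nP1 : m1 <= M1 by move: (hm1 _ sP1) f2; rewrite /M1; clear; lia.
have nE1' : M1 <= 2 * m1 by move: (hM1 _ sE1) f1; rewrite /m1; clear; lia.
have nE3 : 0 <= m3 by move: f3; rewrite /m3; clear; lia.
have nP3 : m3 <= M3 by move: (hm3 _ sP3); rewrite /M3; clear; lia.
have nE3' : M3 <= 2 * m3 by move: (hM3 _ sE3) f3; rewrite /m3; clear; lia.
have nP2 : m2 <= M2 by move: (hm2 _ sP2); rewrite /M2; clear; lia.
have nE2' : M2 <= 2 * m2 by move: (hM2 _ sE2); rewrite /m2; clear; lia.
have nP4 : m4 <= M4 by move: (hm4 _ sP4); rewrite /M4; clear; lia.
have nE4' : M4 <= 2 * m4 by move: (hM4 _ sE4); rewrite /m4; clear; lia.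
have nE5 : 0 <= m5 by rewrite /m5; clear; lia.
have nE2 : 0 <= m2 by rewrite /m2; clear; lia.
have nE4 : 0 <= m4 by rewrite /m4; clear; lia.
have dm1 : 0 <= d - m1 by rewrite /m1 opprB addrC subrK; clear; lia.
have dm3 : 0 <= d - m3 by rewrite /m3 opprB addrC subrK; clear; lia.
have g0 : d = (mL ord0)%:Z + (mL ord_max)%:Z by [].

(* Intersections with the six lines *)
have l0 : M1 + m3 <= d by move: (hM1 _ sL) (hm3 _ sL) g0; clear; lia.
have s1X : (size (1 - 'X : {poly k})%R <= 2)%N by rewrite -opprB size_polyN -polyC1 size_XsubC.
have s1Xp : (size (1 + 'X : {poly k})%R <= 2)%N.
  by rewrite addrC -[1]opprK -polyC1 -polyCN size_XsubC.
have sX : (size ('X : {poly k}) <= 2)%N by rewrite size_polyX.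
have X0n (n a : nat) (c : {poly k}) : (0 < a)%N -> 'X^n %| c * 0 ^+ a.
  by move=> h; rewrite expr0n eqn0Ngt h mulr0 dvdp0.
have X0n' (n a : nat) (c : {poly k}) : (0 < a)%N -> 'X^n %| 0 ^+ a * c.
  by move=> h; rewrite expr0n eqn0Ngt h mul0r dvdp0.
(* The line x = 0 has the direction of the point infinitely near to Q4, so the restriction has order
   at least M4 there. Its degree is at most the degree of q in y, that is d - m1. The other lines
   are similar. *)
have lx : m1 + M4 <= d.
  have : (`|M4|%N + 0 <= `|(d - m1)%R|%N)%N; last by move: nE4 nP4 dm1; clear; lia.
  apply: bnd1; rewrite ?dvd1p //.
    apply: restr_dvd => m /hM4 h; have [b0|b0] := posnP (m ord_max); last exact: X0n.
    by rewrite b0 mulr1 -[X in _ %| X]mul1r; apply: XnX_dvd; move: h nE4 nE2 nE5 nP2 nP4; rewrite ?a0 ?b0; clear; lia.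
  rewrite tx0E; apply: restr_size => m /hm1 h.
  case: (posnP (m ord0)) => [->|a0]; last by rewrite expr0n eqn0Ngt a0 mul0r size_poly0.
  by rewrite mul1r; apply: leq_trans (size_linX _ s1X) _; move: h dm1; clear; lia.
have ly : m2 + M3 <= d.
  (* Needed first because an absolute value of d - M3 is used as a degree; if M3 exceeded d, the
     restriction to y = 0 would be zero. *)
  have dM3 : M3 <= d.
    rewrite leNgt; apply/negP => lt; move: t2; rewrite -size_poly_eq0 -leqn0.
    apply/negP/negPn; rewrite ty0E; apply: restr_size => m /hM3 h.
    have b0 : (0 < m ord_max)%N by move: h lt; clear; lia.
    by rewrite [0 ^+ _]expr0n eqn0Ngt b0 mulr0 size_poly0.
  have : (`|m2|%N + 0 <= `|(d - M3)%R|%N)%N; last by move: nE2 dM3; clear; lia.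
  apply: bnd2; rewrite ?dvd1p //.
    apply: restr_dvd => m /hm2 h; have [a0|a0] := posnP (m ord0); last exact: X0n'.
    by rewrite a0; apply: XnX_dvd; move: h nE4 nE2 nE5 nP2 nP4; rewrite ?a0 ?b0; clear; lia.
  rewrite ty0E; apply: restr_size => m /hM3 h.
  case: (posnP (m ord_max)) => [e|a0]; last by rewrite [0 ^+ _]expr0n eqn0Ngt a0 mulr0 size_poly0.
  by rewrite e mulr1; apply: leq_trans (size_linX _ s1Xp) _; move: h; rewrite e; clear; lia.
have l1x : m1 + m2 + m5 <= d.
  have : (`|m2|%N + `|m5|%N <= `|(d - m1)%R|%N)%N; last by move: nE2 nE5 dm1; clear; lia.
  apply: bnd3.
  - apply: restr_dvd => m /hm2 h; rewrite -exprD -[X in _ %| X]mul1r; apply: XnX_dvd; move: h nE4 nE2 nE5 nP2 nP4; rewrite ?a0 ?b0; clear; lia.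
  - rewrite tx1_comp; apply: restr_dvd => m /hm5 h.
    have [a0|a0] := posnP (m ord0); last exact: X0n'.
    by rewrite a0; apply: XnX_dvd; move: h nE4 nE2 nE5 nP2 nP4; rewrite ?a0 ?b0; clear; lia.
  by rewrite tx1E; apply: restr_size => m /hm1 h; rewrite expr1n mul1r size_polyXn; move: h dm1; clear; lia.
have l1y : m3 + m4 + m5 <= d.
  have : (`|m4|%N + `|m5|%N <= `|(d - m3)%R|%N)%N; last by move: nE4 nE5 dm3; clear; lia.
  apply: bnd4.
  - apply: restr_dvd => m /hm4 h; have [a0|a0] := posnP (m ord0); last exact: X0n'.
    by rewrite a0; apply: XnX_dvd; move: h nE4 nE2 nE5 nP2 nP4; rewrite ?a0 ?b0; clear; lia.
  - rewrite ty1_comp; apply: restr_dvd => m /hm5 h.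
    have [a0|a0] := posnP (m ord_max); last exact: X0n.
    by rewrite a0 mulr1 -[X in _ %| X]mul1r; apply: XnX_dvd; move: h nE4 nE2 nE5 nP2 nP4; rewrite ?a0 ?b0; clear; lia.
  by rewrite ty1E; apply: restr_size => m /hm3 h; rewrite expr1n mulr1 size_polyXn; move: h dm3; clear; lia.
have lxy : M2 + m4 <= d.
  have : (`|m4|%N + `|M2|%N <= `|d|%N)%N; last by move: nE4 nP4 nE2 nP2 g0; clear; lia.
  apply: bnd5.
  - apply: restr_dvd => m /hm4 h; rewrite -exprD -[X in _ %| X]mul1r; apply: XnX_dvd; move: h nE4 nE2 nE5 nP2 nP4; rewrite ?a0 ?b0; clear; lia.
  - rewrite txy_comp; apply: restr_dvd => m /hM2 h.
    have [a0|a0] := posnP (m ord_max); last exact: X0n.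
    by rewrite a0 mulr1 -[X in _ %| X]mul1r; apply: XnX_dvd; move: h nE4 nE2 nE5 nP2 nP4; rewrite ?a0 ?b0; clear; lia.
  rewrite txyE; apply: restr_size => m /hd h.
  have := size_lin2 (m ord0) (m ord_max) sX s1X; move/leq_trans; apply.
  by move: h; clear; lia.
exists [:: d; m1; M1; m2; M2; m3; M3; m4; M4; m5]; split=> //.
- by rewrite /nef /= l0 lx ly l1x l1y lxy nE1' nP1 nE2' nP2 nE3' nP3 nE4' nP4 nE5.
- rewrite /= lt_neqAle; apply/andP; split; last by rewrite /d; clear; lia.
  apply/negP => /eqP d0; case: iq => q0 nq _; apply: nq.
  pose c := \sum_(m <- msupp q) q@_m.
  have ec : q = c%:MP.
    apply: (birat_inj (b_xy M)); rewrite evC evE mevE rmorph_sum; apply: eq_big_seq => m /hd le.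
    have [-> ->] : m ord0 = 0%N /\ m ord_max = 0%N by move: d0 le; clear; lia.
    by rewrite !expr0 !mulr1.
  exists (c^-1)%:MP; rewrite ec -rmorphM divff ?rmorph1 //.
  by apply: contraNneq q0 => c0; rewrite ec c0 rmorph0.

(* Products of lines as sections *)
move=> n; rewrite /line_mon => adm; move: adm; rewrite /admissible [D in D -> _]/=.
move: (nth 0%N n 0) (nth 0%N n 1) (nth 0%N n 2) (nth 0%N n 3) (nth 0%N n 4) (nth 0%N n 5).
move=> n0' nx ny n1x n1y nxy /and5P[a0 a1 a2 a3 /and5P[a4 a5 a6 a7 /andP[a8 a9]]].
have wc p v : birat p v -> [/\ lring (Wc p v X), p != 0, Wc p v X p, Wc p v X v & Wc p v X v^-1].
  move=> b; have iX := irr_X k; have lW := Wc_lring b iX; have [p0 v0] := birat_neq0 b.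
  have : iu (Wc p v X) (ev p v Y) by apply: Wc_iu => //; rewrite rX_Y polyX_eq0.
  rewrite evY => -[h1 h2]; split=> //.
  by have := Wc_ev p v iX X; rewrite evX.
have z2 (p : K) : p ^ (2 : int) = p * p by rewrite -exprnP expr2.
have zN2 (p : K) : p ^ (- 2 : int) = (p * p)^-1 by rewrite -exprnN expr2.
move=> p; rewrite /exc !inE => /orP[|/orP[|/orP[|/orP[|/orP[|/orP[|/orP[|/orP[|/orP[]]]]]]]]] /eqP->.
- have [lW p0 hp hv hvi] := wc _ _ bI; rewrite [p in Wc p]/= [p in Wc _ p]/=.
  (* In this block and the nine that follow, [e1] to [e5] are the orders of x, y, 1 - x, 1 - y, x +
     y - 1 along the curve considered. *)
  apply: (lmon_order (e1 := (-1)) (e2 := (-1)) (e3 := (-1)) (e4 := (-1)) (e5 := (-1)) lW p0 hp _ _ _ _ _ uL).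
  + have -> : x / (1 / y) ^ (-1) = (x / y) by rewrite ?expr0z ?expr1z ?exprN1 ?z2 ?zN2; fieldq.
    by lrs lW.
  + have -> : y / (1 / y) ^ (-1) = 1 by rewrite ?expr0z ?expr1z ?exprN1 ?z2 ?zN2; fieldq.
    by lrs lW.
  + have -> : (1 - x) / (1 / y) ^ (-1) = (1 / y) - (x / y) by rewrite ?expr0z ?expr1z ?exprN1 ?z2 ?zN2; fieldq.
    by lrs lW.
  + have -> : (1 - y) / (1 / y) ^ (-1) = (1 / y) - 1 by rewrite ?expr0z ?expr1z ?exprN1 ?z2 ?zN2; fieldq.
    by lrs lW.
  + have -> : (x + y - 1) / (1 / y) ^ (-1) = (x / y) + 1 - (1 / y) by rewrite ?expr0z ?expr1z ?exprN1 ?z2 ?zN2; fieldq.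
    by lrs lW.
  by move: a0 a1 a2 a3 a4 a5 a6 a7 a8 a9; rewrite /d /m1 /M1 /m2 /M2 /m3 /M3 /m4 /M4 /m5; clear; lia.
- have [lW p0 hp hv hvi] := wc _ _ (bE _ _ b5); rewrite [p in Wc p]/= [p in Wc _ p]/=.
  apply: (lmon_order (e1 := 0) (e2 := 0) (e3 := 1) (e4 := 1) (e5 := 0) lW p0 hp _ _ _ _ _ uE5).
  + have -> : x / (1 - y) ^ (0) = 1 - (1 - y) * ((1 - x) / (1 - y)) by rewrite ?expr0z ?expr1z ?exprN1 ?z2 ?zN2; fieldq.
    by lrs lW.
  + have -> : y / (1 - y) ^ (0) = 1 - (1 - y) by rewrite ?expr0z ?expr1z ?exprN1 ?z2 ?zN2; fieldq.
    by lrs lW.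
  + have -> : (1 - x) / (1 - y) ^ (1) = ((1 - x) / (1 - y)) by rewrite ?expr0z ?expr1z ?exprN1 ?z2 ?zN2; fieldq.
    by lrs lW.
  + have -> : (1 - y) / (1 - y) ^ (1) = 1 by rewrite ?expr0z ?expr1z ?exprN1 ?z2 ?zN2; fieldq.
    by lrs lW.
  + have -> : (x + y - 1) / (1 - y) ^ (0) = 1 - (1 - y) * ((1 - x) / (1 - y)) - (1 - y) by rewrite ?expr0z ?expr1z ?exprN1 ?z2 ?zN2; fieldq.
    by lrs lW.
  by move: a0 a1 a2 a3 a4 a5 a6 a7 a8 a9; rewrite /d /m1 /M1 /m2 /M2 /m3 /M3 /m4 /M4 /m5; clear; lia.
- have [lW p0 hp hv hvi] := wc _ _ (bE _ _ b1); rewrite [p in Wc p]/= [p in Wc _ p]/=.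
  apply: (lmon_order (e1 := 0) (e2 := (-1)) (e3 := 0) (e4 := (-1)) (e5 := (-1)) lW p0 hp _ _ _ _ _ uE1).
  + have -> : x / (1 / y) ^ (0) = (x / y / (1 / y)) by rewrite ?expr0z ?expr1z ?exprN1 ?z2 ?zN2; fieldq.
    by lrs lW.
  + have -> : y / (1 / y) ^ (-1) = 1 by rewrite ?expr0z ?expr1z ?exprN1 ?z2 ?zN2; fieldq.
    by lrs lW.
  + have -> : (1 - x) / (1 / y) ^ (0) = 1 - (x / y / (1 / y)) by rewrite ?expr0z ?expr1z ?exprN1 ?z2 ?zN2; fieldq.
    by lrs lW.
  + have -> : (1 - y) / (1 / y) ^ (-1) = (1 / y) - 1 by rewrite ?expr0z ?expr1z ?exprN1 ?z2 ?zN2; fieldq.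
    by lrs lW.
  + have -> : (x + y - 1) / (1 / y) ^ (-1) = (1 / y) * (x / y / (1 / y)) + 1 - (1 / y) by rewrite ?expr0z ?expr1z ?exprN1 ?z2 ?zN2; fieldq.
    by lrs lW.
  by move: a0 a1 a2 a3 a4 a5 a6 a7 a8 a9; rewrite /d /m1 /M1 /m2 /M2 /m3 /M3 /m4 /M4 /m5; clear; lia.
- have [lW p0 hp hv hvi] := wc _ _ (bP _ _ b1); rewrite [p in Wc p]/= [p in Wc _ p]/=.
  apply: (lmon_order (e1 := (-1)) (e2 := (-2)) (e3 := (-1)) (e4 := (-2)) (e5 := (-2)) lW p0 hp _ _ _ _ _ uP1).
  + have -> : x / (x / y) ^ (-1) = (1 / y / (x / y) ^+ 2)^-1 by rewrite ?expr0z ?expr1z ?exprN1 ?z2 ?zN2; fieldq.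
    by lrs lW.
  + have -> : y / (x / y) ^ (-2) = (1 / y / (x / y) ^+ 2)^-1 by rewrite ?expr0z ?expr1z ?exprN1 ?z2 ?zN2; fieldq.
    by lrs lW.
  + have -> : (1 - x) / (x / y) ^ (-1) = (x / y) - (1 / y / (x / y) ^+ 2)^-1 by rewrite ?expr0z ?expr1z ?exprN1 ?z2 ?zN2; fieldq.
    by lrs lW.
  + have -> : (1 - y) / (x / y) ^ (-2) = (x / y) * (x / y) - (1 / y / (x / y) ^+ 2)^-1 by rewrite ?expr0z ?expr1z ?exprN1 ?z2 ?zN2; fieldq.
    by lrs lW.
  + have -> : (x + y - 1) / (x / y) ^ (-2) = (x / y) * (1 / y / (x / y) ^+ 2)^-1 + (1 / y / (x / y) ^+ 2)^-1 - (x / y) * (x / y) by rewrite ?expr0z ?expr1z ?exprN1 ?z2 ?zN2; fieldq.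
    by lrs lW.
  by move: a0 a1 a2 a3 a4 a5 a6 a7 a8 a9; rewrite /d /m1 /M1 /m2 /M2 /m3 /M3 /m4 /M4 /m5; clear; lia.
- have [lW p0 hp hv hvi] := wc _ _ (bE _ _ b2); rewrite [p in Wc p]/= [p in Wc _ p]/=.
  apply: (lmon_order (e1 := 0) (e2 := 1) (e3 := 1) (e4 := 0) (e5 := 1) lW p0 hp _ _ _ _ _ uE2).
  + have -> : x / (x + y - 1) ^ (0) = 1 + (x + y - 1) - (x + y - 1) * (y / (x + y - 1)) by rewrite ?expr0z ?expr1z ?exprN1 ?z2 ?zN2; fieldq.
    by lrs lW.
  + have -> : y / (x + y - 1) ^ (1) = (y / (x + y - 1)) by rewrite ?expr0z ?expr1z ?exprN1 ?z2 ?zN2; fieldq.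
    by lrs lW.
  + have -> : (1 - x) / (x + y - 1) ^ (1) = (y / (x + y - 1)) - 1 by rewrite ?expr0z ?expr1z ?exprN1 ?z2 ?zN2; fieldq.
    by lrs lW.
  + have -> : (1 - y) / (x + y - 1) ^ (0) = 1 - (x + y - 1) * (y / (x + y - 1)) by rewrite ?expr0z ?expr1z ?exprN1 ?z2 ?zN2; fieldq.
    by lrs lW.
  + have -> : (x + y - 1) / (x + y - 1) ^ (1) = 1 by rewrite ?expr0z ?expr1z ?exprN1 ?z2 ?zN2; fieldq.
    by lrs lW.
  by move: a0 a1 a2 a3 a4 a5 a6 a7 a8 a9; rewrite /d /m1 /M1 /m2 /M2 /m3 /M3 /m4 /M4 /m5; clear; lia.
- have [lW p0 hp hv hvi] := wc _ _ (bP _ _ b2); rewrite [p in Wc p]/= [p in Wc _ p]/=.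
  apply: (lmon_order (e1 := 0) (e2 := 1) (e3 := 1) (e4 := 0) (e5 := 2) lW p0 hp _ _ _ _ _ uP2).
  + have -> : x / (y) ^ (0) = 1 + (y) * (y) * ((x + y - 1) / y ^+ 2) - (y) by rewrite ?expr0z ?expr1z ?exprN1 ?z2 ?zN2; fieldq.
    by lrs lW.
  + have -> : y / (y) ^ (1) = 1 by rewrite ?expr0z ?expr1z ?exprN1 ?z2 ?zN2; fieldq.
    by lrs lW.
  + have -> : (1 - x) / (y) ^ (1) = 1 - (y) * ((x + y - 1) / y ^+ 2) by rewrite ?expr0z ?expr1z ?exprN1 ?z2 ?zN2; fieldq.
    by lrs lW.
  + have -> : (1 - y) / (y) ^ (0) = 1 - (y) by rewrite ?expr0z ?expr1z ?exprN1 ?z2 ?zN2; fieldq.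
    by lrs lW.
  + have -> : (x + y - 1) / (y) ^ (2) = ((x + y - 1) / y ^+ 2) by rewrite ?expr0z ?expr1z ?exprN1 ?z2 ?zN2; fieldq.
    by lrs lW.
  by move: a0 a1 a2 a3 a4 a5 a6 a7 a8 a9; rewrite /d /m1 /M1 /m2 /M2 /m3 /M3 /m4 /M4 /m5; clear; lia.
- have [lW p0 hp hv hvi] := wc _ _ (bE _ _ b3); rewrite [p in Wc p]/= [p in Wc _ p]/=.
  apply: (lmon_order (e1 := (-1)) (e2 := 0) (e3 := (-1)) (e4 := 0) (e5 := (-1)) lW p0 hp _ _ _ _ _ uE3).
  + have -> : x / (y / x) ^ (-1) = (1 / x / (y / x))^-1 by rewrite ?expr0z ?expr1z ?exprN1 ?z2 ?zN2; fieldq.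
    by lrs lW.
  + have -> : y / (y / x) ^ (0) = (1 / x / (y / x))^-1 by rewrite ?expr0z ?expr1z ?exprN1 ?z2 ?zN2; fieldq.
    by lrs lW.
  + have -> : (1 - x) / (y / x) ^ (-1) = (y / x) - (1 / x / (y / x))^-1 by rewrite ?expr0z ?expr1z ?exprN1 ?z2 ?zN2; fieldq.
    by lrs lW.
  + have -> : (1 - y) / (y / x) ^ (0) = 1 - (1 / x / (y / x))^-1 by rewrite ?expr0z ?expr1z ?exprN1 ?z2 ?zN2; fieldq.
    by lrs lW.
  + have -> : (x + y - 1) / (y / x) ^ (-1) = (1 / x / (y / x))^-1 + (y / x) * (1 / x / (y / x))^-1 - (y / x) by rewrite ?expr0z ?expr1z ?exprN1 ?z2 ?zN2; fieldq.
    by lrs lW.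
  by move: a0 a1 a2 a3 a4 a5 a6 a7 a8 a9; rewrite /d /m1 /M1 /m2 /M2 /m3 /M3 /m4 /M4 /m5; clear; lia.
- have [lW p0 hp hv hvi] := wc _ _ (bP _ _ b3); rewrite [p in Wc p]/= [p in Wc _ p]/=.
  apply: (lmon_order (e1 := (-1)) (e2 := 1) (e3 := (-1)) (e4 := 0) (e5 := (-1)) lW p0 hp _ _ _ _ _ uP3).
  + have -> : x / (1 / x) ^ (-1) = 1 by rewrite ?expr0z ?expr1z ?exprN1 ?z2 ?zN2; fieldq.
    by lrs lW.
  + have -> : y / (1 / x) ^ (1) = (y / x / (1 / x) ^+ 2) by rewrite ?expr0z ?expr1z ?exprN1 ?z2 ?zN2; fieldq.
    by lrs lW.
  + have -> : (1 - x) / (1 / x) ^ (-1) = (1 / x) - 1 by rewrite ?expr0z ?expr1z ?exprN1 ?z2 ?zN2; fieldq.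
    by lrs lW.
  + have -> : (1 - y) / (1 / x) ^ (0) = 1 - (1 / x) * (y / x / (1 / x) ^+ 2) by rewrite ?expr0z ?expr1z ?exprN1 ?z2 ?zN2; fieldq.
    by lrs lW.
  + have -> : (x + y - 1) / (1 / x) ^ (-1) = 1 + (1 / x) * (1 / x) * (y / x / (1 / x) ^+ 2) - (1 / x) by rewrite ?expr0z ?expr1z ?exprN1 ?z2 ?zN2; fieldq.
    by lrs lW.
  by move: a0 a1 a2 a3 a4 a5 a6 a7 a8 a9; rewrite /d /m1 /M1 /m2 /M2 /m3 /M3 /m4 /M4 /m5; clear; lia.
- have [lW p0 hp hv hvi] := wc _ _ (bE _ _ b4); rewrite [p in Wc p]/= [p in Wc _ p]/=.
  apply: (lmon_order (e1 := 1) (e2 := 0) (e3 := 0) (e4 := 1) (e5 := 1) lW p0 hp _ _ _ _ _ uE4).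
  + have -> : x / (x) ^ (1) = 1 by rewrite ?expr0z ?expr1z ?exprN1 ?z2 ?zN2; fieldq.
    by lrs lW.
  + have -> : y / (x) ^ (0) = 1 - (x) * ((1 - y) / x) by rewrite ?expr0z ?expr1z ?exprN1 ?z2 ?zN2; fieldq.
    by lrs lW.
  + have -> : (1 - x) / (x) ^ (0) = 1 - (x) by rewrite ?expr0z ?expr1z ?exprN1 ?z2 ?zN2; fieldq.
    by lrs lW.
  + have -> : (1 - y) / (x) ^ (1) = ((1 - y) / x) by rewrite ?expr0z ?expr1z ?exprN1 ?z2 ?zN2; fieldq.
    by lrs lW.
  + have -> : (x + y - 1) / (x) ^ (1) = 1 - ((1 - y) / x) by rewrite ?expr0z ?expr1z ?exprN1 ?z2 ?zN2; fieldq.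
    by lrs lW.
  by move: a0 a1 a2 a3 a4 a5 a6 a7 a8 a9; rewrite /d /m1 /M1 /m2 /M2 /m3 /M3 /m4 /M4 /m5; clear; lia.
- have [lW p0 hp hv hvi] := wc _ _ (bP _ _ b4); rewrite [p in Wc p]/= [p in Wc _ p]/=.
  apply: (lmon_order (e1 := 2) (e2 := 0) (e3 := 0) (e4 := 1) (e5 := 1) lW p0 hp _ _ _ _ _ uP4).
  + have -> : x / (1 - y) ^ (2) = (x / (1 - y) ^+ 2) by rewrite ?expr0z ?expr1z ?exprN1 ?z2 ?zN2; fieldq.
    by lrs lW.
  + have -> : y / (1 - y) ^ (0) = 1 - (1 - y) by rewrite ?expr0z ?expr1z ?exprN1 ?z2 ?zN2; fieldq.
    by lrs lW.
  + have -> : (1 - x) / (1 - y) ^ (0) = 1 - (1 - y) * (1 - y) * (x / (1 - y) ^+ 2) by rewrite ?expr0z ?expr1z ?exprN1 ?z2 ?zN2; fieldq.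
    by lrs lW.
  + have -> : (1 - y) / (1 - y) ^ (1) = 1 by rewrite ?expr0z ?expr1z ?exprN1 ?z2 ?zN2; fieldq.
    by lrs lW.
  + have -> : (x + y - 1) / (1 - y) ^ (1) = (1 - y) * (x / (1 - y) ^+ 2) - 1 by rewrite ?expr0z ?expr1z ?exprN1 ?z2 ?zN2; fieldq.
    by lrs lW.
  by move: a0 a1 a2 a3 a4 a5 a6 a7 a8 a9; rewrite /d /m1 /M1 /m2 /M2 /m3 /M3 /m4 /M4 /m5; clear; lia.
Qed.
End ClassOfCurve2.

(** * Nef classes *)

Definition numbers (D : seq int) : seq int :=
  let: (d, m1, M1, m2, M2) := (D`_0, D`_1, D`_2, D`_3, D`_4) in
  let: (m3, M3, m4, M4, m5) := (D`_5, D`_6, D`_7, D`_8, D`_9) in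
  [:: d - M1 - m3; d - m1 - M4; d - m2 - M3; d - m1 - m2 - m5; d - m3 - m4 - m5; d - M2 - m4;
      m1 *+ 2 - M1; M1 - m1; m2 *+ 2 - M2; M2 - m2; m3 *+ 2 - M3; M3 - m3; m4 *+ 2 - M4; M4 - m4; m5].

(* The classes of the conic bundles, and last that of the elliptic fibration;
   each comes with two members of the linear system, given by the exponents of
   x0, x1, x2, x0 - x1, x0 - x2, x1 + x2 - x0 in their equations. *)
Definition conic_classes : seq (seq int * (seq nat * seq nat)) :=
  [:: ([:: 1; 0; 0; 0; 0; 0; 0; 0; 0; 1], ([:: 0; 0; 0; 1; 0; 0], [:: 0; 0; 0; 0; 1; 0]));
      ([:: 1; 0; 0; 1; 1; 0; 0; 0; 0; 0], ([:: 0; 0; 1; 0; 0; 0], [:: 0; 0; 0; 1; 0; 0]));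
      ([:: 1; 0; 0; 0; 0; 0; 0; 1; 1; 0], ([:: 0; 0; 0; 0; 0; 1], [:: 0; 0; 0; 0; 1; 0]));
      ([:: 1; 0; 0; 0; 0; 1; 1; 0; 0; 0], ([:: 1; 0; 0; 0; 0; 0], [:: 0; 0; 0; 0; 1; 0]));
      ([:: 1; 1; 1; 0; 0; 0; 0; 0; 0; 0], ([:: 0; 1; 0; 0; 0; 0], [:: 0; 0; 0; 1; 0; 0]));
      ([:: 2; 0; 0; 1; 1; 0; 0; 1; 2; 1], ([:: 0; 1; 0; 1; 0; 0], [:: 0; 0; 0; 0; 1; 1]));
      ([:: 2; 0; 0; 1; 2; 1; 1; 0; 0; 1], ([:: 0; 0; 0; 0; 1; 1], [:: 0; 0; 1; 1; 0; 0]));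
      ([:: 2; 0; 0; 1; 1; 1; 1; 1; 2; 0], ([:: 0; 0; 0; 0; 1; 1], [:: 0; 1; 1; 0; 0; 0]));
      ([:: 2; 0; 0; 0; 0; 1; 2; 1; 2; 0], ([:: 0; 0; 0; 0; 2; 0], [:: 0; 1; 1; 0; 0; 0]));
      ([:: 2; 1; 1; 1; 2; 1; 1; 0; 0; 0], ([:: 0; 0; 1; 1; 0; 0], [:: 1; 0; 0; 0; 0; 1]));
      ([:: 2; 1; 1; 1; 1; 1; 1; 1; 1; 0], ([:: 0; 0; 0; 1; 1; 0], [:: 1; 0; 0; 0; 0; 1]));
      ([:: 2; 1; 1; 0; 0; 1; 2; 0; 0; 1], ([:: 0; 0; 1; 1; 0; 0], [:: 1; 0; 0; 0; 1; 0]));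
      ([:: 2; 1; 1; 0; 0; 1; 2; 1; 1; 0], ([:: 0; 1; 1; 0; 0; 0], [:: 1; 0; 0; 0; 1; 0]));
      ([:: 2; 1; 2; 1; 2; 0; 0; 0; 0; 0], ([:: 0; 0; 0; 2; 0; 0], [:: 1; 0; 0; 0; 0; 1]));
      ([:: 2; 1; 2; 0; 0; 0; 0; 1; 1; 1], ([:: 1; 0; 0; 0; 1; 0], [:: 0; 1; 0; 1; 0; 0]));
      ([:: 2; 1; 2; 1; 1; 0; 0; 1; 1; 0], ([:: 1; 0; 0; 0; 0; 1], [:: 0; 1; 0; 1; 0; 0]));
      ([:: 3; 1; 1; 1; 2; 2; 2; 1; 2; 0], ([:: 0; 1; 2; 0; 0; 0], [:: 1; 0; 0; 0; 1; 1]));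
      ([:: 3; 1; 2; 2; 2; 1; 1; 1; 2; 0], ([:: 1; 0; 0; 0; 0; 2], [:: 0; 1; 1; 1; 0; 0]));
      ([:: 3; 1; 2; 1; 1; 1; 2; 2; 2; 0], ([:: 0; 2; 1; 0; 0; 0], [:: 1; 0; 0; 0; 1; 1]));
      ([:: 3; 2; 2; 1; 2; 1; 2; 1; 1; 0], ([:: 2; 0; 0; 0; 0; 1], [:: 0; 1; 1; 1; 0; 0]));
      ([:: 3; 1; 2; 1; 2; 1; 2; 1; 2; 1], ([:: 0; 1; 1; 1; 0; 0], [:: 1; 0; 0; 0; 1; 1]))].

(* The classes of the fifteen negative curves, in the order of [numbers]. *)
Definition negative_curves : seq (seq int) :=
  [:: [:: 1; 1; 2; 0; 0; 1; 1; 0; 0; 0];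
      [:: 1; 1; 1; 0; 0; 0; 0; 1; 2; 0];
      [:: 1; 0; 0; 1; 1; 1; 2; 0; 0; 0];
      [:: 1; 1; 1; 1; 1; 0; 0; 0; 0; 1];
      [:: 1; 0; 0; 0; 0; 1; 1; 1; 1; 1];
      [:: 1; 0; 0; 1; 2; 0; 0; 1; 1; 0];
      [:: 0; - 1; 0; 0; 0; 0; 0; 0; 0; 0];
      [:: 0; 0; - 1; 0; 0; 0; 0; 0; 0; 0];
      [:: 0; 0; 0; - 1; 0; 0; 0; 0; 0; 0];
      [:: 0; 0; 0; 0; - 1; 0; 0; 0; 0; 0];
      [:: 0; 0; 0; 0; 0; - 1; 0; 0; 0; 0];
      [:: 0; 0; 0; 0; 0; 0; - 1; 0; 0; 0];
      [:: 0; 0; 0; 0; 0; 0; 0; - 1; 0; 0];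
      [:: 0; 0; 0; 0; 0; 0; 0; 0; - 1; 0];
      [:: 0; 0; 0; 0; 0; 0; 0; 0; 0; - 1]].

(* The divisors of x, y, 1 - x, 1 - y, x + y - 1, and minus the total transform
   of the line at infinity. *)
Definition line_divisors : seq (seq int) :=
  [:: [:: - 1; 1; 0; 0; 0; 0; 0; - 1; 0; 0; - 1; - 1; 1; 2; 0];
      [:: - 1; 0; 1; 0; 0; 0; - 1; - 2; 1; 1; 0; 1; 0; 0; 0];
      [:: - 1; 0; 0; 1; 0; 0; 0; - 1; 1; 1; - 1; - 1; 0; 0; 1];
      [:: - 1; 0; 0; 0; 1; 0; - 1; - 2; 0; 0; 0; 0; 1; 1; 1];
      [:: - 1; 0; 0; 0; 0; 1; - 1; - 2; 1; 2; - 1; - 1; 1; 1; 0];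
      [:: - 1; 0; 0; 0; 0; 0; - 1; - 2; 0; 0; - 1; - 1; 0; 0; 0]].

(** Coefficients of the rows of [line_divisors] in linear relations between the fifteen numbers,
    which depend on ten parameters only. These relations let the search tighten bounds. *)
Definition relation_coefs : seq (seq int) :=
  [:: [:: - 1; 0; 0; 2; 0; 1]; [:: 1; 0; 0; 0; - 1; 0]; [:: 1; 0; 1; - 1; 0; 0]; [:: 1; 1; 1; 0; - 2; 0];
      [:: 0; 0; - 1; - 1; 1; 0]; [:: 1; 1; 1; - 1; - 1; 0]; [:: - 2; - 1; 0; 1; 1; 0];
      [:: 0; - 1; - 1; 1; 0; 0]; [:: 0; - 1; 1; - 1; 1; 0]; [:: 0; - 1; 0; 1; - 1; 0];
      [:: 1; 1; 0; - 2; 0; 0]; [:: - 1; - 2; 0; 1; 1; 0]; [:: 0; 1; 0; 0; 0; 0]; [:: 0; 0; - 2; 0; 1; 0];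
      [:: - 1; 0; 0; 0; 0; 0]; [:: - 1; - 1; - 1; 1; 1; 0]; [:: 1; 1; 1; 0; - 1; 0];
      [:: - 1; - 2; - 2; 2; 0; 0]; [:: 1; 2; 0; 0; - 1; 0]; [:: - 1; - 2; 0; 0; 2; 0];
      [:: 0; 0; - 1; 1; - 1; 0]; [:: 1; 1; - 1; 1; 0; 0]; [:: 0; 1; 1; - 1; - 1; 0];
      [:: 0; - 1; 0; 0; 1; 0]; [:: - 1; 0; - 1; 1; 1; 0]; [:: - 2; - 1; - 1; 2; 2; 0]].

Definition bound := (int * option int)%type.

Definition combine (e : seq int) (V : seq (seq int)) : seq int :=
  foldr (fun p acc => [seq p.1 * q.1 + q.2 | q <- zip p.2 acc]) (nseq 15 0) (zip e V).

(* (s, m): the contribution s of the bounded terms of the relation, and the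
   number m of its terms that are not bounded below. *)
Fixpoint low (c : seq int) (st : seq bound) : int * nat :=
  match c, st with
  | a :: c', (l, u) :: st' =>
    let: (s, m) := low c' st' in
    if a == 0 then (s, m) else if 0 < a then (a * l + s, m) else
    match u with Some v => (a * v + s, m) | None => (s, m.+1) end
  | _, _ => (0, 0%N)
  end.

(** A relation asks for a sum that is at most 0. If giving the variable its lower bound l, and the
    other terms their least values, already makes the sum positive, the lower bound becomes l +
    1. *)
Definition raise (t : int * nat) (a : int) (b : bound) : bound :=
  let: (s, m) := t in let: (l, u) := b in
  if a < 0 then
    match u, m with
    | Some v, 0%N => if 0 < s - a * v + a * l then (l + 1, u) else b
    | None, 1%N => if 0 < s + a * l then (l + 1, u) else b
    | _, _ => b
    end
  else b.

Definition use_relation (r : int * seq int) (st : seq bound) : seq bound :=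
  let: (s, m) := low r.2 st in
  [seq raise (r.1 + s, m) p.1 p.2 | p <- zip r.2 st].

Definition clash (r : int * seq int) (st : seq bound) : bool :=
  let: (s, m) := low r.2 st in (m == 0%N) && (0 < r.1 + s).

Definition empty_box (rs : seq (int * seq int)) (st : seq bound) : bool :=
  has (fun b : bound => if b.2 is Some v then v < b.1 else false) st || has (fun r => clash r st) rs.

Fixpoint propagate (rs : seq (int * seq int)) fuel (st : seq bound) : seq bound :=
  match fuel with
  | 0 => st
  | f.+1 =>
    let st' := foldl (fun s r => use_relation r s) st rs in
    if st' == st then st else if empty_box rs st' then st' else propagate rs f st'
  end.

Definition addl (a b : seq int) : seq int := [seq p.1 + p.2 | p <- zip a b].

Definition zero_hit (p : int * bound) : bool := (p.2.2 == Some 0) && (0 < p.1).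

(* If D.C_i = 0 and (t + E).C_i > 0 for some E >= 0, then D - t - E can only
   become nef after subtracting C_i as well. *)
Fixpoint close (gram : seq (seq int)) fuel (G : seq int) (st : seq bound) : seq int :=
  match fuel with
  | 0 => G
  | f.+1 => let i := find zero_hit (zip G st) in
    if (i < 15)%N then close gram f (addl G (nth [::] gram i)) st else G
  end.

Definition fits (G : seq int) (st : seq bound) : bool :=
  all (fun p : int * bound => p.1 <= p.2.1) (zip G st).

Definition possible (G : seq int) (st : seq bound) : bool :=
  all (fun p : int * bound => if p.2.2 is Some v then p.1 <= v else true) (zip G st).

Definition deficit (G : seq int) (st : seq bound) : int :=
  foldr (fun (p : int * bound) s => if p.2.1 < p.1 then p.1 - p.2.1 + s else s) 0 (zip G st).

(** Branching rule: among the candidate classes take one that misses the lower bounds by the least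
    total, and split on its first curve that does not fit. The value 15 means that there is none. *)
Definition choose_curve (Gs : seq (seq int)) (st : seq bound) : nat :=
  let best := foldl (fun (b : option (int * seq int)) G =>
     let k := deficit G st in
     match b with Some (k', _) => if k < k' then Some (k, G) else b | None => Some (k, G) end) None Gs in
  match best with Some (_, G) => find (fun p : int * bound => p.2.1 < p.1) (zip G st) | None => 15 end.

(* Branch and bound: a nef class D of positive degree satisfies t + E <= D for a
   class t of the list and a sum E of negative curves, where <= compares the
   intersections with the fifteen curves, so that D - t - E is nef. *)
Fixpoint search rs gram (S : seq (seq int)) fuel (st0 : seq bound) : bool :=
  match fuel with
  | 0 => false
  | f.+1 =>
    let st := propagate rs 40 st0 in
    if empty_box rs st then true else
    let Gs := [seq G <- [seq close gram 60 s st | s <- S] | possible G st] in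
    if has (fun G => fits G st) Gs then true else
    let j := choose_curve Gs st in
    if (j < 15)%N then
      let b := nth (0, None) st j in
      if search rs gram S f (set_nth (0, None) st j (b.1, Some b.1))
      then search rs gram S f (set_nth (0, None) st j (b.1 + 1, b.2)) else false
    else false
  end.

Lemma propagateS rs f st : propagate rs f.+1 st =
  let st' := foldl (fun s r => use_relation r s) st rs in
  if st' == st then st else if empty_box rs st' then st' else propagate rs f st'.
Proof. by []. Qed.

Lemma closeS gram f G st : close gram f.+1 G st =
  if (find zero_hit (zip G st) < 15)%N
  then close gram f (addl G (nth [::] gram (find zero_hit (zip G st)))) st else G.
Proof. by []. Qed.

Lemma searchS rs gram S f st0 : search rs gram S f.+1 st0 =
  let st := propagate rs 40 st0 in
  if empty_box rs st then true else
  let Gs := [seq G <- [seq close gram 60 s st | s <- S] | possible G st] in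
  if has (fun G => fits G st) Gs then true else
  let j := choose_curve Gs st in
  if (j < 15)%N then
    let b := nth (0, None) st j in
    if search rs gram S f (set_nth (0, None) st j (b.1, Some b.1))
    then search rs gram S f (set_nth (0, None) st j (b.1 + 1, b.2)) else false
  else false.
Proof. by []. Qed.

Arguments propagate : simpl never.
Arguments close : simpl never.
Arguments search : simpl never.

(* The first five line divisors are principal, hence orthogonal to D, and the
   last one has intersection - d <= -1 with D: so each row, whose last entry is
   0 or 1, gives an inequality between the intersection numbers of D. *)
Definition relations : seq (int * seq int) :=
  [seq (nth 0 e 5, combine e line_divisors) | e <- relation_coefs].

(** Evaluated from the box of all nonnegative values: each branch ends with contradictory bounds or
    with a class of the list that fits. *)
Lemma search_succeeds : search relations [seq numbers c | c <- negative_curves]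
  [seq numbers t.1 | t <- conic_classes] 40 (nseq 15 (0, None)).
Proof. by vm_compute. Qed.
Opaque search.

Section SearchSoundness.
Implicit Types (c n G : seq int) (st : seq bound) (b : bound).

Definition b0 : bound := (0, None).

Definition okb b (x : int) : bool := (b.1 <= x) && (if b.2 is Some v then x <= v else true).

Fixpoint in_box st n : bool :=
  match st, n with
  | [::], [::] => true
  | b :: st', x :: n' => okb b x && in_box st' n'
  | _, _ => false
  end.

Definition dot c n : int := foldr (fun p s => p.1 * p.2 + s) 0 (zip c n).

Lemma in_box_size st n : in_box st n -> size st = size n.
Proof. by elim: st n => [|b st IH] [|x n] //= /andP[_ /IH->]. Qed.

Lemma in_box_nth st n j : in_box st n -> (j < size st)%N -> okb (nth b0 st j) (nth 0 n j).
Proof. by elim: st n j => [|b st IH] [|x n] //= [|j] /= /andP[h1 h2] // hj; apply: IH. Qed.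

Lemma in_box_set st n j b : in_box st n -> (j < size st)%N -> okb b (nth 0 n j) ->
  in_box (set_nth b0 st j b) n.
Proof.
elim: st n j => [|b' st IH] [|x n] //= [|j] /= /andP[h1 h2]; first by rewrite h2 => _ ->.
by move=> hj hb; rewrite h1 IH.
Qed.

(* The part of a relation that [low] evaluates: unbounded terms are kept exact. *)
Definition cont (a : int) b (x : int) : int :=
  if a == 0 then 0 else if 0 < a then a * b.1 else if b.2 is Some v then a * v else a * x.

Definition unb (a : int) b : bool := (a < 0) && (b.2 == None).

Fixpoint usum c st n : int :=
  match c, st, n with
  | a :: c', b :: st', x :: n' => (if unb a b then a * x else 0) + usum c' st' n'
  | _, _, _ => 0
  end.

Lemma cont_le a b x : okb b x -> cont a b x <= a * x.
Proof.
case: b => l [u|]; rewrite /okb /cont /= => /andP[hl hu].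
  case: eqVneq => [->|a0]; first by rewrite mul0r.
  case: ltrP => h; nia.
case: eqVneq => [->|a0]; first by rewrite mul0r.
case: ltrP => h //; nia.
Qed.

Lemma low_cons a c b st n x : (low (a :: c) (b :: st)).1 + usum (a :: c) (b :: st) (x :: n) =
  cont a b x + ((low c st).1 + usum c st n).
Proof.
case: b => l u; rewrite /= /cont /unb /=; case: (low c st) => s m /=.
have [->|a0] := eqVneq a 0; first by rewrite ltxx !add0r.
have [h|h] := ltrP 0 a; first by rewrite ltNge (ltW h) /=; ring.
have -> : a < 0 by rewrite lt_neqAle a0.
by case: u => [v|] /=; ring.
Qed.

Lemma low_le c st n : in_box st n -> (low c st).1 + usum c st n <= dot c n.
Proof.
elim: st c n => [|b st IH] [|a c] [|x n] // /andP[hb hn].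
by rewrite low_cons [dot _ _]/(a * x + dot c n) lerD ?cont_le // IH.
Qed.

Lemma low_one_out c st n j : in_box st n -> size c = size st -> (j < size st)%N ->
  (low c st).1 + usum c st n - cont (nth 0 c j) (nth b0 st j) (nth 0 n j) + nth 0 c j * nth 0 n j <= dot c n.
Proof.
elim: st c n j => [|b st IH] [|a c] [|x n] // [|j] /andP[hb hn] [sz] hj; rewrite low_cons [dot _ _]/(a * x + dot c n).
  by rewrite [nth _ _ _]/= [nth b0 _ _]/=; have := low_le c hn; rewrite /=; lia.
have := IH c n j hn sz hj; have := cont_le a hb; rewrite /= -/(nth 0 _ _).
move: (cont _ _ _) (cont _ _ _) ((low c st).1 + _) (dot _ _) (a * x) (nth 0 c j * _); lia.
Qed.

Lemma low_unb0 c st n : (low c st).2 = 0%N -> usum c st n = 0.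
Proof.
elim: c st n => [|a c IH] [|[l u] st] [|x n] //=; case E: (low c st) => [s m].
rewrite /unb /=; have := IH st n; rewrite E /= => H.
have [->|a0] := eqVneq a 0; first by rewrite ltxx => /H->.
have [h|h] := ltrP 0 a; first by rewrite ltNge (ltW h) => /H->.
by case: u => [v|] //= /H->; rewrite andbF.
Qed.

Lemma low_unb1 c st n j : (low c st).2 = 1%N -> unb (nth 0 c j) (nth b0 st j) ->
  (j < size st)%N -> size c = size st -> size n = size st -> usum c st n = nth 0 c j * nth 0 n j.
Proof.
elim: c st n j => [|a c IH] [|[l u] st] [|x n] // [|j] /=; case E: (low c st) => [s m].
  rewrite /unb /= => h /andP[a0 /eqP u0] _ [sz] [sn]; move: h; rewrite u0 a0 /=.
  rewrite lt_eqF // ltNge (ltW a0) /= => -[m0].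
  by have := @low_unb0 c st n; rewrite E => ->; rewrite ?addr0.
rewrite /unb /=; have := IH st n j; rewrite E /= => H.
have [->|a0] := eqVneq a 0; first by rewrite ltxx add0r /= => h1 h2 h3 [h4] [h5]; apply: H.
have [h|h] := ltrP 0 a; first by rewrite [a < 0]ltNge (ltW h) add0r /= => h1 h2 h3 [h4] [h5]; apply: H.
case: u => [v|] /=; first by rewrite andbF add0r => h1 h2 h3 [h4] [h5]; apply: H.
case=> m0 hu hj [sz] [sn]; exfalso.
have {IH H} : (low c st).2 = 0%N by rewrite E.
elim: c st n j hu hj sz sn {E} => [|a' c IH] [|[l' u'] st] [|x' n] // [|j] /=; case E2: (low c st) => [s' m'].
  move=> /andP[a1 /eqP u0] _ _ _; rewrite u0 lt_eqF // ltNge (ltW a1) /= //.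
move=> hu hj [sz] [sn]; have := IH st n j hu hj sz sn; rewrite E2.
by case: (a' == 0) => //; case: (0 < a') => //; case: u'.
Qed.

Variable n : seq int.

Definition relation_holds (r : int * seq int) : bool := (r.1 + dot r.2 n <= 0) && (size r.2 == size n).

Lemma raise_ok r st j : relation_holds r -> in_box st n -> (j < size st)%N ->
  okb (raise (r.1 + (low r.2 st).1, (low r.2 st).2) (nth 0 r.2 j) (nth b0 st j)) (nth 0 n j).
Proof.
move=> /andP[hr /eqP sr] hst hj; have hb := in_box_nth hst hj.
have ss := in_box_size hst; have sc : size r.2 = size st by rewrite sr ss.
have := low_one_out hst sc hj; have := @low_unb0 r.2 st n; have := @low_unb1 r.2 st n j.
move: hb; rewrite /raise /cont /unb; case: (low r.2 st) => s m /=.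
case: (nth b0 st j) => l u /=; move: (nth 0 r.2 j) (nth 0 n j) => a x.
case: ltrP => // a0; rewrite lt_eqF // ltNge (ltW a0) /=.
case: u m => [v|] [|[|m]] //=; rewrite /okb /= => hx.
  move=> _ /(_ erefl) -> h; case: ltrP => // h2; move: hx hr h h2 => /andP[h3 h4].
  rewrite /= h4 andbT; have [<-|] := eqVneq x l; move: (dot _ _) r.1 (a * v) (a * x) (a * l) => dd kk av ax al; lia.
move=> /(_ erefl isT hj sc (esym ss)) -> _ h; case: ltrP => // h2; move: hx hr h h2; rewrite !andbT.
have [<-|] := eqVneq x l; move: (dot _ _) r.1 (a * x) (a * l) => dd kk ax al; rewrite /=; lia.
Qed.

Lemma in_boxP st : reflect (size st = size n /\ forall j, (j < size st)%N -> okb (nth b0 st j) (nth 0 n j))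
  (in_box st n).
Proof.
apply: (iffP idP) => [h|[]]; first by split; [exact: in_box_size|move=> j; apply: in_box_nth].
elim: st n => [|b st IH] [|x m] //= [sz] h; rewrite (h 0%N) //=; apply: IH => // j hj.
exact: (h j.+1).
Qed.

Lemma use_relation_ok r st : relation_holds r -> in_box st n -> in_box (use_relation r st) n.
Proof.
move=> hr hst; have := hr => /andP[_ /eqP sr]; have ss := in_box_size hst.
rewrite /use_relation; case E: (low r.2 st) => [s m]; apply/in_boxP.
have sz : size (zip r.2 st) = size st by rewrite size_zip sr ss minnn.
rewrite size_map sz; split=> // j hj; rewrite (nth_map (0, b0)) ?sz // nth_zip ?sr ?ss //=.
by have := raise_ok hr hst hj; rewrite E.
Qed.

Lemma empty_box_ok rs st : all relation_holds rs -> in_box st n -> empty_box rs st = false.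
Proof.
move=> hrs hst; apply/negbTE; rewrite negb_or; apply/andP; split; apply/hasPn.
  move=> b /(nthP b0)[j hj <-]; have := in_box_nth hst hj; rewrite /okb.
  by case: (nth b0 st j) => l [v|] //= /andP[h1 h2]; rewrite -leNgt (le_trans h1).
move=> r /(allP hrs)/andP[hr _]; rewrite /clash.
have := low_le r.2 hst; have := @low_unb0 r.2 st n; case: (low r.2 st) => s [|m] //= /(_ erefl) ->.
rewrite addr0 => h; rewrite -leNgt; apply: le_trans hr; exact: lerD.
Qed.

Lemma propagate_ok rs f st : all relation_holds rs -> in_box st n -> in_box (propagate rs f st) n.
Proof.
move=> hrs; elim: f st => // f IH st hst; rewrite propagateS /=.
have h : in_box (foldl (fun s r => use_relation r s) st rs) n.
  elim: rs hrs st hst {IH} => //= r rs IH /andP[hr hrs] st hst.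
  by apply: IH => //; apply: use_relation_ok.
by case: ifP => // _; case: ifP => // _; apply: IH.
Qed.

(** What soundness retains of [close]: negative curves have been added to the starting class. The
    final comparison [fits] does the rest. *)
Inductive reach (gram : seq (seq int)) : seq int -> seq int -> Prop :=
| Reach0 G : reach gram G G
| ReachS G G' i : (i < 15)%N -> reach gram (addl G (nth [::] gram i)) G' -> reach gram G G'.

Lemma close_reach gram f G st : reach gram G (close gram f G st).
Proof.
elim: f G => [|f IH] G; first exact: Reach0.
by rewrite closeS; case: ifP => h; [apply: ReachS h (IH _)|apply: Reach0].
Qed.

Lemma search_sound rs gram S f st : all relation_holds rs -> size n = 15%N -> (forall s, s \in S -> size s = 15%N) ->
  search rs gram S f st -> in_box st n ->
  exists s G, [/\ s \in S, reach gram s G & forall j, (j < size G)%N -> (j < 15)%N -> nth 0 G j <= nth 0 n j].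
Proof.
move=> hrs sn hS; elim: f st => // f IH st0; rewrite searchS /= => + hst0.
have hst := propagate_ok 40 hrs hst0; move: (propagate _ _ _) hst => st hst.
rewrite (empty_box_ok hrs hst); have ss := in_box_size hst.
case: ifP => [/hasP[G]|_].
  rewrite mem_filter => /andP[_ /mapP[s sS ->]] hfit _.
  exists s, (close gram 60 s st); split=> //; first exact: close_reach.
  move=> j hj j15; have hjs : (j < size st)%N by rewrite ss sn.
  have /andP[h1 _] := in_box_nth hst hjs; apply: le_trans h1.
  have hz : (j < size (zip (close gram 60 s st) st))%N by rewrite size_zip leq_min hj.
  by have := allP hfit _ (mem_nth (0, b0) hz); rewrite nth_zip_cond hz.
set j := choose_curve _ _; case: ifP => // hj; set b := nth _ st j.
have hjs : (j < size st)%N by rewrite ss sn.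
have hb : okb b (nth 0 n j) by apply: in_box_nth.
case: ifP => // h1 h2; have [le|lt] := lerP (nth 0 n j) b.1.
  apply: (IH _ h1); apply: in_box_set => //; move: hb; rewrite /okb /= le => /andP[-> _] //.
apply: (IH _ h2); apply: in_box_set => //; move: hb; rewrite /okb /= => /andP[_ ->].
by rewrite andbT lezD1.
Qed.
End SearchSoundness.

Definition addc (C D : seq int) : seq int := mkseq (fun i => C`_i + D`_i) 10.
Definition subc (C D : seq int) : seq int := mkseq (fun i => C`_i - D`_i) 10.
Definition add6 (n m : seq nat) : seq nat := mkseq (fun i => nth 0 n i + nth 0 m i)%N 6.

Lemma numbersD C D : numbers (addc C D) = addl (numbers C) (numbers D).
Proof.
rewrite /numbers /addl /= !mulr2n.
by do 15 (congr (_ :: _); first by ring).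
Qed.

Lemma numbersB C D : numbers (subc C D) = [seq p.1 - p.2 | p <- zip (numbers C) (numbers D)].
Proof.
rewrite /numbers /= !mulr2n.
by do 15 (congr (_ :: _); first by ring).
Qed.

Lemma nef_numbers D : nef D = all (fun x => 0 <= x) (numbers D).
Proof. by rewrite /nef /numbers /= !mulr2n; apply/idP/idP; lia. Qed.

Lemma admissibleD C D n m : admissible C n -> admissible D m -> admissible (addc C D) (add6 n m).
Proof.
rewrite /admissible /=.
move: (nth 0 n _) (nth 0 n _) (nth 0 n _) (nth 0 n _) (nth 0 n _) (nth 0 n _).
move: (nth 0 m _) (nth 0 m _) (nth 0 m _) (nth 0 m _) (nth 0 m _) (nth 0 m _).
move=> ????????????.
move=> /and5P[? ? ? ? /and5P[? ? ? ? /andP[? ?]]] /and5P[? ? ? ? /and5P[? ? ? ? /andP[? ?]]].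
by repeat (apply/andP; split); lia.
Qed.

(** The first six negative curves are the lines. For larger i all exponents are 0: the curve is
    exceptional and its equation in the plane is 1. *)
Definition line_of (i : nat) : seq nat := mkseq (fun j => (j == i) : nat) 6.

Lemma negative_curves_ok : all (fun i => admissible (nth [::] negative_curves i) (line_of i) &&
  (0 <= (nth [::] negative_curves i)`_0)) (iota 0 15).
Proof. by []. Qed.

Lemma conic_classes_ok : all (fun t => [&& admissible t.1 t.2.1, admissible t.1 t.2.2 & 0 < t.1`_0]) conic_classes.
Proof. by []. Qed.

(** The fixed part w is the product of those added curves that are lines; multiplying by it turns
    members of the system of C into members of that of E. *)
Lemma reach_class C G : reach [seq numbers c | c <- negative_curves] (numbers C) G ->
  exists E w, [/\ G = numbers E, C`_0 <= E`_0 & forall n, admissible C n -> admissible E (add6 n w)].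
Proof.
move: {-1}(numbers C) (erefl (numbers C)) => G0 e0 r.
elim: r C e0 => {G0 G} [G|G G' i hi _ IH] C e0.
  exists C, (nseq 6 0%N); split=> // n; rewrite /admissible /add6 /= !addn0; exact.
have hi' : i \in iota 0 15 by rewrite mem_iota.
have /andP[a1 a2] := allP negative_curves_ok i hi'.
have [|E [w [eG dE hE]]] := IH (addc C (nth [::] negative_curves i)).
  by rewrite numbersD e0 (nth_map [::]).
exists E, (add6 (line_of i) w); split=> // [|n hn].
  by apply: le_trans dE; rewrite /addc /=; move: a2; move: (nth [::] _ i)`_0; lia.
have := hE _ (admissibleD hn a1); rewrite /add6 /line_of.
by congr (is_true (admissible _ _)); rewrite /mkseq /=; do 6 (congr (_ :: _); first by rewrite addnA).
Qed.

Lemma dot_comb a v acc n : size v = size n -> size acc = size n ->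
  dot [seq a * q.1 + q.2 | q <- zip v acc] n = a * dot v n + dot acc n.
Proof.
elim: n v acc => [|x n IH] [|b v] [|c acc] //=; first by rewrite /dot /= mulr0.
move=> [s1] [s2]; rewrite /dot /= -!/(dot _ n) IH //.
by move: (dot v n) (dot acc n) => X Y; ring.
Qed.

Lemma dot0 m n : dot (nseq m 0) n = 0.
Proof. by elim: m n => [|m IH] [|x n] //=; rewrite /dot /= -/(dot _ n) IH mul0r. Qed.

Lemma in_box_free n : all (fun x => 0 <= x) n -> in_box (nseq (size n) (0, None)) n.
Proof. by elim: n => //= x n IH /andP[h /IH ->]; rewrite /okb /= h. Qed.

Lemma dot_lin e V n : size n = 15%N -> all (fun v => size v == 15%N) V ->
  dot (combine e V) n = foldr (fun p s => p.1 * dot p.2 n + s) 0 (zip e V) /\ size (combine e V) = 15%N.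
Proof.
move=> sn; rewrite /combine; elim: V e => [|v V IH] [|a e] //=.
- by rewrite (dot0 15).
- by rewrite (dot0 15).
- by rewrite (dot0 15).
move=> /andP[/eqP sv hV]; have [h1 h2] := IH e hV; split; last by rewrite size_map size_zip sv h2.
by rewrite dot_comb ?sv ?h2 ?sn // h1.
Qed.

(** Principal divisors contribute 0 and the last divisor contributes -d, so a row with last entry k
    gives k (1 - d), which is at most 0. *)
Lemma relations_hold D : 0 < D`_0 -> all (relation_holds (numbers D)) relations.
Proof.
move=> d0; apply/allP => r /mapP[e he ->].
have : all (fun e => (size e == 6%N) && (0 <= e`_5)) relation_coefs by [].
move=> /allP/(_ e he)/andP[/eqP se ke].
have [h1 h2] := @dot_lin e line_divisors (numbers D) erefl erefl.
rewrite /relation_holds h2 eqxx andbT h1.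
case: e se ke {he h1 h2} => [|e0 [|e1 [|e2 [|e3 [|e4 [|k [|]]]]]]] // _ /= ke.
rewrite /dot /=.
move: D`_0 D`_1 D`_2 D`_3 D`_4 D`_5 D`_6 D`_7 D`_8 D`_9 d0 => d m1 M1 m2 M2 m3 M3 m4 M4 m5 d0.
rewrite [X in X <= 0](_ : _ = k * (1 - d)); first by nia.
by rewrite !mulr2n; ring.
Qed.

(** The search yields a class E, equal to t plus negative curves, whose fifteen numbers are at most
    those of D; hence D' = D - E is nef. Its degree is smaller because t has positive degree and no
    negative curve has negative degree. *)
Lemma nef_decompose D : nef D -> 0 < D`_0 -> exists t D' w, [/\ t \in conic_classes, nef D',
  D'`_0 < D`_0 & forall n n', admissible D' n -> admissible t.1 n' -> admissible D (add6 n (add6 n' w))].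
Proof.
move=> nD d0; have box : in_box (nseq 15 (0, None)) (numbers D).
  by apply: (@in_box_free (numbers D)); rewrite -nef_numbers.
have [|s [G [hs r le]]] := search_sound (relations_hold d0) (erefl _) _ search_succeeds box.
  by move=> s /mapP[t _ ->].
have [t ht es] := mapP hs; have /and3P[a1 a2 a3] := allP conic_classes_ok t ht.
rewrite es in r; have [E [w [eG dE hE]]] := reach_class r.
exists t, (subc D E), w; split=> //.
- rewrite nef_numbers numbersB; apply/(all_nthP 0) => i.
  rewrite size_map => hi; rewrite (nth_map (0, 0)) // nth_zip //= subr_ge0.
  by move: hi; rewrite size_zip minnn => hi; rewrite -eG; apply: le => //; rewrite eG.
- by rewrite /subc /= gtrBl (lt_le_trans a3).
move=> n n' hn /hE hn'; have := admissibleD hn hn'.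
by rewrite /admissible /addc /subc /= !subrK.
Qed.

(** Induction on the degree by [nef_decompose], with one member chosen for each class split off. A
    nef class of degree 0 is 0, and the empty product is a member. *)
Lemma nef_admissible D : nef D -> exists n, admissible D n.
Proof.
have H (N : nat) : forall D, nef D -> D`_0 <= N%:Z -> exists n, admissible D n.
  elim: N => [|N IH] {}D nD dN.
    exists (nseq 6 0%N); move: nD dN; rewrite /nef /admissible /=.
    move: D`_0 D`_1 D`_2 D`_3 D`_4 D`_5 D`_6 D`_7 D`_8 D`_9 => d m1 M1 m2 M2 m3 M3 m4 M4 m5.
    move=> /and5P[? ? ? ? /and5P[? ? ? ? /and5P[? ? ? ? /and3P[? ? ?]]]] ?.
    by repeat (apply/andP; split); lia.
  have [le|lt] := lerP D`_0 N%:Z; first exact: IH.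
  have d0 : 0 < D`_0 by move: lt; move: D`_0; lia.
  have [t [D' [w [ht nD' dD' h]]]] := nef_decompose nD d0.
  have [|n hn] := IH D' nD'; first by move: dN dD'; move: D`_0 D'`_0; lia.
  have /and3P[a1 _ _] := allP conic_classes_ok t ht.
  by exists (add6 n (add6 t.2.1 w)); apply: h.
by move=> nD; apply: (H (absz D`_0)) => //; rewrite abszE ler_norm.
Qed.

(** After splitting off one class t, its two members are completed by the same fixed factor, so that
    only the members of t remain in the quotient. *)
Lemma nef_two_admissible D : nef D -> 0 < D`_0 -> exists t n,
  [/\ t \in conic_classes, admissible D (add6 n t.2.1) & admissible D (add6 n t.2.2)].
Proof.
move=> nD d0; have [t [D' [w [ht nD' _ h]]]] := nef_decompose nD d0.
have [n hn] := nef_admissible nD'; have /and3P[a1 a2 _] := allP conic_classes_ok t ht.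
have e m : add6 n (add6 m w) = add6 (add6 n w) m.
  by rewrite /add6 /mkseq /=; do 6 (congr (_ :: _); first by rewrite addnA addnAC).
by exists t, (add6 n w); split=> //; rewrite -e; apply: h.
Qed.

(** * Reduction to the orbits of automorphisms *)

Section Monomials.
Variables (k : closedFieldType) (M : funfield k).
Local Notation K := (ff M).
Local Notation cst := (cst M).
Local Notation ev := (@ev k M).
Local Notation x := (@fx k M).
Local Notation y := (@fy k M).

Definition monomial (e : seq int) : K :=
  x ^ e`_0 * y ^ e`_1 * (1 - x) ^ e`_2 * (1 - y) ^ e`_3 * (x + y - 1) ^ e`_4.

(** The action of [aut5] on exponents, up to sign: it sends each of x, y, 1 - x, 1 - y, x + y - 1 to
    plus or minus a monomial in the same five functions. Likewise [act4] for [aut4]. *)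
Definition act5 (e : seq int) : seq int :=
  [:: - e`_1 - e`_3 - e`_4; e`_0; e`_1 + e`_2 + e`_4; e`_4; - e`_0 - e`_2 - e`_4].

Definition act4 (e : seq int) : seq int :=
  [:: - e`_0 - e`_1 - e`_2 - e`_3 - e`_4; e`_4; e`_3; e`_2; e`_0].

Lemma samep_scale c (f : K) : c != 0 -> samep (cst c * f) f.
Proof.
move=> c0; exists 1, 0, 0, c; rewrite mul1r mul0r subr0; split=> //.
by rewrite (rmorph1 cst) (rmorph0 cst) mul0r mul1r add0r addr0 mulrC.
Qed.

Lemma eqaut_monomial (s : {rmorphism K -> K}) e e' c : autX s -> c != 0 ->
  s (monomial e) = cst c * monomial e' -> eqaut (monomial e) (monomial e').
Proof.
by move=> hs c0 h; exists s; split=> //; rewrite h; apply: samep_scale.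
Qed.

Lemma monomial_morph (s : {rmorphism K -> K}) e : s (monomial e) =
  s x ^ e`_0 * s y ^ e`_1 * s (1 - x) ^ e`_2 * s (1 - y) ^ e`_3 * s (x + y - 1) ^ e`_4.
Proof. by rewrite /monomial !rmorphM /= !fmorphXz. Qed.

Lemma signz_neq0 (n : int) : (-1 : k) ^ n != 0.
Proof. by rewrite expfz_neq0 // oppr_eq0 oner_neq0. Qed.

Lemma cst_signz (n : int) : cst ((-1) ^ n) = (-1) ^ n.
Proof. by rewrite (fmorphXz cst) (rmorphN1 cst). Qed.

Lemma eqaut_act5 e : eqaut (monomial e) (monomial (act5 e)).
Proof.
have [s [hs sx sy]] := aut5 M; have [[n1 n2 n3 n4 n5] [n6 n7 n8 n9]] := nz_lines2 M.
apply: (@eqaut_monomial s e (act5 e) ((-1) ^ (e`_1 + e`_2))) => //; first exact: signz_neq0.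
have s1x : s (1 - x) = -1 * ((1 - x) / (x + y - 1)) by rewrite rmorphB rmorph1 sx; fieldq.
have s1y : s (1 - y) = x^-1 by rewrite rmorphB rmorph1 sy; fieldq.
have sxy : s (x + y - 1) = (1 - x) * (1 - y) / (x * (x + y - 1)).
  by rewrite rmorphB rmorphD rmorph1 sx sy; fieldq.
have {}sy : s y = -1 * ((1 - x) / x) by rewrite sy; fieldq.
rewrite monomial_morph s1x s1y sxy sx sy cst_signz /monomial /act5 /=.
have N1 : (-1 : K) != 0 by rewrite oppr_eq0 oner_neq0.
rewrite !(expfzMl, exprz_inv, invfM, expfzDr) ?invr_eq0 //.
ring.
Qed.

Lemma eqaut_act4 e : eqaut (monomial e) (monomial (act4 e)).
Proof.
have [s [hs sx sy]] := aut4 M; have [[n1 n2 n3 n4 n5] [n6 n7 n8 n9]] := nz_lines2 M.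
apply: (@eqaut_monomial s e (act4 e) ((-1) ^ e`_3)) => //; first exact: signz_neq0.
have s1x : s (1 - x) = (1 - y) / x by rewrite rmorphB rmorph1 sx; fieldq.
have s1y : s (1 - y) = -1 * ((1 - x) / x) by rewrite rmorphB rmorph1 sy; fieldq.
have sxy : s (x + y - 1) = y / x by rewrite rmorphB rmorphD rmorph1 sx sy; fieldq.
have {}sy : s y = x^-1 by rewrite sy; fieldq.
rewrite monomial_morph s1x s1y sxy sx sy cst_signz /monomial /act4 /=.
have N1 : (-1 : K) != 0 by rewrite oppr_eq0 oner_neq0.
rewrite !(expfzMl, exprz_inv, invfM, expfzDr) ?invr_eq0 //.
ring.
Qed.

Definition base_monomials : seq (seq int) :=
  [:: [:: 1; 0; 0; 0; 0]; [:: 1; 1; 0; -1; 0]; [:: 0; 1; 1; -1; 0]].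

(** For each class but the last, the index of one of the three base monomials and a word in the two
    automorphisms ([true] for [aut5], [false] for [aut4]) leading from it to the class. *)
Definition orbit_words : seq (nat * seq bool) :=
  [:: (1, [:: true; true]); (0, [:: true; true; false]); (0, [:: true; true]); (0, [:: true; true; true; true]); (0, [:: true; false; true]); (2, [:: true; true]); (2, [:: true; true; false]); (1, [:: false; true]); (2, [:: true; false]); (1, [:: true]); (0, [:: true; true; true]); (2, [::]); (1, [::]); (2, [:: true]); (2, [:: false]); (1, [:: false]); (2, [:: false; true; false]); (2, [:: false; true]); (2, [:: true; true; true]); (2, [:: true; false; true])]%N.

(** Exponents of the quotient of the two members; the line x0 = 0 drops out, its equation being 1 in
    affine coordinates. *)
Definition class_exponents (t : seq int * (seq nat * seq nat)) : seq int :=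
  mkseq (fun i => (nth 0%N t.2.1 i.+1)%:Z - (nth 0%N t.2.2 i.+1)%:Z) 5.

(* The last class of the list is that of the elliptic fibration. *)
Lemma orbit_words_ok : [seq class_exponents t | t <- conic_classes] =
  rcons [seq foldl (fun e (b : bool) => if b then act5 e else act4 e) (nth [::] base_monomials w.1) w.2
    | w <- orbit_words] [:: 1; 1; 1; -1; -1].
Proof. by []. Qed.

Lemma eqaut_word e w : eqaut (monomial e) (monomial (foldl (fun e (b : bool) => if b then act5 e else act4 e) e w)).
Proof.
elim: w e => [|b w IH] e /=; first exact/eqaut_samep/samep_refl.
by apply: eqaut_trans (IH _); case: b; [exact: eqaut_act5|exact: eqaut_act4].
Qed.

Definition is_base (f : K) := [\/ eqaut f x, eqaut f (g2 M) | eqaut f (g3 M)].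

Lemma is_base_eqaut (f g : K) : eqaut f g -> is_base g -> is_base f.
Proof. by move=> h; case=> h'; [apply: Or31|apply: Or32|apply: Or33]; apply: eqaut_trans h'. Qed.

Lemma base_monomials_ok e : e \in base_monomials -> is_base (monomial e).
Proof.
have [[n1 n2 n3 n4 n5] [n6 n7 n8 n9]] := nz_lines2 M.
have sm c (h f : K) : c != 0 -> f = cst c * h -> eqaut f h by move=> c0 ->; apply/eqaut_samep/samep_scale.
have N1 : (-1 : k) != 0 by rewrite oppr_eq0 oner_neq0.
rewrite !inE => /or3P[]/eqP->; rewrite /is_base /monomial /= !expr1z !expr0z ?exprN1.
- by apply: Or31; apply: (sm 1); rewrite ?oner_neq0 // rmorph1; ring.
- by apply: Or32; apply: (sm (-1)) => //; rewrite rmorphN1 /g2; fieldq.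
by apply: Or33; apply: (sm 1); rewrite ?oner_neq0 // rmorph1 /g3; fieldq.
Qed.

Lemma class_monomial t : t \in conic_classes ->
  is_base (monomial (class_exponents t)) \/ samep (monomial (class_exponents t)) (TT M).
Proof.
move=> ht; have : class_exponents t \in [seq class_exponents t | t <- conic_classes] by apply: map_f.
rewrite orbit_words_ok mem_rcons in_cons => /orP[/eqP->|/mapP[w hw ->]].
  right; have [[n1 n2 n3 n4 n5] [n6 n7 n8 n9]] := nz_lines2 M.
  have -> : monomial [:: 1; 1; 1; -1; -1] = cst (-1) * TT M; last first.
    by apply: samep_scale; rewrite oppr_eq0 oner_neq0.
  by rewrite TTE rmorphN1 /monomial /= !expr1z !exprN1; fieldq.
left; apply: is_base_eqaut (eqaut_sym (eqaut_word _ _)) _; apply/base_monomials_ok.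
by move: w hw; apply/allP.
Qed.

Lemma eqaut_const (f g : K) c : eqaut f g -> f = cst c -> exists d, g = cst d.
Proof.
move=> [s [[_ sc _] [a [b [a' [b' [h0 h]]]]]]] ef; have nz := samep_nz h0 h.
move: h nz; rewrite ef sc -!(rmorphM cst) -!(rmorphD cst) => h nz.
exists ((a * c + b) / (a' * c + b')); rewrite (rmorphM cst) fmorphV -h mulfK //.
Qed.

Lemma cbundle_nonconst (f : K) c : cbundle f -> f <> cst c.
Proof.
move=> [_ [s hs]] ef; have [t] := fresh_elt (c :: s); rewrite in_cons negb_or => /andP[tc ts].
have [V [cV _ _ hV]] := hs t ts; have lV := curve_lring cV.
have : mx V 1.
  apply/hV; exists (cst (c - t)^-1); first exact: lrC.
  by rewrite ef -(rmorphB cst) -rmorphM mulVf ?rmorph1 // subr_eq0 eq_sym.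
by rewrite -(rmorph1 cst) => /(mx_cst lV)/eqP; rewrite oner_eq0.
Qed.

Lemma TT_nonconst c : TT M <> cst c.
Proof.
have [b _] := base_typeI M; move=> e; apply: b; rewrite e.
by apply: lrC; apply: loc_lring; exact: typeI_birat.
Qed.

Lemma class_nonconst t c : t \in conic_classes -> monomial (class_exponents t) <> cst c.
Proof.
move=> /class_monomial[[] h|/eqaut_samep h] e; have [d ed] := eqaut_const h e.
- exact: cbundle_nonconst (cbundle_x M) ed.
- exact: cbundle_nonconst (cbundle_g2 M) ed.
- exact: cbundle_nonconst (cbundle_g3 M) ed.
exact: TT_nonconst ed.
Qed.

Definition line_mon_value (n : seq nat) : K := ev x y (line_mon k n).

Lemma line_mon_ratio n m : line_mon_value n / line_mon_value m =
  monomial (mkseq (fun i => (nth 0%N n i.+1)%:Z - (nth 0%N m i.+1)%:Z) 5).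
Proof.
have [[n1 n2 n3 n4 n5] [n6 n7 n8 n9]] := nz_lines2 M.
rewrite /line_mon_value /line_mon !ev_lmon /monomial /= !expfzDr // -!exprnN -!exprnP.
by rewrite !invfM; ring.
Qed.

Lemma line_mon_neq0 n : line_mon_value n != 0.
Proof.
have [[n1 n2 n3 n4 n5] [n6 n7 n8 n9]] := nz_lines2 M.
by rewrite /line_mon_value /line_mon ev_lmon !mulf_neq0 // expf_neq0.
Qed.

Lemma add6_ratio n t : t \in conic_classes ->
  line_mon_value (add6 n t.2.1) / line_mon_value (add6 n t.2.2) = monomial (class_exponents t).
Proof.
move=> _; rewrite line_mon_ratio; congr monomial; rewrite /add6 /class_exponents /mkseq /=.
by do 5 (congr (_ :: _); first by rewrite !PoszD; ring).
Qed.

Lemma cbundle_monomial (f : K) : cbundle f -> exists2 t, t \in conic_classes & samep f (monomial (class_exponents t)).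
Proof.
move=> cf; have nf c := @cbundle_nonconst f c cf; have [reg [s0 hs]] := cf.
have [[n1 n2 n3 n4 n5] [n6 n7 n8 n9]] := nz_lines2 M.
(* On a general fibre the five affine lines are units, so the curve is none of them and
   [class_of_curve] applies to its equation. *)
have [|s1 h1] := @generic_units k M f [:: x; y; 1 - x; 1 - y; x + y - 1].
  by move=> z; rewrite !inE => /or4P[||| /orP[]] /eqP->.
have [s2 h2] := generic_not_const f.
have [tau] := fresh_elt (s0 ++ s1 ++ s2); rewrite !mem_cat !negb_or => /and3P[t0 t1 t2].
have [V [cV rV uV gV]] := hs tau t0; have lV := curve_lring cV.
have g0 : f - cst tau != 0 by rewrite subr_eq0; apply/eqP/nf.
have mg := mx_Vg cV gV; have un := h1 tau t1 V cV mg; have nc := h2 tau t2 V cV mg.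
have ux : iu V x by apply: un; rewrite !inE eqxx.
have uy : iu V y by apply: un; rewrite !inE eqxx ?orbT.
have u1x : iu V (1 - x) by apply: un; rewrite !inE eqxx ?orbT.
have u1y : iu V (1 - y) by apply: un; rewrite !inE eqxx ?orbT.
have uxy : iu V (x + y - 1) by apply: un; rewrite !inE eqxx ?orbT.
have inV (p : {mpoly k[2]}) : V (ev x y p) by apply: lr_ev; [|exact: ux.1|exact: uy.1].
have [P [Q [Q0 ePQ _]]] := fracP (b_xy M) (f - cst tau).
have P0 : P != 0 by apply: contraNneq g0 => e; rewrite ePQ e rmorph0 mul0r.
have mP : mx V (ev x y P).
  have -> : ev x y P = (f - cst tau) * ev x y Q by rewrite ePQ mulfVK // (ev_neq0 (b_xy M)).
  exact: mxMr.
(* The curve V lies in the affine plane; its equation is an irreducible factor of the numerator of f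
   - tau that vanishes along V. *)
have [||q [iq _ mq]] := @irr_factor k (fun a => mx V (ev x y a)) P _ _ P0 mP.
- by move=> a b; rewrite rmorphM; apply: mx_prime.
- move=> a [e ea] ma; have : mx V (ev x y (a * e)) by rewrite rmorphM; apply: mxMr.
  by rewrite -ea rmorph1 -(rmorph1 cst) => /(mx_cst lV)/eqP; rewrite oner_eq0.
have eV : V = Wc x y q.
  by apply: eqset_eq; apply: same_curve => //; [exact: ux.1|exact: uy.1].
have nd (p : {mpoly k[2]}) (z : K) : iu V z -> z != 0 -> ev x y p = z \/ ev x y p = - z -> ~ dvr q p.
  move=> [hz hzi] z0 ep [e ee]; have mz : mx V z.
    have h : mx V (ev x y p) by rewrite ee rmorphM; apply: mxMr.
    by case: ep => ep; [rewrite -ep|rewrite -[z]opprK -ep; apply: mxN].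
  by have := mx_unitF mz hzi; apply/eqP.
have eX := evX x y; have eY := evY x y.
have [|||||D [_ nD d0 hD]] := @class_of_curve k M q iq.
- by apply: (nd _ x) => //; left.
- by apply: (nd _ y) => //; left.
- by apply: (nd _ (1 - x)) => //; right; rewrite rmorphB rmorph1 /= eX opprB.
- by apply: (nd _ (1 - y)) => //; right; rewrite rmorphB rmorph1 /= eY opprB.
- by apply: (nd _ (x + y - 1)) => //; left; rewrite rmorphB rmorphD rmorph1 /= eX eY.
have [t [n [ht a1 a2]]] := nef_two_admissible nD d0; exists t => //.
have [rho [r1 r2 r3 r4]] := rV.
have sec m : admissible D m -> exists a b, line_mon_value m / ev x y q = cst a + cst b * (f - cst tau)^-1.
  move=> hm; apply: (two_sections reg cV _ uV gV g0); first by split; [exact: r1|exact: r2|exact: r4].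
  by apply: Lsec_lines => //; rewrite -?eV //; exact: hD.
have [a [b e1]] := sec _ a1; have [a' [b' e2]] := sec _ a2.
have q0 : ev x y q != 0 by rewrite (ev_neq0 (b_xy M)); case: iq.
have e3 := add6_ratio n ht; set h := monomial _ in e3 *.
have m0 := line_mon_neq0 (add6 n t.2.2).
have eh : h * (cst a' + cst b' * (f - cst tau)^-1) = cst a + cst b * (f - cst tau)^-1.
  by rewrite -e1 -e2 -e3 mulrA divfK.
have eh2 : h * (cst a' * f + cst (b' - a' * tau)) = cst a * f + cst (b - a * tau).
  rewrite !(rmorphB cst) !(rmorphM cst).
  have r (u v : K) : u * f + (v - u * cst tau) = (u + v * (f - cst tau)^-1) * (f - cst tau).
    by rewrite mulrDl divfK //; ring.
  by rewrite !r mulrA eh.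
exists a, (b - a * tau), a', (b' - a' * tau); split=> //.
(* With a zero determinant the two sections are proportional and the monomial h is constant, which
   [class_nonconst] excludes. *)
apply/eqP => det; have det2 : a * b' = b * a'.
  by apply/eqP; rewrite -subr_eq0 -det; apply/eqP; ring.
have prop c : a = c * a' -> b = c * b' -> False.
  move=> ea eb; apply: (class_nonconst (c := c) ht); rewrite -/h -e3.
  apply: (mulIf m0); rewrite divfK //; apply: (mulIf (invr_neq0 q0)).
  by rewrite e1 -mulrA e2 ea eb !(rmorphM cst) mulrDr mulrA.
have [a0|a0] := eqVneq a' 0; last first.
  by apply: (prop (a / a')); rewrite ?divfK // mulrAC det2 mulfK.
have [b0|b0] := eqVneq b' 0.
  move: e2; rewrite a0 b0 (rmorph0 cst) mul0r addr0 => /eqP.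
  by rewrite mulf_eq0 invr_eq0 (negPf m0) (negPf q0).
have ea : a = 0 by apply: (mulIf b0); rewrite det2 a0 mulr0 mul0r.
by apply: (prop (b / b')); rewrite ?divfK // ea a0 mulr0.
Qed.

Lemma classification (f : K) : (samep f (TT M) -> False) -> cbundle f -> is_base f.
Proof.
move=> nT cf; have [t ht h] := cbundle_monomial cf.
case: (class_monomial ht) => [hb|hT]; first exact: is_base_eqaut (eqaut_samep h) hb.
by exfalso; apply: nT; apply: samep_trans h hT.
Qed.
End Monomials.

(** * The elliptic fibration *)

Section Cubic.
Variables (R : comNzRingType) (t : R).

Definition cubic (a b c : R) : R := a * b * (c - a) - t * (c * (c - a - b) * (c - b)).
(** The three partial derivatives of the member F - t G of the pencil, with (a, b, c) standing for
    (x1, x2, x0). *)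
Definition cubic_a (a b c : R) : R := b * (c - a - a) + t * (c * (c - b)).
Definition cubic_b (a b c : R) : R := a * (c - a) + t * (c * (c + c - a - b - b)).
Definition cubic_c (a b c : R) : R :=
  a * b - t * ((c - a - b) * (c - b) + c * (c - b) + c * (c - a - b)).

Lemma cubic_euler a b c : a * cubic_a a b c + b * cubic_b a b c + c * cubic_c a b c = cubic a b c *+ 3.
Proof. by rewrite /cubic /cubic_a /cubic_b /cubic_c; ring. Qed.

Lemma cross_a (a b c a' b' c' p q r : R) : a * p + b * q + c * r = 0 -> a' * p + b' * q + c' * r = 0 ->
  (b * c' - c * b') * q = (c * a' - a * c') * p.
Proof.
move=> e1 e2; apply/eqP; rewrite -subr_eq0; apply/eqP.
have -> : (b * c' - c * b') * q - (c * a' - a * c') * p =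
  c' * (a * p + b * q + c * r) - c * (a' * p + b' * q + c' * r) by ring.
by rewrite e1 e2 !mulr0 subrr.
Qed.

(** A vector proportional to (p, q, r) is a multiple of it when p, q, r generate the unit ideal; the
    multiplier is the same combination of its entries. *)
Lemma bezout_split (w1 w2 w3 p q r u v w : R) : u * p + v * q + w * r = 1 ->
  w1 * q = w2 * p -> w1 * r = w3 * p -> w1 = (u * w1 + v * w2 + w * w3) * p.
Proof.
move=> e h1 h2; rewrite -[LHS]mulr1 -e.
have -> : w1 * (u * p + v * q + w * r) = u * w1 * p + v * (w1 * q) + w * (w1 * r) by ring.
by rewrite h1 h2; ring.
Qed.
End Cubic.

(** Euler's relation puts a zero of the gradient on the cubic, as 3 is invertible. The excluded
    values of t are those of singular fibres: 0 for a fibre of type I5, the roots of t^2 - 11 t - 1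
    for the nodal ones. *)
Lemma cubic_smooth (k : fieldType) (t a b c : k) : (3%:R : k) != 0 -> t != 0 -> t ^+ 2 - t *+ 11 - 1 != 0 ->
  cubic_a t a b c = 0 -> cubic_b t a b c = 0 -> cubic_c t a b c = 0 -> [/\ a = 0, b = 0 & c = 0].
Proof.
move=> h3 t0 dt ea eb ec.
have e : cubic t a b c = 0.
  apply/eqP; have := cubic_euler t a b c; rewrite ea eb ec !mulr0 !addr0 => /esym/eqP.
  by rewrite -mulr_natr mulf_eq0 (negPf h3) orbF.
have [c0|c0] := eqVneq c 0.
  move: eb ec e; rewrite c0 /cubic_b /cubic_c /cubic !mul0r !mulr0 !addr0 !sub0r => /eqP.
  rewrite mulf_eq0 oppr_eq0 orbb => /eqP->; rewrite !mul0r subr0 sub0r => /eqP.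
  by rewrite oppr0 sub0r mulrNN oppr_eq0 !mulf_eq0 (negPf t0) /= orbb => /eqP->.
exfalso; move: ea eb e; set a1 := a / c; set b1 := b / c.
have -> : a = a1 * c by rewrite divfK.
have -> : b = b1 * c by rewrite divfK.
have -> : cubic_a t (a1 * c) (b1 * c) c = (b1 * (1 - a1 - a1) + t * (1 - b1)) * c ^+ 2.
  by rewrite /cubic_a; ring.
have -> : cubic_b t (a1 * c) (b1 * c) c = (a1 * (1 - a1) + t * (1 + 1 - a1 - b1 - b1)) * c ^+ 2.
  by rewrite /cubic_b; ring.
have -> : cubic t (a1 * c) (b1 * c) c = (a1 * b1 * (1 - a1) - t * ((1 - a1 - b1) * (1 - b1))) * c ^+ 3.
  by rewrite /cubic; ring.
move: {a b ec} a1 b1 => a b /eqP; rewrite mulf_eq0 expf_eq0 /= (negPf c0) orbF => /eqP ea.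
move/eqP; rewrite mulf_eq0 expf_eq0 /= (negPf c0) orbF => /eqP eb.
move/eqP; rewrite mulf_eq0 expf_eq0 /= (negPf c0) orbF => /eqP e.
have b0 : b != 0.
  apply: contraTneq t0 => b0; move: ea; rewrite b0 mul0r add0r subr0 mulr1 => ->; by rewrite eqxx.
have b1 : 1 - b != 0.
  apply/negP => /eqP h; have hb : b = 1 by apply/eqP; rewrite eq_sym -subr_eq0 h.
  move: ea e; rewrite hb subrr !mulr0 addr0 subr0 !(mulr1, mul1r) => h1 /eqP.
  have : 1 = a + a by move/eqP: h1; rewrite -addrA -opprD subr_eq0 => /eqP.
  move=> h2; rewrite mulf_eq0 => /orP[]/eqP h4.
    by move: h2; rewrite h4 addr0 => /eqP; rewrite oner_eq0.
  have a1 : a = 1 by apply/eqP; rewrite eq_sym -subr_eq0 h4.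
  by move/eqP: h2; rewrite a1 -subr_eq0 opprD addrA subrr sub0r oppr_eq0 oner_eq0.
have f1 : b * (1 - a - a) = (1 - a) ^+ 2.
  apply/eqP; rewrite -subr_eq0; apply/eqP; apply: (mulfI b0); rewrite mulr0.
  have -> : b * (b * (1 - a - a) - (1 - a) ^+ 2) =
    - (a * b * (1 - a) - t * ((1 - a - b) * (1 - b))) - (1 - a - b) * (b * (1 - a - a) + t * (1 - b)) by ring.
  by rewrite ea e mulr0 subr0 oppr0.
have a0 : a != 0.
  apply: contraNneq b1 => a0; move: f1; rewrite a0 !subr0 expr1n mulr1 => ->; by rewrite subrr.
have a1 : 1 - a != 0.
  apply: contraNneq b0 => h; move: f1; rewrite h expr0n /= sub0r mulrN => /eqP; rewrite oppr_eq0 mulf_eq0 (negPf a0) orbF.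
  exact.
have f2 : a * (1 - a) * (1 - b) = b * (1 - a - a) * (1 + 1 - a - b - b).
  apply/eqP; rewrite -subr_eq0; apply/eqP.
  have -> : a * (1 - a) * (1 - b) - b * (1 - a - a) * (1 + 1 - a - b - b) =
    (1 - b) * (a * (1 - a) + t * (1 + 1 - a - b - b)) - (1 + 1 - a - b - b) * (b * (1 - a - a) + t * (1 - b)) by ring.
  by rewrite ea eb !mulr0 subr0.
have f3 : (1 - b) * (1 - a - a) = - a ^+ 2.
  by rewrite mulrBl f1; ring.
(* Eliminating t and then b leaves a^2 + a = 1. Then t = 3 - 5 a, and t^2 - 11 t - 1 = 25 (a^2 + a -
   1) = 0. *)
have f4 : a ^+ 2 = 1 - a.
  have : (1 - a) * (a * (a ^+ 2 - (1 - a))) = 0.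
    have h : (1 - a - a) * (a * (1 - a) * (1 - b) - b * (1 - a - a) * (1 + 1 - a - b - b)) = 0 by rewrite f2 subrr mulr0.
    have := h; have -> : (1 - a - a) * (a * (1 - a) * (1 - b) - b * (1 - a - a) * (1 + 1 - a - b - b)) =
      a * (1 - a) * ((1 - b) * (1 - a - a)) - b * (1 - a - a) * ((1 + 1 - a) * (1 - a - a) - (b * (1 - a - a)) *+ 2) by ring.
    rewrite f3 f1 => h'; rewrite -[RHS]oppr0 -h'; ring.
  move/eqP; rewrite !mulf_eq0 (negPf a1) (negPf a0) /= subr_eq0 => /eqP //.
have et : t = 3%:R - a *+ 5.
  have : t * - a ^+ 2 = - (1 - a) ^+ 2 * (1 - a - a).
    have h : (1 - a - a) * (b * (1 - a - a) + t * (1 - b)) = 0 by rewrite ea mulr0.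
    rewrite -f3; apply/eqP; rewrite -subr_eq0; apply/eqP; rewrite -h -f1; ring.
  have -> : (1 - a) ^+ 2 = (a ^+ 2) ^+ 2 by rewrite f4.
  move=> h; have a20 : - a ^+ 2 != 0 by rewrite oppr_eq0 expf_neq0.
  apply: (mulIf a20); rewrite h; have -> : - (a ^+ 2) ^+ 2 * (1 - a - a) = - a ^+ 2 * (a ^+ 2 - a ^+ 2 * a *+ 2) by ring.
  rewrite [RHS]mulrC; congr (_ * _); rewrite f4.
  have -> : 1 - a - (1 - a) * a *+ 2 = 1 - a *+ 3 + a ^+ 2 *+ 2 by ring.
  by rewrite f4; ring.
move/eqP: dt; apply; rewrite et; have -> : (3%:R - a *+ 5) ^+ 2 - (3%:R - a *+ 5) *+ 11 - 1 = (a ^+ 2 - (1 - a)) *+ 25 by ring.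
by rewrite f4 subrr mul0rn.
Qed.

Lemma coefM_top (R : comNzRingType) (p q : {poly R}) N L : (size p <= N.+1)%N -> (size q <= L.+1)%N ->
  (p * q)`_(N + L) = p`_N * q`_L.
Proof.
move=> hp hq; rewrite coefM; have hN : (N < (N + L).+1)%N by lia.
rewrite (bigD1 (Ordinal hN)) //= addKn big1 ?addr0 // => -[i hi] /= ne.
have [lt|gt|e] := ltngtP i N.
- by rewrite [q`_ _]nth_default ?mulr0 //; apply: leq_trans hq _; lia.
- by rewrite [p`_ _]nth_default ?mul0r //; apply: leq_trans hp _.
by case/negP: ne; apply/eqP/val_inj.
Qed.

Section Rational.
Variable k : closedFieldType.
Implicit Types p q A B C : {poly k}.

(** Polynomials without a common root over a closed field generate the unit ideal. *)
Lemma bezout3 p q r : (forall t, p.[t] = 0 -> q.[t] = 0 -> r.[t] <> 0) ->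
  exists u v w : {poly k}, u * p + v * q + w * r = 1.
Proof.
move=> h; have [[u1 u2] /= e] := Bezoutp q r.
have : coprimep p (u1 * q + u2 * r).
  rewrite (eqp_coprimepr _ e) /coprimep; apply/negPn/negP => /closed_rootP[t].
  rewrite !root_gcd => /and3P[/rootP h1 /rootP h2 /rootP h3]; exact: h h1 h2 h3.
case/Bezout_eq1_coprimepP => -[v1 v2] /= e1; exists v1, (v2 * u1), (v2 * u2).
by rewrite -e1; ring.
Qed.

Lemma deriv_cubic (t : k) A B C : (cubic t%:P A B C)^`() =
  A^`() * cubic_a t%:P A B C + B^`() * cubic_b t%:P A B C + C^`() * cubic_c t%:P A B C.
Proof.
rewrite /cubic !(derivB, derivM) derivC mul0r add0r /cubic_a /cubic_b /cubic_c.
by move: A^`() B^`() C^`() t%:P => A' B' C' t'; ring.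
Qed.

Lemma size_sub p q n : (size p <= n)%N -> (size q <= n)%N -> (size (p - q)%R <= n)%N.
Proof. by move=> h1 h2; apply: leq_trans (size_polyD _ _) _; rewrite size_polyN geq_max h1. Qed.

Lemma size_add p q n : (size p <= n)%N -> (size q <= n)%N -> (size (p + q)%R <= n)%N.
Proof. by move=> h1 h2; apply: leq_trans (size_polyD _ _) _; rewrite geq_max h1. Qed.

Lemma size_deriv_le p n : (size p <= n.+1)%N -> (size p^`() <= n)%N.
Proof.
have [->|p0] := eqVneq p 0; first by rewrite deriv0 size_poly0.
by move=> h; rewrite -ltnS; apply: leq_trans (lt_size_deriv p0) h.
Qed.

Ltac sz := repeat first [exact | apply: size_sub | apply: size_add].

Hypothesis char0 : forall n, (n.+1%:R : k) != 0.

Lemma deriv_eq0 p : p^`() = 0 -> (size p <= 1)%N.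
Proof.
move=> h; apply/leq_sizeP => -[|j] // _; have := congr1 (fun q : {poly k} => q`_j) h.
by rewrite coef_deriv coef0 -mulr_natr => /eqP; rewrite mulf_eq0 (negPf (char0 j)) orbF => /eqP.
Qed.

Lemma cubic_param_const (t : k) A B C : t != 0 -> t ^+ 2 - t *+ 11 - 1 != 0 ->
  C != 0 -> (forall r, A.[r] = 0 -> B.[r] = 0 -> C.[r] <> 0) -> cubic t%:P A B C = 0 ->
  [/\ (size A <= 1)%N, (size B <= 1)%N & (size C <= 1)%N].
Proof.
move=> t0 dt C0 co e.
set ga := cubic_a t%:P A B C; set gb := cubic_b t%:P A B C; set gc := cubic_c t%:P A B C.
have eu : A * ga + B * gb + C * gc = 0 by rewrite cubic_euler e mul0rn.
have ed : A^`() * ga + B^`() * gb + C^`() * gc = 0 by rewrite -deriv_cubic e deriv0.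
(* N is the degree of the parametrization: the coefficients of degree N are not all zero. *)
have [N [sA sB sC nz]] : exists N, [/\ (size A <= N.+1)%N, (size B <= N.+1)%N, (size C <= N.+1)%N
    & [\/ A`_N != 0, B`_N != 0 | C`_N != 0]].
  exists (maxn (size A) (maxn (size B) (size C))).-1.
  have lc (p : {poly k}) n : size p = n.+1 -> p`_n != 0.
    by move=> sp; have := lead_coef_eq0 p; rewrite lead_coefE sp /= -size_poly_eq0 sp => ->.
  have sC : (0 < size C)%N by rewrite size_poly_gt0.
  case E : (maxn _ _) => [|n] /=.
    by move: E sC; move: (size A) (size B) (size C) => a b c; lia.
  have [h1 h2 h3 h] : [/\ (size A <= n.+1)%N, (size B <= n.+1)%N, (size C <= n.+1)%N &
      size A = n.+1 \/ size B = n.+1 \/ size C = n.+1].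
    by move: E; move: (size A) (size B) (size C) => a b c E; split; lia.
  split=> //; case: h => [h|[h|h]].
  - by apply: Or31; apply: lc.
  - by apply: Or32; apply: lc.
  by apply: Or33; apply: lc.
have h3 : (3%:R : k) != 0 by apply: char0.
have ca : ga`_(N + N) = cubic_a t A`_N B`_N C`_N.
  rewrite /ga /cubic_a coefD coefCM !coefM_top; first by rewrite !coefB.
  all: sz.
have cb : gb`_(N + N) = cubic_b t A`_N B`_N C`_N.
  rewrite /gb /cubic_b coefD coefCM !coefM_top; first by rewrite !(coefB, coefD).
  all: sz.
have cc : gc`_(N + N) = cubic_c t A`_N B`_N C`_N.
  rewrite /gc /cubic_c coefB coefCM !coefD !coefM_top; first by rewrite !coefB.
  all: sz.
have [u [v [w bz]]] : exists u v w, u * ga + v * gb + w * gc = 1.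
  apply: bezout3 => r ha hb hc.
  have [|||a0 b0 c0] := @cubic_smooth k t A.[r] B.[r] C.[r] h3 t0 dt.
  - by rewrite -ha /ga /cubic_a !(hornerE).
  - by rewrite -hb /gb /cubic_b !(hornerE).
  - by rewrite -hc /gc /cubic_c !(hornerE).
  exact: (co r a0 b0 c0).
set w1 := B * C^`() - C * B^`(); set w2 := C * A^`() - A * C^`(); set w3 := A * B^`() - B * A^`().
have r12 : w1 * gb = w2 * ga by apply: cross_a eu ed.
have r31 : w3 * ga = w1 * gc.
  by apply: (@cross_a _ C A B _ _ _ gc ga gb); rewrite -addrA addrC.
have r23 : w2 * gc = w3 * gb.
  by apply: (@cross_a _ B C A _ _ _ gb gc ga); rewrite addrC addrA.
set s := u * w1 + v * w2 + w * w3.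
have e1 : w1 = s * ga by apply: bezout_split bz r12 (esym r31).
have e2 : w2 = s * gb.
  rewrite /s [u * _ + _]addrC -addrA [u * _ + _]addrC addrA.
  apply: (@bezout_split _ w2 w3 w1 gb gc ga v w u) => //.
  by rewrite -bz; ring.
have e3 : w3 = s * gc.
  rewrite /s addrC addrA.
  apply: (@bezout_split _ w3 w1 w2 gc ga gb w u v) => //.
  by rewrite -bz; ring.
have sw (p q : {poly k}) : (size p <= N.+1)%N -> (size q <= N.+1)%N -> (size (p * q^`())%R <= N + N)%N.
  move=> h1 /size_deriv_le h2; apply: leq_trans (size_polyMleq _ _) _.
  by move: h1 h2; move: (size _) (size _) => a b; lia.
have sww (p q r l : {poly k}) : (size p <= N.+1)%N -> (size q <= N.+1)%N -> (size r <= N.+1)%N -> (size l <= N.+1)%N ->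
    (size (p * q^`() - r * l^`())%R <= N + N)%N.
  by move=> *; apply: leq_trans (size_polyD _ _) _; rewrite size_polyN geq_max !sw.
(* The coefficients of degree N form a nonzero vector, where the gradient does not vanish; so some
   gradient entry has degree at least 2 N, while the entries of the cross product have degree below
   2 N. *)
have s0 : s = 0.
  apply/eqP/negPn/negP => sn.
  have big (g : {poly k}) : g`_(N + N) != 0 -> (N + N < size (s * g)%R)%N.
    move=> hg; have g0 : g != 0 by apply: contraNneq hg => ->; rewrite coef0.
    have hs : (N + N < size g)%N by rewrite ltnNge; apply: contra hg => h; rewrite nth_default.
    rewrite size_mul //; move: hs; rewrite -size_poly_gt0 in sn; move: sn.
    by move: (size _) (size _) => a b; lia.
  have lA : cubic_a t A`_N B`_N C`_N = 0.
    by rewrite -ca; apply/eqP/negPn/negP => /big; rewrite -e1 ltnNge sww.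
  have lB : cubic_b t A`_N B`_N C`_N = 0.
    by rewrite -cb; apply/eqP/negPn/negP => /big; rewrite -e2 ltnNge sww.
  have lC : cubic_c t A`_N B`_N C`_N = 0.
    by rewrite -cc; apply/eqP/negPn/negP => /big; rewrite -e3 ltnNge sww.
  have [a0 b0 c0] := cubic_smooth h3 t0 dt lA lB lC.
  by case: nz; rewrite ?a0 ?b0 ?c0 eqxx.
have [u' [v' [w' bz']]] := bezout3 co.
have z1 : B * C^`() = C * B^`() by apply/eqP; rewrite -subr_eq0 -/w1 e1 s0 mul0r.
have z2 : C * A^`() = A * C^`() by apply/eqP; rewrite -subr_eq0 -/w2 e2 s0 mul0r.
have z3 : A * B^`() = B * A^`() by apply/eqP; rewrite -subr_eq0 -/w3 e3 s0 mul0r.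
(* With a zero cross product, Bezout's relation for A, B, C makes each derivative a multiple of its
   polynomial. For degree reasons the derivative is 0, and characteristic 0 makes the polynomial
   constant. *)
have fin (p l : {poly k}) : p^`() = p * l -> (size p <= 1)%N.
  have [->|p0] := eqVneq p 0; first by rewrite size_poly0.
  move=> ep; apply: deriv_eq0; apply/eqP/negPn/negP => d0.
  have := lt_size_deriv p0; rewrite ep size_mul //.
    move: d0; rewrite ep mulf_eq0 negb_or => /andP[_]; rewrite -size_poly_gt0.
    by move: (size _) (size _) => a b; lia.
  by move: d0; rewrite ep mulf_eq0 negb_or => /andP[].
split.
- apply: (fin A (u' * A^`() + v' * B^`() + w' * C^`())).
  rewrite -[LHS]mulr1 -bz'; transitivity (u' * A * A^`() + v' * (B * A^`()) + w' * (C * A^`())); first by ring.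
  by rewrite -z3 z2; ring.
- apply: (fin B (u' * A^`() + v' * B^`() + w' * C^`())).
  rewrite -[LHS]mulr1 -bz'; transitivity (u' * (A * B^`()) + v' * B * B^`() + w' * (C * B^`())); first by ring.
  by rewrite z3 -z1; ring.
apply: (fin C (u' * A^`() + v' * B^`() + w' * C^`())).
rewrite -[LHS]mulr1 -bz'; transitivity (u' * (A * C^`()) + v' * (B * C^`()) + w' * C * C^`()); first by ring.
by rewrite -z2 z1; ring.
Qed.

Section EllipticFibration.
Variable M : funfield k.
Local Notation K := (ff M).
Local Notation F := (rf M).
Local Notation pf := (pf M).
Local Notation cst := (cst M).
Local Notation x := (@fx k M).
Local Notation y := (@fy k M).

Lemma common_denominator (X Y : F) : exists A B C : {poly k}, [/\ C != 0, X = pf A / pf C, Y = pf B / pf C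
  & forall r, A.[r] = 0 -> B.[r] = 0 -> C.[r] <> 0].
Proof.
have [a [b [b0 ->]]] := @pfP k M X; have [c [d [d0 ->]]] := @pfP k M Y.
have [A [B [C [g [g0 eA eB eC co]]]]] : exists A B C g, [/\ g != 0, a * d = A * g, c * b = B * g, b * d = C * g
    & forall r, A.[r] = 0 -> B.[r] = 0 -> C.[r] <> 0].
  pose g := gcdp (a * d) (gcdp (c * b) (b * d)).
  have g0 : g != 0 by rewrite !gcdp_eq0 !mulf_eq0 (negPf b0) (negPf d0) !andbF.
  have [gA gB gC] : [/\ g %| a * d, g %| c * b & g %| b * d].
    split; first exact: dvdp_gcdl.
      exact: dvdp_trans (dvdp_gcdr _ _) (dvdp_gcdl _ _).
    exact: dvdp_trans (dvdp_gcdr _ _) (dvdp_gcdr _ _).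
  exists (a * d %/ g), (c * b %/ g), (b * d %/ g), g; rewrite !divpK //; split=> // r hA hB hC.
  have : 'X - r%:P %| 1.
    rewrite -(dvdp_mul2r _ _ g0) mul1r {2}/g !dvdp_gcd.
    have h (z : {poly k}) : g %| z -> (z %/ g).[r] = 0 -> ('X - r%:P) * g %| z.
      by move=> gz hz; rewrite -(divpK gz) dvdp_mul // dvdp_XsubCl; apply/rootP.
    by rewrite !h.
  by rewrite dvdp1 size_XsubC.
have C0 : C != 0 by apply: contraNneq (mulf_neq0 b0 d0) => e; rewrite eC e mul0r.
have fr (p q p' q' : {poly k}) : q != 0 -> q' != 0 -> p * q' = p' * q -> pf p / pf q = pf p' / pf q'.
  by move=> h1 h2 e; apply/eqP; rewrite eqr_div ?pf_eq0 // -!rmorphM e.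
exists A, B, C; split=> //; apply: fr => //; apply: (mulIf g0).
  have -> : A * b * g = A * g * b by ring.
  by rewrite -eA -mulrA -eC; ring.
have -> : B * d * g = B * g * d by ring.
by rewrite -eB -mulrA -eC; ring.
Qed.

(** On a general fibre T has a value sigma giving a smooth cubic. The residue map would turn x and y
    into a rational parametrization of that cubic, which is constant, whereas x and y are not both
    constant on the fibre. *)
Lemma not_elliptic (f : K) : cbundle f -> samep f (TT M) -> False.
Proof.
move=> cf hT; have nf c := @cbundle_nonconst k M f c cf; have [reg [s0 hs]] := cf.
have [[n1 n2 n3 n4 n5] [n6 n7 n8 n9]] := nz_lines2 M.
have nT c : TT M != cst c by apply/eqP/TT_nonconst.
have T0 : TT M != 0 by rewrite -(rmorph0 cst).
(* The discriminant is split into linear factors so that [generic_units] can avoid its roots as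
   values of T. *)
have split_disc : exists r1 r2 : k, forall z : K, z ^+ 2 - z *+ 11 - 1 = (z - cst r1) * (z - cst r2).
  have [r er] : exists r : k, r ^+ 2 = 1 + 11%:R * r.
    have [r] := @solve_monicpoly k 2 (fun i => if i == 0%N then 1 else 11%:R) isT.
    by rewrite !big_ord_recl big_ord0 /= /bump /= expr0 expr1 mulr1 addr0; exists r.
  exists r, (11%:R - r) => z.
  rewrite (rmorphB cst) (rmorph_nat cst).
  have e1 : cst r ^+ 2 = 1 + cst r *+ 11.
    by rewrite -(rmorphXn cst) er (rmorphD cst) (rmorph1 cst) mulr_natl (rmorphMn cst).
  have -> : (z - cst r) * (z - (11%:R - cst r)) = z ^+ 2 - z *+ 11 - (cst r ^+ 2 - cst r *+ 11) by ring.
  by rewrite e1; ring.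
have [r1 [r2 hd]] := split_disc.
have [|s1 h1] := @generic_units k M f [:: x; y; 1 - y; 1 - x - y; TT M; TT M - cst r1; TT M - cst r2].
  by move=> z; rewrite !inE => /or4P[||| /or4P[]] /eqP-> //; rewrite subr_eq0.
have [s2 h2] := generic_not_const f.
have [a [b [a' [b' [det0 eT]]]]] := hT; have nzd := samep_nz det0 eT.
(* Excludes the value of f at which T has a pole. *)
have [s3 h3] : exists s3 : seq k, forall t, t \notin s3 -> a' * t + b' != 0.
  have [a0|a0] := eqVneq a' 0; last first.
    exists [:: - b' / a'] => t; rewrite inE => ht; apply: contra ht => /eqP e.
    by apply/eqP/(mulfI a0); rewrite mulrCA divff // mulr1; apply/eqP; rewrite -subr_eq0 opprK e.
  exists [::] => t _; rewrite a0 mul0r add0r; apply: contraNneq det0 => b0.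
  by rewrite a0 b0 !mulr0 subrr.
have [tau] := fresh_elt (s0 ++ s1 ++ s2 ++ s3).
rewrite !mem_cat !negb_or => /and4P[t0 t1 t2 t3].
have [V [cV [rho [q1 q2 q3 q4]] uV gV]] := hs tau t0; have lV := curve_lring cV.
have mg := mx_Vg cV gV; have un := h1 tau t1 V cV mg; have nc := h2 tau t2 V cV mg.
have ux : iu V x by apply: un; rewrite !inE eqxx.
have uy : iu V y by apply: un; rewrite !inE eqxx ?orbT.
have u1y : iu V (1 - y) by apply: un; rewrite !inE eqxx ?orbT.
have uxy : iu V (1 - x - y) by apply: un; rewrite !inE eqxx ?orbT.
have uT : iu V (TT M) by apply: un; rewrite !inE eqxx ?orbT.
have ud1 : iu V (TT M - cst r1) by apply: un; rewrite !inE eqxx ?orbT.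
have ud2 : iu V (TT M - cst r2) by apply: un; rewrite !inE eqxx ?orbT.
have [sigma vT] : exists sigma, vl V (TT M) sigma.
  exists ((a * tau + b) / (a' * tau + b')).
  have -> : TT M = (cst a * f + cst b) / (cst a' * f + cst b') by rewrite -eT mulfK.
  have vf : vl V f tau by exact: mg.
  apply: (vl_div lV); last exact: h3.
    by apply: vlD => //; [apply: vlM => //|]; apply: vlC.
  by apply: vlD => //; [apply: vlM => //|]; apply: vlC.
have unz z c : iu V z -> z != 0 -> vl V z c -> c != 0.
  move=> [hz hzi] z0 hc; apply/negP => /eqP c0; rewrite c0 in hc.
  by have := mx_unitF ((vl0 _ _).1 hc) hzi; apply/eqP.
have sg0 : sigma != 0 by apply: unz uT T0 vT.
have v11 n : vl V (TT M *+ n) (sigma *+ n).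
  elim: n => [|n ih]; first by rewrite !mulr0n -(rmorph0 cst); apply: vlC.
  by rewrite !mulrS; apply: vlD.
have disc : sigma ^+ 2 - sigma *+ 11 - 1 != 0.
  apply: (unz ((TT M - cst r1) * (TT M - cst r2))); first exact: iuM.
    by rewrite mulf_neq0 // subr_eq0.
  rewrite -hd; apply: vlB => //; last exact: vl1.
  by apply: vlB => //; exact: vlX.
have [A [B [C [C0 eX eY co]]]] := common_denominator (rho x) (rho y).
have rr : resmap V rho by split.
have r0 (z : K) : mx V z -> rho z = 0 by move=> h; apply/(q4 _ (mx_in h)).
have rD u v : V u -> V v -> rho (u + v) = rho u + rho v by move=> hu hv; case: (q1 u v hu hv).
have rM u v : V u -> V v -> rho (u * v) = rho u * rho v by move=> hu hv; case: (q1 u v hu hv).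
have rC c : rho (cst c) = pf c%:P := q2 c.
have r1' : rho 1 = 1 by rewrite -(rmorph1 cst) rC polyC1 rmorph1.
have rN u : V u -> rho (- u) = - rho u.
  move=> hu; rewrite -mulN1r -(rmorphN1 cst) rM ?rC //; last exact: lrC.
  by rewrite polyCN polyC1 rmorphN1 mulN1r.
have [[Vx _] [Vy _]] := (ux, uy).
have V1 : V 1 by rewrite -(rmorph1 cst); apply: lrC.
have rB u v : V u -> V v -> rho (u - v) = rho u - rho v.
  by move=> hu hv; rewrite rD ?rN //; apply: lrN.
have pC0 : pf C != 0 by rewrite pf_eq0.
have eqC : cubic sigma%:P A B C = 0.
  have mz : mx V (x * y * (1 - x) - cst sigma * ((1 - x - y) * (1 - y))).
    have -> : x * y * (1 - x) - cst sigma * ((1 - x - y) * (1 - y)) =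
        (TT M - cst sigma) * ((1 - x - y) * (1 - y)).
      by rewrite TTE [RHS]mulrBl divfK // mulf_neq0.
    apply: mxMr => //; apply: lrM => //; [by case: uxy|by case: u1y].
  have := r0 _ mz.
  have V1x : V (1 - x) by apply: lrB.
  have V1y : V (1 - y) by apply: lrB.
  have V1xy : V (1 - x - y) by apply: lrB.
  have Vs : V (cst sigma) by apply: lrC.
  rewrite rB ?rM ?rC ?rB ?r1' ?eX ?eY //; do ?[apply: lrM => //].
  move/(congr1 (fun z => z * pf C ^+ 3)); rewrite mul0r => e.
  apply: (@pf_inj k M); rewrite rmorph0 -e /cubic !(rmorphB, rmorphM) /=.
  by move: pC0; move: (pf A) (pf B) (pf C) (pf sigma%:P) => a1 b1 c1 t4 c0; field.
have [sA sB sC] := cubic_param_const sg0 disc C0 co eqC.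
have vc (p : {poly k}) z : (size p <= 1)%N -> V z -> rho z = pf p / pf C -> mx V (z - cst (p`_0 / C`_0)).
  move=> sp Vz ez; have Vc : V (cst (p`_0 / C`_0)) by apply: lrC.
  apply/(q4 _ (lrB lV Vz Vc)); rewrite rB // ez rC.
  have hC := size1_polyC sC; have c0 : C`_0 != 0 by rewrite -polyC_eq0 -hC.
  have -> : p = (p`_0 / C`_0)%:P * C by rewrite {2}hC -polyCM divfK // -size1_polyC.
  by rewrite coefCM rmorphM /= !mulfK ?subrr.
by apply: (nc (A`_0 / C`_0) (B`_0 / C`_0)); apply: vc.
Qed.
End EllipticFibration.
End Rational.

Lemma fractionP (R : idomainType) (z : {fraction R}) : exists a b : R, b != 0 /\ z = tofrac a / tofrac b.
Proof.
elim/quotW: z => -[[a b] /= b0]; exists a, b; split=> //.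
have tb0 : tofrac b != 0 by rewrite tofrac_eq0.
apply: (mulIf tb0); rewrite divfK // ; unlock FracField.tofrac.
rewrite -[LHS]FracField.pi_mul; apply/eqmodP; rewrite /= FracField.equivfE /FracField.mulf /=.
by rewrite !numer_Ratio ?denom_Ratio ?numer_Ratio ?(mulr1, oner_neq0) // mulrC.
Qed.

Lemma tofrac_inj (R : idomainType) : injective (@tofrac R).
Proof. by move=> a b /eqP; rewrite tofrac_eq => /eqP. Qed.

(** * Return from the abstract function field to the fraction fields of the statement *)

Section Bridge.
Variable k : closedFieldType.

Definition ratfun : funfield k := FunField
  (@tofrac_inj {mpoly k[2]}) (@fractionP {mpoly k[2]}) (@tofrac_inj {poly k}) (@fractionP {poly k}).

Lemma ratioE (A B : {mpoly k[3]}) : Defs.ratio A B = @dh k ratfun A / @dh k ratfun B.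
Proof. by rewrite /Defs.ratio /dehom /dh. Qed.

Lemma plane_local_ringE a : @plane_local_ring k a = @planeloc k ratfun a.
Proof.
apply: funext => z; apply: propext; split=> -[d [A [B [h1 h2 h3 h4]]]]; exists d, A, B.
  by rewrite ratioE in h4; exact: (And4 h1 h2 h3 h4).
by rewrite -ratioE in h4; exact: (And4 h1 h2 h3 h4).
Qed.

Lemma base_pointE T O : @base_point k T O = @basept k ratfun T O.
Proof. by rewrite /base_point /basept. Qed.

Lemma near_pointE (T : ff ratfun) O : @near_point k T O <-> nearp T O.
Proof.
split=> [h P h1 h2|h].
  elim: h => [a {}O ha e|{}O O' _ ih hb hq]; last exact: (h2 O O' ih hb hq).
  have eO : O = @plane_local_ring k a := funext (fun z => propext (e z)).
  by rewrite eO plane_local_ringE; exact: (h1 a ha).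
apply: h => [a ha|{}O O' ih hb hq]; last exact: (InfinitelyNearPoint ih hb hq).
rewrite -plane_local_ringE; exact: (@PlanePoint k T a _ ha (fun z => iff_refl _)).
Qed.

Lemma R55E (O : ff ratfun -> Prop) : R55 k O <-> XX O.
Proof.
rewrite /R55 /blowup_base_points ratioE base_pointE.
have e := near_pointE (TT ratfun) O.
by split=> -[h1 h2]; split; [exact: (e.1 h1)|exact: h2|exact: (e.2 h1)|exact: h2].
Qed.

Lemma curve_onE (V : ff ratfun -> Prop) : curve_on (R55 k) V <-> curve V.
Proof.
split=> -[O [p [h1 h2 h3]]]; exists O, p.
  exact: (And3 ((R55E O).1 h1) h2 h3).
exact: (And3 ((R55E O).2 h1) h2 h3).
Qed.

Lemma rational_fibreE (f : ff ratfun) t : rational_fibre (R55 k) f t <-> ratfib f t.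
Proof.
split=> -[V [h1 h2 h3 h4]]; exists V.
  exact: (And4 ((curve_onE V).1 h1) h2 (fun W hW => h3 W ((curve_onE W).2 hW)) h4).
exact: (And4 ((curve_onE V).2 h1) h2 (fun W hW => h3 W ((curve_onE W).1 hW)) h4).
Qed.

Lemma conic_bundleE (f : ff ratfun) : conic_bundle (R55 k) f <-> cbundle f.
Proof.
split=> -[h1 [s h2]]; split; [|exists s => t ts| |exists s => t ts].
- exact: (fun O hO => h1 O ((R55E O).2 hO)).
- exact: ((rational_fibreE f t).1 (h2 t ts)).
- exact: (fun O hO => h1 O ((R55E O).1 hO)).
exact: ((rational_fibreE f t).2 (h2 t ts)).
Qed.

Lemma equiv_up_to_autE (f g : ff ratfun) : equiv_up_to_aut (R55 k) f g <-> eqaut f g.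
Proof.
have e (sigma : ff ratfun -> ff ratfun) (O : ff ratfun -> Prop) := R55E (fun z => O (sigma z)).
split=> -[sigma [[h1 h2 h3] h4]]; exists sigma; (split; last exact: h4); (split; [exact: h1|exact: h2|move=> O]).
  exact: (iff_trans (iff_sym (e sigma O)) (iff_trans (h3 O) (R55E O))).
exact: (iff_trans (e sigma O) (iff_trans (h3 O) (iff_sym (R55E O)))).
Qed.

Lemma B1E : B1 k = @fx k ratfun.
Proof.
rewrite -(dh_x1 ratfun) -[RHS]divr1 -(dh_x0 ratfun).
have -> : B1 k = @dh k ratfun (x1 - 0 *: x0) / @dh k ratfun (x1 - 0 *: x0 - (x1 - 1 *: x0)) by [].
by rewrite scale0r scale1r subr0 subKr.
Qed.

Lemma B2E : B2 k = g2 ratfun.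
Proof.
have -> : B2 k = @dh k ratfun (x1 * x2 - 0 *: (x0 * x2 - x0 ^+ 2)) /
  @dh k ratfun (x1 * x2 - 0 *: (x0 * x2 - x0 ^+ 2) - (x1 * x2 - 1 *: (x0 * x2 - x0 ^+ 2))) by [].
rewrite scale0r scale1r subr0 subKr dhB !dhM dh_x0 dh_x1 dh_x2 mul1r mulr1 //.
Qed.

Lemma B3E : B3 k = g3 ratfun.
Proof.
have -> : B3 k = @dh k ratfun (x1 * x2 - ((0 + 1) *: (x0 * x2) - 0 *: x0 ^+ 2)) /
  @dh k ratfun (x1 * x2 - ((0 + 1) *: (x0 * x2) - 0 *: x0 ^+ 2) - (x1 * x2 - ((1 + 1) *: (x0 * x2) - 1 *: x0 ^+ 2))) by [].
have -> : x1 * x2 - ((0 + 1) *: (x0 * x2) - 0 *: x0 ^+ 2) = x1 * x2 - x0 * x2 :> {mpoly k[3]}.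
  by rewrite add0r scale1r scale0r subr0.
have -> : x1 * x2 - x0 * x2 - (x1 * x2 - ((1 + 1) *: (x0 * x2) - 1 *: x0 ^+ 2)) = x0 * x2 - x0 * x0 :> {mpoly k[3]}.
  by rewrite scalerDl !scale1r expr2; move: (x0 * x2) (x1 * x2) (x0 * x0) => a b c; ring.
by rewrite !(dhB, dhM) dh_x0 dh_x1 dh_x2 !mul1r -[X in _ - X]mul1r -mulrBl.
Qed.
End Bridge.

Theorem proposition3p1 (R : realType) :
  [/\ conic_bundle (R55 R[i]) (B1 R[i]),
      conic_bundle (R55 R[i]) (B2 R[i])
    & conic_bundle (R55 R[i]) (B3 R[i])] /\
  [/\ ~ equiv_up_to_aut (R55 R[i]) (B1 R[i]) (B2 R[i]),
      ~ equiv_up_to_aut (R55 R[i]) (B1 R[i]) (B3 R[i])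
    & ~ equiv_up_to_aut (R55 R[i]) (B2 R[i]) (B3 R[i])] /\
  (forall f : ffield R[i], conic_bundle (R55 R[i]) f ->
     [\/ equiv_up_to_aut (R55 R[i]) f (B1 R[i]),
         equiv_up_to_aut (R55 R[i]) f (B2 R[i])
       | equiv_up_to_aut (R55 R[i]) f (B3 R[i])]).
Proof.
have e1 : B1 R[i] = _ := @B1E R[i]; have e2 : B2 R[i] = _ := @B2E R[i]; have e3 : B3 R[i] = _ := @B3E R[i].
rewrite e1 e2 e3; split; first by split; apply/conic_bundleE; [exact: cbundle_x|exact: cbundle_g2|exact: cbundle_g3].
split; first by split=> /equiv_up_to_autE; [exact: x_neq_g2|exact: x_neq_g3|exact: g2_neq_g3].
move=> f /conic_bundleE cf; have char0 n : (n.+1%:R : R[i]) != 0 by rewrite pnatr_eq0.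
by case: (classification (not_elliptic char0 cf) cf) => h; [apply: Or31|apply: Or32|apply: Or33]; apply/equiv_up_to_autE.
Qed.
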